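(* Let $\kappa\in\{-1,0,1\}$. For any piecewise smooth simple closed curve $\mathcal{C}$ in $M^2_\kappa$ with arc-length $\ell$ and enclosing area $A>0$ (with $A\le 2\pi$ if $\kappa=1$) we have $$\ell^{2}\ \ge\ 4\pi A-\kappa A^2,$$ and equality holds if and only if $\mathcal{C}$ is a circle in $M^2_\kappa$ of radius $AS_\kappa\!\left(\frac{\sqrt{A(4\pi-\kappa A)}}{2\pi}\right)$.
   Context: $M^2_\kappa$ denotes the complete simply connected surface of constant curvature $\kappa$: the Euclidean plane for $\kappa=0$, the unit sphere $S^2\subset\mathbb{R}^3$ for $\kappa=1$, the hyperbolic plane for $\kappa=-1$; $d_\kappa$ is its Riemannian distance. A circle in $M^2_\kappa$ of radius $r>0$ ($r<\pi$ if $\kappa=1$) is a set $\{x\in M^2_\kappa : d_\kappa(p,x)=r\}$ with $p\in M^2_\kappa$. For $\kappa\ne 1$ the area enclosed by a simple closed curve is the area of the unique relatively compact component of its complement; for $\kappa=1$, a simple closed curve encloses area $A$ if one of the two components of its complement has area $A$. The function $AS_\kappa$ is $AS_0(t)=t$, $AS_1(t)=\arcsin t$, $AS_{-1}(t)=\sinh^{-1}t$. *)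

(* Defs.v *)
From HB Require Import structures.
From mathcomp Require Import all_boot all_order all_algebra.
From mathcomp Require Import all_classical all_reals all_analysis.
Set Implicit Arguments.
Unset Strict Implicit.
Unset Printing Implicit Defensive.
Import Order.TTheory GRing.Theory Num.Theory.
Import numFieldNormedType.Exports.
Local Open Scope classical_set_scope.
Local Open Scope ring_scope.

(** The three surfaces are realised simultaneously in R^3, with coordinates
    (x, y, z), as
        kappa * (x^2 + y^2) + z^2 = 1,   with z > 0 unless kappa = 1,
    carrying the restriction of the form dx^2 + dy^2 + kappa * dz^2.
    - kappa =  1: the unit sphere, with the metric induced by Euclidean R^3;
    - kappa =  0: the plane z = 1, on which dz = 0, i.e. the Euclidean plane;
    - kappa = -1: the upper sheet of z^2 - x^2 - y^2 = 1 in Minkowski space,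
      i.e. the hyperboloid model of the hyperbolic plane. *)

Definition model (R : realType) (kappa : R) : set 'rV[R]_3 :=
  [set p | kappa * (p 0 0 ^+ 2 + p 0 1 ^+ 2) + p 0 2 ^+ 2 = 1 /\
           (kappa != 1 -> 0 < p 0 2)].

(** Riemannian norm; the radicand is nonnegative on vectors tangent to
    [model kappa]. *)
Definition rnorm (R : realType) (kappa : R) (v : 'rV[R]_3) : R :=
  Num.sqrt (v 0 0 ^+ 2 + v 0 1 ^+ 2 + kappa * v 0 2 ^+ 2).

Definition smooth (R : realType) (g : R -> 'rV[R]_3) : Prop :=
  forall (n : nat) (t : R), derivable (derive1n n g) t 1.

(** On each closed piece the curve is C^infinity up to the endpoints, i.e. it
    is the restriction of a smooth map; continuity on [a, b] follows since
    consecutive pieces share an endpoint. *)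
Definition piecewise_smooth (R : realType) (a b : R) (gamma : R -> 'rV[R]_3) :
    Prop :=
  exists2 s : seq R, itv_partition a b s &
    forall i : nat, (i < size s)%N ->
      exists2 g : R -> 'rV[R]_3, smooth g &
        forall t : R, nth a (a :: s) i <= t <= nth a (a :: s) i.+1 ->
          gamma t = g t.

Definition piecewise_smooth_curve (R : realType) (kappa a b : R)
    (gamma : R -> 'rV[R]_3) : Prop :=
  piecewise_smooth a b gamma /\
  (forall t : R, a <= t <= b -> model kappa (gamma t)).

Definition simple_closed (R : realType) (a b : R) (gamma : R -> 'rV[R]_3) :
    Prop :=
  [/\ a < b, gamma a = gamma b & {in `[a, b[ &, injective gamma}].

(** For a piecewise smooth curve the derivative exists off a finite set of
    parameters, which does not contribute to the integral. *)
Definition arc_length (R : realType) (kappa a b : R)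
    (gamma : R -> 'rV[R]_3) : R :=
  \int[@lebesgue_measure R]_(t in `[a, b]) rnorm kappa (derive1 gamma t).

Definition rdist (R : realType) (kappa : R) (p q : 'rV[R]_3) : R :=
  inf [set l : R | exists (a b : R) (gamma : R -> 'rV[R]_3),
    [/\ piecewise_smooth_curve kappa a b gamma, gamma a = p, gamma b = q &
        l = arc_length kappa a b gamma]].

Definition is_circle (R : realType) (kappa r : R) (C : set 'rV[R]_3) : Prop :=
  [/\ 0 < r, kappa = 1 -> r < pi &
      exists2 p : 'rV[R]_3, model kappa p &
        C = [set x | model kappa x /\ rdist kappa p x = r]].

Definition height (R : realType) (kappa : R) (w : R * R) : R :=
  Num.sqrt (1 - kappa * (w.1 ^+ 2 + w.2 ^+ 2)).

Definition pt3 (R : realType) (x y z : R) : 'rV[R]_3 :=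
  \row_(i < 3) [:: x; y; z]`_i.

(** Riemannian area of [S `<=` model kappa].  Away from z = 0 (on the sphere, a
    null set) the surface consists of the graphs z = +h and z = -h of
    h(x, y) = sqrt (1 - kappa * (x^2 + y^2)), the second one only if kappa = 1;
    in the coordinates (x, y) the metric has determinant 1 / h^2 on each of
    them. *)
Definition area (R : realType) (kappa : R) (S : set 'rV[R]_3) : \bar R :=
  (\int[@lebesgue_measure R \x @lebesgue_measure R]_(w in
      [set w : R * R | (kappa * (w.1 ^+ 2 + w.2 ^+ 2) < 1)%R])
    ((\1_S (pt3 w.1 w.2 (height kappa w)) +
      \1_S (pt3 w.1 w.2 (- height kappa w))) / height kappa w)%:E)%E.

(** [model kappa] is closed in R^3, so that relative compactness in the surface
    is compactness of the closure in R^3. *)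
Definition encloses (R : realType) (kappa : R) (C : set 'rV[R]_3) (A : R) :
    Prop :=
  exists2 x : 'rV[R]_3, (model kappa `\` C) x &
    let U := connected_component (model kappa `\` C) x in
    (kappa != 1 -> compact (closure U)) /\ area kappa U = A%:E.

Definition sinh (R : realType) (x : R) : R := (expR x - expR (- x)) / 2.

(** [sinh] is a bijection of [R], so the value is never the default of [get]. *)
Definition asinh (R : realType) (t : R) : R := get [set y : R | sinh y = t].

Definition AS (R : realType) (kappa t : R) : R :=
  if kappa == 1 then asin t else if kappa == -1 then asinh t else t.

(* Main.v *)
(* E. Schmidt's argument, run simultaneously in the three geometries.

   In coordinates (y, u), with u the longitude around the y-axis, the area element is dy du.
   Pushing each point of the enclosed region U along its meridian, away from a parallel
   y = y0, until it meets the curve g gives A <= int |y - y0| |u'|.  Let y1 < y2 be the extreme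
   values of y on g, and let a circle with centre on u = 0 be tangent to the parallels y = y1
   and y = y2, with r and c (c^2 + k r^2 = 1) the generalized sine and cosine of its radius.
   Comparing with this circle by the Cauchy-Schwarz inequality gives
   r l >= c A + 2 pi r^2 / (1 + c), that is
   r^2 l^2 >= r^2 (4 pi A - k A^2) + (A - 2 pi r^2 / (1 + c))^2.

   In the equality case c and r depend on A only and, for each axis near the given one, the
   coordinate along it of one of the two points c g +- r n (n the unit normal of g) is a
   constant.  Among 17 axes three select the same signs at three given times, and three axes
   determine a point; so the selected points agree, and one point is at constant distance from
   all of g.  (For k = 0 two orthogonal axes suffice.)  Conversely, an injective closed curve
   on a circle runs around it exactly once.

   On the sphere the argument needs an axis whose poles avoid U and g.  If l < 2 pi, bisecting
   g into two arcs of equal length shows that g lies in an open hemisphere, and such an axis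
   exists.  If l >= 2 pi the inequality is trivial, and equality forces l = A = 2 pi, in which
   case four suitable points cut g into quarters of a great circle. *)

Require Import Defs.
From HB Require Import structures.
From mathcomp Require Import all_boot all_order all_algebra.
From mathcomp Require Import all_classical all_reals all_analysis.
From mathcomp Require Import measurable_realfun.
From mathcomp Require Import ring lra.
Set Implicit Arguments.
Unset Strict Implicit.
Unset Printing Implicit Defensive.
Import Order.TTheory GRing.Theory Num.Theory.
Import numFieldNormedType.Exports.
Local Open Scope classical_set_scope.
Local Open Scope ring_scope.

(** * Piecewise differentiable functions *)

(** In the coordinates (y, u) the metric is y'^2 / q + q u'^2 with q = 1 - k y^2. The comparison
    circle enters through the identity (y2 - y)(y - y1) + (c y - e)^2 = r^2 q, where e is the height
    of its centre: the two squares are those of the weights that Cauchy-Schwarz gives to y' and to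
    u'. The first weighted term depends on y alone, so a closed curve, which climbs from y1 to y2
    and comes back, contributes at least twice its integral over [y1, y2], and this is the area of
    the comparison disk. The second is c times the sweep bound for y0 = e / c. Equality determines
    squares only, so each axis leaves a choice of sign at each parameter. Three parameters give
    eight sign patterns, and 17 = 2 * 8 + 1 axes force three of them to share one. The axes are
    varied by rotations about the coordinate axes. For k = 0 these degenerate to translations, which
    produce no new direction; exchanging x and y takes their place. Of the enclosed component the
    properties in [domain] are kept; the decisive one is that a path in the surface that misses the
    curve cannot leave it. *)

Lemma within_cont_sub (R : realType) (a b c d : R) (f : R -> R) :
  a <= c -> d <= b -> {within `[a, b], continuous f} ->
  {within `[c, d], continuous f}.
Proof.
move=> ac db; apply: continuous_subspaceW => x /=.
by rewrite !in_itv/= => /andP[? ?]; apply/andP; split; lra.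
Qed.

(** A point of [E] inside the interval cuts it into two pieces, to which the induction hypothesis
    for the rest of [E] applies; hence the induction is for all a and b. *)
Lemma mono_off (R : realType) (E : seq R) (f df : R -> R) (a b : R) : a <= b ->
  {within `[a, b], continuous f} ->
  (forall t, a < t < b -> t \notin E -> is_derive t 1 f (df t) /\ 0 <= df t) ->
  f a <= f b.
Proof.
elim: E a b => [|e E IH] a b ab cf H.
  apply: (@ger0_derive1_le_cc R f a b) => //.
  - by move=> x; rewrite in_itv/= => xab; have [h _] := H x xab isT.
  - move=> x; rewrite in_itv/= => xab; have [h h0] := H x xab isT.
    by rewrite derive1E (@derive_val _ _ _ _ _ _ _ h).
  - by rewrite in_itv/= lexx.
  - by rewrite in_itv/= lexx ab.
have [/andP[ae eb]|neab] := boolP (a < e < b).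
  apply: (@le_trans _ _ (f e)).
    apply: IH; first exact: ltW.
      by apply: within_cont_sub cf => //; exact: ltW.
    move=> t /andP[ta te] tE; apply: H; first by rewrite ta (lt_trans te eb).
    by rewrite inE negb_or tE andbT lt_eqF.
  apply: IH; first exact: ltW.
    by apply: within_cont_sub cf => //; exact: ltW.
  move=> t /andP[ta te] tE; apply: H; first by rewrite te (lt_trans ae ta).
  by rewrite inE negb_or tE andbT gt_eqF.
apply: IH => // t tab tE; apply: H => //.
rewrite inE negb_or tE andbT; apply: contraNneq neab => <- //.
Qed.

(** Models the derivative of a piecewise smooth curve: its values at the corners [E] and at the end
    points are arbitrary, and the bound makes it integrable. *)
Definition pwc (R : realType) (a b : R) (E : seq R) (v : R -> R) : Prop :=
  (forall t, a < t < b -> t \notin E -> {for t, continuous v}) /\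
  exists K, forall t, a < t < b -> t \notin E -> `|v t| <= K.

Definition pwd (R : realType) (a b : R) (E : seq R) (f df : R -> R) : Prop :=
  [/\ {within `[a, b], continuous f},
      forall t, a < t < b -> t \notin E -> is_derive t 1 f (df t) &
      pwc a b E df].

Definition prim (R : realType) (a : R) (v : R -> R) (t : R) : R :=
  \int[@lebesgue_measure R]_(s in `[a, t]) v s.

(** Integrals along the curve are estimated in this way, by comparing derivatives pointwise off
    [E]. *)
Lemma pwd_le (R : realType) (a b : R) E (f df g dg : R -> R) :
  pwd a b E f df -> pwd a b E g dg ->
  forall s t, a <= s -> s <= t -> t <= b ->
  (forall u, s < u < t -> u \notin E -> df u <= dg u) ->
  f t - f s <= g t - g s.
Proof.
move=> [cf Hf _] [cg Hg _] s t as_ st tb H.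
suff : (g \- f) s <= (g \- f) t by rewrite /=; lra.
apply: (@mono_off _ E _ (fun u => dg u - df u)) => //.
  move=> x; apply: continuousB; last exact: (within_cont_sub as_ tb cf).
  exact: (within_cont_sub as_ tb cg).
move=> u ust uE; have uab : a < u < b by case/andP: ust => *; apply/andP; split; lra.
have hf := Hf u uab uE; have hg := Hg u uab uE.
by split; [exact: is_deriveB|rewrite subr_ge0; exact: H].
Qed.

Lemma near_itv_notin (R : realType) (a b : R) (E : seq R) (t : R) :
  a < t < b -> t \notin E -> \forall s \near t, a < s < b /\ s \notin E.
Proof.
move=> tab tE.
have h1 : \forall s \near t, a < s < b.
  have : t \in `]a, b[ by rewrite in_itv.
  by move/near_in_itvoo; apply: filterS => s; rewrite in_itv.
elim: E tE => [|e E IH]; first by move=> _; apply: filterS h1.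
rewrite inE negb_or => /andP[te tE]; have := IH tE; move: (open_nbhs_nbhs (conj (open_neq (y := e)) te)).
by apply: filterS2 => s se [-> sE]; rewrite inE negb_or se sE.
Qed.

Lemma pwc_itv_open (R : realType) (a b : R) (E : seq R) :
  open [set t : R | a < t < b /\ t \notin E].
Proof.
by rewrite openE => t [tab tE]; apply: near_itv_notin.
Qed.

(** Measurability holds on the open set [O] by continuity, and on the rest of the interval because
    it is finite. For boundedness, the unknown values at the exceptional points are absorbed into
    the sum of their norms. *)
Lemma pwc_integrable (R : realType) (a b : R) (E : seq R) (v : R -> R) :
  pwc a b E v -> (@lebesgue_measure R).-integrable `[a, b] (EFin \o v).
Proof.
move=> [cv [K HK]].
pose O := [set t : R | a < t < b /\ t \notin E].
have mO : measurable O by apply: open_measurable; exact: pwc_itv_open.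
have defI : (`[a, b]%classic : set R) = O `|` (`[a, b] `\` O).
  rewrite setDUK// => t [/andP[ta tb] _] /=.
  by rewrite in_itv/= (ltW ta) (ltW tb).
have finF : finite_set (`[a, b]%classic `\` O).
  apply: (sub_finite_set _ (finite_seq [:: a, b & E])) => t [/=].
  rewrite in_itv/= => /andP[ta tb]; rewrite /O/= => /not_andP H.
  rewrite !inE; apply/or3P; case: H => [/negP|/negP]; last first.
    by rewrite negbK => tE; apply: Or33.
  rewrite negb_and -!leNgt => /orP[ta'|bt].
    by apply: Or31; apply/eqP/le_anti; rewrite ta ta'.
  by apply: Or32; apply/eqP/le_anti; rewrite tb bt.
apply: measurable_bounded_integrable => //.
- by rewrite /= lebesgue_measure_itv/=; case: ifPn => // _; exact: ltry.
- rewrite defI; apply/measurable_funU => //.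
    by apply: measurableD.
  split.
    apply: open_continuous_measurable_fun; first exact: pwc_itv_open.
    by move=> t; rewrite inE => -[tab tE]; exact: cv.
  move=> _ B mB; apply: countable_measurable => //.
  by apply: finite_set_countable; apply: sub_finite_set finF => t [].
- pose M := K + \sum_(e <- [:: a, b & E]) `|v e|.
  have sum0 : forall s : seq R, 0 <= \sum_(e <- s) `|v e|.
    by move=> s; apply: sumr_ge0.
  have HM : forall t, `[a, b]%classic t -> `|v t| <= `|K| + \sum_(e <- [:: a, b & E]) `|v e|.
    move=> t abt; have [Ot|nOt] := pselect (O t).
      have [tab tE] := Ot.
      apply: (le_trans (HK _ tab tE)); apply: (le_trans (ler_norm K)).
      by rewrite lerDl.
    have : t \in [:: a, b & E].
      move: nOt => /not_andP; move: abt; rewrite /= in_itv/= => /andP[ta tb] H.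
      rewrite !inE; apply/or3P; case: H => [/negP|/negP]; last first.
        by rewrite negbK => tE; apply: Or33.
      rewrite negb_and -!leNgt => /orP[ta'|bt].
        by apply: Or31; apply/eqP/le_anti; rewrite ta ta'.
      by apply: Or32; apply/eqP/le_anti; rewrite tb bt.
    move=> tE; rewrite (perm_big _ (perm_to_rem tE)) big_cons addrCA lerDl.
    by rewrite addr_ge0.
  exists (`|K| + \sum_(e <- [:: a, b & E]) `|v e|); split; first exact: num_real.
  by move=> N /ltW MN t /HM /le_trans; apply.
Qed.

Lemma pwd_prim (R : realType) (a b : R) (E : seq R) (v : R -> R) : a <= b ->
  pwc a b E v -> pwd a b E (prim a v) v.
Proof.
move=> ab pv; have iv := pwc_integrable pv; split => //.
  exact: parameterized_integral_continuous.
move=> t /andP[at_ tb] tE.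
have [] := @continuous_FTC1_closed R v a t b tb iv at_.
  by case: pv => + _; apply; rewrite ?at_.
by move=> d1 d2; apply: DeriveDef => //; rewrite -derive1E.
Qed.

Lemma prim_self (R : realType) (a : R) (v : R -> R) : prim a v a = 0.
Proof. by rewrite /prim set_itv1 Rintegral_set1. Qed.

Lemma within_comp (R : realType) (a b : R) (f g : R -> R) :
  {within `[a, b], continuous f} ->
  (forall t, a <= t <= b -> {for f t, continuous g}) ->
  {within `[a, b], continuous (g \o f)}.
Proof.
move=> cf cg; rewrite continuous_subspace_in => x; rewrite inE /= in_itv/= => xab.
apply: (@continuous_comp (subspace _) R R f g x); first exact: cf.
exact: cg.
Qed.

Lemma withinM (R : realType) (a b : R) (f g : R -> R) :
  {within `[a, b], continuous f} -> {within `[a, b], continuous g} ->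
  {within `[a, b], continuous (fun t => f t * g t)}.
Proof. by move=> cf cg x; apply: continuousM; [exact: cf|exact: cg]. Qed.

Lemma withinD (R : realType) (a b : R) (f g : R -> R) :
  {within `[a, b], continuous f} -> {within `[a, b], continuous g} ->
  {within `[a, b], continuous (fun t => f t + g t)}.
Proof. by move=> cf cg x; apply: continuousD; [exact: cf|exact: cg]. Qed.

Lemma within_cst (R : realType) (a b : R) (k : R) :
  {within `[a, b], continuous (fun _ : R => k)}.
Proof. by move=> x; exact: cst_continuous. Qed.

Lemma within_bounded (R : realType) (a b : R) (f : R -> R) :
  {within `[a, b], continuous f} -> exists K, forall t, a <= t <= b -> `|f t| <= K.
Proof.
move=> cf; have /compact_bounded[M [_ HM]] := continuous_compact cf (@segment_compact _ a b).
exists (M + 1) => t tab; apply: HM; first by rewrite ltrDl.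
by exists t => //=; rewrite in_itv.
Qed.

Lemma within_interior (R : realType) (a b : R) (f : R -> R) (t : R) :
  {within `[a, b], continuous f} -> a < t < b -> {for t, continuous f}.
Proof.
move=> cf /andP[ta tb]; have ab : a < b by exact: lt_trans tb.
have [h _ _] := (continuous_within_itvP f ab).1 cf.
by apply: h; rewrite in_itv/= ta tb.
Qed.

Lemma pwc_within (R : realType) (a b : R) E (f : R -> R) :
  {within `[a, b], continuous f} -> pwc a b E f.
Proof.
move=> cf; split=> [t tab _|]; first exact: within_interior cf tab.
have [K HK] := within_bounded cf; exists K => t /andP[ta tb] _.
by apply: HK; rewrite !ltW.
Qed.

Lemma pwcD (R : realType) (a b : R) E (f g : R -> R) :
  pwc a b E f -> pwc a b E g -> pwc a b E (fun t => f t + g t).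
Proof.
move=> [cf [K HK]] [cg [L HL]]; split=> [t h1 h2|].
  by apply: continuousD; [exact: cf|exact: cg].
exists (K + L) => t h1 h2; apply: (le_trans (ler_normD _ _)).
by apply: lerD; [exact: HK|exact: HL].
Qed.

Lemma pwcM (R : realType) (a b : R) E (f g : R -> R) :
  pwc a b E f -> pwc a b E g -> pwc a b E (fun t => f t * g t).
Proof.
move=> [cf [K HK]] [cg [L HL]]; split=> [t h1 h2|].
  by apply: continuousM; [exact: cf|exact: cg].
exists (K * L) => t h1 h2; rewrite normrM.
by apply: ler_pM => //; [exact: HK|exact: HL].
Qed.

Lemma pwc_norm (R : realType) (a b : R) E (f : R -> R) :
  pwc a b E f -> pwc a b E (fun t => `|f t|).
Proof.
move=> [cf [K HK]]; split=> [t h1 h2|].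
  by apply: continuous_comp; [exact: cf|exact: norm_continuous].
by exists K => t h1 h2; rewrite normr_id; exact: HK.
Qed.

Lemma pwc_sqrt (R : realType) (a b : R) E (f : R -> R) :
  pwc a b E f -> pwc a b E (fun t => Num.sqrt (f t)).
Proof.
move=> [cf [K HK]]; split=> [t h1 h2|].
  by apply: continuous_comp; [exact: cf|exact: sqrt_continuous].
exists (Num.sqrt K) => t h1 h2; rewrite ger0_norm ?sqrtr_ge0//.
by apply: ler_wsqrtr; apply: le_trans (HK _ h1 h2); exact: ler_norm.
Qed.

Lemma pwc_cst (R : realType) (a b : R) E (k : R) : pwc a b E (fun _ => k).
Proof. by apply: pwc_within; exact: within_cst. Qed.

Lemma pwd_pwc (R : realType) (a b : R) E (f df : R -> R) :
  pwd a b E f df -> pwc a b E f.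
Proof. by case=> cf _ _; exact: pwc_within. Qed.

Lemma pwdD (R : realType) (a b : R) E (f df g dg : R -> R) :
  pwd a b E f df -> pwd a b E g dg ->
  pwd a b E (fun t => f t + g t) (fun t => df t + dg t).
Proof.
move=> [cf Hf pf] [cg Hg pg]; split; first exact: withinD.
  by move=> t h1 h2; apply: is_deriveD; [exact: Hf|exact: Hg].
exact: pwcD.
Qed.

Lemma pwdM (R : realType) (a b : R) E (f df g dg : R -> R) :
  pwd a b E f df -> pwd a b E g dg ->
  pwd a b E (fun t => f t * g t) (fun t => f t * dg t + g t * df t).
Proof.
move=> Pf Pg; move: (Pf) (Pg) => [cf Hf pf] [cg Hg pg]; split; first exact: withinM.
  move=> t h1 h2; have h3 := Hf t h1 h2; have h4 := Hg t h1 h2.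
  exact: (is_deriveM h3 h4).
by apply: pwcD; apply: pwcM => //; [exact: (pwd_pwc Pf)|exact: (pwd_pwc Pg)].
Qed.

Lemma pwd_cst (R : realType) (a b : R) E (k : R) :
  pwd a b E (fun _ => k) (fun _ => 0).
Proof.
split; [exact: within_cst| |exact: pwc_cst].
by move=> t _ _; exact: is_derive_cst.
Qed.

Lemma pwd_ext (R : realType) (a b : R) E (f df dg : R -> R) :
  (forall t, df t = dg t) -> pwd a b E f df -> pwd a b E f dg.
Proof. by move=> /funext ->. Qed.

Lemma pwdZ (R : realType) (a b : R) E (k : R) (f df : R -> R) :
  pwd a b E f df -> pwd a b E (fun t => k * f t) (fun t => k * df t).
Proof.
move=> pf; apply: (pwd_ext _ (pwdM (pwd_cst a b E k) pf)) => t.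
by rewrite mulr0 addr0.
Qed.

Lemma pwdB (R : realType) (a b : R) E (f df g dg : R -> R) :
  pwd a b E f df -> pwd a b E g dg ->
  pwd a b E (fun t => f t - g t) (fun t => df t - dg t).
Proof.
move=> pf pg; have := pwdD pf (pwdZ (-1) pg).
have -> : (fun t => f t + -1 * g t) = (fun t => f t - g t).
  by apply/funext => t; rewrite mulN1r.
by apply: pwd_ext => t; rewrite mulN1r.
Qed.

Lemma pwd_comp (R : realType) (a b : R) E (f df g dg : R -> R) :
  pwd a b E f df ->
  (forall t, a <= t <= b -> is_derive (f t) 1 g (dg (f t)) /\
     {for f t, continuous dg}) ->
  pwd a b E (g \o f) (fun t => dg (f t) * df t).
Proof.
move=> Pf H; move: (Pf) => [cf Hf pf]; split.
- apply: within_comp => // t tab; have [h _] := H t tab.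
  apply: differentiable_continuous; apply/derivable1_diffP.
  exact: (@ex_derive _ _ _ _ _ _ _ h).
- move=> t h1 h2; have [|h3 _] := H t; first by case/andP: h1 => *; rewrite !ltW.
  by have h4 := Hf t h1 h2; exact: is_derive1_comp.
- apply: pwcM => //; apply: pwc_within; apply: within_comp => // t tab.
  by have [] := H t tab.
Qed.

Lemma pwd_sub (R : realType) (a b c d : R) E (f df : R -> R) :
  a <= c -> d <= b -> pwd a b E f df -> pwd c d E f df.
Proof.
move=> ac db [cf Hf [pc [K HK]]].
have sub t : c < t < d -> a < t < b by case/andP=> *; apply/andP; split; lra.
split; first exact: within_cont_sub cf.
  by move=> t /sub; exact: Hf.
by split=> [t /sub|]; [exact: pc|exists K => t /sub; exact: HK].
Qed.

Lemma pwd_continuous (R : realType) (a b : R) E (f df : R -> R) :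
  pwd a b E f df -> {within `[a, b], continuous f}.
Proof. by case. Qed.

Lemma pwd_const (R : realType) (a b : R) E (f df : R -> R) s t :
  pwd a b E f df -> a <= s -> s <= t -> t <= b ->
  (forall u, s < u < t -> u \notin E -> df u = 0) -> f t = f s.
Proof.
move=> pf as_ st tb H; have p0 := pwd_cst a b E 0.
have h1 : f t - f s <= 0 - 0.
  by apply: (pwd_le pf p0 as_ st tb) => u h1 h2; rewrite H.
have h2 : 0 - 0 <= f t - f s.
  by apply: (pwd_le p0 pf as_ st tb) => u h1' h2; rewrite H.
lra.
Qed.

Lemma pwd_deriv_const (R : realType) (a b : R) E (f df : R -> R) (k : R) :
  pwd a b E f df -> (forall t, a <= t <= b -> f t = k) ->
  forall t, a < t < b -> t \notin E -> df t = 0.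
Proof.
move=> [_ Hf _] H t tab tE; have h := Hf t tab tE.
have hc : is_derive t 1 f 0.
  apply: (@near_eq_is_derive _ _ _ (cst k) f t 1 0).
  have := near_itv_notin tab tE; apply: filterS => s [/andP[sa sb] _].
  by rewrite H// !ltW.
by rewrite -(@derive_val _ _ _ _ _ _ _ h) (@derive_val _ _ _ _ _ _ _ hc).
Qed.

(** * Change of variables *)

(** The image under [s] of the measure with density [f]. The proofs are arguments of the definition
    so that a measure structure can be attached to it. *)
Definition push_density (R : realType) (f : R -> R)
    (s : measurableTypeR R -> measurableTypeR R)
    (mf : measurable_fun [set: R] f) (f0 : forall x, 0 <= f x)
    (ms : measurable_fun [set: measurableTypeR R] s)
    (E : set (measurableTypeR R)) : \bar R :=
  (\int[@lebesgue_measure R]_(x in s @^-1` E) (f x)%:E)%E.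

Lemma push_density0 (R : realType) (f : R -> R) s mf f0 ms :
  @push_density R f s mf f0 ms set0 = 0%E.
Proof. by rewrite /push_density preimage_set0 integral_set0. Qed.

Lemma push_density_ge0 (R : realType) (f : R -> R) s mf f0 ms E :
  (0 <= @push_density R f s mf f0 ms E)%E.
Proof. by apply: integral_ge0 => x _; rewrite lee_fin. Qed.

Lemma push_density_sigma_additive (R : realType) (f : R -> R) s mf f0 ms :
  semi_sigma_additive (@push_density R f s mf f0 ms).
Proof.
move=> /= F mF tF mUF; rewrite /push_density; apply: cvg_toP.
  apply: ereal_nondecreasing_is_cvgn => m n mn.
  apply: lee_sum_nneg_natr => // k _ _; apply: integral_ge0 => /= x _.
  by rewrite lee_fin.
rewrite preimage_bigcup ge0_integral_bigcup//=.
- by move=> k; rewrite -[X in measurable X]setTI; exact: ms.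
- by apply/measurable_funTS/measurable_EFinP.
- by move=> x _; rewrite lee_fin.
- apply/trivIsetP => /= i j _ _ ij; rewrite -preimage_setI.
  by move/trivIsetP : tF => /(_ _ _ _ _ ij) ->//; rewrite preimage_set0.
Qed.

HB.instance Definition _ (R : realType) (f : R -> R) s mf f0 ms :=
  isMeasure.Build _ _ _ (@push_density R f s mf f0 ms)
    (push_density0 mf f0 ms) (push_density_ge0 mf f0 ms)
    (@push_density_sigma_additive R f s mf f0 ms).

Lemma itv_oc_setI (R : realType) (u v p r : R) :
  (`]u, v] `&` `]p, r] = `]Num.max u p, Num.min v r])%classic.
Proof.
apply/seteqP; split=> x /=; rewrite !in_itv/= gt_max le_min.
  by move=> [/andP[-> ->] /andP[-> ->]].
by move=> /andP[/andP[-> ->] /andP[-> ->]].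
Qed.

(** Uniqueness of Lebesgue measure concerns measures on the whole line, so the image measure
    restricted to ]p, r] is completed by Lebesgue measure on the complement. *)
Lemma push_density_eq (R : realType) (f : R -> R)
    (s : measurableTypeR R -> measurableTypeR R)
    (mf : measurable_fun [set: R] f)
    (f0 : forall x, 0 <= f x) (ms : measurable_fun setT s) (p r : R) :
  (forall u v, p <= u -> u <= v -> v <= r ->
    push_density mf f0 ms (`]u, v]) = (v - u)%:E) ->
  forall E : set (measurableTypeR R), measurable E ->
    push_density mf f0 ms (E `&` `]p, r]) = lebesgue_measure (E `&` `]p, r]).
Proof.
move=> H E mE.
have mJ : measurable (`]p, r]%classic : set (measurableTypeR R)) by [].
have mJC := measurableC mJ.
pose m1 : {measure set (measurableTypeR R) -> \bar R} :=
  mrestr (@lebesgue_measure R) mJC.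
pose m2 : {measure set (measurableTypeR R) -> \bar R} :=
  mrestr (push_density mf f0 ms) mJ.
pose m : {measure set (measurableTypeR R) -> \bar R} := measure_add m2 m1.
have mE' X : m X = (m2 X + m1 X)%E by exact: measure_addE.
have -> : push_density mf f0 ms (E `&` `]p, r]) = m (E `&` `]p, r]).
  rewrite mE' /m1 /m2 /= /mrestr -setIA setIid -setIA setICr setI0.
  by rewrite [X in (_ + X)%E]measure0 adde0.
symmetry; apply: (@lebesgue_measure_unique R m); last exact: measurableI.
move=> _ [[u v] _ <-] /=; rewrite mE' /m1 /m2 /= /mrestr.
rewrite -[X in lebesgue_measure X](setIT `]u, v]%classic).
rewrite -(setUv (`]p, r]%classic)) setIUr measureU//=; last 3 first.
- exact: measurableI.
- exact: measurableI.
- by rewrite setIACA setICr setI0.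
congr (_ + _)%E; rewrite itv_oc_setI.
have [h|h] := leP (Num.max u p) (Num.min v r); last first.
  by rewrite set_itv_ge ?bnd_simp -?leNgt ?ltW// !measure0.
rewrite H//; last 2 first.
- by rewrite le_max lexx orbT.
- by rewrite ge_min lexx orbT.
rewrite lebesgue_measure_itv/= lte_fin; case: ltP => [_|h2]; first by rewrite EFinB.
by rewrite (@le_anti _ _ (Num.min v r) (Num.max u p)) ?subrr// h2 h.
Qed.

Lemma lebesgue_translation (R : realType) (c : R) (E : set R) : measurable E ->
  lebesgue_measure [set x | E (x + c)] = lebesgue_measure E.
Proof.
move=> mE; pose s : measurableTypeR R -> measurableTypeR R := fun x => x + c.
have ms : measurable_fun setT s by apply: measurable_funD.
symmetry; apply: (@lebesgue_measure_unique R (pushforward (@lebesgue_measure R) s)) => //.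
move=> _ [[u v] _ <-] /=; rewrite /pushforward.
rewrite (_ : s @^-1` _ = `]u - c, v - c]%classic).
  rewrite !lebesgue_measure_itv/= !lte_fin; congr (if _ then _ else _); first lra.
  by rewrite -!EFinB; congr EFin; lra.
apply/seteqP; split=> x /=; rewrite /s !in_itv/= => /andP[? ?]; apply/andP; split; lra.
Qed.

Lemma measurable_patch (R : realType) (I : set R) (f : R -> R) : open I ->
  (forall x, I x -> {for x, continuous f}) -> measurable_fun [set: R] (f \_ I).
Proof.
move=> oI cf; apply/(measurable_restrictT _ _).1; first exact: open_measurable.
by apply: open_continuous_measurable_fun => // x; rewrite inE; exact: cf.
Qed.

(** The density may be unbounded at the ends of [I], and [J] may be the whole line. So the
    substitution is proved inside the compact intervals [- al n, al n] by the fundamental theorem of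
    calculus and extended to [J] by exhaustion. *)
Lemma integral_substitution (R : realType) (f sigma s : R -> R) (I J : set R)
    (al : nat -> R) :
  open I -> (forall x y z, I x -> I y -> x <= z -> z <= y -> I z) ->
  (forall x, I x -> [/\ is_derive x 1 sigma (f x), 0 <= f x & {for x, continuous f}]) ->
  (forall n u, - al n <= u <= al n -> J u) ->
  (forall u, J u -> exists n, - al n < u <= al n) ->
  {homo al : m n / (m <= n)%N >-> m <= n} ->
  (forall u, J u -> I (s u) /\ sigma (s u) = u) ->
  (forall x, I x -> J (sigma x) /\ s (sigma x) = x) ->
  (forall u v, J u -> J v -> u <= v -> s u <= s v) ->
  measurable J -> measurable_fun [set: R] s ->
  forall B : set R, measurable B ->
  (\int[@lebesgue_measure R]_(x in I `&` B) (f x)%:E =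
   lebesgue_measure (J `&` s @^-1` B))%E.
Proof.
move=> oI cI hf hJ1 hJ2 hal h1 h2 hs mJ ms B mB.
have mI : measurable I by exact: open_measurable.
have mf' : measurable_fun [set: R] (f \_ I).
  by apply: measurable_patch => // x /hf[].
have f0 x : 0 <= (f \_ I) x.
  by rewrite patchE; case: ifPn => //; rewrite inE => /hf[].
have ms' : measurable_fun [set: R] (sigma \_ I).
  apply: measurable_patch => // x /hf[h _ _].
  apply: differentiable_continuous; apply/derivable1_diffP.
  exact: (@ex_derive _ _ _ _ _ _ _ h).
pose pd : {measure set (measurableTypeR R) -> \bar R} := push_density mf' f0 ms'.
have pdE (E : set R) : measurable E -> E `<=` J ->
    pd E = (\int[@lebesgue_measure R]_(x in I `&` sigma @^-1` E) (f x)%:E)%E.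
  move=> mE EJ; rewrite /pd/= /push_density.
  have -> : I `&` sigma @^-1` E = (sigma \_ I) @^-1` E `&` I.
    rewrite setIC; apply/seteqP; split=> x /= [H Ix]; split => //;
      by move: H; rewrite patchE mem_set.
  by rewrite integral_mkcondr; apply: eq_integral => x _; rewrite restrict_EFin.
have pditv n u v : - al n <= u -> u <= v -> v <= al n ->
    pd `]u, v]%classic = (v - u)%:E.
  move=> nu uv vn; have Ju : J u by apply: (hJ1 n); rewrite nu (le_trans uv).
  have Jv : J v by apply: (hJ1 n); rewrite vn andbT (le_trans nu).
  have [Isu su] := h1 _ Ju; have [Isv sv] := h1 _ Jv.
  have suv : s u <= s v by exact: hs.
  rewrite pdE//; last first.
    move=> w /=; rewrite in_itv/= => /andP[uw wv]; apply: (hJ1 n).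
    by rewrite (le_trans wv vn) (le_trans nu (ltW uw)).
  have -> : I `&` sigma @^-1` `]u, v] = `]s u, s v]%classic.
    apply/seteqP; split=> x /=; rewrite !in_itv/=.
      move=> [Ix /andP[ux xv]]; have [Jx sx] := h2 _ Ix.
      rewrite -{2}sx (hs _ _ Jx Jv xv) andbT lt_neqAle; apply/andP; split.
        by apply: contraTneq ux => xE; rewrite -xE su ltxx.
      by rewrite -sx; apply: hs => //; exact: ltW.
    move=> /andP[ux xv]; have Ix : I x by apply: (cI _ _ _ Isu Isv) => //; exact: ltW.
    have [Jx sx] := h2 _ Ix; split => //; apply/andP; split.
      rewrite ltNge; apply/negP => xu; have := hs _ _ Jx Ju xu.
      by rewrite sx leNgt ux.
    rewrite leNgt; apply/negP => xu; have := hs _ _ Jv Jx (ltW xu); rewrite sx => vx.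
    have xE : x = s v by apply/le_anti; rewrite xv vx.
    by move: xu; rewrite xE sv ltxx.
  move: (suv); rewrite le_eqVlt => /predU1P[suvE|suvlt].
    have : u = v by rewrite -su -sv suvE.
    by move=> ->; rewrite set_itv_ge ?bnd_simp ?ltxx// integral_set0 subrr.
  have Isub x : s u <= x -> x <= s v -> I x by move=> *; exact: (cI _ _ _ Isu Isv).
  have cont (g : R -> R) : (forall x, I x -> {for x, continuous g}) ->
      {within `[s u, s v], continuous g}.
    move=> cg; have := @continuous_in_subspaceT R R `[s u, s v]%classic g; apply.
    move=> x; rewrite inE/= in_itv/=.
    by move=> /andP[? ?]; apply: cg; exact: Isub.
  have cs x : I x -> {for x, continuous sigma}.
    move=> /hf[h _ _]; apply: differentiable_continuous; apply/derivable1_diffP.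
    exact: (@ex_derive _ _ _ _ _ _ _ h).
  rewrite integral_itv_obnd_cbnd; last first.
    apply/measurable_EFinP.
    apply: (@measurable_funS _ _ _ _ `[s u, s v]%classic) => //.
      by move=> x /=; rewrite !in_itv/= => /andP[/ltW -> ->].
    apply: subspace_continuous_measurable_fun => //.
    by apply: cont => x /hf[].
  rewrite (@continuous_FTC2 _ f sigma)//.
  - by rewrite su sv.
  - by apply: cont => x /hf[].
  - have [cc cr cl] := (continuous_within_itvP sigma suvlt).1 (cont _ cs).
    split=> //; move=> x; rewrite in_itv/= => /andP[h3 h4].
    have [h _ _] := hf x (Isub _ (ltW h3) (ltW h4)).
    exact: (@ex_derive _ _ _ _ _ _ _ h).
  - move=> x; rewrite in_itv/= => /andP[h3 h4].
    have [h _ _] := hf x (Isub _ (ltW h3) (ltW h4)).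
    by rewrite derive1E (@derive_val _ _ _ _ _ _ _ h).
pose E : set (measurableTypeR R) := J `&` s @^-1` B.
have mE : measurable E.
  by apply: measurableI => //; rewrite -[X in measurable X]setTI; exact: ms.
pose F n : set (measurableTypeR R) := E `&` `]- al n, al n]%classic.
have mF n : measurable (F n) by exact: measurableI.
have UF : \bigcup_n F n = E.
  apply/seteqP; split=> [u [n _ []]//|u Eu]; have [n hn] := hJ2 u Eu.1.
  by exists n => //; split => //=; rewrite in_itv.
have ndF : nondecreasing_seq F.
  move=> m n mn; apply/subsetPset => u [Eu /=]; rewrite in_itv/= => /andP[h3 h4].
  split => //=; rewrite in_itv/= (le_trans h4 (hal _ _ mn)) andbT.
  by apply: le_lt_trans h3; rewrite lerN2; exact: hal.
have key n : pd (F n) = lebesgue_measure (F n).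
  by apply: push_density_eq => // u v; exact: pditv.
have -> : I `&` B = I `&` sigma @^-1` E.
  apply/seteqP; split=> x [Ix H]; split => //; have [Jx sx] := h2 _ Ix.
    by split => //=; rewrite sx.
  by case: H => _ /=; rewrite sx.
rewrite -pdE//; last by move=> u [].
rewrite -/E -UF.
have l1 : pd (F n) @[n --> \oo] --> pd (\bigcup_n F n).
  by apply: nondecreasing_cvg_mu => //; rewrite UF.
have l2 : lebesgue_measure (F n) @[n --> \oo] --> lebesgue_measure (\bigcup_n F n).
  by apply: nondecreasing_cvg_mu => //; rewrite UF.
have l3 : lebesgue_measure (F n) @[n --> \oo] --> pd (\bigcup_n F n).
  by rewrite -(_ : (fun n => pd (F n)) = (fun n => lebesgue_measure (F n))) //;
    apply/funext.
exact: cvg_unique l3 l2.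
Qed.

(** * Generalized trigonometric functions *)

Definition curv (R : realType) (k : R) : Prop := k = -1 \/ k = 0 \/ k = 1.

(** [snk k] and [csk k] solve f'' = - k f with initial data (0, 1) and (1, 0); this is why one set
    of addition formulas serves the three geometries. *)
Definition snk (R : realType) (k u : R) : R :=
  if k == 1 then sin u else if k == -1 then sinh u else u.

Definition csk (R : realType) (k u : R) : R :=
  if k == 1 then cos u else if k == -1 then (expR u + expR (- u)) / 2 else 1.

(** For k = -1 an explicit logarithm, whose derivative can be computed; it also shows that [sinh]
    takes every value, on which [sinh_asinh] rests. *)
Definition arsnk (R : realType) (k v : R) : R :=
  if k == 1 then asin v else if k == -1 then ln (v + Num.sqrt (v ^+ 2 + 1)) else v.

Lemma N1_neq1 (R : realType) : ((-1 : R) == 1) = false.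
Proof. by apply: lt_eqF; lra. Qed.

Lemma zero_neqN1 (R : realType) : ((0 : R) == -1) = false.
Proof. by apply: gt_eqF; lra. Qed.

Lemma zero_neq1 (R : realType) : ((0 : R) == 1) = false.
Proof. by apply: lt_eqF; lra. Qed.

Definition curvE := (N1_neq1, zero_neqN1, zero_neq1, eqxx).

Lemma is_derive_expRN (R : realType) (u : R) :
  is_derive u 1 (fun v => expR (- v)) (- expR (- u)).
Proof.
have h : is_derive u 1 (-%R : R -> R) (-1) by apply: is_deriveNid.
have := @is_derive1_comp _ expR -%R u _ _ (is_derive_expR (- u)) h.
by rewrite mulrN1.
Qed.

Lemma is_derive_snk (R : realType) (k u : R) : curv k ->
  is_derive u 1 (snk k) (csk k u).
Proof.
move=> [|[|]] ->; rewrite /snk /csk !curvE.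
- have h1 := is_derive_expR u; have h2 := is_derive_expRN u.
  have h3 := is_deriveB h1 h2; have := is_deriveZ (2^-1) h3.
  rewrite (_ : _ \*: _ = (fun u => sinh u)).
    by rewrite opprK /GRing.scale/= mulrC.
  by apply/funext => v; rewrite /sinh /= /GRing.scale/= mulrC.
- exact: is_derive_id.
- exact: is_derive_sin.
Qed.

Lemma is_derive_csk (R : realType) (k u : R) : curv k ->
  is_derive u 1 (csk k) (- k * snk k u).
Proof.
move=> [|[|]] ->; rewrite /snk /csk !curvE.
- have h1 := is_derive_expR u; have h2 := is_derive_expRN u.
  have h3 := is_deriveD h1 h2; have := is_deriveZ (2^-1) h3.
  rewrite (_ : _ \*: _ = (fun u => (expR u + expR (- u)) / 2)).
    by rewrite opprK mul1r /GRing.scale/= /sinh mulrC.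
  by apply/funext => v; rewrite /= /GRing.scale/= mulrC.
- rewrite oppr0 mul0r; exact: is_derive_cst.
- rewrite mulN1r; exact: is_derive_cos.
Qed.

Lemma csk2snk2 (R : realType) (k u : R) : curv k ->
  csk k u ^+ 2 + k * snk k u ^+ 2 = 1.
Proof.
move=> [|[|]] ->; rewrite /snk /csk !curvE.
- have := expRxMexpNx_1 u; rewrite /sinh; set a := expR u; set b := expR (- u) => h.
  by transitivity (a * b); [field|].
- by rewrite mul0r addr0 expr1n.
- by rewrite mul1r cos2Dsin2.
Qed.

Lemma snkD (R : realType) (k u v : R) : curv k ->
  snk k (u + v) = snk k u * csk k v + csk k u * snk k v.
Proof.
move=> [|[|]] ->; rewrite /snk /csk !curvE.
- by rewrite /sinh opprD !expRD; field.
- by rewrite mulr1 mul1r.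
- exact: sinD.
Qed.

Lemma cskD (R : realType) (k u v : R) : curv k ->
  csk k (u + v) = csk k u * csk k v - k * (snk k u * snk k v).
Proof.
move=> [|[|]] ->; rewrite /snk /csk !curvE.
- by rewrite /sinh opprD !expRD; field.
- by rewrite mul0r subr0 mulr1.
- by rewrite cosD mul1r.
Qed.

Lemma snk0 (R : realType) (k : R) : snk k 0 = 0.
Proof.
by rewrite /snk; case: ifP => _; rewrite ?sin0//; case: ifP => _//;
  rewrite /sinh oppr0 subrr mul0r.
Qed.

Lemma csk0 (R : realType) (k : R) : csk k 0 = 1.
Proof.
rewrite /csk; case: ifP => _; rewrite ?cos0//; case: ifP => _//.
by rewrite oppr0 expR0; field.
Qed.

Lemma csk_gt0 (R : realType) (k u : R) : k != 1 -> 0 < csk k u.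
Proof.
move=> /negbTE k1; rewrite /csk k1; case: ifP => // _.
by rewrite divr_gt0// addr_gt0// expR_gt0.
Qed.

Lemma snkK (R : realType) (k u : R) : curv k ->
  (k = 1 -> - (pi / 2) <= u <= pi / 2) -> arsnk k (snk k u) = u.
Proof.
move=> [|[|]] -> hu; rewrite /snk /arsnk !curvE//.
- have h := @csk2snk2 R (-1) u (or_introl erefl).
  rewrite (_ : sinh u ^+ 2 + 1 = csk (-1) u ^+ 2); last first.
    by move: h; rewrite /snk !curvE; lra.
  rewrite sqrtr_sqr ger0_norm ?ltW ?csk_gt0 ?curvE//.
  by rewrite /sinh /csk !curvE (_ : _ + _ = expR u) ?expRK//; field.
- by rewrite sinK// in_itv/= hu.
Qed.

Lemma arsnkN_gt0 (R : realType) (v : R) : 0 < v + Num.sqrt (v ^+ 2 + 1).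
Proof.
suff : `|v| < Num.sqrt (v ^+ 2 + 1) by rewrite ltr_norml => /andP[? _]; lra.
rewrite -sqrtr_sqr ltr_sqrt; [lra|].
by rewrite ltr_wpDl ?sqr_ge0.
Qed.

Lemma arsnkK (R : realType) (k v : R) : curv k ->
  (k = 1 -> -1 <= v <= 1) -> snk k (arsnk k v) = v.
Proof.
move=> [|[|]] -> hv; rewrite /snk /arsnk !curvE//.
- have w0 := arsnkN_gt0 v; rewrite /sinh expRN lnK//.
  have s2 : Num.sqrt (v ^+ 2 + 1) ^+ 2 = v ^+ 2 + 1.
    by rewrite sqr_sqrtr// addr_ge0 ?sqr_ge0.
  have w1 := lt0r_neq0 w0; move: w1 s2; set s := Num.sqrt _ => w1 s2.
  apply: (mulIf w1); rewrite -mulrA [_^-1 * _]mulrC mulrA mulrBl mulVf//.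
  rewrite (_ : v * (v + s) = ((v + s) * (v + s) - 1) / 2) //.
  have -> : (v + s) * (v + s) = v ^+ 2 + s ^+ 2 + 2 * v * s by ring.
  by rewrite s2; field.
- by rewrite asinK// in_itv/= hv.
Qed.

Lemma is_derive_arsnk (R : realType) (k v : R) : curv k -> 0 < 1 - k * v ^+ 2 ->
  is_derive v 1 (arsnk k) (Num.sqrt (1 - k * v ^+ 2))^-1.
Proof.
move=> [|[|]] -> hv; rewrite /arsnk !curvE.
- rewrite (_ : 1 - -1 * v ^+ 2 = v ^+ 2 + 1); last by ring.
  have p0 : 0 < v ^+ 2 + 1 by rewrite ltr_wpDl ?sqr_ge0.
  have s0 : 0 < Num.sqrt (v ^+ 2 + 1) by rewrite sqrtr_gt0.
  have h1 : is_derive v 1 (fun v : R => v ^+ 2 + 1) (2 * v).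
    by apply: is_derive_eq; rewrite /GRing.scale/=; ring.
  have h2 := @is_derive1_comp _ Num.sqrt (fun v : R => v ^+ 2 + 1) v _ _
    (is_derive1_sqrt p0) h1.
  have h3 := is_deriveD (is_derive_id v 1) h2.
  have h4 := @is_derive1_comp _ (@ln R) _ v _ _ (is_derive1_ln (arsnkN_gt0 v)) h3.
  apply: is_derive_eq h4 _.
  have w1 := lt0r_neq0 (arsnkN_gt0 v); have s1 := lt0r_neq0 s0.
  by field; rewrite s1 w1.
- rewrite mul0r subr0 sqrtr1 invr1; exact: is_derive_id.
- rewrite mul1r; apply: is_derive1_asin; rewrite mul1r subr_gt0 in hv.
  by rewrite -ltr_norml -(@ltr_pXn2r _ 2)// ?nnegrE// real_normK ?num_real// expr1n.
Qed.

Lemma continuous_derive (R : realType) (f : R -> R) (x d : R) :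
  is_derive x 1 f d -> {for x, continuous f}.
Proof.
move=> h; apply: differentiable_continuous; apply/derivable1_diffP.
exact: (@ex_derive _ _ _ _ _ _ _ h).
Qed.

Lemma continuous_snk (R : realType) (k : R) : curv k -> continuous (snk k).
Proof. by move=> hk u; exact: continuous_derive (is_derive_snk u hk). Qed.

Lemma continuous_csk (R : realType) (k : R) : curv k -> continuous (csk k).
Proof. by move=> hk u; exact: continuous_derive (is_derive_csk u hk). Qed.

(** On the parallel at height y of the surface, k x^2 + z^2 is the square of [lrad k y]; on the
    sphere this is the Euclidean radius of the parallel. *)
Definition lrad (R : realType) (k y : R) : R := Num.sqrt (1 - k * y ^+ 2).

Lemma lrad_gt0 (R : realType) (k y : R) : 0 < 1 - k * y ^+ 2 -> 0 < lrad k y.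
Proof. by rewrite sqrtr_gt0. Qed.

Lemma sqr_lrad (R : realType) (k y : R) : 0 < 1 - k * y ^+ 2 ->
  lrad k y ^+ 2 = 1 - k * y ^+ 2.
Proof. by move=> h; rewrite sqr_sqrtr// ltW. Qed.

Lemma height_snk (R : realType) (k y u : R) : curv k -> 0 < 1 - k * y ^+ 2 ->
  (k = 1 -> - (pi / 2) <= u <= pi / 2) ->
  height k (lrad k y * snk k u, y) = lrad k y * csk k u.
Proof.
move=> hk hy hu; rewrite /height/=.
have -> : 1 - k * ((lrad k y * snk k u) ^+ 2 + y ^+ 2) = (lrad k y * csk k u) ^+ 2.
  rewrite !exprMn sqr_lrad//; have := csk2snk2 u hk.
  by move=> h; rewrite -[csk k u ^+ 2](addrK (k * snk k u ^+ 2)) h; ring.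
rewrite sqrtr_sqr ger0_norm// mulr_ge0 ?sqrtr_ge0//.
have [k1|k1] := eqVneq k 1; last by rewrite ltW// csk_gt0.
by rewrite /csk k1 eqxx cos_ge0_pihalf// hu.
Qed.

(** * Area by parallels and its invariance *)

(** The longitudes covered by the graph z = h: on the sphere it carries only the open half z > 0 of
    each parallel, in the other geometries the whole parallel. *)
Definition sheet (R : realType) (k : R) : set R :=
  [set u | k = 1 -> - (pi / 2) < u < pi / 2].

Lemma sheet_ball (R : realType) (k : R) : exists al : nat -> R,
  [/\ {homo al : m n / (m <= n)%N >-> m <= n},
      forall n u, - al n <= u <= al n -> sheet k u &
      forall u, sheet k u -> exists n, - al n < u <= al n].
Proof.
have bnd (x : R) : exists n : nat, - n%:R < x < n%:R.
  by exists (Num.bound `|x|); rewrite -ltr_norml archi_boundP.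
have [k1|k1] := eqVneq k 1.
  (* [atan n] increases to pi / 2, the end of the sheet. *)
  exists (fun n => atan n%:R); split.
  - by move=> m n mn; apply: le_atan; rewrite ler_nat.
  - move=> n u /andP[h1 h2] _; have := atan_ltpi2 (n%:R : R).
    by move=> h3; apply/andP; split; lra.
  - move=> u /(_ k1) hu; have [n /andP[h1 h2]] := bnd (tan u); exists n.
    rewrite -atanN -[u]tanK ?in_itv//; apply/andP; split; first exact: lt_atan.
    by apply: le_atan; exact: ltW.
exists (fun n => n%:R); split.
- by move=> m n mn; rewrite ler_nat.
- by move=> n u _ k1'; move: k1; rewrite k1' eqxx.
- by move=> u _; have [n /andP[h1 h2]] := bnd u; exists n; rewrite h1 ltW.
Qed.

Lemma measurable_sheet (R : realType) (k : R) : measurable (sheet k).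
Proof.
have [k1|k1] := eqVneq k 1.
  rewrite (_ : sheet k = `](- (pi / 2)), (pi / 2)[%classic) //.
  by apply/seteqP; split=> u /=; rewrite /sheet/= in_itv/= k1; [exact|].
rewrite (_ : sheet k = setT) //; apply/seteqP; split=> // u _ k1'.
by move: k1; rewrite k1' eqxx.
Qed.

Lemma continuous_quad (R : realType) (k c : R) :
  continuous (fun x : R => k * (x ^+ 2 + c)).
Proof.
move=> x; apply: (@continuous_derive _ _ _ (k * (2 * x))).
by apply: is_derive_eq; rewrite /GRing.scale/=; ring.
Qed.

Lemma continuous_height1 (R : realType) (k y : R) :
  continuous (fun x : R => height k (x, y)).
Proof.
move=> x; rewrite /height/=.
apply: (@continuous_comp R R R (fun x => 1 - k * (x ^+ 2 + y ^+ 2)) (@Num.sqrt R)).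
  by apply: continuousB; [exact: cst_continuous|exact: continuous_quad].
exact: sqrt_continuous.
Qed.

(** Put x = [lrad k y * snk k u]. Then [height] equals [lrad k y * csk k u], so dx / height = du:
    along a parallel the area density is uniform in the longitude. *)
Lemma slice_integral (R : realType) (k y : R) (B : set R) : curv k ->
  0 < 1 - k * y ^+ 2 -> measurable B ->
  (\int[@lebesgue_measure R]_(x in [set x | (k * (x ^+ 2 + y ^+ 2) < 1)%R] `&` B)
     ((height k (x, y))^-1)%R%:E =
   lebesgue_measure (sheet k `&` [set u | B (lrad k y * snk k u)%R]))%E.
Proof.
move=> hk hy mB; have q0 := lrad_gt0 hy; have q2 := sqr_lrad hy.
set q := lrad k y in q0 q2 *.
have [al [al1 al2 al3]] := sheet_ball k.
have Ix x : k * (x ^+ 2 + y ^+ 2) < 1 -> 0 < 1 - k * (x / q) ^+ 2.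
  move=> h; rewrite expr_div_n; have q20 : 0 < q ^+ 2 by rewrite exprn_gt0.
  rewrite -(pmulr_lgt0 _ q20) mulrBl mul1r -mulrA divfK ?lt0r_neq0// q2.
  by lra.
have dx (x : R) : is_derive x 1 (fun x : R => x / q) q^-1.
  have := is_deriveZ q^-1 (is_derive_id x 1).
  rewrite (_ : _ \*: _ = (fun x => x / q)); last by apply/funext => z; rewrite /= mulrC.
  by rewrite /GRing.scale/= mulr1.
apply: (@integral_substitution _ _ (fun x => arsnk k (x / q)) _ _ _ al) => //.
- rewrite (_ : [set x | _] = (fun x => k * (x ^+ 2 + y ^+ 2)) @^-1` [set z | z < 1]) //.
  apply: open_comp; last exact: open_lt.
  by move=> x _; exact: continuous_quad.
- move=> x x' z /= hx hx' xz zx'.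
  case: hk => [|[|]] kE; rewrite kE in hx hx' *.
  + by have := sqr_ge0 z; have := sqr_ge0 y; lra.
  + by lra.
  + have : z ^+ 2 <= x ^+ 2 \/ z ^+ 2 <= x' ^+ 2 by
      have [z0|z0] := leP 0 z; [right|left]; nra.
    by case=> ?; lra.
- move=> x /= hx; split.
  + have := @is_derive1_comp _ (arsnk k) (fun x => x / q) x _ _
      (is_derive_arsnk hk (Ix _ hx)) (dx x).
    move=> h; apply: is_derive_eq h _.
    rewrite -invfM; congr (_^-1); rewrite /height/=.
    have -> : 1 - k * (x ^+ 2 + y ^+ 2) = (1 - k * (x / q) ^+ 2) * q ^+ 2.
      rewrite expr_div_n mulrBl mul1r -mulrA divfK ?q2; first by ring.
      by rewrite -q2 lt0r_neq0// exprn_gt0.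
    by rewrite sqrtrM ?ltW ?Ix// sqrtr_sqr gtr0_norm.
  + by rewrite invr_ge0 sqrtr_ge0.
  + apply: continuousV; first by rewrite lt0r_neq0// sqrtr_gt0 subr_gt0.
    exact: continuous_height1.
- move=> u Ju; split.
    rewrite /= exprMn q2; have := csk2snk2 u hk => h.
    have hc : csk k u ^+ 2 = 1 - k * snk k u ^+ 2 by lra.
    suff : 0 < (1 - k * y ^+ 2) * csk k u ^+ 2 by rewrite hc; lra.
    apply: mulr_gt0 => //; rewrite exprn_even_gt0//=; apply/lt0r_neq0.
    have [k1|k1] := eqVneq k 1; last exact: csk_gt0.
    by rewrite /csk k1 eqxx cos_gt0_pihalf// Ju.
  rewrite mulrAC divff ?lt0r_neq0// mul1r snkK// => /Ju /andP[? ?].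
  by rewrite !ltW.
- move=> x /= hx; split.
    move=> k1; have := Ix _ hx; rewrite k1 mul1r => h.
    have xq : -1 < x / q < 1.
      rewrite -ltr_norml -(@ltr_pXn2r _ 2)// ?nnegrE// real_normK ?num_real// expr1n.
      by lra.
    rewrite /arsnk eqxx; case/andP: xq => h1 h2.
    by rewrite asin_gtNpi2 ?h1 ?ltW// asin_ltpi2// (ltW h1) h2.
  rewrite arsnkK//; first by rewrite mulrC divfK// lt0r_neq0.
  move=> k1; have := Ix _ hx; rewrite k1 mul1r => h.
  rewrite -ler_norml -(@ler_pXn2r _ 2)// ?nnegrE// real_normK ?num_real// expr1n.
  by lra.
- move=> u v Ju Jv uv; rewrite ler_pM2l//.
  apply: (@ger0_derive1_le_cc R (snk k) u v) => //.
  + move=> w _; exact: (@ex_derive _ _ _ _ _ _ _ (is_derive_snk w hk)).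
  + move=> w; rewrite in_itv/= => /andP[uw wv].
    rewrite derive1E (@derive_val _ _ _ _ _ _ _ (is_derive_snk w hk)).
    have [k1|k1] := eqVneq k 1; last by rewrite ltW// csk_gt0.
    rewrite /csk k1 eqxx cos_ge0_pihalf//.
    by have := Ju k1; have := Jv k1; move=> /andP[? ?] /andP[? ?]; apply/andP; split; lra.
  + by apply: continuous_subspaceT => w; exact: continuous_snk.
  + by rewrite in_itv/= lexx.
  + by rewrite in_itv/= lexx uv.
- exact: measurable_sheet.
- apply: continuous_measurable_fun => u.
  apply: (@continuous_comp R R R (snk k) ( *%R q)); first exact: continuous_snk.
  exact: mulrl_continuous.
Qed.

(** * Area as the integral of its slices by parallels *)

Lemma open2_measurable (R : realType) (O : set (R * R)) : open O -> measurable O.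
Proof.
(* Rational boxes that are not contained in [O] are replaced by the empty set, so that the union may
   run over all rationals. *)
move=> oO; pose F (p q r s : rat) : set (R * R) :=
  if `[< (`]ratr p, ratr q[ `*` `]ratr r, ratr s[)%classic `<=` O >]
  then (`]ratr p, ratr q[ `*` `]ratr r, ratr s[)%classic else set0.
have -> : O = \bigcup_p \bigcup_q \bigcup_r \bigcup_s F p q r s.
  apply/seteqP; split=> [[a b] Oab|w [p _ [q _ [r _ [s _]]]]]; last first.
    by rewrite /F; case: asboolP => // H Hw; exact: H.
  move: oO; rewrite openE => /(_ _ Oab) [[A B]/= [/nbhs_ballP[e e0 eA] /nbhs_ballP[d d0 dB]] ABO].
  have rat_between (x y : R) : x < y -> exists p : rat, x < ratr p < y.
    by move=> /rat_in_itvoo[p]; rewrite in_itv/= => hp; exists p.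
  have [|p /andP[p1 p2]] := rat_between (a - e) a; first by move: e0; rewrite /= ; lra.
  have [|q /andP[q1 q2]] := rat_between a (a + e); first by move: e0; rewrite /= ; lra.
  have [|r /andP[r1 r2]] := rat_between (b - d) b; first by move: d0; rewrite /= ; lra.
  have [|s /andP[s1 s2]] := rat_between b (b + d); first by move: d0; rewrite /= ; lra.
  exists p => //; exists q => //; exists r => //; exists s => //.
  rewrite /F; case: asboolP => [_|[]].
    by split; rewrite /= in_itv/= ?p2 ?r2.
  move=> [x y] [/=]; rewrite !in_itv/= => /andP[x1 x2] /andP[y1 y2]; apply: ABO.
  split => /=.
    by apply: eA; rewrite /ball/= ltr_norml; apply/andP; split; lra.
  by apply: dB; rewrite /ball/= ltr_norml; apply/andP; split; lra.
do 4 (apply: bigcupT_measurable_rat => ?).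
rewrite /F; case: ifP => // _.
by apply: measurableX.
Qed.

(** Regions are predicates of three reals in what follows, which makes rotations mere substitutions;
    [region] leads back to sets of row vectors. *)
Definition md (R : realType) (k x y z : R) : Prop :=
  k * (x ^+ 2 + y ^+ 2) + z ^+ 2 = 1 /\ (k != 1 -> 0 < z).

(** The open set of R^3 is what continuous parametrizations of the surface pull back to open, hence
    measurable, sets. *)
Definition ropen (R : realType) (k : R) (U : R -> R -> R -> Prop) : Prop :=
  exists2 O : set (R * R * R), open O &
    forall x y z, U x y z <-> md k x y z /\ O (x, y, z).

Definition chart (R : realType) (k s : R) (U : R -> R -> R -> Prop) : set (R * R) :=
  [set w | k * (w.1 ^+ 2 + w.2 ^+ 2) < 1 /\ U w.1 w.2 (s * height k w)].

Lemma height_gt0 (R : realType) (k : R) (w : R * R) :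
  k * (w.1 ^+ 2 + w.2 ^+ 2) < 1 -> 0 < height k w.
Proof. by move=> h; rewrite sqrtr_gt0 subr_gt0. Qed.

Lemma sqr_height (R : realType) (k : R) (w : R * R) :
  k * (w.1 ^+ 2 + w.2 ^+ 2) < 1 ->
  height k w ^+ 2 = 1 - k * (w.1 ^+ 2 + w.2 ^+ 2).
Proof. by move=> h; rewrite sqr_sqrtr// subr_ge0 ltW. Qed.

Lemma continuous_quad2 (R : realType) (k : R) :
  continuous (fun w : R * R => k * (w.1 ^+ 2 + w.2 ^+ 2)).
Proof.
move=> w; apply: (@continuous_comp _ _ _ (fun w : R * R => w.1 ^+ 2 + w.2 ^+ 2) ( *%R k));
  last exact: mulrl_continuous.
have sq (g : R * R -> R) : continuous g -> continuous (fun w => g w ^+ 2).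
  move=> cg v; apply: (@continuous_comp _ _ _ g (fun x : R => x ^+ 2)); first exact: cg.
  exact: exprn_continuous.
by apply: continuousD; apply: sq => v; [exact: cvg_fst|exact: cvg_snd].
Qed.

Lemma continuous_height (R : realType) (k : R) : continuous (height k : R * R -> R).
Proof.
move=> w; apply: (@continuous_comp _ _ _ (fun w : R * R => 1 - k * (w.1 ^+ 2 + w.2 ^+ 2))
  (@Num.sqrt R)); last exact: sqrt_continuous.
by apply: continuousB; [exact: cst_continuous|exact: continuous_quad2].
Qed.

Lemma open_disk (R : realType) (k : R) :
  open [set w : R * R | k * (w.1 ^+ 2 + w.2 ^+ 2) < 1].
Proof.
apply: (@open_comp _ _ (fun w : R * R => k * (w.1 ^+ 2 + w.2 ^+ 2)) [set z | z < 1]).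
  by move=> w _; exact: continuous_quad2.
exact: open_lt.
Qed.

Lemma continuous_pair (T U V : topologicalType) (f : T -> U) (g : T -> V) (x : T) :
  {for x, continuous f} -> {for x, continuous g} ->
  {for x, continuous (fun t => (f t, g t))}.
Proof. by move=> cf cg; exact: (cvg_pair cf cg). Qed.

Lemma open_chart (R : realType) (k s : R) U : s = 1 \/ s = -1 -> ropen k U ->
  open (chart k s U).
Proof.
move=> hs [V oO OE].
have [[k1 s1]|ks] := pselect (k != 1 /\ s = -1).
  rewrite (_ : chart k s U = set0); first exact: open0.
  apply/seteqP; split=> // w [/height_gt0 h0 /OE[[_ /(_ k1)]]].
  by rewrite s1 mulN1r; lra.
rewrite (_ : chart k s U = [set w | k * (w.1 ^+ 2 + w.2 ^+ 2) < 1] `&`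
  (fun w => (w.1, w.2, s * height k w)) @^-1` V); last first.
  apply/seteqP; split=> w [hw H]; split => //.
    by have [] := (OE _ _ _).1 H.
  apply/OE; split => //; split.
    rewrite exprMn sqr_height//.
    have -> : s ^+ 2 = 1 by case: hs => ->; rewrite ?sqrrN expr1n.
    by ring.
  move=> k1; case: hs => s1; last by case: ks.
  by rewrite s1 mul1r height_gt0.
apply: openI; first exact: open_disk.
apply: open_comp => // w _.
apply: (@continuous_pair _ _ _ (fun w : R * R => (w.1, w.2)) (fun w => s * height k w) w).
  by apply: (@continuous_pair _ _ _ (@fst R R) (@snd R R) w); [exact: cvg_fst|exact: cvg_snd].
apply: (@continuous_comp _ _ _ (height k) ( *%R s)); first exact: continuous_height.
exact: mulrl_continuous.
Qed.

Lemma measurable_chart (R : realType) (k s : R) U : s = 1 \/ s = -1 -> ropen k U ->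
  measurable (chart k s U).
Proof. by move=> hs hU; apply: open2_measurable; exact: open_chart. Qed.

(* [(lrad k y * snk k u, y, lrad k y * csk k u)] is the point at height [y] and longitude
   [u] around the [y]-axis; for [k = 1] the two terms are the two halves of a parallel. *)
Definition slice (R : realType) (k y : R) (U : R -> R -> R -> Prop) : \bar R :=
  (lebesgue_measure (sheet k `&`
     [set u | U (lrad k y * snk k u)%R y (lrad k y * csk k u)%R])
   + lebesgue_measure (sheet k `&`
     [set u | U (lrad k y * snk k u)%R y (- (lrad k y * csk k u))%R]))%E.

Definition region (R : realType) (U : R -> R -> R -> Prop) : set 'rV[R]_3 :=
  [set p | U (p 0 0) (p 0 1) (p 0 2)].

Lemma pt3E (R : realType) (x y z : R) :
  [/\ pt3 x y z 0 0 = x, pt3 x y z 0 1 = y & pt3 x y z 0 2 = z].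
Proof. by rewrite /pt3; split; rewrite mxE. Qed.

Lemma indic_region (R : realType) (U : R -> R -> R -> Prop) x y z :
  \1_(region U) (pt3 x y z) = `[< U x y z >]%:R :> R.
Proof.
rewrite indicE; congr (nat_of_bool _)%:R; have [h0 h1 h2] := pt3E x y z.
by apply/idP/asboolP; rewrite inE /region/= h0 h1 h2.
Qed.

Lemma measurable_inv (R : realType) : measurable_fun [set: R] (@GRing.inv R).
Proof.
rewrite -(setUv [set x : R | x != 0]); apply/measurable_funU.
- by apply: open_measurable; exact: open_neq.
- by apply: measurableC; apply: open_measurable; exact: open_neq.
split.
  apply: open_continuous_measurable_fun; first exact: open_neq.
  by move=> x; rewrite inE /= => x0; exact: inv_continuous.
rewrite (_ : ~` _ = [set 0]); first exact: measurable_fun_set1.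
by apply/seteqP; split=> x /=; [move/negP; rewrite negbK => /eqP|move=> ->; rewrite eqxx].
Qed.

Lemma measurable_height (R : realType) (k : R) :
  measurable_fun [set: R * R] (height k).
Proof.
rewrite /height; apply: (@measurableT_comp _ _ _ _ _ _ (@Num.sqrt R)).
  apply: continuous_measurable_fun; exact: sqrt_continuous.
apply: measurable_funB => //; apply: measurable_funM => //.
by apply: measurable_funD; apply: measurable_funX; [exact: measurable_fst|exact: measurable_snd].
Qed.

(** The integrand of [area] extended by zero to the whole plane, the form to which Tonelli
    applies. *)
Definition areaf (R : realType) (k : R) (U : R -> R -> R -> Prop) (w : R * R) : \bar R :=
  ((fun w => ((\1_(chart k 1 U) w + \1_(chart k (-1) U) w) / height k w)%:E)
     \_ [set w : R * R | k * (w.1 ^+ 2 + w.2 ^+ 2) < 1]) w.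

Lemma areaf_ge0 (R : realType) (k : R) U (w : R * R) : (0 <= areaf k U w)%E.
Proof.
rewrite /areaf patchE; case: ifP => // _; rewrite lee_fin divr_ge0 ?sqrtr_ge0//.
Qed.

Lemma measurable_areaf (R : realType) (k : R) U : ropen k U ->
  measurable_fun setT (areaf k U).
Proof.
move=> hU; rewrite /areaf; apply/(measurable_restrictT _ _).1.
  by apply: open2_measurable; exact: open_disk.
apply/measurable_EFinP; apply: measurable_funTS; apply: measurable_funM.
  by apply: measurable_funD; apply: measurable_indic; apply: measurable_chart => //;
    [left|right].
by apply: (@measurableT_comp _ _ _ _ _ _ (@GRing.inv R));
  [exact: measurable_inv|exact: measurable_height].
Qed.

Lemma area_areaf (R : realType) (k : R) U :
  area k (region U) =
  (\int[@lebesgue_measure R \x @lebesgue_measure R]_w areaf k U w)%E.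
Proof.
rewrite /area integral_mkcond; apply: eq_integral => w _; rewrite /areaf !patchE.
case: ifP => //; rewrite inE/= => hw; congr (_ / _)%:E.
rewrite !indic_region !indicE; congr (_%:R + _%:R); congr nat_of_bool.
  by apply/asboolP/idP; rewrite inE /chart/= mul1r; [|case].
by apply/asboolP/idP; rewrite inE /chart/= mulN1r; [|case].
Qed.

Lemma sheet_lt (R : realType) (k y u : R) : curv k -> 0 < 1 - k * y ^+ 2 ->
  sheet k u -> k * ((lrad k y * snk k u) ^+ 2 + y ^+ 2) < 1.
Proof.
move=> hk hy Ju; rewrite exprMn sqr_lrad//; have h := csk2snk2 u hk.
have hc : csk k u ^+ 2 = 1 - k * snk k u ^+ 2 by lra.
suff : 0 < (1 - k * y ^+ 2) * csk k u ^+ 2 by rewrite hc; lra.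
apply: mulr_gt0 => //; rewrite exprn_even_gt0//=; apply/lt0r_neq0.
have [k1|k1] := eqVneq k 1; last exact: csk_gt0.
by rewrite /csk k1 eqxx cos_gt0_pihalf// Ju.
Qed.

Lemma integral_areaf_slice (R : realType) (k y : R) U : curv k -> ropen k U ->
  (\int[@lebesgue_measure R]_x areaf k U (x, y) =
   ((slice k ^~ U) \_ [set y | (0 < 1 - k * y ^+ 2)%R]) y)%E.
Proof.
move=> hk hU; rewrite patchE; have [hy|hy] := pselect (0 < 1 - k * y ^+ 2); last first.
  rewrite memNset// integral0_eq// => x _; rewrite /areaf patchE; case: ifPn => //.
  rewrite inE/= => hx; exfalso; apply: hy; move: hk => [|[|]] kE; rewrite kE in hx *.
  - by have := sqr_ge0 y; lra.
  - by lra.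
  - by have := sqr_ge0 x; lra.
rewrite mem_set//; have mD : measurable [set x : R | k * (x ^+ 2 + y ^+ 2) < 1].
  apply: open_measurable.
  apply: (@open_comp _ _ (fun x : R => k * (x ^+ 2 + y ^+ 2)) [set z | z < 1]).
    by move=> x _; exact: continuous_quad.
  exact: open_lt.
pose B s := [set x : R | chart k s U (x, y)].
have mB s : s = 1 \/ s = -1 -> measurable (B s).
  move=> hs; have := measurable_chart hs hU.
  by move=> /(@measurable_ysection _ _ _ _ _ y); rewrite /ysection/B; congr measurable;
    apply/seteqP; split=> x /=; rewrite inE.
have mh : measurable_fun [set: R] (fun x => (height k (x, y))^-1).
  apply: (@measurableT_comp _ _ _ _ _ _ (@GRing.inv R)); first exact: measurable_inv.
  by apply: continuous_measurable_fun; exact: continuous_height1.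
have hB s : s = 1 \/ s = -1 ->
  (\int[@lebesgue_measure R]_(x in [set x | (k * (x ^+ 2 + y ^+ 2) < 1)%R])
    ((\1_(B s) x / height k (x, y))%R%:E) =
  \int[@lebesgue_measure R]_(x in [set x | (k * (x ^+ 2 + y ^+ 2) < 1)%R] `&` B s)
     ((height k (x, y))^-1)%R%:E)%E.
  move=> hs; rewrite integral_mkcondr; apply: eq_integral => x _.
  by rewrite patchE indicE; case: ifP => _ /=; rewrite ?mul1r ?mul0r.
have ge0 s x : 0 <= \1_(B s) x / height k (x, y).
  by rewrite divr_ge0 ?sqrtr_ge0.
transitivity (\int[@lebesgue_measure R]_(x in [set x | (k * (x ^+ 2 + y ^+ 2) < 1)%R])
    ((\1_(B 1) x / height k (x, y))%R%:E + (\1_(B (-1)) x / height k (x, y))%R%:E))%E.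
  rewrite [RHS]integral_mkcond; apply: eq_integral => x _; rewrite /areaf !patchE.
  rewrite (_ : ((x, y) \in [set w : R * R | k * (w.1 ^+ 2 + w.2 ^+ 2) < 1]) =
    (x \in [set x | k * (x ^+ 2 + y ^+ 2) < 1])); last by apply/idP/idP; rewrite !inE.
  case: ifP => // _; rewrite mulrDl EFinD; congr (_%:E + _%:E)%E;
  by congr (_ / _); rewrite !indicE; congr (nat_of_bool _)%:R; apply/idP/idP; rewrite !inE.
have m1 s : s = 1 \/ s = -1 -> measurable_fun [set x : R | k * (x ^+ 2 + y ^+ 2) < 1]
    (fun x => (\1_(B s) x / height k (x, y))%:E).
  move=> hs; apply/measurable_EFinP; apply: measurable_funTS; apply: measurable_funM => //.
  by apply: measurable_indic; exact: mB.
rewrite ge0_integralD//; last 4 first.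
- by move=> x _; rewrite lee_fin.
- by apply: m1; left.
- by move=> x _; rewrite lee_fin.
- by apply: m1; right.
rewrite !hB; [|by right|by left].
rewrite !slice_integral//; [|by apply: mB; right|by apply: mB; left].
rewrite /slice; congr (lebesgue_measure _ + lebesgue_measure _)%E.
  apply/seteqP; split=> u /= [Ju H]; split => //; move: H;
    rewrite /B /chart/= ?mul1r height_snk//; try by case.
  - by move=> k1; have := Ju k1; move=> /andP[/ltW -> /ltW ->].
  - by move=> H; split => //; exact: sheet_lt.
  - by move=> k1; have := Ju k1; move=> /andP[/ltW -> /ltW ->].
apply/seteqP; split=> u /= [Ju H]; split => //; move: H;
  rewrite /B /chart/= ?mulN1r height_snk//; try by case.
- by move=> k1; have := Ju k1; move=> /andP[/ltW -> /ltW ->].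
- by move=> H; split => //; exact: sheet_lt.
- by move=> k1; have := Ju k1; move=> /andP[/ltW -> /ltW ->].
Qed.

Lemma areaE (R : realType) (k : R) U : curv k -> ropen k U ->
  (area k (region U) =
   \int[@lebesgue_measure R]_(y in [set y | (0 < 1 - k * y ^+ 2)%R]) slice k y U)%E.
Proof.
move=> hk hU; rewrite area_areaf fubini_tonelli2; first last.
- by move=> w; exact: areaf_ge0.
- exact: measurable_areaf.
rewrite [RHS]integral_mkcond; apply: eq_integral => y _.
exact: integral_areaf_slice.
Qed.

Lemma measurable_slice (R : realType) (k : R) U : curv k -> ropen k U ->
  measurable_fun [set: R] ((slice k ^~ U) \_ [set y | 0 < 1 - k * y ^+ 2]).
Proof.
move=> hk hU.
have := measurable_fun_fubini_tonelli_G (m1 := @lebesgue_measure R)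
  (areaf k U) (measurable_areaf hU) (areaf_ge0 k U).
by congr measurable_fun; apply/funext => y; exact: integral_areaf_slice.
Qed.

(** * Invariance of the area under rotations *)

Lemma ropen_swap (R : realType) (k : R) U : ropen k U ->
  ropen k (fun x y z => U y x z).
Proof.
move=> [V oV VE]; exists ((fun p : R * R * R => (p.1.2, p.1.1, p.2)) @^-1` V).
  apply: open_comp => // p _.
  apply: (@continuous_pair _ _ _ (fun p : R * R * R => (p.1.2, p.1.1)) snd p);
    last exact: cvg_snd.
  apply: (@continuous_pair _ _ _ (fun p : R * R * R => p.1.2) (fun p => p.1.1) p).
    by apply: (@continuous_comp _ _ _ fst snd p); [exact: cvg_fst|exact: cvg_snd].
  by apply: (@continuous_comp _ _ _ fst fst p); [exact: cvg_fst|exact: cvg_fst].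
by move=> x y z; rewrite VE /md [y ^+ 2 + _]addrC.
Qed.

(** The integrand for the swapped region is the original one with its arguments exchanged, and the
    two iterated integrals of a nonnegative function agree. Together with [area_rotxz] this provides
    the rotations about the x-axis. *)
Lemma area_swap (R : realType) (k : R) U : ropen k U ->
  area k (region (fun x y z => U y x z)) = area k (region U).
Proof.
move=> hU; have hU' := ropen_swap hU.
rewrite !area_areaf fubini_tonelli1; first last.
- by move=> w; exact: areaf_ge0.
- exact: measurable_areaf.
rewrite fubini_tonelli2; first last.
- by move=> w; exact: areaf_ge0.
- exact: measurable_areaf.
apply: eq_integral => y _; apply: eq_integral => x _.
rewrite /areaf !patchE /=.
have hsym : height k (y, x) = height k (x, y) by rewrite /height/= [y ^+ 2 + _]addrC.
have -> : ((y, x) \in [set w : R * R | k * (w.1 ^+ 2 + w.2 ^+ 2) < 1]) =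
    ((x, y) \in [set w : R * R | k * (w.1 ^+ 2 + w.2 ^+ 2) < 1]).
  by apply/idP/idP; rewrite !inE/= [y ^+ 2 + _]addrC.
case: ifP => // _; rewrite hsym; congr (((_ + _) / _)%:E);
rewrite !indicE; congr (nat_of_bool _)%:R; apply/idP/idP;
  by rewrite !inE /chart/= hsym [y ^+ 2 + _]addrC.
Qed.

(** The longitude is a real number rather than an angle: on the sphere this set has period 2 pi, and
    [slice] measures one period of it. *)
Definition lon (R : realType) (k y : R) (U : R -> R -> R -> Prop) : set R :=
  [set u | U (lrad k y * snk k u) y (lrad k y * csk k u)].

Lemma md_lon (R : realType) (k y u : R) : curv k -> 0 < 1 - k * y ^+ 2 ->
  md k (lrad k y * snk k u) y (lrad k y * csk k u).
Proof.
move=> hk hy; split; last by move=> k1; rewrite mulr_gt0 ?lrad_gt0 ?csk_gt0.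
have h := csk2snk2 u hk; rewrite !exprMn sqr_lrad//.
have hc : csk k u ^+ 2 = 1 - k * snk k u ^+ 2 by lra.
by rewrite hc; ring.
Qed.

Lemma continuous_lon (R : realType) (k y : R) : curv k ->
  continuous (fun u => (lrad k y * snk k u, y, lrad k y * csk k u)).
Proof.
move=> hk u.
apply: (@continuous_pair _ _ _ (fun u => (lrad k y * snk k u, y)) (fun u => lrad k y * csk k u) u).
  apply: (@continuous_pair _ _ _ (fun u => lrad k y * snk k u) (fun=> y) u);
    last exact: cst_continuous.
  apply: (@continuous_comp R R R (snk k) ( *%R (lrad k y))); first exact: continuous_snk.
  exact: mulrl_continuous.
apply: (@continuous_comp R R R (csk k) ( *%R (lrad k y))); first exact: continuous_csk.
exact: mulrl_continuous.
Qed.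

Lemma measurable_lon (R : realType) (k y : R) U : curv k -> 0 < 1 - k * y ^+ 2 ->
  ropen k U -> measurable (lon k y U).
Proof.
move=> hk hy [V oV VE]; apply: open_measurable.
rewrite (_ : lon k y U =
  (fun u => (lrad k y * snk k u, y, lrad k y * csk k u)) @^-1` V).
  by apply: open_comp => // u _; exact: continuous_lon.
apply/seteqP; split=> u; rewrite /lon/= VE; first by case.
by split => //; exact: md_lon.
Qed.

Lemma lebesgue_reflection (R : realType) (c : R) (E : set R) : measurable E ->
  lebesgue_measure [set x | E (c - x)] = lebesgue_measure E.
Proof.
move=> mE; rewrite -(lebesgue_translation c mE).
have mE' : measurable [set x : R | E (x + c)].
  rewrite (_ : [set x | _] = (fun x => x + c) @^-1` E) // -[X in measurable X]setTI.
  have mf : measurable_fun [set: R] (fun x : R => x + c) by apply: measurable_funD.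
  exact: mf.
rewrite -(lebesgue_measureN mE'); congr lebesgue_measure.
by apply/seteqP; split=> x /=; rewrite addrC.
Qed.

Lemma slice_hyp (R : realType) (k y : R) U : curv k -> 0 < 1 - k * y ^+ 2 ->
  k != 1 -> ropen k U -> slice k y U = lebesgue_measure (lon k y U).
Proof.
move=> hk hy k1 [V oV VE]; rewrite /slice.
have sT : sheet k = setT.
  by apply/seteqP; split=> // u _ k1'; move: k1; rewrite k1' eqxx.
rewrite sT setTI [X in (_ + lebesgue_measure X)%E](_ : _ = set0); last first.
  apply/seteqP; split=> // u [_ /=] /VE[[_ /(_ k1)]].
  have : 0 < lrad k y * csk k u by rewrite mulr_gt0 ?lrad_gt0 ?csk_gt0.
  by lra.
by rewrite measure0 adde0.
Qed.

Lemma lon_2pi (R : realType) (y : R) (U : R -> R -> R -> Prop) u :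
  lon 1 y U (u + 2 * pi) = lon 1 y U u.
Proof.
by rewrite mulr_natl mulr2n addrA; rewrite /lon/= /snk /csk !curvE !sinDpi !cosDpi !opprK.
Qed.

Lemma lam_oo_oc (R : realType) (a b : R) (E : set R) : measurable E ->
  lebesgue_measure (E `&` `]a, b[%classic) = lebesgue_measure (E `&` `]a, b]%classic).
Proof.
move=> mE; have [ab|ba] := ltP a b; last first.
  rewrite !(@set_itv_ge _ _ (BRight a)) ?bnd_simp -?leNgt//.
have h : E `&` `]a, b]%classic = (E `&` `]a, b[%classic) `|` (E `&` [set b]).
  rewrite -setIUr; congr (_ `&` _); apply/seteqP; split=> u /=; rewrite !in_itv/=.
    move=> /andP[h1]; rewrite le_eqVlt => /predU1P[->|h2]; [by right|left].
    by rewrite h1.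
  by case=> [/andP[-> /ltW]//|->]; rewrite ab lexx.
rewrite h measureU//; last 3 first.
- by apply: measurableI.
- by apply: measurableI.
- by apply/seteqP; split=> // u [[_ /=]]; rewrite in_itv/= => /andP[_ h1] [_ /= ub]; move: h1; rewrite ub ltxx.
rewrite [X in _ = (_ + X)%E](_ : _ = 0%E) ?adde0//.
apply/eqP; rewrite -measure_le0 -(@lebesgue_measure_set1 _ b); apply: le_measure => //; rewrite inE//.
by apply: measurableI.
Qed.

(** The reflection of u to pi - u turns the second sheet into the half pi / 2 < u < 3 pi / 2 of the
    parallel. The window is half-open so that its translates tile the line. *)
Lemma slice_sph (R : realType) (y : R) U : 0 < 1 - 1 * y ^+ 2 ->
  ropen 1 U -> slice 1 y U =
  lebesgue_measure (lon 1 y U `&` `]- (pi / 2), 3 * (pi / 2)]%classic).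
Proof.
move=> hy hU; have hk : curv (1 : R) by right; right.
have mL := measurable_lon hk hy hU.
have p0 := pi_gt0 R.
have sE : sheet 1 = `](- (pi / 2)), (pi / 2)[%classic :> set R.
  by apply/seteqP; split=> u /=; rewrite in_itv/= /sheet/=; [exact|].
rewrite /slice.
have -> : lebesgue_measure (sheet 1 `&`
    [set u | U (lrad 1 y * snk 1 u) y (- (lrad 1 y * csk 1 u))]) =
  lebesgue_measure (lon 1 y U `&` `](pi / 2), (3 * (pi / 2))[%classic).
  rewrite -[RHS](@lebesgue_reflection _ pi); last by apply: measurableI.
  congr lebesgue_measure; rewrite sE; apply/seteqP.
  have sp u : sin (pi - u) = sin u by rewrite sinB sinpi cospi; ring.
  have cp u : cos (pi - u) = - cos u by rewrite cosB sinpi cospi; ring.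
  split=> u /=; rewrite !in_itv/= /lon/= /snk /csk !curvE sp cp mulrN.
    by move=> [/andP[h1 h2] H]; split; [exact: H|apply/andP; split; lra].
  by move=> [H /andP[h1 h2]]; split; [apply/andP; split; lra|].
rewrite sE setIC !lam_oo_oc// -measureU//; last 3 first.
- by apply: measurableI.
- by apply: measurableI.
- apply/seteqP; split=> // u [[_ /=]]; rewrite in_itv/= => /andP[_ h1] [_ /=].
  by rewrite in_itv/= => /andP[h2 _]; lra.
rewrite -setIUr; congr (lebesgue_measure (_ `&` _)).
apply/seteqP; split=> u /=; rewrite !in_itv/=.
  by case=> /andP[h1 h2]; apply/andP; split; lra.
move=> /andP[h1 h2]; have [h|h] := leP u (pi / 2); [left|right]; apply/andP; split; lra.
Qed.

(** Cut the window at the first multiple of p beyond s and translate the two pieces back: they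
    exchange places inside ]0, p]. *)
Lemma periodic_window (R : realType) (E : set R) (p s : R) : 0 < p ->
  measurable E -> (forall u, E (u + p) <-> E u) ->
  lebesgue_measure (E `&` `]s, s + p]%classic) = lebesgue_measure (E `&` `]0, p]%classic).
Proof.
move=> p0 mE perE.
have perN (n : nat) u : E (u + n%:R * p) <-> E u.
  elim: n => [|n IH]; first by rewrite mul0r addr0.
  have -> : u + n.+1%:R * p = u + n%:R * p + p by rewrite -natr1; ring.
  exact: (iff_trans (perE _) IH).
have perZ (n : int) u : E (u + n%:~R * p) <-> E u.
  case: n => n; first exact: perN.
  by rewrite NegzE mulrNz mulNr -(perN n.+1 (u - _)) subrK.
have trans (n : int) (a b : R) : lebesgue_measure (E `&` `]a + n%:~R * p, b + n%:~R * p]%classic)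
    = lebesgue_measure (E `&` `]a, b]%classic).
  rewrite -(@lebesgue_translation _ (n%:~R * p)); last by apply: measurableI.
  congr lebesgue_measure; apply/seteqP; split=> u /= [/perZ Eu]; rewrite !in_itv/= => /andP[h1 h2];
    (split; first by [|apply/perZ]); apply/andP; split; lra.
have split3 (a b c : R) : a <= b -> b <= c -> lebesgue_measure (E `&` `]a, c]%classic) =
    (lebesgue_measure (E `&` `]a, b]%classic) + lebesgue_measure (E `&` `]b, c]%classic))%E.
  move=> ab bc; rewrite -measureU//; last 3 first.
  - by apply: measurableI.
  - by apply: measurableI.
  - apply/seteqP; split=> // u [[_ /=]]; rewrite in_itv/= => /andP[_ h1] [_ /=].
    by rewrite in_itv/= => /andP[h2 _]; lra.
  rewrite -setIUr; congr (lebesgue_measure (_ `&` _)).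
  apply/seteqP; split=> u /=; rewrite !in_itv/=.
    move=> /andP[h1 h2]; have [h|h] := leP u b; [left|right]; apply/andP; split; lra.
  by case=> /andP[h1 h2]; apply/andP; split; lra.
pose n := Num.floor (s / p); pose r := s - n%:~R * p.
have /andP[n1 n2] : n%:~R <= s / p < (n + 1)%:~R by exact: floor_itv.
have r0 : 0 <= r by rewrite subr_ge0 -ler_pdivlMr.
have rp : r <= p.
  by move: n2; rewrite ltr_pdivrMr// intrD mulrDl mul1r /r; lra.
rewrite (split3 s ((n + 1)%:~R * p)); last 2 first.
- by rewrite -ler_pdivrMr// ltW.
- by rewrite intrD mulrDl mul1r -/r; move: r0; rewrite /r; lra.
rewrite (split3 0 r)// addeC; congr (_ + _)%E.
  rewrite -(trans (n + 1) 0 r) add0r.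
  by have -> : r + (n + 1)%:~R * p = s + p by rewrite /r intrD; ring.
rewrite -(trans n r p); have -> : r + n%:~R * p = s by rewrite /r subrK.
by have -> : p + n%:~R * p = (n + 1)%:~R * p by rewrite intrD; ring.
Qed.

(** Pulls [U] back along a motion that fixes y: a rotation for k = 1, a Lorentz boost for k = -1,
    and for k = 0 a translation of the plane z = 1 along x. *)
Definition rotxz (R : realType) (k tau : R) (U : R -> R -> R -> Prop) (x y z : R) : Prop :=
  U (x * csk k tau + z * snk k tau) y (z * csk k tau - k * (x * snk k tau)).

Lemma snkN (R : realType) (k u : R) : curv k -> snk k (- u) = - snk k u.
Proof.
move=> [|[|]] ->; rewrite /snk !curvE//; last by rewrite sinN.
by rewrite /sinh opprK; lra.
Qed.

Lemma cskN (R : realType) (k u : R) : curv k -> csk k (- u) = csk k u.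
Proof.
move=> [|[|]] ->; rewrite /csk !curvE//; last by rewrite cosN.
by rewrite opprK addrC.
Qed.

Lemma md_rotxz (R : realType) (k tau x y z : R) : curv k ->
  md k (x * csk k tau + z * snk k tau) y (z * csk k tau - k * (x * snk k tau)) <->
  md k x y z.
Proof.
move=> hk; have half t x' z' : md k x' y z' ->
    md k (x' * csk k t + z' * snk k t) y (z' * csk k t - k * (x' * snk k t)).
  move=> [h hz]; have ht := csk2snk2 t hk; split.
    transitivity ((k * x' ^+ 2 + z' ^+ 2) * (csk k t ^+ 2 + k * snk k t ^+ 2) + k * y ^+ 2).
      by ring.
    by rewrite ht mulr1 -h; ring.
  move=> k1; have z0 := hz k1; have c0 := csk_gt0 t k1.
  case: hk => [|[|]] kE; rewrite kE in h hz z0 c0 ht k1 *; last by rewrite eqxx in k1.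
    set c := csk _ t in c0 ht *; set s := snk _ t in ht *.
    (* The upper sheet is preserved, because |s| < c and |x'| < z'. *)
    have : `|x' * s| < z' * c.
      rewrite -(@ltr_pXn2r _ 2)// ?nnegrE ?mulr_ge0 ?ltW//.
      rewrite real_normK ?num_real// !exprMn.
      have -> : z' ^+ 2 = 1 + x' ^+ 2 + y ^+ 2 by lra.
      have -> : c ^+ 2 = 1 + s ^+ 2 by lra.
      by have := sqr_ge0 x'; have := sqr_ge0 y; have := sqr_ge0 s; nra.
    by rewrite ltr_norml => /andP[? ?]; lra.
  by rewrite mul0r subr0 mulr_gt0.
split; last exact: half.
move=> /(half (- tau)); rewrite snkN// cskN//; have ht := csk2snk2 tau hk.
congr md.
  transitivity (x * (csk k tau ^+ 2 + k * snk k tau ^+ 2)); first by ring.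
  by rewrite ht mulr1.
transitivity (z * (csk k tau ^+ 2 + k * snk k tau ^+ 2)); first by ring.
by rewrite ht mulr1.
Qed.

Lemma ropen_rotxz (R : realType) (k tau : R) U : curv k -> ropen k U ->
  ropen k (rotxz k tau U).
Proof.
move=> hk [V oV VE]; exists ((fun p : R * R * R =>
  (p.1.1 * csk k tau + p.2 * snk k tau, p.1.2,
   p.2 * csk k tau - k * (p.1.1 * snk k tau))) @^-1` V).
  apply: open_comp => // p _.
  have c1 : {for p, continuous (fun p : R * R * R => p.1.1)}.
    by apply: (@continuous_comp _ _ _ fst fst p); [exact: cvg_fst|exact: cvg_fst].
  have c2 : {for p, continuous (fun p : R * R * R => p.1.2)}.
    by apply: (@continuous_comp _ _ _ fst snd p); [exact: cvg_fst|exact: cvg_snd].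
  have c3 : {for p, continuous (fun p : R * R * R => p.2)} by exact: cvg_snd.
  have cm (f : R * R * R -> R) (c : R) : {for p, continuous f} ->
      {for p, continuous (fun p => f p * c)}.
    by move=> cf; apply: (@continuous_comp _ _ _ f ( *%R ^~ c)) => //; exact: mulrr_continuous.
  apply: (@continuous_pair _ _ _
    (fun p : R * R * R => (p.1.1 * csk k tau + p.2 * snk k tau, p.1.2))
    (fun p => p.2 * csk k tau - k * (p.1.1 * snk k tau)) p).
    apply: (@continuous_pair _ _ _
      (fun p : R * R * R => p.1.1 * csk k tau + p.2 * snk k tau) (fun p => p.1.2) p) => //.
    by apply: continuousD; exact: cm.
  apply: continuousB; first exact: cm.
  apply: (@continuous_comp _ _ _ (fun p : R * R * R => p.1.1 * snk k tau) ( *%R k)).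
    exact: cm.
  exact: mulrl_continuous.
by move=> x y z; rewrite /rotxz VE md_rotxz.
Qed.

Lemma lon_rotxz (R : realType) (k tau y u : R) U : curv k ->
  lon k y (rotxz k tau U) u = lon k y U (u + tau).
Proof.
move=> hk; rewrite /lon/= /rotxz snkD// cskD//; congr U; ring.
Qed.

(** The motion adds tau to the longitude. On the sphere this moves the window of length 2 pi, and
    periodicity moves it back. *)
Lemma slice_rotxz (R : realType) (k tau y : R) U : curv k -> 0 < 1 - k * y ^+ 2 ->
  ropen k U -> slice k y (rotxz k tau U) = slice k y U.
Proof.
move=> hk hy hU; have hU' := ropen_rotxz tau hk hU.
have lonE : lon k y (rotxz k tau U) = [set u | lon k y U (u + tau)].
  by apply/funext => u; rewrite lon_rotxz.
have mL := measurable_lon hk hy hU.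
have [k1|k1] := eqVneq k 1; last first.
  by rewrite !slice_hyp// lonE lebesgue_translation.
rewrite k1 in hk hy hU hU' lonE mL *; rewrite !slice_sph// lonE.
have w0 : 0 < 2 * pi :> R by have := pi_gt0 R; lra.
have pE : 3 * (pi / 2) = - (pi / 2) + 2 * pi :> R by lra.
have per u : lon 1 y U (u + 2 * pi) <-> lon 1 y U u by rewrite lon_2pi.
rewrite (_ : _ `&` _ = [set u | (lon 1 y U `&`
  `]- (pi / 2) + tau, 3 * (pi / 2) + tau]%classic) (u + tau)]); last first.
  apply/seteqP; split=> u /= [H]; rewrite !in_itv/= => /andP[h1 h2];
    split => //; apply/andP; split; lra.
rewrite lebesgue_translation; last by apply: measurableI.
have -> : 3 * (pi / 2) + tau = - (pi / 2) + tau + 2 * pi by lra.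
by rewrite pE !periodic_window.
Qed.

Lemma area_rotxz (R : realType) (k tau : R) U : curv k -> ropen k U ->
  area k (region (rotxz k tau U)) = area k (region U).
Proof.
move=> hk hU; rewrite !areaE//; last exact: ropen_rotxz.
by apply: eq_integral => y; rewrite inE/= => hy; exact: slice_rotxz.
Qed.

(** On the sphere the interval is repeated with period 2 pi, since a meridian determines the lifted
    longitude of the curve only modulo 2 pi. *)
Definition arcs (R : realType) (k m M : R) : set R :=
  [set u | exists2 n : int, (k = 1 \/ n = 0) & m <= u + n%:~R * (2 * pi) <= M].

Lemma measurable_arcs (R : realType) (k m M : R) : measurable (arcs k m M).
Proof.
rewrite (_ : arcs k m M = \bigcup_(n in [set n : int | k = 1 \/ n = 0])
   `[m - n%:~R * (2 * pi), M - n%:~R * (2 * pi)]%classic).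
  rewrite bigcup_mkcond; apply: countable_bigcupT_measurable => // n.
  by case: ifP => // _; exact: measurable_itv.
apply/seteqP; split=> u /= [n hn].
  by move=> /andP[h1 h2]; exists n => //=; rewrite in_itv/=; apply/andP; split; lra.
by move=> /=; rewrite in_itv/= => /andP[h1 h2]; exists n => //; apply/andP; split; lra.
Qed.

Lemma arcs_periodic (R : realType) (m M u : R) :
  arcs 1 m M (u + 2 * pi) <-> arcs 1 m M u.
Proof.
split=> -[n _ /andP[h1 h2]].
  by exists (n + 1); [left|rewrite intrD mulrDl mul1r; apply/andP; split; lra].
by exists (n - 1); [left|rewrite intrB mulrBl mul1r; apply/andP; split; lra].
Qed.

Lemma arcs_hyp (R : realType) (k m M : R) : k != 1 -> m <= M ->
  lebesgue_measure (arcs k m M) = (M - m)%:E.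
Proof.
move=> k1 mM; rewrite (_ : arcs k m M = `[m, M]%classic).
  rewrite lebesgue_measure_itv/= lte_fin; move: mM; rewrite le_eqVlt => /predU1P[->|->].
    by rewrite ltxx subrr.
  by rewrite EFinB.
apply/seteqP; split=> u /=; rewrite in_itv/=.
  by move=> [n [/eqP|->]]; [rewrite (negbTE k1)|rewrite mul0r addr0].
by move=> h; exists 0; [right|rewrite mul0r addr0].
Qed.

Lemma arcs_sph (R : realType) (m M s : R) : m <= M ->
  (lebesgue_measure (arcs 1 m M `&` `](s : R), (s + 2 * pi)%R]%classic) <= (M - m)%:E)%E.
Proof.
move=> mM; have p0 : 0 < 2 * pi :> R by have := pi_gt0 R; lra.
rewrite periodic_window//; [|exact: measurable_arcs|by move=> u; exact: arcs_periodic].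
(* In the window ]M - 2 pi, M] a point u with u + 2 pi n in [m, M] has n <= 0, hence m <= u. *)
rewrite -(@periodic_window _ _ _ (M - 2 * pi))//;
  [|exact: measurable_arcs|by move=> u; exact: arcs_periodic].
have -> : (M - m)%:E = lebesgue_measure `[m, M]%classic.
  rewrite lebesgue_measure_itv/= lte_fin; move: mM; rewrite le_eqVlt => /predU1P[->|->].
    by rewrite ltxx subrr.
  by rewrite EFinB.
apply: le_measure; rewrite ?inE//.
  by apply: measurableI => //; exact: measurable_arcs.
move=> u [[n _ /andP[h1 h2]]] /=; rewrite !in_itv/= => /andP[h3 h4].
have h5 : u <= M by lra.
rewrite h5 andbT; have [n0|n0] := leP n 0; last first.
  move: n0; rewrite gtz0_ge1 -(ler_int R) => n1. have : 2 * pi <= n%:~R * (2 * pi) :> R by rewrite ler_peMl// ltW.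
  by lra.
move: n0; rewrite -(ler_int R) => n1; have : n%:~R * (2 * pi) <= 0 :> R by rewrite mulr_le0_ge0// ltW.
by lra.
Qed.

Lemma slice_le (R : realType) (k y : R) U (N : nat) (m M : nat -> R) :
  curv k -> 0 < 1 - k * y ^+ 2 -> ropen k U ->
  (forall i, (i < N)%N -> m i <= M i) ->
  (forall u, lon k y U u -> exists2 i, (i < N)%N & arcs k (m i) (M i) u) ->
  (slice k y U <= \sum_(i < N) (M i - m i)%:E)%E.
Proof.
move=> hk hy hU mM H; have mL := measurable_lon hk hy hU.
have sub i : measurable (arcs k (m i) (M i)) by exact: measurable_arcs.
have [k1|k1] := eqVneq k 1; last first.
  rewrite slice_hyp//.
  apply: (@le_trans _ _ (\sum_(i < N) lebesgue_measure (arcs k (m i) (M i)))%E).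
    apply: (@content_subadditive _ _ _ lebesgue_measure _
      (fun i => arcs k (m i) (M i)) N).
    - by move=> i _; exact: sub.
    - exact: mL.
    - move=> u /H[i iN Hi].
      by rewrite -(bigcup_mkord N (fun i => arcs k (m i) (M i))); exists i.
  by apply: lee_sum => i _; rewrite arcs_hyp// mM.
rewrite k1 in hk hy hU mL H sub *; rewrite slice_sph//.
have -> : 3 * (pi / 2) = - (pi / 2) + 2 * pi :> R by lra.
apply: (@le_trans _ _ (\sum_(i < N) lebesgue_measure (arcs 1 (m i) (M i) `&`
   `](- (pi / 2))%R, (- (pi / 2) + 2 * pi)%R]%classic))%E).
  apply: (@content_subadditive _ _ _ lebesgue_measure _ (fun i => arcs 1 (m i) (M i) `&`
    `]- (pi / 2), - (pi / 2) + 2 * pi]%classic) N).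
  - by move=> i _; apply: measurableI; [exact: sub|].
  - by apply: measurableI.
  - move=> u [/H[i iN Hi] hu].
    by rewrite -(bigcup_mkord N (fun i => arcs 1 (m i) (M i) `&`
      `]- (pi / 2), - (pi / 2) + 2 * pi]%classic)); exists i.
by apply: lee_sum => i _; apply: arcs_sph; exact: mM.
Qed.

(** Area is Lebesgue measure in the coordinates (y, u), so covering boxes bound it by the sum of
    their areas. *)
Lemma area_le_boxes (R : realType) (k : R) U (N : nat) (m M c d : nat -> R) :
  curv k -> ropen k U ->
  (forall i, (i < N)%N -> m i <= M i) ->
  (forall i, (i < N)%N -> c i <= d i) ->
  (forall y u, 0 < 1 - k * y ^+ 2 -> lon k y U u ->
    exists i, [/\ (i < N)%N, c i <= y <= d i & arcs k (m i) (M i) u]) ->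
  (area k (region U) <= \sum_(i < N) ((M i - m i) * (d i - c i))%:E)%E.
Proof.
move=> hk hU mM cd H; rewrite areaE//.
rewrite integral_mkcond.
apply: (@le_trans _ _ (\int[@lebesgue_measure R]_y
   (\sum_(i < N) ((M i - m i) * \1_(`[c i, d i]%classic) y)%:E))%E).
  apply: ge0_le_integral => //.
  - move=> y _; rewrite patchE; case: ifP => // _.
    by rewrite /slice adde_ge0.
  - exact: measurable_slice.
  - apply: emeasurable_sum => i; apply/measurable_EFinP; apply: measurable_funM => //.
  - move=> y _; rewrite patchE; case: ifPn => [|_]; last first.
      by apply: sume_ge0 => i _; rewrite lee_fin mulr_ge0// subr_ge0 mM.
    rewrite inE/= => hy.
    (* At heights outside the box i its interval shrinks to a point, so the sum over all i counts
       only the boxes met by this parallel. *)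
    pose M' i := if c i <= y <= d i then M i else m i.
    have M'E i : M' i - m i = (M i - m i) * \1_(`[c i, d i]%classic) y.
      rewrite /M' indicE; case: ifPn => h; first by rewrite mem_set ?mulr1//= in_itv.
      rewrite memNset ?mulr0 ?subrr//= in_itv/=; exact/negP.
    under eq_bigr => i _ do rewrite -M'E.
    apply: slice_le => //.
      by move=> i iN; rewrite /M'; case: ifP => // _; exact: mM.
    move=> u /(H y u hy)[i [iN hi Hi]]; exists i => //.
    by rewrite /M' hi.
rewrite ge0_integral_sum//; last 2 first.
- by move=> i; apply/measurable_EFinP; apply: measurable_funM.
- by move=> i y _; rewrite lee_fin mulr_ge0// subr_ge0 mM.
apply: lee_sum => i _.
under eq_integral do rewrite EFinM.
rewrite ge0_integralZl//; last 2 first.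
- exact/measurable_EFinP.
- by rewrite lee_fin subr_ge0 mM.
rewrite integral_indic// setIT EFinM /= lebesgue_measure_itv/= lte_fin.
have := cd i (ltn_ord i); rewrite le_eqVlt => /predU1P[->|->].
  by rewrite ltxx subrr.
by rewrite EFinB.
Qed.

(** * The area swept along meridians *)

Lemma itv_oo_sub (R : realType) (a b c d t : R) :
  a <= c -> d <= b -> c < t < d -> a < t < b.
Proof.
by move=> ac db /andP[h1 h2]; rewrite (le_lt_trans ac h1) (lt_le_trans h2 db).
Qed.

Lemma pwd_id (R : realType) (a b : R) E : pwd a b E (fun t => t) (fun _ => 1).
Proof.
split; last exact: pwc_cst.
  by apply: continuous_subspaceT => x; exact: cvg_id.
by move=> t _ _; exact: is_derive_id.
Qed.

Lemma pwd_norm_le (R : realType) (a b : R) E (f df g dg : R -> R) :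
  pwd a b E f df -> pwd a b E g dg ->
  forall s t, a <= s -> s <= t -> t <= b ->
  (forall u, s < u < t -> u \notin E -> `|df u| <= dg u) ->
  `|f t - f s| <= g t - g s.
Proof.
move=> pf pg s t as_ st tb H; rewrite ler_norml; apply/andP; split.
  have := pwd_le (pwdZ (-1) pf) pg as_ st tb.
  have h u : s < u < t -> u \notin E -> -1 * df u <= dg u.
    by move=> h1 h2; have := H u h1 h2; rewrite ler_norml => /andP[? ?]; lra.
  by move=> /(_ h); lra.
apply: (pwd_le pf pg as_ st tb) => u h1 h2.
by have := H u h1 h2; rewrite ler_norml => /andP[].
Qed.

Lemma pwc_le (R : realType) (a b : R) E (v w : R -> R) :
  a <= b -> pwc a b E v -> pwc a b E w ->
  (forall u, a < u < b -> u \notin E -> v u <= w u) -> prim a v b <= prim a w b.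
Proof.
move=> ab pv pw H.
have := pwd_le (pwd_prim ab pv) (pwd_prim ab pw) (lexx a) ab (lexx b) H.
by rewrite !prim_self !subr0.
Qed.

Lemma pwd_inv (R : realType) (a b : R) E (f df : R -> R) :
  pwd a b E f df -> (forall t, a <= t <= b -> f t != 0) ->
  pwd a b E (fun t => (f t)^-1) (fun t => - (df t * ((f t)^-1 * (f t)^-1))).
Proof.
move=> pf f0; have cinv t : a <= t <= b -> {for f t, continuous (@GRing.inv R)}.
  by move=> /f0; exact: inv_continuous.
move: (pf) => [cf hf pdf]; have ci := @within_comp _ _ _ f (@GRing.inv R) cf cinv.
split=> //.
- move=> t tab tE; have h := hf t tab tE.
  have ft : f t != 0 by apply: f0; case/andP: tab => *; rewrite !ltW.
  have h' := is_deriveV ft h.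
  by apply: is_derive_eq h' _; rewrite /GRing.scale/= expr2 invfM mulNr mulrC.
- have p1 := pwcM pdf (pwcM (pwc_within E ci) (pwc_within E ci)).
  have := pwcM (pwc_cst a b E (-1)) p1; congr pwc.
  by apply/funext => t; rewrite mulN1r.
Qed.

Record curve (R : realType) (k a b : R) (E : seq R) (x dx y dy z dz : R -> R) : Prop :=
  Curve {
    curve_ab : a < b;
    curve_x : pwd a b E x dx;
    curve_y : pwd a b E y dy;
    curve_z : pwd a b E z dz;
    curve_md : forall t, a <= t <= b -> md k (x t) (y t) (z t) }.

Lemma curve_tangent (R : realType) (k a b : R) E (x dx y dy z dz : R -> R) :
  curve k a b E x dx y dy z dz -> forall t, a < t < b -> t \notin E ->
  k * (x t * dx t + y t * dy t) + z t * dz t = 0.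
Proof.
move=> [ab px py pz hmd] t tab tE.
have p := pwdD (pwdZ k (pwdD (pwdM px px) (pwdM py py))) (pwdM pz pz).
have := pwd_deriv_const p (k := 1) _ tab tE.
move=> h; have {}h := h _.
have : k * (x t * dx t + x t * dx t + (y t * dy t + y t * dy t)) + (z t * dz t + z t * dz t) = 0.
  by apply: h => s /hmd[h1 _]; rewrite -!expr2.
by lra.
Qed.

Lemma lon_exists (R : realType) (k x y z : R) : curv k -> md k x y z ->
  0 < 1 - k * y ^+ 2 -> exists u, x = lrad k y * snk k u /\ z = lrad k y * csk k u.
Proof.
move=> hk [h hz] hy; have q0 := lrad_gt0 hy; have q2 := sqr_lrad hy.
have q0' := lt0r_neq0 q0; set q := lrad k y in q0 q0' q2 *.
have h1 : k * (x / q) ^+ 2 + (z / q) ^+ 2 = 1.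
  apply: (mulIf (expf_neq0 2 q0')); rewrite mul1r mulrDl -mulrA -!exprMn !divfK// q2.
  by rewrite -[in RHS]h; ring.
have [k1|k1] := eqVneq k 1; last first.
  have s1 : snk k (arsnk k (x / q)) = x / q.
    by apply: arsnkK => // k1'; rewrite k1' eqxx in k1.
  exists (arsnk k (x / q)); split; first by rewrite s1 mulrC divfK.
  have c0 := csk_gt0 (arsnk k (x / q)) k1.
  have := csk2snk2 (arsnk k (x / q)) hk; rewrite s1 -h1 addrC => /addrI/eqP.
  rewrite eqrXn2 ?ltW ?divr_gt0 ?hz// => /eqP ->.
  by rewrite mulrC divfK.
rewrite k1 mul1r in h1.
have xq : -1 <= x / q <= 1.
  rewrite -ler_norml -(@ler_pXn2r _ 2)// ?nnegrE// real_normK ?num_real// expr1n.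
  by have := sqr_ge0 (z / q); lra.
have s1 : sin (asin (x / q)) = x / q by rewrite asinK// in_itv.
have c1 : cos (asin (x / q)) = `|z / q|.
  by rewrite cos_asin// (_ : 1 - _ = (z / q) ^+ 2) ?sqrtr_sqr//; lra.
have [z0|z0] := leP 0 (z / q).
  exists (asin (x / q)); rewrite /snk /csk k1 !curvE s1 c1 ger0_norm//.
  by split; rewrite mulrC divfK.
exists (pi - asin (x / q)); rewrite /snk /csk k1 !curvE sinB cosB sinpi cospi s1 c1 ltr0_norm//.
rewrite (_ : 0 * _ - _ = x / q); last by ring.
rewrite (_ : -1 * _ + _ = z / q); last by ring.
by split; rewrite mulrC divfK.
Qed.

(** The candidate [th] integrates the angular derivative. Let P and N be the components of (x, z)
    across and along the direction [th]. The quotient of P^2 by 1 - k y^2 has zero derivative and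
    starts at 0, so P vanishes; hence N^2 = 1 - k y^2 > 0, and N keeps its positive initial sign. *)
Lemma curve_lift (R : realType) (k a b : R) E (x dx y dy z dz : R -> R) :
  curv k -> curve k a b E x dx y dy z dz ->
  (forall t, a <= t <= b -> 0 < 1 - k * y t ^+ 2) ->
  exists2 th : R -> R,
    pwd a b E th (fun t => (z t * dx t - x t * dz t) * (1 - k * y t ^+ 2)^-1) &
    forall t, a <= t <= b ->
      x t = lrad k (y t) * snk k (th t) /\ z t = lrad k (y t) * csk k (th t).
Proof.
move=> hk hc hy; have htan := curve_tangent hc; have [ab px py pz hmd] := hc.
have aab : a <= a <= b by rewrite lexx ltW.
have pq : pwd a b E (fun t => 1 - k * y t ^+ 2) (fun t => - (2 * k * (y t * dy t))).
  have := pwdB (pwd_cst a b E 1) (pwdZ k (pwdM py py)).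
  rewrite (_ : (fun t => 1 - k * (y t * y t)) = (fun t => 1 - k * y t ^+ 2))//.
  by apply: pwd_ext => t; ring.
have q0 t : a <= t <= b -> 1 - k * y t ^+ 2 != 0 by move=> /hy/lt0r_neq0.
have pqi := pwd_inv pq q0.
pose v t := (z t * dx t - x t * dz t) * (1 - k * y t ^+ 2)^-1.
have pv : pwc a b E v.
  apply: pwcM; last exact: pwd_pwc pqi.
  have [_ _ pdx] := px; have [_ _ pdz] := pz.
  have := pwcD (pwcM (pwd_pwc pz) pdx) (pwcM (pwc_cst a b E (-1)) (pwcM (pwd_pwc px) pdz)).
  by congr pwc; apply/funext => t; rewrite mulN1r.
have [u0 [xu0 zu0]] := lon_exists hk (hmd _ aab) (hy _ aab).
pose th t := u0 + prim a v t.
have pth : pwd a b E th v.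
  have := pwdD (pwd_cst a b E u0) (pwd_prim (ltW ab) pv).
  by apply: pwd_ext => t; rewrite add0r.
have ps : pwd a b E (snk k \o th) (fun t => csk k (th t) * v t).
  apply: (pwd_comp pth) => t _; split; first exact: is_derive_snk.
  exact: continuous_csk.
have pc : pwd a b E (csk k \o th) (fun t => - k * snk k (th t) * v t).
  apply: (@pwd_comp _ _ _ _ _ _ (csk k) (fun u => - k * snk k u) pth) => t _.
  split; first exact: is_derive_csk.
  apply: (@continuous_comp R R R (snk k) ( *%R (- k))); first exact: continuous_snk.
  exact: mulrl_continuous.
exists th => //.
have pP := pwdB (pwdM px pc) (pwdM pz ps).
(* P^2 and 1 - k y^2 have the same logarithmic derivative, so their quotient is constant. *)
have pP2 := pwdM (pwdM pP pP) pqi.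
have sc t : csk k (th t) ^+ 2 + k * snk k (th t) ^+ 2 = 1 by exact: csk2snk2.
have P0 t : a <= t <= b -> x t * csk k (th t) - z t * snk k (th t) = 0.
  move=> /andP[at_ tb].
  have := pwd_const pP2 (lexx a) at_ tb; rewrite /= => h.
  have {}h := h _.
  have tab : a <= t <= b by rewrite at_.
  have tha : th a = u0 by rewrite /th prim_self addr0.
  have : (x t * csk k (th t) - z t * snk k (th t)) *
     (x t * csk k (th t) - z t * snk k (th t)) * (1 - k * y t ^+ 2)^-1 = 0.
    rewrite h; first by rewrite tha xu0 zu0; ring.
    move=> s sat sE.
    have sab : a < s < b by exact: itv_oo_sub sat.
    have sab' : a <= s <= b by case/andP: sab => *; rewrite !ltW.
    have tg := htan s sab sE; have [m1 _] := hmd _ sab'.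
    rewrite /v; set q := 1 - _; have qn : q != 0 by exact: q0.
    have qE : q = k * x s ^+ 2 + z s ^+ 2 by rewrite /q -m1; ring.
    have yE : - (2 * k * (y s * dy s)) = 2 * (k * (x s * dx s) + z s * dz s).
      by rewrite -[RHS]subr0 -[in RHS](mulr0 2) -tg; ring.
    rewrite yE; move: qE qn; move: (q) => q' qE qn; rewrite qE in qn *.
    by field.
  move=> /eqP; rewrite !mulf_eq0 invr_eq0 (negbTE (q0 _ tab)) orbF orbb => /eqP //.
pose N t := z t * csk k (th t) + k * (x t * snk k (th t)).
have N2 t : a <= t <= b -> N t ^+ 2 = 1 - k * y t ^+ 2.
  move=> tab; have p0 := P0 t tab; have [m1 _] := hmd _ tab.
  transitivity ((k * x t ^+ 2 + z t ^+ 2) * (csk k (th t) ^+ 2 + k * snk k (th t) ^+ 2)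
     - k * (x t * csk k (th t) - z t * snk k (th t)) ^+ 2); first by rewrite /N; ring.
  by rewrite p0 sc expr0n/= mulr0 subr0 mulr1 -m1; ring.
have cN : {within `[a, b], continuous N}.
  have pN := pwdD (pwdM pz pc) (pwdZ k (pwdM px ps)).
  exact: pwd_continuous pN.
have Na : 0 < N a.
  have tha : th a = u0 by rewrite /th prim_self addr0.
  rewrite /N tha xu0 zu0 (_ : _ + _ = lrad k (y a) * (csk k u0 ^+ 2 + k * snk k u0 ^+ 2)); last by ring.
  by rewrite csk2snk2// mulr1 lrad_gt0// hy.
have Npos t : a <= t <= b -> 0 < N t.
  move=> /andP[at_ tb]; rewrite ltNge; apply/negP => Nt.
  have [c cat Nc] : exists2 c, c \in `[a, t] & N c = 0.
    apply: IVT => //; first exact: within_cont_sub cN.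
    by rewrite ge_min le_max Nt orbT (ltW Na).
  move: cat; rewrite in_itv/= => /andP[ac ct].
  have cab : a <= c <= b by rewrite ac (le_trans ct tb).
  by have := N2 c cab; rewrite Nc expr0n/= => h; have := hy c cab; rewrite -h ltxx.
move=> t tab; have Nq : N t = lrad k (y t).
  by rewrite /lrad -N2// sqrtr_sqr gtr0_norm// Npos.
have p0 := P0 t tab; have s1 := sc t; rewrite -Nq /N; split.
  transitivity (x t * (csk k (th t) ^+ 2 + k * snk k (th t) ^+ 2)); first by rewrite s1 mulr1.
  transitivity (csk k (th t) * (x t * csk k (th t) - z t * snk k (th t)) +
    (z t * csk k (th t) + k * (x t * snk k (th t))) * snk k (th t)); first by ring.
  by rewrite p0; ring.
transitivity (z t * (csk k (th t) ^+ 2 + k * snk k (th t) ^+ 2)); first by rewrite s1 mulr1.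
transitivity (- k * snk k (th t) * (x t * csk k (th t) - z t * snk k (th t)) +
    (z t * csk k (th t) + k * (x t * snk k (th t))) * csk k (th t)); first by ring.
by rewrite p0; ring.
Qed.

(** What the argument retains of a component of the complement of the curve. In [domain_path] the
    path is continuous on R, but has to lie on the surface and to miss the curve on [s0, s1]
    only. *)
Record domain (R : realType) (k a b : R) (x y z : R -> R)
    (U : R -> R -> R -> Prop) : Prop := Domain {
  domain_open : ropen k U;
  domain_avoid : forall t, a <= t <= b -> ~ U (x t) (y t) (z t);
  domain_path : forall (fx fy fz : R -> R) (s0 s1 : R),
    continuous fx -> continuous fy -> continuous fz -> s0 <= s1 ->
    (forall s, s0 <= s <= s1 -> md k (fx s) (fy s) (fz s) /\
       forall t, a <= t <= b -> ~ [/\ fx s = x t, fy s = y t & fz s = z t]) ->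
    U (fx s0) (fy s0) (fz s0) -> U (fx s1) (fy s1) (fz s1);
  domain_bounded : k != 1 -> exists M, forall x y z, U x y z ->
    [/\ `|x| <= M, `|y| <= M & `|z| <= M] }.

Lemma sin_cos_eq (R : realType) (u v : R) : sin u = sin v -> cos u = cos v ->
  exists n : int, u + n%:~R * (2 * pi) = v.
Proof.
move=> hs hc; have p0 : 0 < 2 * pi :> R by have := pi_gt0 R; lra.
have cos1 : cos (v - u) = 1 by rewrite cosB hs hc -!expr2 cos2Dsin2.
pose n := Num.floor ((v - u) / (2 * pi)).
have /andP[n1 n2] : n%:~R <= (v - u) / (2 * pi) < (n + 1)%:~R by exact: floor_itv.
move: n1 n2; rewrite ler_pdivlMr// ltr_pdivrMr// intrD mulrDl mul1r => n1 n2.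
exists n; apply/eqP; rewrite eq_sym -subr_eq0 opprD addrA.
have per (m : nat) w : cos (w + m%:R * (2 * pi)) = cos w :> R.
  elim: m w => [|m IH] w; first by rewrite mul0r addr0.
  have -> : w + m.+1%:R * (2 * pi) = w + m%:R * (2 * pi) + pi + pi by rewrite -natr1; ring.
  by rewrite !cosDpi opprK.
have perz (m : int) w : cos (w + m%:~R * (2 * pi)) = cos w :> R.
  case: m => m; first exact: per.
  by rewrite NegzE mulrNz mulNr -(per m.+1 (w - _)) subrK.
set w := v - u - _; have w0 : 0 <= w by rewrite /w; lra.
have w2 : w < 2 * pi by rewrite /w; lra.
have cw : cos w = 1.
  rewrite -(perz n w) (_ : w + n%:~R * (2 * pi) = v - u) //.
  by rewrite /w; ring.
apply/negPn/negP => wn0; have wp : 0 < w by rewrite lt_neqAle eq_sym wn0 w0.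
have s0 : 0 < sin (w / 2) by apply: sin_gt0_pi; lra.
have : cos (w / 2 + w / 2) = 1 by rewrite -splitr.
rewrite cosD; have := cos2Dsin2 (w / 2); have := mulr_gt0 s0 s0.
by rewrite !expr2; lra.
Qed.

Lemma snk_csk_eq (R : realType) (k u v : R) : curv k ->
  snk k u = snk k v -> csk k u = csk k v ->
  exists2 n : int, (k = 1 \/ n = 0) & u + n%:~R * (2 * pi) = v.
Proof.
move=> hk hs hc; have [k1|k1] := eqVneq k 1.
  move: hs hc; rewrite /snk /csk k1 !curvE => hs hc.
  by have [n hn] := sin_cos_eq hs hc; exists n => //; left.
exists 0; first by right.
rewrite mul0r addr0 -(@snkK _ k u)//; last by move=> k1'; rewrite k1' eqxx in k1.
by rewrite hs snkK// => k1'; rewrite k1' eqxx in k1.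
Qed.

Lemma continuous_lrad (R : realType) (k : R) : continuous (lrad k).
Proof.
move=> y; rewrite /lrad.
apply: (@continuous_comp R R R (fun y => 1 - k * y ^+ 2) (@Num.sqrt R));
  last exact: sqrt_continuous.
apply: continuousB; first exact: cst_continuous.
apply: (@continuous_comp R R R (fun y : R => y ^+ 2) ( *%R k)); first exact: exprn_continuous.
exact: mulrl_continuous.
Qed.

(* A point of [U] moves along its meridian, away from the parallel [y = y0],
   until it meets the curve: otherwise [U] would be unbounded, or contain a pole. *)
Lemma meridian_exit (R : realType) (k a b : R) (x y z : R -> R) U (u y1 : R) (up : bool) :
  curv k -> domain k a b x y z U ->
  (k = 1 -> ~ U 0 1 0 /\ ~ U 0 (-1) 0) ->
  0 < 1 - k * y1 ^+ 2 -> lon k y1 U u ->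
  exists t, [/\ a <= t <= b, (if up then y1 <= y t else y t <= y1),
    x t = lrad k (y t) * snk k u & z t = lrad k (y t) * csk k u].
Proof.
move=> hk hU hpole hy1 hu.
pose e : R := if up then 1 else -1.
pose fy (s : R) := y1 + e * s.
pose fx (s : R) := lrad k (fy s) * snk k u.
pose fz (s : R) := lrad k (fy s) * csk k u.
have e2 : e ^+ 2 = 1 by rewrite /e; case: ifP => _; rewrite ?sqrrN expr1n.
have cy : continuous fy.
  move=> s; apply: continuousD; first exact: cst_continuous.
  exact: mulrl_continuous.
have cl : continuous (lrad k \o fy).
  by move=> s; apply: continuous_comp; [exact: cy|exact: continuous_lrad].
have cx : continuous fx.
  move=> s; apply: (@continuous_comp R R R (lrad k \o fy) ( *%R ^~ (snk k u))); first exact: cl.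
  exact: mulrr_continuous.
have cz : continuous fz.
  move=> s; apply: (@continuous_comp R R R (lrad k \o fy) ( *%R ^~ (csk k u))); first exact: cl.
  exact: mulrr_continuous.
have key (s1 : R) : 0 <= s1 -> (forall s, 0 <= s <= s1 -> 0 <= 1 - k * fy s ^+ 2) ->
    ~ U (fx s1) (fy s1) (fz s1) ->
    exists t, [/\ a <= t <= b, (if up then y1 <= y t else y t <= y1),
      x t = lrad k (y t) * snk k u & z t = lrad k (y t) * csk k u].
  move=> s10 hq nU; apply: contrapT => nex; apply: nU.
  apply: (domain_path hU cx cy cz s10); last by rewrite /fx /fz /fy mulr0 addr0.
  move=> s s01; split.
    have [q0|q0] := ltP 0 (1 - k * fy s ^+ 2); first exact: md_lon.
    have q1 : 1 - k * fy s ^+ 2 = 0 by apply/le_anti; rewrite q0 hq.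
    have k1 : k = 1.
      case: hk => [|[|]] kE //; rewrite kE in q1 *; last by lra.
      by have := sqr_ge0 (fy s); lra.
    split; last by rewrite k1 eqxx.
    by rewrite /fx /fz /lrad q1 sqrtr0 !mul0r expr0n/= add0r addr0; lra.
  move=> t tab [h1 h2 h3]; apply: nex; exists t; rewrite -h1 -h2 -h3; split => //.
  by rewrite /fy /e; case/andP: s01 => s0 _; case: ifP => hup; rewrite ?hup; lra.
have [k1|k1] := eqVneq k 1.
  have [hp1 hp2] := hpole k1.
  rewrite k1 mul1r in hy1.
  have y1b : -1 < y1 < 1.
    rewrite -ltr_norml -(@ltr_pXn2r _ 2)// ?nnegrE// real_normK ?num_real// expr1n.
    by lra.
  case/andP: y1b => y1l y1r.
  (* The parameter at which the meridian reaches the pole (0, e, 0). *)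
  pose s1 : R := 1 - e * y1.
  have fs1 : fy s1 = e.
    rewrite /fy /s1; transitivity (y1 + e - e ^+ 2 * y1); first by ring.
    by rewrite e2; ring.
  have s10 : 0 <= s1 by rewrite /s1 /e; case: ifP => hup; rewrite ?hup; lra.
  apply: (key s1) => //.
    move=> s /andP[s0 ss1]; rewrite k1 mul1r subr_ge0.
    have h : `|fy s| <= 1.
      rewrite ler_norml; move: ss1; rewrite /s1 /fy /e.
      by case: ifP => hup ss1; rewrite ?hup; apply/andP; split; lra.
    by rewrite -(real_normK (num_real _)) expr_le1.
  rewrite /fx /fz fs1 /lrad e2 k1 mulr1 subrr sqrtr0 !mul0r.
  by rewrite /e; case: (up).
have [M HM] := domain_bounded hU k1.
have M0 : 0 <= M by have [h _ _] := HM _ _ _ hu; exact: le_trans h.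
(* Here the height is e (M + 1), out of reach of the bounded region. *)
pose s1 : R := M + 1 - e * y1.
have y1M : `|y1| <= M by have [_ h _] := HM _ _ _ hu.
have fs1 : fy s1 = e * (M + 1).
  rewrite /fy /s1; transitivity (y1 + e * (M + 1) - e ^+ 2 * y1); first by ring.
  by rewrite e2; ring.
have s10 : 0 <= s1.
  by move: y1M; rewrite ler_norml => /andP[? ?]; rewrite /s1 /e; case: ifP => hup; rewrite ?hup; lra.
apply: (key s1) => //.
  move=> s _; case: hk => [|[|]] kE; rewrite kE in k1 *; last by rewrite eqxx in k1.
    by have := sqr_ge0 (fy s); lra.
  by lra.
move=> /HM[_ + _]; rewrite fs1 normrM (_ : `|e| = 1).
  by rewrite mul1r ger0_norm; lra.
by rewrite /e; case: ifP => _; rewrite ?normrN normr1.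
Qed.

Lemma within_range (R : realType) (s t : R) (f : R -> R) : s <= t ->
  {within `[s, t], continuous f} ->
  exists c d, [/\ s <= c <= t, s <= d <= t &
    forall u, s <= u <= t -> f c <= f u <= f d].
Proof.
move=> st cf; have [c cst Hc] := EVT_min st cf; have [d dst Hd] := EVT_max st cf.
exists c, d; split; [by rewrite in_itv in cst|by rewrite in_itv in dst|].
by move=> u ust; rewrite Hc ?Hd// in_itv.
Qed.

Lemma pwd_osc (R : realType) (a b : R) E (f df g dg : R -> R) :
  pwd a b E f df -> pwd a b E g dg ->
  (forall u, a < u < b -> u \notin E -> `|df u| <= dg u) ->
  forall s t c d, a <= s -> t <= b -> s <= c <= t -> s <= d <= t ->
  f d - f c <= g t - g s.
Proof.
move=> pf pg H s t c d as_ tb /andP[sc ct] /andP[sd dt].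
have Hg p q : a <= p -> p <= q -> q <= b -> 0 <= g q - g p.
  move=> ap pq qb; have := pwd_le (pwd_cst a b E 0) pg ap pq qb; rewrite subrr; apply.
  move=> u upq uE; apply: le_trans (H u _ uE) => //; exact: itv_oo_sub upq.
have Hf p q : a <= p -> p <= q -> q <= b -> `|f q - f p| <= g q - g p.
  move=> ap pq qb; apply: (pwd_norm_le pf pg) => // u upq uE.
  by apply: H => //; exact: itv_oo_sub upq.
have [cd|dc] := leP c d.
  have h1 := Hf c d (le_trans as_ sc) cd (le_trans dt tb).
  have h2 := Hg s c as_ sc (le_trans ct tb).
  have h3 := Hg d t (le_trans as_ sd) dt tb.
  by move: h1; rewrite ler_norml => /andP[? ?]; lra.
have h1 := Hf d c (le_trans as_ sd) (ltW dc) (le_trans ct tb).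
have h2 := Hg s d as_ sd (le_trans dt tb).
have h3 := Hg c t (le_trans as_ sc) ct tb.
by move: h1; rewrite ler_norml => /andP[? ?]; lra.
Qed.

(** Over [s, t] the meridian segments from the curve to the parallel y = y0 stay in one box. Its
    height exceeds |y u - y0| by at most the oscillation of y, hence by at most L (t - s); this is
    the error term. *)
Lemma sweep_piece (R : realType) (a b : R) E (th v y dy : R -> R) (y0 L s t : R) :
  pwd a b E th v -> pwd a b E y dy -> 
  (forall u, a < u < b -> u \notin E -> `|dy u| <= L) ->
  a <= s -> s <= t -> t <= b ->
  let B := prim a (fun u => `|y u - y0| * `|v u|) in
  let B' := prim a (fun u => `|v u|) in
  exists m M c d, [/\ m <= M, c <= y0 <= d,
    forall u, s <= u <= t -> m <= th u <= M /\ c <= y u <= d &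
    (M - m) * (d - c) <= (B t - B s) + L * (t - s) * (B' t - B' s)].
Proof.
move=> pth py HL as_ st tb B B'.
have ab : a <= b by exact: le_trans (le_trans as_ st) tb.
have [_ _ pv] := pth.
have pv' := pwc_norm pv.
have py0 : pwc a b E (fun u => `|y u - y0|).
  by apply: pwc_norm; apply: pwcD; [exact: pwd_pwc py|exact: pwc_cst].
have pB := pwd_prim ab (pwcM py0 pv'); have pB' := pwd_prim ab pv'.
have [ct _ _] := pth; have [cy _ _] := py.
have [p [q [pst qst Hpq]]] := within_range st (within_cont_sub as_ tb ct).
have [p' [q' [p'st q'st Hpq']]] := within_range st (within_cont_sub as_ tb cy).
have pL := pwdZ L (pwd_id a b E).
have osc : y q' - y p' <= L * (t - s).
  rewrite mulrBr; apply: (pwd_osc py pL) => // u uab uE.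
  by rewrite mulr1; exact: HL.
have oscth : th q - th p <= B' t - B' s.
  by apply: (pwd_osc pth pB').
have [hp1 hq1] : y p' <= y q' /\ th p <= th q.
  have := Hpq' _ q'st; have := Hpq _ qst.
  by move=> /andP[h1 _] /andP[h2 _].
exists (th p), (th q), (Num.min y0 (y p')), (Num.max y0 (y q')); split => //.
- by rewrite ge_min le_max lexx.
- move=> u ust; split; first exact: Hpq.
  by have /andP[h1 h2] := Hpq' u ust; rewrite ge_min le_max h1 h2 !orbT.
set D := Num.max _ _ - Num.min _ _.
have D0 : 0 <= D.
  by rewrite subr_ge0 (@le_trans _ _ y0)// ?ge_min ?le_max lexx.
have HD u : s <= u <= t -> D <= `|y u - y0| + L * (t - s).
  move=> ust; have /andP[h1 h2] := Hpq' u ust.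
  have n1 := ler_norm (y u - y0); have n2 := ler_norm (- (y u - y0)); rewrite normrN in n2.
  clear - n1 n2 osc h1 h2 hp1; rewrite /D /Num.max /Num.min.
  by case: ltP => _; case: ltP => _; lra.
apply: (@le_trans _ _ (D * (B' t - B' s))).
  by rewrite mulrC; apply: ler_wpM2l.
have := pwd_le (pwdZ D pB') (pwdD pB (pwdZ (L * (t - s)) pB')) as_ st tb.
have H u : s < u < t -> u \notin E ->
    D * `|v u| <= `|y u - y0| * `|v u| + L * (t - s) * `|v u|.
  move=> /andP[su ut] _; rewrite -mulrDl; apply: ler_wpM2r => //.
  by apply: HD; rewrite !ltW.
by move=> /(_ H); rewrite -/B -/B' mulrBr; clear; lra.
Qed.

Lemma archi_le (R : realType) (p q K : R) :
  (forall n : nat, (0 < n)%N -> p <= q + K / n%:R) -> p <= q.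
Proof.
move=> H; rewrite leNgt; apply/negP => qp.
have e0 : 0 < p - q by rewrite subr_gt0.
have [K0|K0] := leP K 0.
  by have := H 1%N isT; rewrite divr1; lra.
pose n := (Num.bound (K / (p - q))).+1.
have h := H n isT.
have : K / (p - q) < n%:R.
  apply: (lt_le_trans (archi_boundP _)); first by rewrite divr_ge0 ?ltW.
  by rewrite ler_nat.
rewrite ltr_pdivrMr// mulrC -ltr_pdivrMr ?ltr0n//.
by lra.
Qed.

(* Each point of [U] lies on a meridian segment joining the curve to the
   parallel [y = y0]; these segments sweep out at most the stated area. *)
Lemma sweep (R : realType) (k a b : R) E (x dx y dy z dz : R -> R) U (y0 A : R) :
  curv k -> curve k a b E x dx y dy z dz -> domain k a b x y z U ->
  (k = 1 -> ~ U 0 1 0 /\ ~ U 0 (-1) 0) ->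
  (forall t, a <= t <= b -> 0 < 1 - k * y t ^+ 2) ->
  area k (region U) = A%:E ->
  A <= prim a (fun t => `|y t - y0| *
                 `|(z t * dx t - x t * dz t) * (1 - k * y t ^+ 2)^-1|) b.
Proof.
move=> hk hc hU hpole hy hA; have [ab px py pz hmd] := hc.
have [th pth hth] := curve_lift hk hc hy.
set v := (fun t => (z t * dx t - x t * dz t) * (1 - k * y t ^+ 2)^-1) in pth *.
have [_ _ [_ [L HL]]] := py.
pose B := prim a (fun u => `|y u - y0| * `|v u|).
pose B' := prim a (fun u => `|v u|).
(* Cut [a, b] into n pieces. The error terms of [sweep_piece] add up to K / n with the K given here,
   and n is arbitrary. *)
apply: (@archi_le _ _ _ (L * (b - a) * (B' b - B' a))) => n n0.
have n0' : 0 < n%:R :> R by rewrite ltr0n.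
pose h := (b - a) / n%:R; pose T (i : nat) := a + i%:R * h.
have h0 : 0 < h by rewrite divr_gt0// subr_gt0.
have Tn : T n = b by rewrite /T /h mulrC divfK ?lt0r_neq0//; ring.
have T0 : T 0%N = a by rewrite /T mul0r addr0.
have TS i : T i.+1 = T i + h by rewrite /T -natr1 mulrDl mul1r addrA.
have Tmono i j : (i <= j)%N -> T i <= T j.
  by move=> ij; rewrite /T lerD2l ler_pM2r// ler_nat.
pose good (i : nat) (r : R * R * (R * R)) : Prop := (i < n)%N ->
  [/\ r.1.1 <= r.1.2, r.2.1 <= y0 <= r.2.2,
    forall u, T i <= u <= T i.+1 -> r.1.1 <= th u <= r.1.2 /\ r.2.1 <= y u <= r.2.2 &
    (r.1.2 - r.1.1) * (r.2.2 - r.2.1) <=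
      (B (T i.+1) - B (T i)) + L * h * (B' (T i.+1) - B' (T i))].
have /choice[r Hr] : forall i, exists r, good i r.
  move=> i; have [ni|iN] := leqP n i.
    by exists (0, 0, (0, 0)) => iN; move: ni; rewrite leqNgt iN.
  have ai : a <= T i by rewrite -T0; exact: Tmono.
  have ib : T i.+1 <= b by rewrite -Tn; exact: Tmono.
  have [m [M [c [d [h1 h2 h3 h4]]]]] := sweep_piece y0 pth py HL ai (Tmono _ _ (leqnSn i)) ib.
  exists (m, M, (c, d)) => _; split => //=; apply: le_trans h4 _.
  by rewrite TS (_ : T i + h - T i = h) //; ring.
have boxes : (area k (region U) <=
    \sum_(i < n) (((r i).1.2 - (r i).1.1) * ((r i).2.2 - (r i).2.1))%:E)%E.
  apply: (area_le_boxes (m := fun i => (r i).1.1) (M := fun i => (r i).1.2)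
    (c := fun i => (r i).2.1) (d := fun i => (r i).2.2)) => //.
  - exact: domain_open hU.
  - by move=> i /(Hr i)[].
  - by move=> i /(Hr i)[_ /andP[h1 h2] _ _]; exact: le_trans h2.
  move=> y1 u hy1 hu.
  (* Moving away from the parallel y0 puts y1 between y0 and y t. The box of the piece containing t
     has both these heights, so it contains the given point. *)
  have [t [tab hyt xt zt]] := meridian_exit (y0 <= y1) hk hU hpole hy1 hu.
  have [xt' zt'] := hth t tab.
  have q0 := lt0r_neq0 (lrad_gt0 (hy t tab)).
  have [m hm um] : exists2 m : int, (k = 1 \/ m = 0) & u + m%:~R * (2 * pi) = th t.
    by apply: snk_csk_eq => //; apply: (mulfI q0); [rewrite -xt -xt'|rewrite -zt -zt'].
  have [i iN tT] : exists2 i, (i < n)%N & T i <= t <= T i.+1.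
    case/andP: tab => at_ tb; rewrite le_eqVlt in tb.
    have [tb'|tb'] := eqVneq t b.
      exists n.-1; first by rewrite prednK.
      by rewrite prednK// Tn tb' lexx andbT -[leRHS]Tn Tmono// leq_pred.
    rewrite (negbTE tb') /= in tb.
    pose i := Num.truncn ((t - a) / h).
    have /andP[i1 i2] : i%:R <= (t - a) / h < i.+1%:R.
      by apply: truncn_itv; rewrite divr_ge0 ?(ltW h0) ?subr_ge0.
    rewrite ler_pdivlMr// in i1; rewrite ltr_pdivrMr// in i2.
    exists i; last by rewrite /T; apply/andP; split; lra.
    rewrite ltnNge; apply/negP => ni; have := Tmono _ _ ni; rewrite Tn /T.
    by move: tb i1; clear; lra.
  exists i; have [g1 /andP[g2 g2'] g3 _] := Hr i iN; have [g4 /andP[g5 g6]] := g3 t tT.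
  split => //; last by exists m; rewrite // um.
  case: ifPn hyt => [y01 hyt|]; first by rewrite (le_trans g2 y01) (le_trans hyt g6).
  by rewrite -ltNge => /ltW y01 hyt; rewrite (le_trans g5 hyt) (le_trans y01 g2').
rewrite hA sumEFin lee_fin in boxes.
apply: (le_trans boxes).
apply: (@le_trans _ _ (\sum_(i < n) ((B (T i.+1) + L * h * B' (T i.+1)) -
   (B (T i) + L * h * B' (T i))))).
  by apply: ler_sum => i _; have [_ _ _] := Hr i (ltn_ord i); clear; lra.
rewrite -(big_mkord xpredT (fun i => (B (T i.+1) + L * h * B' (T i.+1)) -
   (B (T i) + L * h * B' (T i)))) telescope_sumr// Tn T0.
have -> : B a = 0 by rewrite /B prim_self.
have -> : B' a = 0 by rewrite /B' prim_self.
rewrite /h; have := lt0r_neq0 n0'; set N := n%:R => N0.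
rewrite -/(B b) (_ : L * (b - a) * (B' b - 0) / N = L * ((b - a) / N) * B' b); last by ring.
by clear; lra.
Qed.

(** * Comparison with a tangent circle *)

(** Meant for [acos], whose continuity is used relative to [-1, 1]: in the antiderivatives below its
    argument attains both 1 and -1. *)
Lemma within_comp2 (R : realType) (a b c d : R) (f g : R -> R) :
  {within `[a, b], continuous f} -> {within `[c, d], continuous g} ->
  (forall t, a <= t <= b -> c <= f t <= d) ->
  {within `[a, b], continuous (g \o f)}.
Proof.
move=> /subspace_continuousP cf /subspace_continuousP cg H.
apply/subspace_continuousP => x abx.
have cfx : `[c, d]%classic (f x).
  by move: abx; rewrite /= !in_itv/=; exact: H.
apply: (cvg_trans _ (cg (f x) cfx)) => W /= HW.
have := cf x abx; rewrite /= => /(_ _ HW) /=.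
rewrite !nbhs_simpl/= /within/=; apply: filter_app; near=> t => h abt.
apply: h => //; move: abt; rewrite /= !in_itv/=; exact: H.
Unshelve. all: by end_near. Qed.

Lemma within_acos (R : realType) : {within `[-1, 1], continuous (@acos R)}.
Proof.
have := @segment_can_ge_continuous R 0 pi cos acos (pi_ge0 R).
rewrite cospi cos0; apply; last exact: cosK.
by apply: continuous_subspaceT; exact: continuous_cos.
Qed.

Lemma antideriv_eq (R : realType) (a b : R) (f g d : R -> R) : a <= b ->
  {within `[a, b], continuous f} -> {within `[a, b], continuous g} ->
  (forall t, a < t < b -> is_derive t 1 f (d t)) ->
  (forall t, a < t < b -> is_derive t 1 g (d t)) ->
  f b - f a = g b - g a.
Proof.
move=> ab cf cg hf hg.
have le1 (p q : R -> R) : {within `[a, b], continuous p} -> {within `[a, b], continuous q} ->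
    (forall t, a < t < b -> is_derive t 1 p (d t)) ->
    (forall t, a < t < b -> is_derive t 1 q (d t)) -> p b - p a <= q b - q a.
  move=> cp cq hp hq; suff : (q \- p) a <= (q \- p) b by rewrite /=; lra.
  apply: (@mono_off _ [::] _ (fun t => d t - d t)) => //.
    by move=> x; apply: continuousB; [exact: cq|exact: cp].
  move=> t tab _; rewrite subrr; split => //.
  have h1 := hq t tab; have h2 := hp t tab.
  by apply: is_derive_eq (is_deriveB h1 h2) _; rewrite subrr.
by apply/le_anti; rewrite !le1.
Qed.

Lemma is_derive_acos_comp (R : realType) (f : R -> R) (y d s : R) :
  is_derive y 1 f d -> 0 < s -> 1 - f y ^+ 2 = s ^+ 2 ->
  is_derive y 1 (acos \o f) (- d / s).
Proof.
move=> hf s0 hs.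
have h1 : -1 < f y < 1.
  rewrite -ltr_norml -(@ltr_pXn2r _ 2)// ?nnegrE// real_normK ?num_real// expr1n.
  by have := exprn_gt0 2 s0; lra.
have := @is_derive1_comp _ acos f y _ _ (is_derive1_acos h1) hf.
move=> h; apply: is_derive_eq h _.
by rewrite hs sqrtr_sqr gtr0_norm// mulNr mulrC mulNr.
Qed.

Lemma is_derive_lrad (R : realType) (k y : R) : 0 < 1 - k * y ^+ 2 ->
  is_derive y 1 (lrad k) (- (k * y) / lrad k y).
Proof.
move=> hy; have h1 : is_derive y 1 (fun y : R => 1 - k * y ^+ 2) (- (2 * k * y)).
  by apply: is_derive_eq; rewrite /GRing.scale/=; ring.
have := @is_derive1_comp _ Num.sqrt _ y _ _ (is_derive1_sqrt hy) h1.
move=> h; apply: is_derive_eq h _; rewrite -/(lrad k y).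
have := lt0r_neq0 (lrad_gt0 hy); set q := lrad k y => q0.
by field.
Qed.

Lemma is_derive_sqrt_comp (R : realType) (f : R -> R) (y d : R) :
  is_derive y 1 f d -> 0 < f y ->
  is_derive y 1 (fun y => Num.sqrt (f y)) (d / (2 * Num.sqrt (f y))).
Proof.
move=> hf f0; have := @is_derive1_comp _ Num.sqrt f y _ _ (is_derive1_sqrt f0) hf.
by move=> h; apply: is_derive_eq h _; rewrite mulrC.
Qed.

Lemma is_derive_div (R : realType) (f g : R -> R) (y df dg : R) :
  is_derive y 1 f df -> is_derive y 1 g dg -> g y != 0 ->
  is_derive y 1 (fun y => f y / g y) ((df * g y - f y * dg) / g y ^+ 2).
Proof.
move=> hf hg g0; have h1 := is_deriveV g0 hg.
have := is_deriveM hf h1; move=> h; apply: is_derive_eq h _.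
by rewrite /GRing.scale/=; field.
Qed.

Lemma within_div (R : realType) (a b : R) (f g : R -> R) :
  {within `[a, b], continuous f} -> {within `[a, b], continuous g} ->
  (forall t, a <= t <= b -> g t != 0) ->
  {within `[a, b], continuous (fun t => f t / g t)}.
Proof.
move=> cf cg g0; apply: withinM => //.
apply: (@within_comp _ _ _ g (@GRing.inv R)) => // t tab.
by apply: inv_continuous; exact: g0.
Qed.

(** The identity that makes the comparison work: r^2 (1 - k y^2) splits into the squares of the
    weights given to y' and to the longitude. *)
Lemma chord_quad (R : realType) (k y1 y2 c r e y : R) :
  c ^+ 2 + k * r ^+ 2 = 1 -> 2 * (c * e) = y1 + y2 -> e ^+ 2 - r ^+ 2 = y1 * y2 ->
  (y2 - y) * (y - y1) = r ^+ 2 * (1 - k * y ^+ 2) - (c * y - e) ^+ 2.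
Proof.
move=> h1 h2 h3.
transitivity ((y1 + y2) * y - y1 * y2 - y ^+ 2); first by ring.
rewrite -h2 -h3.
transitivity (2 * (c * e) * y - (e ^+ 2 - r ^+ 2) - (c ^+ 2 + k * r ^+ 2) * y ^+ 2).
  by rewrite h1; ring.
ring.
Qed.

Lemma within_of_continuous (R : realType) (a b : R) (f : R -> R) :
  continuous f -> {within `[a, b], continuous f}.
Proof. by move=> cf; apply: continuous_subspaceT. Qed.

Lemma within_acos_comp (R : realType) (a b : R) (f : R -> R) :
  {within `[a, b], continuous f} -> (forall t, a <= t <= b -> 0 <= 1 - f t ^+ 2) ->
  {within `[a, b], continuous (acos \o f)}.
Proof.
move=> cf H; apply: (within_comp2 cf (@within_acos R)) => t /H h.
rewrite -ler_norml -(@ler_pXn2r _ 2)// ?nnegrE// real_normK ?num_real// expr1n.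
by lra.
Qed.

(** The weight of |y'|. Over [y1, y2] it integrates to half the area of the comparison disk, which
    is 2 pi r^2 / (1 + c); beyond y1 and y2 the value of [Num.sqrt] at negative numbers makes it
    0. *)
Definition chordw (R : realType) (k y1 y2 y : R) : R :=
  Num.sqrt ((y2 - y) * (y - y1)) / (1 - k * y ^+ 2).

Lemma continuous_chord_poly (R : realType) (y1 y2 : R) :
  continuous (fun y : R => (y2 - y) * (y - y1)).
Proof.
move=> y; apply: (@continuous_derive _ _ _ (y2 + y1 - 2 * y)).
by apply: is_derive_eq; rewrite /GRing.scale/=; ring.
Qed.

Lemma continuous_sqrt_chord (R : realType) (y1 y2 : R) :
  continuous (fun y : R => Num.sqrt ((y2 - y) * (y - y1))).
Proof.
move=> y; apply: (@continuous_comp R R R (fun y => (y2 - y) * (y - y1)) (@Num.sqrt R)).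
  exact: continuous_chord_poly.
exact: sqrt_continuous.
Qed.

Lemma continuous_one_sub (R : realType) (k : R) : continuous (fun y : R => 1 - k * y ^+ 2).
Proof.
move=> y; apply: (@continuous_derive _ _ _ (- (2 * k * y))).
by apply: is_derive_eq; rewrite /GRing.scale/=; ring.
Qed.

Lemma continuous_chordw (R : realType) (k y1 y2 y : R) : 0 < 1 - k * y ^+ 2 ->
  {for y, continuous (chordw k y1 y2)}.
Proof.
move=> hy; apply: (@continuousM _ _ (fun y => Num.sqrt ((y2 - y) * (y - y1)))
  (fun y => (1 - k * y ^+ 2)^-1) y).
  exact: continuous_sqrt_chord.
by apply: continuousV; [exact: lt0r_neq0|exact: continuous_one_sub].
Qed.

Lemma within_chordw (R : realType) (k y1 y2 a b : R) :
  (forall y, a <= y <= b -> 0 < 1 - k * y ^+ 2) ->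
  {within `[a, b], continuous (chordw k y1 y2)}.
Proof.
move=> H; have := @continuous_in_subspaceT R R `[a, b]%classic (chordw k y1 y2); apply.
move=> y; rewrite inE/= in_itv/= => /H; exact: continuous_chordw.
Qed.

(** Data of the comparison circle: c and r are the generalized cosine and sine of its radius, e is
    the height of its centre. The last four inequalities provide the signs needed in
    [chord_integral1]. *)
Record chord (R : realType) (k y1 y2 c r e : R) : Prop := Chord {
  chord_curv : curv k;
  chord_lt : y1 < y2;
  chord_dom : forall y, y1 <= y <= y2 -> 0 < 1 - k * y ^+ 2;
  chord_cr : c ^+ 2 + k * r ^+ 2 = 1;
  chord_ce : 2 * (c * e) = y1 + y2;
  chord_er : e ^+ 2 - r ^+ 2 = y1 * y2;
  chord_r0 : 0 < r;
  chord_c0 : 0 < c;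
  chord_e0 : 0 < 1 - k * e ^+ 2;
  chord_m0 : forall y, y1 <= y <= y2 -> 0 < c - k * e * y;
  chord_e1 : 0 < e - c * y1;
  chord_e2 : e - c * y2 < 0 }.

Lemma chord_sum (R : realType) (k y1 y2 : R) (F : R -> R) :
  y1 < y2 -> (forall y, y1 <= y <= y2 -> 0 < 1 - k * y ^+ 2) ->
  {within `[y1, y2], continuous F} ->
  (forall y, y1 < y < y2 -> is_derive y 1 F (Num.sqrt ((y2 - y) * (y - y1)) / (1 - k * y ^+ 2))) ->
  prim y1 (chordw k y1 y2) y2 = F y2 - F y1.
Proof.
move=> y12 hy cF dF; have pw := pwc_within [::] (@within_chordw _ k y1 y2 y1 y2 hy).
have [cp dp _] := pwd_prim (ltW y12) pw.
have := antideriv_eq (ltW y12) cp cF (fun t h => dp t h isT) dF.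
by rewrite prim_self subr0.
Qed.

(** For k = 0 the circle is Euclidean and c = 1; [F] is the classical antiderivative of sqrt (r^2 -
    (y - e)^2). *)
Lemma chord_integral0 (R : realType) (k y1 y2 c r e : R) :
  chord k y1 y2 c r e -> k = 0 ->
  prim y1 (chordw k y1 y2) y2 = pi * r ^+ 2 / (1 + c).
Proof.
move=> [hk y12 hy h1 h2 h3 r0 c0 f0 hm he1 he2] k0.
pose s (y : R) := Num.sqrt ((y2 - y) * (y - y1)).
have c1 : c = 1.
  have : (c - 1) * (c + 1) = 0.
    by transitivity (c ^+ 2 - 1); [ring|rewrite -h1 k0; ring].
  by move/eqP; rewrite mulf_eq0 => /orP[/eqP|/eqP]; move: c0; clear; lra.
have r0' := lt0r_neq0 r0.
have polyE y : (y2 - y) * (y - y1) = r ^+ 2 - (e - y) ^+ 2.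
  by rewrite (chord_quad y h1 h2 h3) k0 c1; ring.
have argE y : 1 - ((e - y) / r) ^+ 2 = (y2 - y) * (y - y1) / r ^+ 2.
  by rewrite polyE; field.
pose F (y : R) : R := ((y - e) * s y + r ^+ 2 * acos ((e - y) / r)) / 2.
have lin (y : R) : is_derive y 1 (fun y : R => (e - y) / r) (- r^-1).
  by apply: is_derive_eq; rewrite /GRing.scale/=; ring.
suff [hF cF dF] : [/\ F y2 - F y1 = pi * r ^+ 2 / (1 + c),
    {within `[y1, y2], continuous F} &
    forall y, y1 < y < y2 ->
      is_derive y 1 F (Num.sqrt ((y2 - y) * (y - y1)) / (1 - k * y ^+ 2))].
  by rewrite -hF; apply: chord_sum.
split.
- rewrite /F /s subrr mul0r subrr mulr0 !sqrtr0 !mulr0 !add0r c1.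
  have ed : e = (y1 + y2) / 2 by move: h2; rewrite c1; clear; lra.
  have rd : r = (y2 - y1) / 2.
    apply/eqP; rewrite -(@eqrXn2 _ 2) ?ltW//; last by move: y12; clear; lra.
    apply/eqP; rewrite -[LHS]opprK -[in LHS](addKr (e ^+ 2) (- r ^+ 2)) h3 ed.
    by field.
  have -> : (e - y2) / r = - 1.
    by apply: (mulIf r0'); rewrite divfK// mulN1r {1}ed rd; field.
  have -> : (e - y1) / r = 1.
    by apply: (mulIf r0'); rewrite divfK// mul1r {1}ed rd; field.
  by rewrite acosN1 acos1; field.
- apply: withinM; last exact: within_cst.
  apply: withinD.
    apply: withinM; apply: within_of_continuous; last exact: continuous_sqrt_chord.
    by move=> y; apply: (@continuous_derive _ _ _ 1); apply: is_derive_eq; rewrite subr0.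
  apply: withinM; first exact: within_cst.
  apply: within_acos_comp.
    by apply: within_of_continuous => y; exact: continuous_derive (lin y).
  move=> y /andP[ya yb]; rewrite argE divr_ge0 ?sqr_ge0// mulr_ge0 ?subr_ge0//.
- move=> y /andP[ya yb]; have R0 : 0 < (y2 - y) * (y - y1) by rewrite mulr_gt0 ?subr_gt0.
  have s0 : 0 < s y by rewrite sqrtr_gt0.
  have s2 : s y ^+ 2 = (y2 - y) * (y - y1) by rewrite sqr_sqrtr ?ltW.
  have dR : is_derive y 1 (fun y : R => (y2 - y) * (y - y1)) (y2 + y1 - 2 * y).
    by apply: is_derive_eq; rewrite /GRing.scale/=; ring.
  have ds := is_derive_sqrt_comp dR R0.
  have dth : is_derive y 1 (acos \o (fun y => (e - y) / r)) (- (- r^-1) / (s y / r)).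
    have := @is_derive_acos_comp _ (fun y => (e - y) / r) y _ (s y / r) (lin y).
    apply; first by rewrite divr_gt0.
    by rewrite argE expr_div_n s2.
  have dl : is_derive y 1 (fun y : R => y - e) 1 by apply: is_derive_eq; rewrite subr0.
  have := is_deriveZ (2^-1) (is_deriveD (is_deriveM dl ds) (is_deriveZ (r ^+ 2) dth)).
  rewrite (_ : _ \*: _ = F); last by apply/funext => z; rewrite /F /= /GRing.scale/= mulrC.
  move=> h; apply: is_derive_eq h _; rewrite -/(s y) k0 mul0r subr0 divr1 /GRing.scale/=.
  have s0' := lt0r_neq0 s0.
  transitivity (((y - e) * (y2 + y1 - 2 * y) / (2 * s y) + s y + r ^+ 2 / s y) / 2).
    by field; rewrite s0' r0'.
  have -> : y2 + y1 - 2 * y = 2 * (e - y) by rewrite [y2 + y1]addrC -h2 c1; ring.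
  have -> : r ^+ 2 = s y ^+ 2 + (e - y) ^+ 2 by rewrite s2 polyE; ring.
  by field.
Qed.

(** At height y on the comparison circle, [acos (th y)] is the angle at the centre counted from the
    lowest point, [ps y] is up to sign the cosine of the angle between the circle and the parallel,
    and [v y] is [snk k] of the longitude. Their combination [F] is an antiderivative because k^2 =
    1. *)
Lemma chord_integral1 (R : realType) (k y1 y2 c r e : R) :
  chord k y1 y2 c r e -> k != 0 ->
  prim y1 (chordw k y1 y2) y2 = pi * r ^+ 2 / (1 + c).
Proof.
move=> [hk y12 hy h1 h2 h3 r0 c0 f0 hm he1 he2] k0.
pose s (y : R) := Num.sqrt ((y2 - y) * (y - y1)); pose f := lrad k e.
have k2 : k ^+ 2 = 1.
  by case: hk k0 => [|[|]] ->; rewrite ?eqxx// ?sqrrN expr1n.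
have f0' : 0 < f by exact: lrad_gt0.
have f2 : f ^+ 2 = 1 - k * e ^+ 2 by exact: sqr_lrad.
have fn := lt0r_neq0 f0'; have rn := lt0r_neq0 r0.
have polyE y := chord_quad y h1 h2 h3.
have q0 y : y1 <= y <= y2 -> 0 < lrad k y by move=> /hy/lrad_gt0.
have q2 y : y1 <= y <= y2 -> lrad k y ^+ 2 = 1 - k * y ^+ 2 by move=> /hy/sqr_lrad.
pose th (y : R) : R := (c * e - y) / (r * f).
pose ps (y : R) : R := (e - c * y) / (r * lrad k y).
pose v (y : R) : R := s y / (f * lrad k y).
have thE y : 1 - th y ^+ 2 = (y2 - y) * (y - y1) / (r * f) ^+ 2.
  rewrite polyE /th; transitivity ((r ^+ 2 * f ^+ 2 - (c * e - y) ^+ 2) / (r * f) ^+ 2).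
    by field; rewrite fn rn.
  congr (_ / _); rewrite f2.
  transitivity (r ^+ 2 - e ^+ 2 * (c ^+ 2 + k * r ^+ 2) + 2 * c * e * y - y ^+ 2); first by ring.
  rewrite h1 mulr1.
  transitivity (r ^+ 2 - e ^+ 2 + 2 * c * e * y - (c ^+ 2 + k * r ^+ 2) * y ^+ 2);
    last by ring.
  by rewrite h1 mul1r.
have psE y : y1 <= y <= y2 -> 1 - ps y ^+ 2 = (y2 - y) * (y - y1) / (r * lrad k y) ^+ 2.
  move=> yy; have qn := lt0r_neq0 (q0 y yy).
  rewrite polyE -(q2 y yy) /ps; set q := lrad k y in qn *.
  by field; rewrite rn qn.
have R0 y : y1 <= y <= y2 -> 0 <= (y2 - y) * (y - y1).
  by move=> /andP[? ?]; rewrite mulr_ge0 ?subr_ge0.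
have s2 y : y1 <= y <= y2 -> s y ^+ 2 = (y2 - y) * (y - y1).
  by move=> /R0; exact: sqr_sqrtr.
have vE y : y1 <= y <= y2 ->
    1 - k * v y ^+ 2 = ((c - k * e * y) / (f * lrad k y)) ^+ 2.
  move=> yy; have qn := lt0r_neq0 (q0 y yy).
  rewrite /v expr_div_n s2// polyE expr_div_n.
  transitivity ((f ^+ 2 * lrad k y ^+ 2 - k * (r ^+ 2 * (1 - k * y ^+ 2) - (c * y - e) ^+ 2))
    / (f * lrad k y) ^+ 2); first by field; rewrite fn qn.
  congr (_ / _); rewrite f2 q2//.
  transitivity (1 - k * r ^+ 2 + 2 * (k ^+ 2 * r ^+ 2) * 0 + (k ^+ 2 * (e ^+ 2 + r ^+ 2)
     - k + k * c ^+ 2) * y ^+ 2 - 2 * k * c * e * y); first by ring.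
  rewrite (_ : 1 - k * r ^+ 2 = c ^+ 2); last by rewrite -h1; ring.
  rewrite (_ : k ^+ 2 * (e ^+ 2 + r ^+ 2) - k + k * c ^+ 2 = k ^+ 2 * e ^+ 2); first by ring.
  transitivity (k ^+ 2 * e ^+ 2 + k * (c ^+ 2 + k * r ^+ 2 - 1)); first by ring.
  by rewrite h1 subrr mulr0 addr0.
have hv0 y : y1 <= y <= y2 -> 0 < 1 - k * v y ^+ 2.
  move=> yy; rewrite vE// exprn_gt0// divr_gt0 ?hm//.
  by apply: mulr_gt0 => //; exact: q0.
pose F (y : R) : R := k * (acos (th y) - c * acos (ps y)) - e * arsnk k (v y).
have dth (y : R) : is_derive y 1 th (- (r * f)^-1).
  by apply: is_derive_eq; rewrite /GRing.scale/=; ring.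
have dq (y : R) : y1 <= y <= y2 -> is_derive y 1 (lrad k) (- (k * y) / lrad k y).
  by move=> /hy; exact: is_derive_lrad.
have dps (y : R) : y1 <= y <= y2 ->
    is_derive y 1 ps (- (c - k * e * y) / (r * lrad k y ^+ 3)).
  move=> yy; have qn := lt0r_neq0 (q0 y yy).
  have dn : is_derive y 1 (fun y : R => e - c * y) (- c).
    by apply: is_derive_eq; rewrite /GRing.scale/=; ring.
  have dd : is_derive y 1 (fun y : R => r * lrad k y) (r * (- (k * y) / lrad k y)).
    exact: (is_deriveZ r (dq y yy)).
  have rq : r * lrad k y != 0 by rewrite mulf_neq0.
  have := is_derive_div dn dd rq; move=> h; apply: is_derive_eq h _.
  rewrite /GRing.scale/=; have := q2 y yy; set q := lrad k y in qn * => qE.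
  transitivity (- (c * q ^+ 2 - (e - c * y) * k * y) / (r * q ^+ 3)).
    by field; rewrite qn rn.
  by rewrite qE; congr (- _ / _); ring.
have cps : {within `[y1, y2], continuous ps}.
  have := @continuous_in_subspaceT R R `[y1, y2]%classic ps; apply=> y.
  by rewrite inE/= in_itv/= => /dps/continuous_derive.
have cv : {within `[y1, y2], continuous v}.
  apply: within_div; first by apply: within_of_continuous; exact: continuous_sqrt_chord.
    apply: withinM; first exact: within_cst.
    by apply: within_of_continuous; exact: continuous_lrad.
  by move=> y yy; rewrite mulf_neq0// lt0r_neq0// q0.
suff [hF cF dF] : [/\ F y2 - F y1 = pi * r ^+ 2 / (1 + c),
    {within `[y1, y2], continuous F} &
    forall y, y1 < y < y2 ->
      is_derive y 1 F (Num.sqrt ((y2 - y) * (y - y1)) / (1 - k * y ^+ 2))].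
  by rewrite -hF; apply: chord_sum.
split.
- have y11 : y1 <= y1 <= y2 by rewrite lexx ltW.
  have y22 : y1 <= y2 <= y2 by rewrite lexx ltW.
  have v1 : v y1 = 0 by rewrite /v /s subrr mulr0 sqrtr0 mul0r.
  have v2 : v y2 = 0 by rewrite /v /s subrr mul0r sqrtr0 mul0r.
  have ar0 : arsnk k 0 = 0.
    rewrite -[X in arsnk k X](snk0 k) snkK// => _; have := pi_gt0 R => p0.
    by apply/andP; split; move: p0; clear; lra.
  have one (w : R) : 1 - w ^+ 2 = 0 -> 0 < w -> w = 1.
    move=> w2 w0; apply/eqP; rewrite -(@eqrXn2 _ 2) ?ltW// expr1n.
    by apply/eqP; move: w2; clear; lra.
  have th1 : th y1 = 1.
    apply: one; first by rewrite thE subrr mulr0 mul0r.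
    rewrite divr_gt0 ?mulr_gt0//; move: h2 y12; clear; lra.
  have th2 : th y2 = -1.
    apply: oppr_inj; rewrite opprK; apply: one; first by rewrite sqrrN thE subrr !mul0r.
    rewrite -mulNr divr_gt0 ?mulr_gt0//; move: h2 y12; clear; lra.
  have ps1 : ps y1 = 1.
    apply: one; first by rewrite psE// subrr mulr0 mul0r.
    by rewrite divr_gt0 ?mulr_gt0 ?q0.
  have ps2 : ps y2 = -1.
    apply: oppr_inj; rewrite opprK; apply: one; first by rewrite sqrrN psE// subrr !mul0r.
    by rewrite -mulNr divr_gt0 ?mulr_gt0 ?q0// oppr_gt0.
  rewrite /F v1 v2 ar0 th1 th2 ps1 ps2 acos1 acosN1.
  have c1 : 1 + c != 0 by rewrite lt0r_neq0// addr_gt0.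
  apply: (mulIf c1); rewrite divfK//.
  transitivity (pi * (k * (1 - c ^+ 2))); first by ring.
  congr (_ * _); rewrite -{1}h1.
  by transitivity (k ^+ 2 * r ^+ 2); [ring|rewrite k2 mul1r].
- apply: withinD.
    apply: withinM; first exact: within_cst.
    apply: withinD.
      apply: within_acos_comp.
        by apply: within_of_continuous => y; exact: continuous_derive (dth y).
      by move=> y yy; rewrite thE divr_ge0 ?sqr_ge0// R0.
    rewrite (_ : (fun t : R => - _) = (fun t => - c * acos (ps t))); last first.
      by apply/funext => t; rewrite mulNr.
    apply: withinM; first exact: within_cst.
    by apply: within_acos_comp => // y yy; rewrite psE// divr_ge0 ?sqr_ge0// R0.
  rewrite (_ : (fun t : R => - _) = (fun t => - e * arsnk k (v t))); last first.
    by apply/funext => t; rewrite mulNr.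
  apply: withinM; first exact: within_cst.
  apply: (@within_comp _ _ _ v (arsnk k)) => // y yy.
  have hv : 0 < 1 - k * v y ^+ 2 by exact: hv0.
  exact: continuous_derive (is_derive_arsnk hk hv).
- move=> y /andP[ya yb]; have yy : y1 <= y <= y2 by rewrite !ltW.
  have R1 : 0 < (y2 - y) * (y - y1) by rewrite mulr_gt0 ?subr_gt0.
  have s0 : 0 < s y by rewrite sqrtr_gt0.
  have sn := lt0r_neq0 s0; have qn := lt0r_neq0 (q0 y yy).
  have dR : is_derive y 1 (fun y : R => (y2 - y) * (y - y1)) (y2 + y1 - 2 * y).
    by apply: is_derive_eq; rewrite /GRing.scale/=; ring.
  have ds := is_derive_sqrt_comp dR R1; rewrite -/(s y) in ds.
  have m0 := hm y yy; have mn := lt0r_neq0 m0.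
  have qE := q2 y yy; have sE := s2 y yy; rewrite polyE -qE in sE.
  have dA : is_derive y 1 (acos \o th) (s y)^-1.
    have := @is_derive_acos_comp _ th y _ (s y / (r * f)) (dth y) _ _.
    move=> h; apply: is_derive_eq (h _ _) _.
    + by rewrite divr_gt0 ?mulr_gt0.
    + by rewrite thE expr_div_n s2.
    + by field; rewrite sn fn rn.
  have dB : is_derive y 1 (acos \o ps) ((c - k * e * y) / (lrad k y ^+ 2 * s y)).
    have := @is_derive_acos_comp _ ps y _ (s y / (r * lrad k y)) (dps y yy) _ _.
    move=> h; apply: is_derive_eq (h _ _) _.
    + by rewrite divr_gt0 ?mulr_gt0 ?q0.
    + by rewrite psE// expr_div_n s2.
    + by field; rewrite sn qn rn.
  have dC : is_derive y 1 (arsnk k \o v) ((e - c * y) / (lrad k y ^+ 2 * s y)).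
    have fq : f * lrad k y != 0 by rewrite mulf_neq0.
    have df : is_derive y 1 (fun y : R => f * lrad k y) (f * (- (k * y) / lrad k y)).
      exact: (is_deriveZ f (dq y yy)).
    have dv := is_derive_div ds df fq.
    have hv : 0 < 1 - k * v y ^+ 2 by exact: hv0.
    have := @is_derive1_comp _ (arsnk k) v y _ _ (is_derive_arsnk hk hv) dv.
    move=> h; apply: is_derive_eq h _.
    rewrite vE// sqrtr_sqr gtr0_norm; last first.
      by rewrite divr_gt0 ?hm//; apply: mulr_gt0 => //; exact: q0.
    rewrite /GRing.scale/= -?/(s y); move: qE sE; set q := lrad k y in qn *; set w := s y in sn * => qE sE.
    transitivity (((y2 + y1 - 2 * y) / 2 * q ^+ 2 + w ^+ 2 * k * y) /
      (w * q ^+ 2 * (c - k * e * y))); first by field; rewrite sn qn fn mn.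
    transitivity ((e - c * y) * (c - k * e * y) / (w * q ^+ 2 * (c - k * e * y)));
      last by field; rewrite sn qn mn.
    congr (_ / _); rewrite sE [y2 + y1]addrC -h2.
    transitivity (q ^+ 2 * (c * e - y + (k * r ^+ 2) * y) - k * y * (c * y - e) ^+ 2); first by field.
    rewrite (_ : k * r ^+ 2 = 1 - c ^+ 2); last by rewrite -h1; ring.
    by rewrite qE; ring.
  have := is_deriveB (is_deriveZ k (is_deriveB dA (is_deriveZ c dB))) (is_deriveZ e dC).
  rewrite (_ : _ - _ = F); last by apply/funext => z; rewrite /F.
  move=> h; apply: is_derive_eq h _; rewrite /GRing.scale/= -qE -?/(s y).
  move: qE sE; set q := lrad k y in qn *; set w := s y in sn * => qE sE.
  transitivity ((k * (q ^+ 2 - c * (c - k * e * y)) - e * (e - c * y)) / (q ^+ 2 * w)).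
    by field; rewrite sn qn.
  transitivity (w ^+ 2 / (q ^+ 2 * w)); last by field; rewrite sn qn.
  congr (_ / _); rewrite sE qE.
  transitivity (k * (1 - c ^+ 2) + k ^+ 2 * (c * e * y - y ^+ 2) + c * e * y - e ^+ 2); first by ring.
  rewrite k2 (_ : 1 - c ^+ 2 = k * r ^+ 2); last by rewrite -h1; ring.
  transitivity (k ^+ 2 * r ^+ 2 - (c ^+ 2 + k * r ^+ 2) * y ^+ 2 + 2 * c * e * y - e ^+ 2);
    last by rewrite k2; ring.
  by rewrite h1 mul1r; ring.
Qed.

Lemma chord_integral (R : realType) (k y1 y2 c r e : R) : chord k y1 y2 c r e ->
  prim y1 (chordw k y1 y2) y2 = pi * r ^+ 2 / (1 + c).
Proof.
move=> H; have [k0|k0] := eqVneq k 0; first exact: chord_integral0 H k0.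
exact: chord_integral1 H k0.
Qed.

(** Monotonicity of the generalized tangent y / q. The squares of the two products differ by y2^2 -
    y1^2, which decides once the signs agree. *)
Lemma ratio_lt (R : realType) (y1 y2 q1 q2 k : R) : y1 < y2 -> 0 < q1 -> 0 < q2 ->
  q1 ^+ 2 = 1 - k * y1 ^+ 2 -> q2 ^+ 2 = 1 - k * y2 ^+ 2 -> y1 * q2 < y2 * q1.
Proof.
move=> y12 q10 q20 e1 e2.
have E : (y2 * q1) ^+ 2 - (y1 * q2) ^+ 2 = y2 ^+ 2 - y1 ^+ 2.
  by rewrite !exprMn e1 e2; ring.
have [y10|y10] := leP y1 0.
  have [y20|y20] := leP 0 y2.
    have h1 : y1 * q2 <= 0 by rewrite mulr_le0_ge0// ltW.
    have h2 : 0 <= y2 * q1 by rewrite mulr_ge0// ltW.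
    rewrite lt_neqAle (le_trans h1 h2) andbT; apply/eqP => h.
    move: E; rewrite h subrr => E.
    have a1 : y1 * q2 = 0 by apply/eqP; rewrite eq_le h1 h h2.
    have a2 : y2 * q1 = 0 by rewrite -h.
    move/eqP: a1; rewrite mulf_eq0 (gt_eqF q20) orbF => /eqP b1.
    move/eqP: a2; rewrite mulf_eq0 (gt_eqF q10) orbF => /eqP b2.
    by move: y12; rewrite b1 b2 ltxx.
  have h1 : 0 <= - (y1 * q2) by rewrite -mulNr mulr_ge0 ?oppr_ge0// ltW.
  have h2 : 0 <= - (y2 * q1) by rewrite -mulNr mulr_ge0 ?oppr_ge0// ltW.
  rewrite -ltrN2 -(@ltr_pXn2r _ 2)// ?nnegrE// !sqrrN -subr_lt0 E.
  by rewrite subr_sqr nmulr_llt0 ?subr_gt0//; move: y12 y20; clear; lra.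
have h1 : 0 <= y1 * q2 by rewrite mulr_ge0 ?ltW.
have h2 : 0 <= y2 * q1 by rewrite mulr_ge0 ?ltW// (lt_trans y10).
rewrite -(@ltr_pXn2r _ 2)// ?nnegrE// -subr_gt0 E.
by rewrite subr_sqr mulr_gt0 ?subr_gt0//; move: y12 y10; clear; lra.
Qed.

(* If [y_i = snk k a_i] then [c] and [r] are the values of [csk k] and [snk k] at
   [(a2 - a1) / 2]. *)
Lemma chord_exists (R : realType) (k y1 y2 : R) : curv k -> y1 < y2 ->
  (forall y, y1 <= y <= y2 -> 0 < 1 - k * y ^+ 2) ->
  exists c r e, chord k y1 y2 c r e.
Proof.
move=> hk y12 hy.
have y11 : y1 <= y1 <= y2 by rewrite lexx ltW.
have y22 : y1 <= y2 <= y2 by rewrite lexx ltW.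
have k3 : k ^+ 3 = k by case: hk => [|[|]] ->; ring.
pose q1 := lrad k y1; pose q2 := lrad k y2.
have q10 : 0 < q1 by exact/lrad_gt0/hy.
have q20 : 0 < q2 by exact/lrad_gt0/hy.
have e1 : q1 ^+ 2 = 1 - k * y1 ^+ 2 by exact/sqr_lrad/hy.
have e2 : q2 ^+ 2 = 1 - k * y2 ^+ 2 by exact/sqr_lrad/hy.
pose F := q1 * q2; pose p := y1 * y2; pose m := (y1 + y2) / 2.
have F0 : 0 < F by rewrite mulr_gt0.
have F2 : F ^+ 2 = (1 + k * p) ^+ 2 - k * (y1 + y2) ^+ 2.
  by rewrite exprMn e1 e2 /p; ring.
have F2' : F ^+ 2 = (1 - k * p) ^+ 2 - k * (y1 - y2) ^+ 2.
  by rewrite exprMn e1 e2 /p; ring.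
have d2 : 0 < (y1 - y2) ^+ 2 by rewrite exprn_even_gt0//= subr_eq0 lt_eqF.
have p1 : k = 1 -> `|p| < 1.
  move=> k1; have a1 := hy y1 y11; have a2 := hy y2 y22; rewrite k1 in a1 a2.
  rewrite -(@ltr_pXn2r _ 2)// ?nnegrE// real_normK ?num_real// expr1n /p exprMn.
  by have := mulr_gt0 a1 a2; have := sqr_ge0 y1; have := sqr_ge0 y2; nra.
have G0 : 0 < (1 + k * p + F) / 2.
  rewrite divr_gt0//; case: (hk) => [k1|[k0|k1]].
  - have : `|p| < F.
      rewrite -(@ltr_pXn2r _ 2)// ?nnegrE ?ltW// real_normK ?num_real//.
      by rewrite F2 k1; have := sqr_ge0 (y1 + y2); rewrite /p; have := sqr_ge0 y1; have := sqr_ge0 y2; nra.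
    by rewrite k1 => h; have := ler_norm p; move: h; clear; lra.
  - by rewrite k0; move: F0; clear; lra.
  - by have := ler_norm (- p); rewrite normrN; have := p1 k1; move: F0; rewrite k1; clear; lra.
(* The half-angle formula: if y_i = [snk k a_i], then [F + k * p] is [csk k (a2 - a1)] by the
   addition formula. *)
pose c := Num.sqrt ((1 + k * p + F) / 2).
have c0 : 0 < c by rewrite sqrtr_gt0.
have c2 : c ^+ 2 = (1 + k * p + F) / 2 by rewrite sqr_sqrtr// ltW.
have cn := lt0r_neq0 c0.
(* Forced by c e = (y1 + y2) / 2; it is the value of [snk k] at (a1 + a2) / 2. *)
pose e := m / c.
have ce : c * e = m by rewrite /e; field.
have ce2 : c ^+ 2 * e ^+ 2 = m ^+ 2 by rewrite -exprMn ce.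
have c4 : c ^+ 4 - (1 + k * p) * c ^+ 2 + k * m ^+ 2 = 0.
  rewrite (_ : c ^+ 4 = (c ^+ 2) ^+ 2); last by ring.
  rewrite c2; transitivity ((F ^+ 2 - (1 + k * p) ^+ 2 + k * (y1 + y2) ^+ 2) / 4).
    by rewrite /m; field.
  by rewrite F2; ring.
have kr : c ^+ 2 + k * (e ^+ 2 - p) = 1.
  apply: (mulfI (lt0r_neq0 (exprn_gt0 2 c0))).
  transitivity (c ^+ 4 + k * (c ^+ 2 * e ^+ 2) - k * p * c ^+ 2); first by ring.
  by rewrite ce2; move: c4; clear; lra.
have r2 : 0 < e ^+ 2 - p.
  case: (hk) => [k1|[k0|k1]].
  - have : 1 + p < F.
      have [/le_lt_trans->//|pp] := leP (1 + p) 0.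
      rewrite -(@ltr_pXn2r _ 2)// ?nnegrE ?ltW// F2' k1.
      by move: d2; clear; nra.
    by move: kr; rewrite c2 k1; clear; lra.
  - have c1 : c ^+ 2 = 1 by rewrite -kr k0; ring.
    have F1 : F ^+ 2 = 1 by rewrite F2 k0; ring.
    have -> : e ^+ 2 = m ^+ 2 by rewrite -ce2 c1 mul1r.
    by move: d2; rewrite /m /p; clear; nra.
  - have : F < 1 - p.
      have := p1 k1; have := ler_norm p => h1 h2.
      rewrite -(@ltr_pXn2r _ 2)// ?nnegrE ?ltW//; last by move: h1 h2; clear; lra.
      by rewrite F2' k1; move: d2; clear; nra.
    by move: kr; rewrite c2 k1; clear; lra.
pose r := Num.sqrt (e ^+ 2 - p).
have rr : r ^+ 2 = e ^+ 2 - p by rewrite sqr_sqrtr// ltW.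
have hm1 : 0 < c ^+ 2 - k * m * y1.
  rewrite c2 (_ : _ - _ = (q1 ^+ 2 + F) / 2); last by rewrite e1 /m /p; field.
  by rewrite divr_gt0// addr_gt0// exprn_gt0.
have hm2 : 0 < c ^+ 2 - k * m * y2.
  rewrite c2 (_ : _ - _ = (q2 ^+ 2 + F) / 2); last by rewrite e2 /m /p; field.
  by rewrite divr_gt0// addr_gt0// exprn_gt0.
have rat := ratio_lt y12 q10 q20 e1 e2.
exists c, r, e; split => //.
- by rewrite rr.
- by rewrite ce /m; field.
- by rewrite rr /p; ring.
- by rewrite sqrtr_gt0.
- case: (hk) => [->|[->|k1]].
  + by have := sqr_ge0 e; clear; lra.
  + by rewrite mul0r subr0.
  + rewrite k1; have := p1 k1; have := ler_norm p; move: kr G0; rewrite -c2 k1.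
    by move=> h1 h2 h3 h4; move: h1; rewrite c2; move: F0 h3 h4; rewrite k1; clear; lra.
- move=> y /andP[ya yb]; rewrite -(pmulr_rgt0 _ c0).
  rewrite (_ : c * _ = c ^+ 2 - k * m * y); last by rewrite -ce; ring.
  have [km|km] := leP 0 (k * m).
    by apply: (lt_le_trans hm2); rewrite lerD2l lerN2 ler_wpM2l.
  by apply: (lt_le_trans hm1); rewrite lerD2l lerN2 ler_wnM2l// ltW.
- rewrite -(pmulr_rgt0 _ c0) (_ : c * _ = m - c ^+ 2 * y1); last by rewrite -ce; ring.
  rewrite (_ : _ - _ = q1 * (y2 * q1 - y1 * q2) / 2).
    by rewrite divr_gt0// mulr_gt0// subr_gt0.
  transitivity ((y2 * q1 ^+ 2 - y1 * F) / 2); last by rewrite /F; ring.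
  by rewrite c2 e1 /m /p; field.
- rewrite -oppr_gt0 -(pmulr_rgt0 _ c0).
  rewrite (_ : c * _ = c ^+ 2 * y2 - m); last by rewrite -ce; ring.
  rewrite (_ : _ - _ = q2 * (y2 * q1 - y1 * q2) / 2).
    by rewrite divr_gt0// mulr_gt0// subr_gt0.
  transitivity ((y2 * F - y1 * q2 ^+ 2) / 2); last by rewrite /F; ring.
  by rewrite c2 e2 /m /p; field.
Qed.

(** Once around, the curve passes from t1 to t2 and back, wherever the base point lies. *)
Lemma closed_variation (R : realType) (a b : R) E (f df V dv : R -> R) (t1 t2 : R) :
  pwd a b E f df -> pwd a b E V dv ->
  (forall t, a < t < b -> t \notin E -> `|df t| <= dv t) ->
  f a = f b -> a <= t1 <= b -> a <= t2 <= b -> 2 * (f t2 - f t1) <= V b - V a.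
Proof.
move=> pf pV H fab /andP[at1 t1b] /andP[at2 t2b].
have N s t : a <= s -> s <= t -> t <= b -> `|f t - f s| <= V t - V s.
  move=> as_ st tb; apply: (pwd_norm_le pf pV) => // u /(itv_oo_sub as_ tb); exact: H.
have ab := le_trans at1 t1b.
have [t12|/ltW t21] := leP t1 t2.
  have h1 := N _ _ (lexx a) at1 t1b; have h2 := N _ _ at1 t12 t2b.
  have h3 := N _ _ at2 t2b (lexx b).
  have g2 := ler_norm (f t2 - f t1).
  have g1 : f a - f t1 <= `|f t1 - f a| by rewrite distrC ler_norm.
  have g3 : f t2 - f b <= `|f b - f t2| by rewrite distrC ler_norm.
  by move: h1 h2 h3 g1 g2 g3; rewrite fab; clear; lra.
have h1 := N _ _ (lexx a) at2 t2b; have h2 := N _ _ at2 t21 t1b.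
have h3 := N _ _ at1 t1b (lexx b).
have g2 : f t2 - f t1 <= `|f t1 - f t2| by rewrite distrC ler_norm.
have g1 := ler_norm (f t2 - f a); have g3 := ler_norm (f b - f t1).
by move: h1 h2 h3 g1 g2 g3; rewrite fab; clear; lra.
Qed.

Definition speed (R : realType) (k : R) (dx dy dz : R -> R) (t : R) : R :=
  Num.sqrt (dx t ^+ 2 + dy t ^+ 2 + k * dz t ^+ 2).

Lemma pwc_speed (R : realType) (k a b : R) E (x dx y dy z dz : R -> R) :
  curve k a b E x dx y dy z dz -> pwc a b E (speed k dx dy dz).
Proof.
move=> [_ [_ _ px] [_ _ py] [_ _ pz] _]; apply: pwc_sqrt.
by apply: pwcD; [apply: pwcD; exact: pwcM|apply: pwcM; [exact: pwc_cst|exact: pwcM]].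
Qed.

(** Since q u' = z x' - x z' with q = 1 - k y^2, this is the metric y'^2 / q + q u'^2 of the
    coordinates (y, u), multiplied by q. *)
Lemma metric_split (R : realType) (k x y z dx dy dz : R) : curv k -> md k x y z ->
  k * (x * dx + y * dy) + z * dz = 0 ->
  (1 - k * y ^+ 2) * (dx ^+ 2 + dy ^+ 2 + k * dz ^+ 2) =
  dy ^+ 2 + (z * dx - x * dz) ^+ 2.
Proof.
move=> hk [h hz] ht.
have -> : 1 - k * y ^+ 2 = k * x ^+ 2 + z ^+ 2 by rewrite -h; ring.
have [k0|kn] := eqVneq k 0.
  move: ht h; rewrite k0 !mul0r !add0r => /eqP; rewrite mulf_eq0.
  rewrite gt_eqF/=; last by apply: hz; rewrite k0 eq_sym oner_eq0.
  move=> /eqP-> z1; transitivity (dy ^+ 2 + z ^+ 2 * dx ^+ 2); last by ring.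
  by rewrite z1; ring.
have k2 : k ^+ 2 = 1.
  by case: hk kn => [|[|]] ->; rewrite ?eqxx// ?sqrrN expr1n.
have ht' : k * x * dx + z * dz = - (k * y * dy) by move: ht; clear; lra.
transitivity ((k * x ^+ 2 + z ^+ 2) * dy ^+ 2 + (k ^+ 2 * x ^+ 2 * dz ^+ 2 + z ^+ 2 * dx ^+ 2
  - 2 * k ^+ 2 * x * z * dx * dz)
  + k * ((k * x * dx + z * dz) ^+ 2 + (1 - k ^+ 2) * x ^+ 2 * dx ^+ 2)); first by ring.
rewrite ht' k2 subrr mul0r mul0r addr0.
transitivity ((k * x ^+ 2 + z ^+ 2 + k * k ^+ 2 * y ^+ 2) * dy ^+ 2 + (z * dx - x * dz) ^+ 2);
  first by ring.
by rewrite k2 mulr1 (_ : _ + k * y ^+ 2 = 1) ?mul1r// -h; ring.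
Qed.

(** Lagrange's identity [id] yields both claims: the defect in the inequality is the square of s |w|
    - |Q| |d|. *)
Lemma cauchy_speed (R : realType) (q r p Q d w v : R) : 0 < q -> 0 < r -> 0 <= p -> 0 <= v ->
  p = r ^+ 2 * q - Q ^+ 2 -> q * v ^+ 2 = d ^+ 2 + w ^+ 2 ->
  Num.sqrt p / q * `|d| + `|Q| * (`|w| / q) <= r * v /\
  (Num.sqrt p / q * `|d| + `|Q| * (`|w| / q) = r * v -> r ^+ 2 * w ^+ 2 = Q ^+ 2 * v ^+ 2).
Proof.
move=> q0 r0 p0 v0 hp hv; have qn := lt0r_neq0 q0.
set s := Num.sqrt p; have s2 : s ^+ 2 = p by rewrite sqr_sqrtr.
have -> : s / q * `|d| + `|Q| * (`|w| / q) = (s * `|d| + `|Q| * `|w|) / q by field.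
have nn (t : R) : `|t| ^+ 2 = t ^+ 2 by rewrite real_normK ?num_real.
have id : (s * `|d| + `|Q| * `|w|) ^+ 2 + (s * `|w| - `|Q| * `|d|) ^+ 2 = (r * q * v) ^+ 2.
  transitivity ((s ^+ 2 + `|Q| ^+ 2) * (`|d| ^+ 2 + `|w| ^+ 2)); first by ring.
  by rewrite !nn s2 -hv hp; ring.
have s0 : 0 <= s by exact: sqrtr_ge0.
have l0 : 0 <= s * `|d| + `|Q| * `|w| by rewrite addr_ge0 ?mulr_ge0.
have r1 : 0 <= r * q * v by rewrite mulr_ge0// mulr_ge0// ltW.
split.
  rewrite ler_pdivrMr// -mulrA [v * q]mulrC mulrA -(@ler_pXn2r _ 2)// ?nnegrE//.
  by rewrite -id lerDl sqr_ge0.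
move=> h; have {}h : s * `|d| + `|Q| * `|w| = r * q * v.
  by rewrite -(divfK qn (s * `|d| + _)) h; ring.
have /eqP : (s * `|w| - `|Q| * `|d|) ^+ 2 = 0 by move: id; rewrite h; clear; lra.
rewrite sqrf_eq0 subr_eq0 => /eqP h2.
have {}h2 : p * w ^+ 2 = Q ^+ 2 * d ^+ 2.
  by rewrite -s2 -(nn w) -(nn Q) -(nn d) -!exprMn h2.
apply: (mulfI qn).
transitivity (p * w ^+ 2 + Q ^+ 2 * w ^+ 2); first by rewrite hp; ring.
by rewrite h2 -mulrDr -hv; ring.
Qed.

(** The curve can attain the heights y1 and y2 at interior parameters, and there the primitive of
    [chordw] has to be differentiable; it is therefore taken on a larger interval. *)
Lemma chord_margin (R : realType) (k y1 y2 : R) : curv k -> y1 < y2 ->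
  (forall y, y1 <= y <= y2 -> 0 < 1 - k * y ^+ 2) ->
  exists lo hi, [/\ lo < y1, y2 < hi & forall y, lo <= y <= hi -> 0 < 1 - k * y ^+ 2].
Proof.
move=> hk y12 hy; have [k1|kn] := eqVneq k 1; last first.
  exists (y1 - 1), (y2 + 1); split; [by rewrite ltrBlDr ltrDl|by rewrite ltrDl|].
  move=> y _; case: hk kn => [|[|]] ->; rewrite ?eqxx// => _.
    by have := sqr_ge0 y; clear; lra.
  by rewrite mul0r subr0.
have b y : y1 <= y <= y2 -> -1 < y < 1.
  move=> /hy; rewrite k1 mul1r => h.
  by rewrite -ltr_norml -(@ltr_pXn2r _ 2)// ?nnegrE// real_normK ?num_real// expr1n -subr_gt0.
have /andP[a1 a2] : -1 < y1 < 1 by apply: b; rewrite lexx ltW.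
have /andP[b1 b2] : -1 < y2 < 1 by apply: b; rewrite lexx ltW.
exists ((y1 - 1) / 2), ((y2 + 1) / 2); split; [move: a1; clear; lra|move: b2; clear; lra|].
move=> y /andP[ya yb]; rewrite k1 mul1r.
have -> : 1 - y ^+ 2 = (1 - y) * (1 + y) by ring.
by rewrite mulr_gt0//; [move: yb b2; clear; lra|move: ya a1; clear; lra].
Qed.

(** Applied with p = pi and S the area of the comparison disk. Equality forces A = S, and with (1 +
    c) S = 2 p r^2 this determines c and r from A. *)
Lemma axis_ineq_eq (R : realType) (p k A L S c r : R) : 0 < p -> 0 < A -> 0 < r -> 0 < c ->
  0 <= L -> c ^+ 2 + k * r ^+ 2 = 1 -> S = 2 * p * r ^+ 2 / (1 + c) ->
  c * A + S <= r * L ->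
  4 * p * A - k * A ^+ 2 <= L ^+ 2 /\
  (L ^+ 2 = 4 * p * A - k * A ^+ 2 ->
    [/\ c = 1 - k * A / (2 * p), r = Num.sqrt (A * (4 * p - k * A)) / (2 * p) &
     r * L = c * A + S]).
Proof.
move=> p0 A0 r0 c0 L0 h1 SE h.
have pn := lt0r_neq0 p0.
have c1 : 0 < 1 + c by rewrite addr_gt0.
have c1n := lt0r_neq0 c1.
have S0 : 0 < S by rewrite SE divr_gt0// !mulr_gt0// exprn_gt0.
have S1 : (1 + c) * S = 2 * p * r ^+ 2 by rewrite SE mulrC divfK.
have r2 : 0 < r ^+ 2 by rewrite exprn_gt0.
have lhs0 : 0 <= c * A + S by rewrite addr_ge0 ?mulr_ge0 ?ltW.
have rhs0 : 0 <= r * L by rewrite mulr_ge0// ltW.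
have id : (c * A + S) ^+ 2 = r ^+ 2 * (4 * p * A - k * A ^+ 2) + (A - S) ^+ 2.
  transitivity ((c ^+ 2 - 1) * A ^+ 2 + 2 * A * ((1 + c) * S) + (A - S) ^+ 2); first by ring.
  by rewrite S1 -{1}h1; ring.
have h2 : (c * A + S) ^+ 2 <= r ^+ 2 * L ^+ 2 by rewrite -exprMn ler_pXn2r.
split.
  rewrite -(ler_pM2l r2); apply: le_trans h2; rewrite id lerDl; exact: sqr_ge0.
move=> LE; have AS : A = S.
  apply/eqP; rewrite -subr_eq0 -sqrf_eq0 eq_le sqr_ge0 andbT.
  by move: h2; rewrite id LE gerDl.
have cA : A * (1 + c) = 2 * p * r ^+ 2 by rewrite {1}AS mulrC.
have cE : c = 1 - k * A / (2 * p).
  apply: (mulIf c1n); rewrite mulrBl.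
  have -> : k * A / (2 * p) * (1 + c) = k * (A * (1 + c)) / (2 * p) by ring.
  rewrite cA.
  have -> : k * (2 * p * r ^+ 2) / (2 * p) = k * r ^+ 2 by field.
  by rewrite mulrDr mulr1 -expr2 mul1r; move: h1; clear; lra.
split => //.
  have rn : 0 <= Num.sqrt (A * (4 * p - k * A)) / (2 * p).
    by rewrite divr_ge0 ?sqrtr_ge0// mulr_ge0// ltW.
  apply/eqP; rewrite -(eqrXn2 (ltn0Sn 1) (ltW r0) rn); apply/eqP.
  have -> : r ^+ 2 = A * (1 + c) / (2 * p) by rewrite cA; field.
  have E : A * (1 + c) / (2 * p) = A * (4 * p - k * A) / (2 * p) ^+ 2.
    by rewrite cE; field.
  rewrite expr_div_n sqr_sqrtr ?E//.
  have -> : A * (4 * p - k * A) = A * (1 + c) * (2 * p) by rewrite cE; field.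
  by rewrite !mulr_ge0 ?ltW.
apply/eqP; rewrite -(@eqrXn2 _ 2)//.
by rewrite id -AS subrr exprMn LE expr0n addr0.
Qed.

Lemma axis_ineq (R : realType) (k a b : R) E (x dx y dy z dz : R -> R) U (A : R) :
  curv k -> curve k a b E x dx y dy z dz -> domain k a b x y z U ->
  (k = 1 -> ~ U 0 1 0 /\ ~ U 0 (-1) 0) ->
  (forall t, a <= t <= b -> 0 < 1 - k * y t ^+ 2) ->
  area k (region U) = A%:E -> 0 < A -> y a = y b ->
  let L := prim a (speed k dx dy dz) b in
  4 * pi * A - k * A ^+ 2 <= L ^+ 2 /\
  (L ^+ 2 = 4 * pi * A - k * A ^+ 2 ->
   exists c r e, [/\ c = 1 - k * A / (2 * pi),
     r = Num.sqrt (A * (4 * pi - k * A)) / (2 * pi), 0 < c, 0 < r /\ c ^+ 2 + k * r ^+ 2 = 1 &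
     forall t, a < t < b -> t \notin E ->
       r ^+ 2 * (z t * dx t - x t * dz t) ^+ 2 =
       (c * y t - e) ^+ 2 * speed k dx dy dz t ^+ 2]).
Proof.
move=> hk hc hU hpole hy hA A0 yab L.
have htan := curve_tangent hc; have psp := pwc_speed hc.
have [ab px py pz hmd] := hc.
have sw y0 := sweep y0 hk hc hU hpole hy hA.
have cy := pwd_continuous py.
have [t1 [t2 [ht1 ht2 hrange]]] := within_range (ltW ab) cy.
set y1 := y t1 in hrange; set y2 := y t2 in hrange.
(* Were y constant, the sweep away from that very parallel would have width 0, and A would not be
   positive. *)
have y12 : y1 < y2.
  have /andP[h1 h2] := hrange _ ht1.
  rewrite lt_neqAle h2 andbT; apply/eqP => y12.
  suff I0 : prim a (fun t => `|y t - y1| *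
      `|(z t * dx t - x t * dz t) * (1 - k * y t ^+ 2)^-1|) b = 0.
    by have := sw y1; rewrite I0 leNgt A0.
  rewrite /prim -[RHS](mul0r (fine (lebesgue_measure `[a, b]))) -Rintegral_cst//.
  by apply: eq_Rintegral => t; rewrite inE/= in_itv/= => /hrange; rewrite -y12 -eq_le => /eqP <-;
    rewrite subrr normr0 mul0r.
have hy' u : y1 <= u <= y2 -> 0 < 1 - k * u ^+ 2.
  have g1 := hy _ ht1; have g2 := hy _ ht2; rewrite -/y1 -/y2 in g1 g2.
  move=> /andP[u1 u2]; case: hk => [->|[->|k1]].
  - by have := sqr_ge0 u; clear; lra.
  - by rewrite mul0r subr0.
  - rewrite k1 !mul1r in g1 g2; rewrite k1 mul1r; have [u0|/ltW u0] := leP 0 u.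
      by apply: lt_le_trans g2 _; rewrite lerD2l lerN2 ler_pXn2r ?nnegrE// (le_trans u0).
    apply: lt_le_trans g1 _; rewrite lerD2l lerN2 -[u ^+ 2]sqrrN -[y1 ^+ 2]sqrrN.
    by rewrite ler_pXn2r ?nnegrE ?lerN2 ?oppr_ge0// (le_trans u1).
have [c [r [e hch]]] := chord_exists hk y12 hy'.
have cint := chord_integral hch.
have [_ _ _ h1 h2 h3 r0 c0 _ _ _ _] := hch.
have [lo [hi [lo1 hi2 hlh]]] := chord_margin hk y12 hy'.
pose P := chordw k y1 y2.
have lohi : lo <= hi by rewrite ltW// (lt_trans lo1)// (lt_trans y12).
have pW : pwd lo hi [::] (prim lo P) P.
  by apply: pwd_prim => //; apply: pwc_within; exact: within_chordw.
have yr t : a <= t <= b -> lo < y t < hi.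
  by move=> /hrange/andP[u1 u2]; rewrite (lt_le_trans lo1 u1) (le_lt_trans u2 hi2).
have pWy : pwd a b E (prim lo P \o y) (fun t => P (y t) * dy t).
  apply: (pwd_comp py) => t /yr yt; have [_ dW _] := pW; split; first exact: dW.
  by apply: continuous_chordw; apply: hlh; move/andP: yt => [/ltW-> /ltW->].
have [_ _ [_ _]] := pWy; have [_ _ pPy] := pWy.
pose V := prim a (fun t => `|P (y t) * dy t|).
have pV : pwd a b E V (fun t => `|P (y t) * dy t|).
  by apply: pwd_prim; [exact: ltW|exact: pwc_norm].
have DW : prim lo P y2 - prim lo P y1 = pi * r ^+ 2 / (1 + c).
  rewrite -cint; apply/esym; apply: chord_sum => //.
    by apply: within_cont_sub (pwd_continuous pW); exact: ltW.
  have [_ dW _] := pW; move=> u /andP[u1 u2]; apply: dW => //.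
  by rewrite (lt_trans lo1 u1) (lt_trans u2 hi2).
have V2 : 2 * (pi * r ^+ 2 / (1 + c)) <= V b - V a.
  rewrite -DW; apply: (closed_variation pWy pV) => //=.
  by rewrite yab.
have V0 : V a = 0 by rewrite /V prim_self.
have [th pth _] := curve_lift hk hc hy.
set v := (fun t => (z t * dx t - x t * dz t) * (1 - k * y t ^+ 2)^-1) in pth.
have [_ _ pv] := pth.
(* The height at which the weight |c y - e| vanishes, so that c |y - y0| is this weight. *)
pose y0 := e / c; have cn := lt0r_neq0 c0.
pose B := prim a (fun t => `|y t - y0| * `|v t|).
have pB : pwd a b E B (fun t => `|y t - y0| * `|v t|).
  apply: pwd_prim; first exact: ltW.
  apply: pwcM; last exact: pwc_norm.
  by apply: pwc_norm; exact: pwd_pwc (pwdB py (pwd_cst a b E y0)).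
have B0 : B a = 0 by rewrite /B prim_self.
have AB : A <= B b := sw y0.
pose Lf := prim a (speed k dx dy dz).
have pL : pwd a b E Lf (speed k dx dy dz) by apply: pwd_prim => //; exact: ltW.
have La : Lf a = 0 by rewrite /Lf prim_self.
have L0 : 0 <= L.
  have := pwd_le (pwd_cst a b E 0) pL (lexx a) (ltW ab) (lexx b).
  by rewrite La !subr0 => H; apply: H => u _ _; exact: sqrtr_ge0.
(* The deficit of the estimate along the curve. It is nondecreasing and starts at 0; equality makes
   it end at 0, so its derivative vanishes off [E] and Cauchy-Schwarz is sharp there. *)
pose D t := r * Lf t - (V t + c * B t).
pose dD t := r * speed k dx dy dz t - (`|P (y t) * dy t| + c * (`|y t - y0| * `|v t|)).
have pD : pwd a b E D dD by exact: pwdB (pwdZ r pL) (pwdD pV (pwdZ c pB)).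
have key t : a < t < b -> t \notin E -> 0 <= dD t /\
    (dD t = 0 -> r ^+ 2 * (z t * dx t - x t * dz t) ^+ 2 =
       (c * y t - e) ^+ 2 * speed k dx dy dz t ^+ 2).
  move=> tab tE; have tab' : a <= t <= b by case/andP: tab => /ltW-> /ltW->.
  have q0 := hy t tab'; have /andP[u1 u2] := hrange t tab'.
  have sp : speed k dx dy dz t ^+ 2 = dx t ^+ 2 + dy t ^+ 2 + k * dz t ^+ 2.
    rewrite sqr_sqrtr// -(pmulr_rge0 _ q0) (metric_split hk (hmd t tab') (htan t tab tE)).
    by rewrite addr_ge0 ?sqr_ge0.
  have hv : (1 - k * y t ^+ 2) * speed k dx dy dz t ^+ 2 =
      dy t ^+ 2 + (z t * dx t - x t * dz t) ^+ 2.
    by rewrite sp (metric_split hk (hmd t tab') (htan t tab tE)).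
  have p0 : 0 <= (y2 - y t) * (y t - y1) by rewrite mulr_ge0 ?subr_ge0.
  have [g1 g2] := cauchy_speed q0 r0 p0 (sqrtr_ge0 _ : 0 <= speed k dx dy dz t)
    (chord_quad (y t) h1 h2 h3) hv.
  have P0 : 0 <= P (y t) by rewrite divr_ge0 ?sqrtr_ge0 ?ltW.
  have dDE : dD t = r * speed k dx dy dz t -
      (Num.sqrt ((y2 - y t) * (y t - y1)) / (1 - k * y t ^+ 2) * `|dy t| +
       `|c * y t - e| * (`|z t * dx t - x t * dz t| / (1 - k * y t ^+ 2))).
    rewrite /dD normrM (ger0_norm P0); congr (_ - (_ + _)).
    rewrite /v normrM normfV (gtr0_norm q0).
    have -> : c * y t - e = c * (y t - y0) by rewrite /y0; field.
    by rewrite [in RHS]normrM (gtr0_norm c0) [LHS]mulrA.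
  rewrite dDE subr_ge0; split => // /eqP; rewrite subr_eq0 => /eqP h; exact: g2.
have D0 : D a = 0 by rewrite /D La V0 B0 !mulr0 addr0 subrr.
have Dle s t : a <= s -> s <= t -> t <= b -> D s <= D t.
  move=> as_ st tb; have := pwd_le (pwd_cst a b E 0) pD as_ st tb.
  rewrite subrr subr_ge0; apply => u /(itv_oo_sub as_ tb) uab uE.
  by have [] := key u uab uE.
have Db : 0 <= D b by rewrite -D0 Dle// ltW.
have SE : 2 * (pi * r ^+ 2 / (1 + c)) = 2 * pi * r ^+ 2 / (1 + c) by rewrite !mulrA.
have hL : c * A + 2 * pi * r ^+ 2 / (1 + c) <= r * L.
  move: Db; rewrite /D -/L; have := ler_wpM2l (ltW c0) AB; move: V2; rewrite V0 SE.
  by rewrite /Lf -/L; clear; lra.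
have [i1 i2] := axis_ineq_eq (pi_gt0 R) A0 r0 c0 L0 h1 erefl hL.
split => // LE; have [cE rE LE'] := i2 LE.
exists c, r, e; split => // t tab tE; have [_] := key t tab tE; apply.
have Db' : D b <= 0.
  rewrite /D /Lf -/L LE'; have := ler_wpM2l (ltW c0) AB; move: V2; rewrite V0 SE.
  by clear; lra.
apply: (pwd_deriv_const (k := 0) pD _ tab tE) => s /andP[as_ sb].
apply/eqP; rewrite eq_le -{2}D0 Dle// andbT.
exact: le_trans (Dle _ _ as_ sb (lexx b)) Db'.
Qed.

(** * The equality case: moving the axis *)

Record setup (R : realType) (k a b : R) (E : seq R) (x dx y dy z dz : R -> R)
    (U : R -> R -> R -> Prop) (A : R) : Prop := Setup {
  setup_curve : curve k a b E x dx y dy z dz;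
  setup_domain : domain k a b x y z U;
  setup_area : area k (region U) = A%:E;
  setup_A : 0 < A;
  setup_closed : [/\ x a = x b, y a = y b & z a = z b];
  setup_inj : forall s t, a <= s < b -> a <= t < b ->
    x s = x t -> y s = y t -> z s = z t -> s = t }.

Lemma curve_swap (R : realType) (k a b : R) E (x dx y dy z dz : R -> R) :
  curve k a b E x dx y dy z dz -> curve k a b E y dy x dx z dz.
Proof. by move=> [ab px py pz H]; split => // t /H[h1 h2]; split => //; rewrite [y t ^+ 2 + _]addrC. Qed.

Lemma setup_swap (R : realType) (k a b : R) E (x dx y dy z dz : R -> R) U A :
  setup k a b E x dx y dy z dz U A ->
  setup k a b E y dy x dx z dz (fun x y z => U y x z) A.
Proof.
move=> [hc [U1 U2 U3 U4] hA A0 [xab yab zab] inj]; split => //.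
- exact: curve_swap.
- split => //; first exact: ropen_swap.
    move=> fx fy fz s0 s1 cx cy cz s01 H; apply: U3 => // s /H[[h1 h2] h3].
    split; first by split => //; rewrite [fy s ^+ 2 + _]addrC.
    by move=> t /h3 h [? ? ?]; apply: h.
  by move=> /U4[M HM]; exists M => u v w /HM[].
- by rewrite area_swap.
- by move=> s t hs ht h1 h2 h3; apply: inj.
Qed.

Lemma rot_inverse (R : realType) (k tau x z : R) : curv k ->
  (x * csk k tau - z * snk k tau) * csk k tau +
    (z * csk k tau + k * (x * snk k tau)) * snk k tau = x /\
  (z * csk k tau + k * (x * snk k tau)) * csk k tau -
    k * ((x * csk k tau - z * snk k tau) * snk k tau) = z.
Proof.
move=> hk; have h := csk2snk2 tau hk; split.
  transitivity (x * (csk k tau ^+ 2 + k * snk k tau ^+ 2)); first by ring.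
  by rewrite h mulr1.
transitivity (z * (csk k tau ^+ 2 + k * snk k tau ^+ 2)); first by ring.
by rewrite h mulr1.
Qed.

Lemma md_rot (R : realType) (k tau x y z : R) : curv k -> md k x y z ->
  md k (x * csk k tau - z * snk k tau) y (z * csk k tau + k * (x * snk k tau)).
Proof.
move=> hk /(md_rotxz (- tau) x y z hk); rewrite snkN// cskN//.
by rewrite !mulrN opprK.
Qed.

Lemma curve_rot (R : realType) (k tau a b : R) E (x dx y dy z dz : R -> R) : curv k ->
  curve k a b E x dx y dy z dz ->
  curve k a b E (fun t => x t * csk k tau - z t * snk k tau)
    (fun t => dx t * csk k tau - dz t * snk k tau) y dy
    (fun t => z t * csk k tau + k * (x t * snk k tau))
    (fun t => dz t * csk k tau + k * (dx t * snk k tau)).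
Proof.
move=> hk [ab px py pz H].
have Z (f df : R -> R) (s : R) : pwd a b E f df -> pwd a b E (fun t => f t * s) (fun t => df t * s).
  move=> /(pwdZ s); rewrite (_ : (fun t => s * f t) = (fun t => f t * s)); last first.
    by apply/funext => t; rewrite mulrC.
  by apply: pwd_ext => t; rewrite mulrC.
split => //.
- by apply: pwdB; exact: Z.
- by apply: pwdD; [exact: Z|apply: pwdZ; exact: Z].
- by move=> t /H; exact: md_rot.
Qed.

Lemma setup_rot (R : realType) (k tau a b : R) E (x dx y dy z dz : R -> R) U A :
  curv k -> setup k a b E x dx y dy z dz U A ->
  setup k a b E (fun t => x t * csk k tau - z t * snk k tau)
    (fun t => dx t * csk k tau - dz t * snk k tau) y dy
    (fun t => z t * csk k tau + k * (x t * snk k tau))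
    (fun t => dz t * csk k tau + k * (dx t * snk k tau)) (rotxz k tau U) A.
Proof.
move=> hk [hc [U1 U2 U3 U4] hA A0 [xab yab zab] inj]; split => //.
- exact: curve_rot.
- split.
  + exact: ropen_rotxz.
  + move=> t tab; rewrite /rotxz.
    have [-> ->] := rot_inverse tau (x t) (z t) hk; exact: U2.
  + move=> fx fy fz s0 s1 cx cy cz s01 H; rewrite /rotxz.
    pose gx s := fx s * csk k tau + fz s * snk k tau.
    pose gz s := fz s * csk k tau - k * (fx s * snk k tau).
    have cZ (f : R -> R) (p : R) : continuous f -> continuous (fun s => f s * p).
      by move=> cf s; apply: (@continuousM _ _ f (fun _ => p)); [exact: cf|exact: cst_continuous].
    apply: (U3 gx fy gz) => //.
    * move=> s; apply: (@continuousD _ _ _ (fun s => fx s * csk k tau) (fun s => fz s * snk k tau)).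
        exact: cZ.
      exact: cZ.
    * move=> s; apply: (@continuousB _ _ _ (fun s => fz s * csk k tau)
        (fun s => k * (fx s * snk k tau))); first exact: cZ.
      rewrite (_ : (fun s => _) = (fun s => fx s * (snk k tau * k))); first exact: cZ.
      by apply/funext => u; rewrite mulrC mulrA.
    * move=> s /H[h1 h2]; split; first exact/md_rotxz.
      move=> t tab [e1 e2 e3]; apply: (h2 t tab).
      have := rot_inverse (- tau) (fx s) (fz s) hk; rewrite snkN// cskN// !mulrN !opprK.
      rewrite -/(gx s) -/(gz s) => -[<- <-]; rewrite -e1 -e2 -e3; split => //; ring.
  + move=> k1; have [M HM] := U4 k1; have M' : exists M', 0 <= M' /\ forall x y z, U x y z ->
        [/\ `|x| <= M', `|y| <= M' & `|z| <= M'].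
      exists `|M|; split => // u v w /HM[h1 h2 h3].
      by split; apply: le_trans (ler_norm M).
    have [N [N0 HN]] := M'; pose K := N * (`|csk k tau| + `|snk k tau| + 1) *(1 + `|k|).
    exists K => u v w; rewrite /rotxz => /HN[].
    set u' := u * _ + _; set w' := w * _ - _ => h1 h2 h3.
    have := rot_inverse (- tau) u w hk; rewrite snkN// cskN// !mulrN !opprK -/u' -/w'.
    move=> [<- <-].
    have c0 := normr_ge0 (csk k tau); have s0 := normr_ge0 (snk k tau); have k0 := normr_ge0 k.
    have KE : K = (N * `|csk k tau| + N * `|snk k tau| + N) * (1 + `|k|) by rewrite /K; ring.
    have g1 : 0 <= N * `|csk k tau| by rewrite mulr_ge0.
    have g2 : 0 <= N * `|snk k tau| by rewrite mulr_ge0.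
    have KE1 : N * `|csk k tau| + N * `|snk k tau| + N <= K.
      by rewrite KE ler_peMr ?lerDl// !addr_ge0.
    have b1 (p s : R) : `|p| <= N -> `|p * s| <= N * `|s|.
      by move=> hp; rewrite normrM ler_wpM2r.
    split.
    * apply: le_trans KE1; apply: le_trans (ler_normD _ _) _; rewrite ?normrN.
      by have := b1 _ (csk k tau) h1; have := b1 _ (snk k tau) h3; move: N0; clear; lra.
    * by apply: le_trans h2 _; apply: le_trans KE1; move: g1 g2; clear; lra.
    * apply: le_trans (ler_normD _ _) _; rewrite ?normrN [`|k * _|]normrM.
      have := b1 _ (csk k tau) h3; have := ler_wpM2l k0 (b1 _ (snk k tau) h1).
      rewrite KE; have : 0 <= `|k| * (N * `|csk k tau| + N) by rewrite mulr_ge0// addr_ge0.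
      by move: g1 g2 N0; clear; lra.
- exact: eq_trans (area_rotxz tau hk U1) hA.
- by rewrite xab yab zab.
- move=> s t hs ht h1 h2 h3; apply: inj => //.
    by rewrite -(rot_inverse tau (x s) (z s) hk).1 -(rot_inverse tau (x t) (z t) hk).1 h1 h3.
  by rewrite -(rot_inverse tau (x s) (z s) hk).2 -(rot_inverse tau (x t) (z t) hk).2 h1 h3.
Qed.

Lemma length_ext (R : realType) (k a b : R) E (x dx y dy z dz x' dx' y' dy' z' dz' : R -> R) :
  curve k a b E x dx y dy z dz -> curve k a b E x' dx' y' dy' z' dz' ->
  (forall t, a < t < b -> t \notin E -> speed k dx' dy' dz' t = speed k dx dy dz t) ->
  prim a (speed k dx' dy' dz') b = prim a (speed k dx dy dz) b.
Proof.
move=> h1 h2 H; have [ab _ _ _ _] := h1.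
have p1 := pwc_speed h1; have p2 := pwc_speed h2.
apply/eqP; rewrite eq_le; apply/andP; split.
  by apply: (pwc_le (ltW ab) p2 p1) => u uab uE; rewrite H.
by apply: (pwc_le (ltW ab) p1 p2) => u uab uE; rewrite H.
Qed.

Lemma rot_length (R : realType) (k tau a b : R) E (x dx y dy z dz : R -> R) : curv k ->
  curve k a b E x dx y dy z dz ->
  prim a (speed k (fun t => dx t * csk k tau - dz t * snk k tau) dy
    (fun t => dz t * csk k tau + k * (dx t * snk k tau))) b = prim a (speed k dx dy dz) b.
Proof.
move=> hk hc; apply: (length_ext hc (curve_rot tau hk hc)) => t tab tE.
rewrite /speed; congr Num.sqrt; have h := csk2snk2 tau hk.
have tab' : a <= t <= b by case/andP: tab => /ltW-> /ltW->.
have [_ _ _ _ /(_ t tab')[h1 h2]] := hc.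
have ht := curve_tangent hc tab tE.
have [k0|kn] := eqVneq k 0.
  move: ht; rewrite k0 !mul0r add0r => /eqP; rewrite mulf_eq0.
  rewrite gt_eqF/=; last by apply: h2; rewrite k0 eq_sym oner_eq0.
  move=> /eqP ->; move: h; rewrite k0 !mul0r addr0 => h.
  by rewrite addr0 subr0 exprMn h mulr1 addr0.
have k2 : k ^+ 2 = 1.
  by case: hk kn => [|[|]] ->; rewrite ?eqxx// ?sqrrN expr1n.
transitivity (dx t ^+ 2 * (csk k tau ^+ 2 + k * k ^+ 2 * snk k tau ^+ 2) + dy t ^+ 2
  + dz t ^+ 2 * (snk k tau ^+ 2 + k * csk k tau ^+ 2)
  + 2 * (k ^+ 2 - 1) * (dx t * dz t * csk k tau * snk k tau)); first by ring.
rewrite k2 mulr1 h subrr mulr0 mul0r addr0 mulr1; congr (_ + _).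
rewrite [RHS]mulrC; congr (_ * _).
transitivity (k * (csk k tau ^+ 2 + k * snk k tau ^+ 2) + (1 - k ^+ 2) * snk k tau ^+ 2).
  by ring.
by rewrite h k2 subrr mul0r addr0 mulr1.
Qed.

Lemma swap_length (R : realType) (k a b : R) (dx dy dz : R -> R) :
  prim a (speed k dy dx dz) b = prim a (speed k dx dy dz) b.
Proof. by congr prim; apply/funext => t; rewrite /speed [dy t ^+ 2 + _]addrC. Qed.

(* The rotation by [phi] about the [y]-axis followed by the rotation by [tau] about the
   [x]-axis; [tiltU] pulls a region back along its inverse. *)
Definition tiltx (R : realType) (k phi x z : R) : R := x * csk k phi - z * snk k phi.
Definition tilt1 (R : realType) (k phi x z : R) : R := z * csk k phi + k * (x * snk k phi).
Definition tilty (R : realType) (k phi tau x y z : R) : R :=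
  y * csk k tau - tilt1 k phi x z * snk k tau.
Definition tiltz (R : realType) (k phi tau x y z : R) : R :=
  tilt1 k phi x z * csk k tau + k * (y * snk k tau).
Definition tiltU (R : realType) (k phi tau : R) (U : R -> R -> R -> Prop) (x y z : R) : Prop :=
  let y0 := y * csk k tau + z * snk k tau in
  let z0 := z * csk k tau - k * (y * snk k tau) in
  U (x * csk k phi + z0 * snk k phi) y0 (z0 * csk k phi - k * (x * snk k phi)).

Lemma curve_tilt (R : realType) (k phi tau a b : R) E (x dx y dy z dz : R -> R) :
  curv k -> curve k a b E x dx y dy z dz ->
  curve k a b E
    (fun t => tiltx k phi (x t) (z t)) (fun t => tiltx k phi (dx t) (dz t))
    (fun t => tilty k phi tau (x t) (y t) (z t)) (fun t => tilty k phi tau (dx t) (dy t) (dz t))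
    (fun t => tiltz k phi tau (x t) (y t) (z t)) (fun t => tiltz k phi tau (dx t) (dy t) (dz t)).
Proof.
move=> hk hc.
exact: (curve_swap (curve_rot tau hk (curve_swap (curve_rot phi hk hc)))).
Qed.

Lemma setup_tilt (R : realType) (k phi tau a b : R) E (x dx y dy z dz : R -> R) U A :
  curv k -> setup k a b E x dx y dy z dz U A ->
  setup k a b E
    (fun t => tiltx k phi (x t) (z t)) (fun t => tiltx k phi (dx t) (dz t))
    (fun t => tilty k phi tau (x t) (y t) (z t)) (fun t => tilty k phi tau (dx t) (dy t) (dz t))
    (fun t => tiltz k phi tau (x t) (y t) (z t)) (fun t => tiltz k phi tau (dx t) (dy t) (dz t))
    (tiltU k phi tau U) A.
Proof.
move=> hk hc.
exact: (setup_swap (setup_rot tau hk (setup_swap (setup_rot phi hk hc)))).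
Qed.

Lemma tilt_length (R : realType) (k phi tau a b : R) E (x dx y dy z dz : R -> R) :
  curv k -> curve k a b E x dx y dy z dz ->
  prim a (speed k (fun t => tiltx k phi (dx t) (dz t))
    (fun t => tilty k phi tau (dx t) (dy t) (dz t))
    (fun t => tiltz k phi tau (dx t) (dy t) (dz t))) b = prim a (speed k dx dy dz) b.
Proof.
move=> hk hc; rewrite -(rot_length phi hk hc) -[RHS]swap_length.
rewrite -(rot_length tau hk (curve_swap (curve_rot phi hk hc))).
by rewrite -[RHS]swap_length.
Qed.

Lemma within_ext_cst (R : realType) (a b K : R) (f : R -> R) : a < b ->
  {within `[a, b], continuous f} -> (forall t, a < t < b -> f t = K) ->
  forall t, a <= t <= b -> f t = K.
Proof.
move=> ab /(continuous_within_itvP _ ab)[_ ca cb] H t /andP[].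
rewrite le_eqVlt => /predU1P[<- _|at_].
  have : f x @[x --> a^'+] --> K.
    apply: cvg_near_cst; near=> s.
    have sa : a < s by near: s; exact: nbhs_right_gt.
    have sb : s < b by near: s; exact: nbhs_right_lt.
    by apply: H; rewrite sa.
  by move=> h; exact: (cvg_unique _ ca h).
rewrite le_eqVlt => /predU1P[->|tb]; last by apply: H; rewrite at_.
have : f x @[x --> b^'-] --> K.
  apply: cvg_near_cst; near=> s.
  have sa : a < s by near: s; exact: nbhs_left_gt.
  have sb : s < b by near: s; exact: nbhs_left_lt.
  by apply: H; rewrite sa.
by move=> h; exact: (cvg_unique _ cb h).
Unshelve. all: by end_near.
Qed.

Lemma metric_ge0 (R : realType) (k x y z dx dy dz : R) : curv k -> md k x y z ->
  k * (x * dx + y * dy) + z * dz = 0 -> 0 <= dx ^+ 2 + dy ^+ 2 + k * dz ^+ 2.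
Proof.
move=> hk hm ht; have [k1|kn] := eqVneq k 1.
  by rewrite k1 mul1r !addr_ge0 ?sqr_ge0.
have q0 : 0 < 1 - k * y ^+ 2.
  case: hk kn => [|[|]] ->; rewrite ?eqxx// => _; last by rewrite mul0r subr0.
  by have := sqr_ge0 y; clear; lra.
by rewrite -(pmulr_rge0 _ q0) (metric_split hk hm ht) addr_ge0 ?sqr_ge0.
Qed.

Lemma sum_sqr_eq0 (R : realType) (u v : R) : u ^+ 2 + v ^+ 2 = 0 -> u = 0 /\ v = 0.
Proof.
move=> h; have hu := sqr_ge0 u; have hv := sqr_ge0 v.
by split; apply/eqP; rewrite -sqrf_eq0 eq_le; apply/andP; split => //; move: h hu hv; clear; lra.
Qed.

(** For k = -1 the ambient form is indefinite, but it is definite on tangent vectors: Lagrange's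
    identity for (x, y) and (dx, dy) expresses dz^2 + (x dy - y dx)^2 by quantities that vanish. *)
Lemma metric_eq0 (R : realType) (k x y z dx dy dz : R) : curv k -> md k x y z ->
  k * (x * dx + y * dy) + z * dz = 0 -> dx ^+ 2 + dy ^+ 2 + k * dz ^+ 2 = 0 ->
  [/\ dx = 0, dy = 0 & dz = 0].
Proof.
move=> hk [hm hz] ht h; have dz0 : dz = 0.
  case: hk hm hz ht h => [|[|]] ->.
  - move=> hm _ ht h.
    have : dz ^+ 2 + (x * dy - y * dx) ^+ 2 = 0.
      transitivity ((x ^+ 2 + y ^+ 2) * (dx ^+ 2 + dy ^+ 2 + -1 * dz ^+ 2) +
        ((-1 * (x ^+ 2 + y ^+ 2) + z ^+ 2 - 1) * -1 * dz ^+ 2) +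
        (-1 * (x * dx + y * dy) + z * dz) * (x * dx + y * dy + z * dz)); first by ring.
      by rewrite hm ht h subrr !mul0r mulr0 !addr0.
    by move/sum_sqr_eq0=> [].
  - move=> _ hz; rewrite !mul0r add0r => /eqP; rewrite mulf_eq0 gt_eqF//=.
      by move/eqP.
    by apply: hz; rewrite eq_sym oner_eq0.
  - move=> _ _ _; rewrite mul1r => h; have h1 := sqr_ge0 dx; have h2 := sqr_ge0 dy.
    have h3 := sqr_ge0 dz; apply/eqP; rewrite -sqrf_eq0 eq_le h3 andbT.
    by move: h h1 h2; clear; lra.
by move: h; rewrite dz0 expr0n mulr0 addr0 => /sum_sqr_eq0[-> ->].
Qed.

Lemma sqr_speed (R : realType) (k a b : R) E (x dx y dy z dz : R -> R) :
  curv k -> curve k a b E x dx y dy z dz -> forall t, a < t < b -> t \notin E ->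
  speed k dx dy dz t ^+ 2 = dx t ^+ 2 + dy t ^+ 2 + k * dz t ^+ 2.
Proof.
move=> hk hc t tab tE; rewrite sqr_sqrtr//.
have tab' : a <= t <= b by case/andP: tab => /ltW-> /ltW->.
have [_ _ _ _ H] := hc.
exact: metric_ge0 hk (H t tab') (curve_tangent hc tab tE).
Qed.

(* An injective curve has nonzero speed on a dense set of parameters. *)
Lemma eq_off_singular (R : realType) (k a b K : R) E (x dx y dy z dz f : R -> R) :
  curv k -> curve k a b E x dx y dy z dz ->
  (forall s t, a <= s < b -> a <= t < b ->
    x s = x t -> y s = y t -> z s = z t -> s = t) ->
  {within `[a, b], continuous f} ->
  (forall t, a < t < b -> t \notin E -> speed k dx dy dz t != 0 -> f t = K) ->
  forall t, a <= t <= b -> f t = K.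
Proof.
move=> hk hc inj cf H; have [ab px py pz hmd] := hc.
apply: (within_ext_cst ab cf) => t tab; apply/eqP/negPn/negP => fK.
have : \forall s \near t, a < s < b /\ f s != K.
  have h1 := near_itv_notin (E := [::]) tab isT.
  have h2 : \forall s \near t, f s != K.
    have /cvgrPdist_lt /(_ `|f t - K|) := within_interior cf tab.
    rewrite normr_gt0 subr_eq0 => /(_ fK); apply: filterS => s; rewrite ltNge => h.
    by apply: contra h => /eqP->.
  by near=> s; split; [apply: (proj1 (near h1 s _))|near: s].
move=> /nbhs_ballP[d /= d0 Hd].
have d2 : t < t + d / 2 by rewrite ltrDl divr_gt0.
have near_ s : t <= s <= t + d / 2 -> a < s < b /\ f s != K.
  move=> /andP[s1 s2]; apply: Hd; rewrite /ball/= distrC ger0_norm ?subr_ge0//.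
  by move: s2 d0; clear; lra.
have [/andP[t1 t2] _] : a < t + d / 2 < b /\ f (t + d / 2) != K.
  by apply: near_; rewrite lexx ltW.
have /andP[t3 t4] := tab.
have zero u : t < u < t + d / 2 -> u \notin E -> [/\ dx u = 0, dy u = 0 & dz u = 0].
  move=> hu uE; have hu' : t <= u <= t + d / 2 by case/andP: hu => /ltW-> /ltW->.
  have [uab fu] := near_ u hu'; have uab' : a <= u <= b by case/andP: uab => /ltW-> /ltW->.
  apply: (metric_eq0 hk (hmd u uab') (curve_tangent hc uab uE)).
  rewrite -(sqr_speed hk hc uab uE).
  apply/eqP; rewrite sqrf_eq0; apply/negPn/negP => sp.
  by move/eqP: fu; apply; exact: H.
(* Zero speed makes the curve constant on [t, t + d / 2], against injectivity. *)
have : t = t + d / 2.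
  apply: inj; rewrite ?t1 ?t2 ?(ltW t3) ?t4 ?(ltW t1)//; apply/esym.
  - by apply: (pwd_const px (ltW t3) (ltW d2) (ltW t2)) => u hu /(zero u hu)[].
  - by apply: (pwd_const py (ltW t3) (ltW d2) (ltW t2)) => u hu /(zero u hu)[].
  - by apply: (pwd_const pz (ltW t3) (ltW d2) (ltW t2)) => u hu /(zero u hu)[].
by move=> h; move: d2; rewrite -h ltxx.
Unshelve. all: by end_near.
Qed.

(** * The centre of the curve from many axes *)

Lemma pigeonhole3 (S : 'I_17 -> bool * bool * bool) :
  exists i j l, [/\ i != j, j != l, l != i, S i = S j & S j = S l].
Proof.
(* Otherwise each of the eight values is taken at most twice, which accounts for 16 indices only. *)
have [s hs] : exists s, (2 < #|[set i | S i == s]%SET|)%N.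
  apply/existsP; rewrite -[X in is_true X]negbK negb_exists; apply/negP => /forallP H.
  have : (\sum_(i < 17) 1 <= \sum_(s : bool * bool * bool) 2)%N.
    rewrite (partition_big S xpredT)//=; apply: leq_sum => s _.
    by rewrite sum1dep_card; have := H s; rewrite -leqNgt.
  by rewrite !sum_nat_const !card_prod !card_bool card_ord.
have /card_gt2P[i [j [l [[hi hj hl] [ij jl li]]]]] := hs.
exists i, j, l; move: hi hj hl; rewrite !inE => /eqP-> /eqP-> /eqP->; split => //.
Qed.

Lemma snk_neq0 (R : realType) (k u : R) : curv k -> u != 0 -> `|u| <= 1 -> snk k u != 0.
Proof.
move=> hk u0 u1; apply: contra u0 => /eqP h; have p2 := pi_ge2 R.
have K v : `|v| <= 1 -> arsnk k (snk k v) = v.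
  move=> hv; apply: snkK => // _; rewrite -ler_norml; apply: le_trans hv _.
  by rewrite ler_pdivlMr// mul1r.
by have := K 0; rewrite normr0 snk0 => z; rewrite -(K u u1) h z.
Qed.

Lemma tilty_comb (R : realType) (k phi tau p q x y z x' y' z' : R) :
  tilty k phi tau (p * x + q * x') (p * y + q * y') (p * z + q * z') =
  p * tilty k phi tau x y z + q * tilty k phi tau x' y' z'.
Proof. by rewrite /tilty /tilt1; ring. Qed.

(** As a function of p, [tilty k p tau x y z] is a combination of 1, [csk k p] and [snk k p]. The
    determinant [Del] of these functions at three parameters factors into 4 k and the generalized
    sines of the half differences, which do not vanish for distinct parameters in [0, 1]. *)
Lemma tilty_independent (R : realType) (k tau p1 p2 p3 x y z : R) : curv k -> k != 0 ->
  snk k tau != 0 -> csk k tau != 0 ->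
  0 <= p1 <= 1 -> 0 <= p2 <= 1 -> 0 <= p3 <= 1 -> p1 != p2 -> p2 != p3 -> p3 != p1 ->
  tilty k p1 tau x y z = 0 -> tilty k p2 tau x y z = 0 -> tilty k p3 tau x y z = 0 ->
  [/\ x = 0, y = 0 & z = 0].
Proof.
move=> hk kn ts tc /andP[a1 b1] /andP[a2 b2] /andP[a3 b3] n12 n23 n31 e1 e2 e3.
pose S p := snk k p; pose C p := csk k p.
pose D := S p1 * C p2 - S p2 * C p1.
have sB u v : snk k (u - v) = snk k u * csk k v - csk k u * snk k v.
  by rewrite snkD// snkN// cskN// mulrN.
have small (u v : R) : 0 <= u -> u <= 1 -> 0 <= v -> v <= 1 -> `|u - v| <= 1.
  by move=> u0 u1 v0 v1; rewrite ler_norml; apply/andP; split; move: u0 u1 v0 v1; clear; lra.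
have half (u v : R) : 0 <= u -> u <= 1 -> 0 <= v -> v <= 1 -> u != v ->
    snk k ((u - v) / 2) != 0.
  move=> u0 u1 v0 v1 uv; apply: snk_neq0 => //; first by rewrite mulf_neq0 ?subr_eq0.
  by rewrite normrM normfV (ger0_norm (ler0n _ 2)) ler_pdivrMr// mul1r;
    apply: le_trans (small _ _ u0 u1 v0 v1) _; rewrite ler1n.
have D0 : D != 0.
  have : snk k (p1 - p2) != 0 by apply: snk_neq0; rewrite ?subr_eq0// small.
  by rewrite sB /D /S /C [X in _ - X]mulrC.
pose Del := (S p2 * C p3 - S p3 * C p2) + (S p3 * C p1 - S p1 * C p3) + D.
have DelE : Del = 4 * k * snk k ((p1 - p2) / 2) * snk k ((p2 - p3) / 2) * snk k ((p1 - p3) / 2).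
  have -> : Del = snk k (p1 - p2) + snk k (p2 - p3) - snk k (p1 - p3).
    by rewrite !sB /Del /D /S /C; ring.
  pose u := (p1 - p2) / 2; pose v := (p2 - p3) / 2.
  have -> : (p1 - p3) / 2 = u + v by rewrite /u /v; field.
  rewrite -/u -/v.
  have -> : p1 - p2 = u + u by rewrite /u; field.
  have -> : p2 - p3 = v + v by rewrite /v; field.
  have -> : p1 - p3 = (u + u) + (v + v) by rewrite /u /v; field.
  rewrite [snk k (u + u + _)]snkD// !snkD// !cskD//.
  have hu := csk2snk2 u hk; have hv := csk2snk2 v hk.
  move: hu hv; set su := snk k u; set cu := csk k u; set sv := snk k v; set cv := csk k v.
  move=> hu hv.
  transitivity (2 * (su * cu) * (1 - cv ^+ 2 + k * sv ^+ 2) +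
    2 * (sv * cv) * (1 - cu ^+ 2 + k * su ^+ 2)); first by ring.
  transitivity (2 * (su * cu) * (cv ^+ 2 + k * sv ^+ 2 - cv ^+ 2 + k * sv ^+ 2) +
    2 * (sv * cv) * (cu ^+ 2 + k * su ^+ 2 - cu ^+ 2 + k * su ^+ 2)); first by rewrite hu hv.
  by ring.
have Del0 : Del != 0.
  by rewrite DelE !mulf_neq0 ?half// ?pnatr_eq0// eq_sym.
pose al := k * x * snk k tau; pose be := y * csk k tau; pose ga := z * snk k tau.
have E p : tilty k p tau x y z = be - (ga * C p + al * S p).
  by rewrite /tilty /tilt1 /be /ga /al /C /S; ring.
rewrite !E in e1 e2 e3.
have b0 : be = 0.
  apply: (mulIf Del0); rewrite mul0r.
  transitivity ((be - (ga * C p1 + al * S p1)) * (S p2 * C p3 - S p3 * C p2)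
   + (be - (ga * C p2 + al * S p2)) * (S p3 * C p1 - S p1 * C p3)
   + (be - (ga * C p3 + al * S p3)) * (S p1 * C p2 - S p2 * C p1)).
    by rewrite /Del /D; ring.
  by rewrite e1 e2 e3 !mul0r !addr0.
have l0 : al = 0.
  apply: (mulIf D0); rewrite mul0r.
  transitivity (- (be - (ga * C p1 + al * S p1)) * C p2 + (be - (ga * C p2 + al * S p2)) * C p1
    + be * (C p2 - C p1)); first by rewrite /D; ring.
  by rewrite e1 e2 b0 oppr0 !mul0r !addr0.
have g0 : ga = 0.
  apply: (mulIf D0); rewrite mul0r.
  transitivity ((be - (ga * C p1 + al * S p1)) * S p2 - (be - (ga * C p2 + al * S p2)) * S p1
    + be * (S p1 - S p2)); first by rewrite /D; ring.
  by rewrite e1 e2 b0 !mul0r subrr addr0.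
split; apply/eqP.
- by move/eqP: l0; rewrite /al !mulf_eq0 (negbTE kn) (negbTE ts) orbF.
- by move/eqP: b0; rewrite /be mulf_eq0 (negbTE tc) orbF.
- by move/eqP: g0; rewrite /ga mulf_eq0 (negbTE ts) orbF.
Qed.

Definition good_axis (R : realType) (k a b : R) (y : R -> R) (U : R -> R -> R -> Prop) : Prop :=
  (k = 1 -> ~ U 0 1 0 /\ ~ U 0 (-1) 0) /\ forall t, a <= t <= b -> 0 < 1 - k * y t ^+ 2.

(** z x' - x z' is the y-component of the generalized cross product of g and g', and this vector is
    tilted together with the curve. *)
Lemma tilt_wind (R : realType) (k phi tau x y z dx dy dz : R) : curv k ->
  tiltz k phi tau x y z * tiltx k phi dx dz - tiltx k phi x z * tiltz k phi tau dx dy dz =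
  tilty k phi tau (y * dz - z * dy) (z * dx - x * dz) (k * (x * dy - y * dx)).
Proof.
move=> hk; rewrite /tilty /tiltz /tiltx /tilt1; have h := csk2snk2 phi hk.
transitivity ((z * dx - x * dz) * csk k tau * (csk k phi ^+ 2 + k * snk k phi ^+ 2) +
  k * snk k tau * (csk k phi * (y * dx - x * dy) + snk k phi * (z * dy - y * dz))); first by ring.
by rewrite h; ring.
Qed.

Lemma rot_quad (R : realType) (k tau x z : R) : curv k -> k != 0 ->
  (x * csk k tau - z * snk k tau) ^+ 2 + k * (z * csk k tau + k * (x * snk k tau)) ^+ 2 =
  x ^+ 2 + k * z ^+ 2.
Proof.
move=> hk kn; have h := csk2snk2 tau hk.
have k2 : k ^+ 2 = 1 by case: hk kn => [|[|]] ->; rewrite ?eqxx// ?sqrrN expr1n.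
transitivity ((x ^+ 2 + k * z ^+ 2) * (csk k tau ^+ 2 + k * snk k tau ^+ 2)
  + (k ^+ 2 - 1) * (2 * (x * z * csk k tau * snk k tau) + (k * x ^+ 2 - z ^+ 2) * snk k tau ^+ 2)).
  by ring.
by rewrite h k2 subrr mul0r addr0 mulr1.
Qed.

Lemma tilt_speed (R : realType) (k phi tau : R) (dx dy dz : R -> R) (t : R) :
  curv k -> k != 0 ->
  speed k (fun t => tiltx k phi (dx t) (dz t)) (fun t => tilty k phi tau (dx t) (dy t) (dz t))
    (fun t => tiltz k phi tau (dx t) (dy t) (dz t)) t = speed k dx dy dz t.
Proof.
move=> hk kn; rewrite /speed; congr Num.sqrt.
rewrite -addrA (rot_quad tau (dy t) (tilt1 k phi (dx t) (dz t)) hk kn).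
by rewrite addrCA (rot_quad phi (dx t) (dz t) hk kn); ring.
Qed.

(** For the axis tilted by phi, equality in [axis_ineq] says that c g + r n or c g - r n has the
    coordinate e(phi) along it, where n is the unit normal. The sign may depend on phi and on t; the
    task is to find one point that is selected at every regular parameter. *)
Lemma center_exists (R : realType) (k tau a b : R) E (x dx y dy z dz : R -> R) U A :
  curv k -> k != 0 -> setup k a b E x dx y dy z dz U A ->
  snk k tau != 0 -> csk k tau != 0 ->
  (forall phi, good_axis k a b (fun t => tilty k phi tau (x t) (y t) (z t)) (tiltU k phi tau U)) ->
  prim a (speed k dx dy dz) b ^+ 2 = 4 * pi * A - k * A ^+ 2 ->
  exists c r o1 o2 o3,
    [/\ c = 1 - k * A / (2 * pi), r = Num.sqrt (A * (4 * pi - k * A)) / (2 * pi),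
      0 < c, 0 < r & c ^+ 2 + k * r ^+ 2 = 1] /\
    (k * (o1 ^+ 2 + o2 ^+ 2) + o3 ^+ 2 = 1 /\
    forall t, a < t < b -> t \notin E -> speed k dx dy dz t != 0 ->
      k * (x t * o1 + y t * o2) + z t * o3 = c).
Proof.
move=> hk kn hs ts tc Hgood Leq; have hc := setup_curve hs.
have k2 : k ^+ 2 = 1 by case: hk kn => [|[|]] ->; rewrite ?eqxx// ?sqrrN expr1n.
pose sp := speed k dx dy dz.
pose Y phi t := tilty k phi tau (x t) (y t) (z t).
pose nx t := y t * dz t - z t * dy t.
pose ny t := z t * dx t - x t * dz t.
pose nz t := k * (x t * dy t - y t * dx t).
set c := 1 - k * A / (2 * pi); set r := Num.sqrt (A * (4 * pi - k * A)) / (2 * pi).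
have ax phi : exists e, [/\ 0 < c, 0 < r, c ^+ 2 + k * r ^+ 2 = 1 &
    forall t, a < t < b -> t \notin E ->
      r ^+ 2 * tilty k phi tau (nx t) (ny t) (nz t) ^+ 2 = (c * Y phi t - e) ^+ 2 * sp t ^+ 2].
  have [hc' hU' hA' A0 [_ ycl _] _] := setup_tilt phi tau hk hs.
  have [hp hy] := Hgood phi.
  have [_] := axis_ineq hk hc' hU' hp hy hA' A0 ycl.
  rewrite (tilt_length phi tau hk hc) => /(_ Leq)[c' [r' [e [-> -> h1 [h2 h3] h4]]]].
  exists e; split => // t tab tE; have := h4 t tab tE.
  by rewrite tilt_wind// tilt_speed.
have [_ [c0 r0 cr _]] := ax 0.
have /choice[e He] : forall phi, exists e, forall t, a < t < b -> t \notin E ->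
      r ^+ 2 * tilty k phi tau (nx t) (ny t) (nz t) ^+ 2 = (c * Y phi t - e) ^+ 2 * sp t ^+ 2.
  by move=> phi; have [e [_ _ _ h]] := ax phi; exists e.
pose reg t := [/\ a < t < b, t \notin E & sp t != 0].
pose sg (s : bool) : R := if s then 1 else -1.
have sg2 s : sg s ^+ 2 = 1 by case: s; rewrite /sg ?sqrrN expr1n.
(* (nx, ny, nz) is the unit normal multiplied by the speed, hence the division by [sp t]. *)
pose q s t : R := sg s * (r / sp t).
pose ox s t := c * x t + q s t * nx t.
pose oy s t := c * y t + q s t * ny t.
pose oz s t := c * z t + q s t * nz t.
have Hs phi t : reg t -> exists s, tilty k phi tau (ox s t) (oy s t) (oz s t) = e phi.
  move=> [tab tE spn]; have h := He phi t tab tE.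
  set T := tilty k phi tau (nx t) (ny t) (nz t) in h.
  have val s : tilty k phi tau (ox s t) (oy s t) (oz s t) = c * Y phi t + q s t * T.
    by rewrite /ox /oy /oz tilty_comb.
  have : (c * Y phi t - e phi - r / sp t * T) * (c * Y phi t - e phi + r / sp t * T) = 0.
    rewrite -subr_sqr exprMn expr_div_n; apply/eqP; rewrite subr_eq0; apply/eqP.
    apply: (mulIf (expf_neq0 2 spn)); rewrite -h; field; exact: spn.
  move/eqP; rewrite mulf_eq0 => /orP[] /eqP h'.
    exists false; rewrite val /q /sg mulN1r mulNr.
    by move: h'; set w := _ * T; clear; lra.
  by exists true; rewrite val /q /sg mul1r; move: h'; set w := _ * T; clear; lra.
have merge t1 t2 t3 : reg t1 -> reg t2 -> reg t3 -> exists s1 s2 s3,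
    [/\ ox s1 t1 = ox s2 t2, oy s1 t1 = oy s2 t2 & oz s1 t1 = oz s2 t2] /\
    [/\ ox s1 t1 = ox s3 t3, oy s1 t1 = oy s3 t3 & oz s1 t1 = oz s3 t3].
  move=> h1 h2 h3; pose ph (i : 'I_17) : R := i%:R / 17.
  have ph01 i : 0 <= ph i <= 1.
    rewrite divr_ge0//= ler_pdivrMr ?ltr0n// mul1r ler_nat ltnW//.
  have phinj i j : i != j -> ph i != ph j.
    apply: contra => /eqP h; apply/eqP/val_inj/eqP; rewrite -(eqr_nat R); apply/eqP.
    by apply: (mulIf (_ : (17 : R)^-1 != 0)) => //; rewrite invr_eq0 pnatr_eq0.
  have /choice[S1 HS1] : forall i, exists s, tilty k (ph i) tau (ox s t1) (oy s t1) (oz s t1) = e (ph i).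
    by move=> i; exact: Hs.
  have /choice[S2 HS2] : forall i, exists s, tilty k (ph i) tau (ox s t2) (oy s t2) (oz s t2) = e (ph i).
    by move=> i; exact: Hs.
  have /choice[S3 HS3] : forall i, exists s, tilty k (ph i) tau (ox s t3) (oy s t3) (oz s t3) = e (ph i).
    by move=> i; exact: Hs.
  have [i [j [l [ij jl li]]]] := pigeonhole3 (fun i => (S1 i, S2 i, S3 i)).
  move=> [e1 e2 e3] [e4 e5 e6].
  exists (S1 i), (S2 i), (S3 i).
  have zero s s' u v : (forall m, m = i \/ m = j \/ m = l ->
      tilty k (ph m) tau (ox s u) (oy s u) (oz s u) = e (ph m) /\
      tilty k (ph m) tau (ox s' v) (oy s' v) (oz s' v) = e (ph m)) ->
      [/\ ox s u = ox s' v, oy s u = oy s' v & oz s u = oz s' v].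
    move=> H.
    have D m : m = i \/ m = j \/ m = l -> tilty k (ph m) tau (1 * ox s u + -1 * ox s' v)
        (1 * oy s u + -1 * oy s' v) (1 * oz s u + -1 * oz s' v) = 0.
      by move=> /H[g1 g2]; rewrite tilty_comb g1 g2 mul1r mulN1r subrr.
    have := tilty_independent hk kn ts tc (ph01 i) (ph01 j) (ph01 l)
      (phinj _ _ ij) (phinj _ _ jl) (phinj _ _ li) (D i (or_introl erefl))
      (D j (or_intror (or_introl erefl))) (D l (or_intror (or_intror erefl))).
    rewrite !mul1r !mulN1r => -[/eqP g1 /eqP g2 /eqP g3]; move: g1 g2 g3.
    by rewrite !subr_eq0 => /eqP -> /eqP -> /eqP ->.
  split; apply: zero => m [->|[->|->]]; split => //.
  - by rewrite e1.
  - by rewrite e2.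
  - by rewrite e1 e4.
  - by rewrite e2 e5.
  - by rewrite e1.
  - by rewrite e3.
  - by rewrite e1 e4.
  - by rewrite e3 e6.
have sq2 s t : reg t -> q s t ^+ 2 * sp t ^+ 2 = r ^+ 2.
  move=> [_ _ spn]; rewrite /q exprMn sg2 mul1r expr_div_n divfK//.
  by rewrite expf_neq0.
have nn t : a < t < b -> t \notin E -> k * (nx t ^+ 2 + ny t ^+ 2) + nz t ^+ 2 = k * sp t ^+ 2.
  move=> tab tE; have tab' : a <= t <= b by case/andP: tab => /ltW-> /ltW->.
  rewrite (sqr_speed hk hc tab tE).
  have [_ _ _ _ /(_ t tab')[h1 _]] := hc; have ht := curve_tangent hc tab tE.
  transitivity (k * ((k * (x t ^+ 2 + y t ^+ 2) + z t ^+ 2) * (dx t ^+ 2 + dy t ^+ 2 + k * dz t ^+ 2)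
    - k * (k * (x t * dx t + y t * dy t) + z t * dz t) ^+ 2)).
    by case: hk kn => [|[|]] kE; rewrite kE ?eqxx// => _; rewrite /nx /ny /nz kE; ring.
  by rewrite h1 ht expr0n mulr0 subr0 mul1r.
have tang t : k * (x t * nx t + y t * ny t) + z t * nz t = 0 by rewrite /nx /ny /nz; ring.
pose O t s := [/\ k * (ox s t ^+ 2 + oy s t ^+ 2) + oz s t ^+ 2 = 1 &
  k * (x t * ox s t + y t * oy s t) + z t * oz s t = c].
have HO t s : reg t -> O t s.
  move=> ht; have [tab tE spn] := ht; have tab' : a <= t <= b by case/andP: tab => /ltW-> /ltW->.
  have [_ _ _ _ /(_ t tab')[h1 _]] := hc; split.
    transitivity (c ^+ 2 * (k * (x t ^+ 2 + y t ^+ 2) + z t ^+ 2)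
      + 2 * c * q s t * (k * (x t * nx t + y t * ny t) + z t * nz t)
      + q s t ^+ 2 * (k * (nx t ^+ 2 + ny t ^+ 2) + nz t ^+ 2)).
      by rewrite /ox /oy /oz; ring.
    by rewrite h1 tang nn// mulr1 mulr0 addr0 mulrCA sq2.
  transitivity (c * (k * (x t ^+ 2 + y t ^+ 2) + z t ^+ 2)
    + q s t * (k * (x t * nx t + y t * ny t) + z t * nz t)).
    by rewrite /ox /oy /oz; ring.
  by rewrite h1 tang mulr1 mulr0 addr0.
(* Without a regular parameter the last claim is empty, and any point of the quadric will do. *)
have [[t1 h1]|N] := pselect (exists t, reg t); last first.
  exists c, r, 0, 0, 1; split; first by split.
  split; first by rewrite expr0n/= expr1n addr0 mulr0 add0r.
  by move=> t tab tE spn; exfalso; apply: N; exists t.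
(* Otherwise each of the two signs at t1 fails at some parameter, t2 for one and t3 for the other,
   and [merge] for t1, t2, t3 contradicts one of these failures. *)
have [s Hsame] : exists s, forall t, reg t -> exists s',
    [/\ ox s t1 = ox s' t, oy s t1 = oy s' t & oz s t1 = oz s' t].
  apply: contrapT => N.
  have H s : exists t, reg t /\ forall s', ~ [/\ ox s t1 = ox s' t, oy s t1 = oy s' t & oz s t1 = oz s' t].
    apply: contrapT => N'; apply: N; exists s => t ht; apply: contrapT => N2.
    by apply: N'; exists t; split => // s' h; apply: N2; exists s'.
  have [t2 [h2 n2]] := H true; have [t3 [h3 n3]] := H false.
  have [[] [s2 [s3 [g2 g3]]]] := merge t1 t2 t3 h1 h2 h3; [exact: n2 g2|exact: n3 g3].
exists c, r, (ox s t1), (oy s t1), (oz s t1); split; first by split.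
split; first by have [] := HO t1 s h1.
move=> t tab tE spn; have ht : reg t by split.
have [s' [-> -> ->]] := Hsame t ht.
by have [] := HO t s' ht.
Qed.

Lemma sin_le (R : realType) (s : R) : 0 <= s -> sin s <= s.
Proof.
move=> s0; rewrite -subr_ge0.
have := @mono_off R [::] (fun s => s - sin s) (fun s => 1 - cos s) 0 s s0.
rewrite sin0 subr0; apply.
  by apply: within_of_continuous => t; apply: (@continuousB _ _ _ id (@sin R));
    [by move=> ?; exact: cvg_id|exact: continuous_sin].
move=> t _ _; split; first exact: is_deriveB.
by rewrite subr_ge0 cos_le1.
Qed.

(** On the sphere the new pole is joined to the old one by an arc of length tau on which y^2 = cos^2
    > 1 - m, while y^2 <= 1 - m on the curve. So the arc misses the curve, and the new pole lies
    outside [U] like the old one. One tau serves for all phi. *)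
Lemma tilt_good (R : realType) (k a b : R) E (x dx y dy z dz : R -> R) U A :
  curv k -> k != 0 -> setup k a b E x dx y dy z dz U A -> good_axis k a b y U ->
  exists tau, [/\ snk k tau != 0, csk k tau != 0 & forall phi,
    good_axis k a b (fun t => tilty k phi tau (x t) (y t) (z t)) (tiltU k phi tau U)].
Proof.
move=> hk kn hs [hp hy]; have [hc hU _ _ _ _] := hs; have [ab px py pz hmd] := hc.
have [k1|kn1] := eqVneq k 1; last first.
  have km : k = -1 by case: hk kn kn1 => [|[|]] ->; rewrite ?eqxx.
  exists 1; split.
  - by apply: snk_neq0; rewrite ?oner_eq0 ?normr1.
  - apply/eqP => h; have := csk2snk2 1 hk; rewrite h km expr0n add0r => h'.
    by have := sqr_ge0 (snk (-1) (1 : R)); move: h'; set w := _ ^+ 2; lra.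
  - move=> phi; split; first by move=> k1; move: kn1; rewrite k1 eqxx.
    by move=> t _; rewrite km; have := sqr_ge0 (tilty (-1) phi 1 (x t) (y t) (z t)); lra.
have [m m0 hm] : exists2 m, 0 < m <= 1 & forall t, a <= t <= b -> m <= 1 - y t ^+ 2.
  have cf : {within `[a, b], continuous (fun t => 1 + -1 * (y t * y t))}.
    by apply: withinD; [exact: within_cst|apply: withinM;
      [exact: within_cst|apply: withinM; exact: pwd_continuous py]].
  have [c [d [hc1 _ H]]] := within_range (ltW ab) cf.
  exists (1 - y c ^+ 2).
    by have := hy c hc1; rewrite k1 mul1r => ->/=; rewrite gerBl sqr_ge0.
  by move=> t /H /andP[+ _]; rewrite !mulN1r -!expr2.
have /andP[m0' m1] := m0.
(* As m <= 1, this gives tau^2 < m, and sin s <= s carries the bound over to the whole arc. *)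
pose tau := m / 2; have t0 : 0 < tau by rewrite divr_gt0.
have t1 : tau <= 1 by rewrite ler_pdivrMr// mul1r (le_trans m1)// ler1n.
have tm : tau ^+ 2 < m.
  rewrite /tau; have -> : (m / 2) ^+ 2 = m * (m / 4) by field.
  by rewrite -[ltRHS]mulr1 ltr_pM2l// ltr_pdivrMr// mul1r (le_lt_trans m1)// ltr1n.
have ss s : 0 <= s <= tau -> sin s ^+ 2 < m.
  move=> /andP[s0 st]; apply: le_lt_trans tm; rewrite ler_pXn2r ?nnegrE//.
  - by apply: le_trans st; exact: sin_le.
  - apply: sin_ge0_pi; rewrite s0 (le_trans st)// (le_trans t1)//.
    by apply: le_trans (pi_ge2 R); rewrite ler1n.
  - exact: ltW.
have cs s : 0 <= s <= tau -> forall t, a <= t <= b -> cos s ^+ 2 != y t ^+ 2.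
  move=> hss t /hm; have := ss s hss; have := cos2Dsin2 s => h h1 h2; apply/eqP => h3.
  by move: h; rewrite h3; move: h1 h2; clear; lra.
have tt : 0 <= tau <= tau by rewrite lexx ltW.
exists tau; split.
- by apply: snk_neq0; rewrite ?gt_eqF ?gtr0_norm.
- rewrite k1 /csk eqxx; apply/eqP => h; have := cos2Dsin2 tau; rewrite h expr0n add0r => h'.
  by have := ss tau tt; rewrite h'; move: m1; clear; lra.
move=> phi; split=> [_|t tab]; last first.
  have [_ _ _ _ /(_ t tab)[h1 _]] := curve_tilt phi tau hk hc.
  rewrite k1 mul1r in h1; rewrite k1 mul1r.
  rewrite lt_neqAle; apply/andP; split; last first.
    move: h1; set X := tiltx _ _ _ _; set Y := tilty _ _ _ _ _ _; set Z := tiltz _ _ _ _ _ _.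
    by move=> h1; have := sqr_ge0 X; have := sqr_ge0 Z; move: h1; clear; lra.
  apply/eqP => h2.
  have /sum_sqr_eq0[_ hz] : tiltx 1 phi (x t) (z t) ^+ 2 + tiltz 1 phi tau (x t) (y t) (z t) ^+ 2 = 0.
    by move: h1 h2; clear; lra.
  have [+ _] := rot_inverse tau (y t) (tilt1 k phi (x t) (z t)) hk.
  rewrite -/(tilty k phi tau (x t) (y t) (z t)) -/(tiltz k phi tau (x t) (y t) (z t)).
  rewrite k1 hz mul0r addr0 => hyt; have /negP := cs tau tt t tab; apply.
  rewrite -hyt exprMn /csk eqxx.
  have -> : tilty 1 phi tau (x t) (y t) (z t) ^+ 2 = 1 by move: h2; clear; lra.
  by rewrite mul1r.
have key (sg : R) : sg ^+ 2 = 1 -> ~ U 0 sg 0 -> ~ tiltU k phi tau U 0 sg 0.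
  move=> sg2 nU; rewrite /tiltU/= => hU1; apply: nU.
  have [_ U2 U3 _] := hU.
  have cM (p : R) (f : R -> R) : continuous f -> continuous (fun s => p * f s).
    move=> cf s; apply: (@continuousM _ _ (fun _ => p) f); [exact: cst_continuous|exact: cf].
  have := U3 (fun s => (k * sg * snk k phi) * snk k s) (fun s => sg * csk k s)
    (fun s => (k * sg * csk k phi) * snk k s) (- tau) 0.
  rewrite snk0 csk0 !mulr0 mulr1; apply => //.
  - by apply: cM; exact: continuous_snk.
  - by apply: cM; exact: continuous_csk.
  - by apply: cM; exact: continuous_snk.
  - by rewrite oppr_le0 ltW.
  - move=> s /andP[s1 s2].
    have hss : 0 <= - s <= tau by rewrite oppr_ge0 s2 lerNl.
    split; last first.
      move=> t tab [_ h _]; have /negP := cs _ hss t tab; apply.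
      by rewrite -h exprMn sg2 mul1r k1 /csk eqxx cosN.
    split; last by rewrite k1 eqxx.
    have h1 := csk2snk2 phi hk; have h2 := csk2snk2 s hk.
    rewrite k1 in h1 h2 *; rewrite !mul1r in h1 h2 *.
    transitivity (sg ^+ 2 * (snk 1 s ^+ 2 * (csk 1 phi ^+ 2 + snk 1 phi ^+ 2) + csk 1 s ^+ 2)).
      by ring.
    by rewrite h1 sg2 mulr1 mul1r addrC.
  - move: hU1; rewrite snkN// cskN//.
    rewrite (_ : 0 * csk k phi + _ = k * sg * snk k phi * - snk k tau); last by ring.
    rewrite (_ : sg * csk k tau + _ = sg * csk k tau); last by ring.
    by rewrite (_ : _ * csk k phi - _ = k * sg * csk k phi * - snk k tau)//; ring.
have [n1 n2] := hp k1.
by split; apply: key => //; rewrite ?sqrrN expr1n.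
Qed.

Lemma equality_circle (R : realType) (k a b : R) E (x dx y dy z dz : R -> R) U A :
  curv k -> setup k a b E x dx y dy z dz U A -> good_axis k a b y U ->
  prim a (speed k dx dy dz) b ^+ 2 = 4 * pi * A - k * A ^+ 2 ->
  exists c r o1 o2 o3,
    [/\ c = 1 - k * A / (2 * pi), r = Num.sqrt (A * (4 * pi - k * A)) / (2 * pi),
      0 < c, 0 < r & c ^+ 2 + k * r ^+ 2 = 1] /\
    (md k o1 o2 o3 /\ forall t, a <= t <= b ->
      (x t - o1) ^+ 2 + (y t - o2) ^+ 2 + k * (z t - o3) ^+ 2 = 2 * r ^+ 2 / (1 + c)).
Proof.
move=> hk hs hg Leq; have [hc hU hA A0 [xcl ycl _] inj] := hs; have [ab px py pz hmd] := hc.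
have cx := pwd_continuous px; have cy := pwd_continuous py; have cz := pwd_continuous pz.
have [k0|kn] := eqVneq k 0.
  have [hp hy] := hg.
  (* The axes y and x give r^2 x'^2 = (y - e)^2 |g'|^2 and r^2 y'^2 = (x - e')^2 |g'|^2; their sum
     is the equation of the circle wherever the speed is nonzero. *)
  have [hc' hU' hA' _ _ _] := setup_swap hs.
  have hy' t : a <= t <= b -> 0 < 1 - k * x t ^+ 2 by rewrite k0 mul0r subr0.
  have hp' : k = 1 -> ~ U 1 0 0 /\ ~ U (-1) 0 0 by rewrite k0 => /eqP; rewrite eq_sym oner_eq0.
  have [_ /(_ Leq)[c [r [e [cE rE c0 [r0 cr] H1]]]]] := axis_ineq hk hc hU hp hy hA A0 ycl.
  have [_] := axis_ineq hk hc' hU' hp' hy' hA' A0 xcl.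
  rewrite swap_length => /(_ Leq)[c' [r' [e' [cE' rE' _ _ H2]]]].
  rewrite -cE -rE in cE' rE'; rewrite cE' rE' in H2.
  have c1 : c = 1 by rewrite cE k0 !mul0r subr0.
  have z1 t : a <= t <= b -> z t = 1.
    move=> /hmd[h1 h2]; rewrite k0 mul0r add0r in h1; rewrite k0 in h2.
    apply/eqP; rewrite -(@eqrXn2 _ 2) ?expr1n ?h1//; apply: ltW; apply: h2.
    by rewrite eq_sym oner_eq0.
  exists c, r, e', e, 1; split; first by split.
  split; first by split; [rewrite k0 mul0r add0r expr1n|].
  have -> : 2 * r ^+ 2 / (1 + c) = r ^+ 2 by rewrite c1; field.
  apply: (eq_off_singular (f := fun t => (x t - e') ^+ 2 + (y t - e) ^+ 2 + k * (z t - 1) ^+ 2) hk hc inj).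
    have cB (f : R -> R) (p : R) : {within `[a, b], continuous f} ->
        {within `[a, b], continuous (fun t => (f t - p) * (f t - p))}.
      by move=> cf; apply: withinM; apply: withinD => //; exact: within_cst.
    by apply: withinD; [apply: withinD; exact: cB|apply: withinM; [exact: within_cst|exact: cB]].
  move=> t tab tE spn; have tab' : a <= t <= b by case/andP: tab => /ltW-> /ltW->.
  have dz0 : dz t = 0.
    by have := curve_tangent hc tab tE; rewrite k0 mul0r add0r z1// mul1r.
  have sp2 := sqr_speed hk hc tab tE.
  have := H1 t tab tE; have := H2 t tab tE.
  have -> : speed k dy dx dz t = speed k dx dy dz t by rewrite /speed [dy t ^+ 2 + _]addrC.
  rewrite z1// dz0 !mulr0 !subr0 !mul1r c1 !mul1r => g1 g2.
  apply: (mulIf (expf_neq0 2 spn)).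
  rewrite subrr expr0n/= mulr0 addr0 mulrDl -g1 -g2 sp2 dz0; ring.
have k2 : k ^+ 2 = 1 by case: hk kn => [|[|]] ->; rewrite ?eqxx// ?sqrrN expr1n.
have [tau [ts tc Hg]] := tilt_good hk kn hs hg.
have [c [r [p1 [p2 [p3 [[cE rE c0 r0 cr] [ho H]]]]]]] := center_exists hk kn hs ts tc Hg Leq.
have {}H : forall t, a <= t <= b -> k * (x t * p1 + y t * p2) + z t * p3 = c.
  apply: (eq_off_singular (f := fun t => k * (x t * p1 + y t * p2) + z t * p3) hk hc inj) => //.
  by apply: withinD; [apply: withinM; [exact: within_cst|apply: withinD]|];
    try apply: withinM => //; exact: within_cst.
exists c, r, p1, p2, p3; split; first by split.
split.
  (* A centre on the lower sheet would have a negative product with the points of the curve, by the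
     reversed Cauchy-Schwarz inequality, whereas this product is c > 0. *)
  split => // kn1; have km : k = -1 by case: (hk) kn kn1 => [|[|]] ->; rewrite ?eqxx.
  have aab : a <= a <= b by rewrite lexx ltW.
  have [h1 /(_ kn1) h2] := hmd a aab; have h3 := H a aab.
  rewrite ltNge; apply/negP => o30.
  move: h1 h2 h3 ho; rewrite km; move: (x a) (y a) (z a) => X Y Z h1 h2 h3 ho.
  have e1 : X * p1 + Y * p2 = Z * p3 - c by move: h3; clear; lra.
  have e2 : (X ^+ 2 + Y ^+ 2) * (p1 ^+ 2 + p2 ^+ 2) = (Z ^+ 2 - 1) * (p3 ^+ 2 - 1).
    have -> : X ^+ 2 + Y ^+ 2 = Z ^+ 2 - 1 by move: h1; clear; lra.
    by have -> : p1 ^+ 2 + p2 ^+ 2 = p3 ^+ 2 - 1 by move: ho; clear; lra.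
  have e3 : (X * p1 + Y * p2) ^+ 2 <= (Z ^+ 2 - 1) * (p3 ^+ 2 - 1).
    rewrite -e2 -subr_ge0.
    by rewrite (_ : _ - _ = (X * p2 - Y * p1) ^+ 2) ?sqr_ge0//; ring.
  rewrite e1 in e3.
  have e4 : 0 <= Z * - p3 by rewrite mulr_ge0 ?oppr_ge0// ltW.
  have e5 : 0 <= c * (Z * - p3) by rewrite mulr_ge0// ltW.
  have e6 : 1 <= Z ^+ 2 by have := sqr_ge0 X; have := sqr_ge0 Y; move: h1; clear; lra.
  have e7 : 0 < c ^+ 2 by rewrite exprn_gt0.
  have e8 : 1 <= p3 ^+ 2 by have := sqr_ge0 p1; have := sqr_ge0 p2; move: ho; clear; lra.
  have : (Z * p3 - c) ^+ 2 = Z ^+ 2 * p3 ^+ 2 + 2 * (c * (Z * - p3)) + c ^+ 2 by ring.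
  move=> e9; move: e3; rewrite e9.
  have -> : (Z ^+ 2 - 1) * (p3 ^+ 2 - 1) = Z ^+ 2 * p3 ^+ 2 - Z ^+ 2 - p3 ^+ 2 + 1 by ring.
  by move: e5 e6 e7 e8; set w := Z ^+ 2 * p3 ^+ 2; clear; lra.
move=> t tab; have [h1 _] := hmd t tab; have h2 := H t tab.
transitivity (k * ((k * (x t ^+ 2 + y t ^+ 2) + z t ^+ 2) + (k * (p1 ^+ 2 + p2 ^+ 2) + p3 ^+ 2)
   - 2 * (k * (x t * p1 + y t * p2) + z t * p3))).
  by case: hk kn => [|[|]] ->; rewrite ?eqxx// => _; ring.
rewrite h1 ho h2; have c1 : 1 + c != 0 by rewrite lt0r_neq0// addr_gt0.
apply: (mulIf c1); rewrite divfK//.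
transitivity (2 * (k * (1 - c ^+ 2))); first by ring.
have -> : 1 - c ^+ 2 = k * r ^+ 2 by rewrite -cr; ring.
by transitivity (2 * (k ^+ 2 * r ^+ 2)); [ring|rewrite k2 mul1r].
Qed.

(** * Length and distance *)

Lemma snk_gt0 (R : realType) (k u : R) : curv k -> 0 < u -> (k = 1 -> u < pi) -> 0 < snk k u.
Proof.
move=> [|[|]] -> u0 hu; rewrite /snk !curvE//.
  by rewrite /sinh divr_gt0// subr_gt0 ltr_expR; move: u0; clear; lra.
by apply: sin_gt0_pi; rewrite u0 hu.
Qed.

Lemma csk_pos (R : realType) (k u : R) : curv k -> (k = 1 -> `|u| < pi / 2) -> 0 < csk k u.
Proof.
move=> [|[|]] -> hu; rewrite /csk !curvE//.
  by rewrite divr_gt0// addr_gt0// expR_gt0.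
by apply: cos_gt0_pihalf; rewrite -ltr_norml hu.
Qed.

(** With m the midpoint and h half the difference, the increment is 2 [csk k m] [snk k h] by the
    addition formula. *)
Lemma snk_lt (R : realType) (k u v : R) : curv k -> 0 <= u -> u < v -> (k = 1 -> v <= pi / 2) ->
  snk k u < snk k v.
Proof.
move=> hk u0 uv hv; pose m := (u + v) / 2; pose h := (v - u) / 2.
have -> : v = m + h by rewrite /m /h; field.
have -> : u = m - h by rewrite /m /h; field.
rewrite !snkD// snkN// cskN//.
have h0 : 0 < snk k h.
  apply: snk_gt0 => //; first by rewrite divr_gt0// subr_gt0.
  by move=> /hv; rewrite /h; move: (pi : R) (pi_gt0 R) u0; clear => p; lra.
have c0 : 0 < csk k m.
  apply: csk_pos => // /hv; rewrite ltr_norml /m; move: (pi : R) (pi_gt0 R) u0 uv.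
  by clear => p p0 u0 uv vp; apply/andP; split; lra.
have w := mulr_gt0 c0 h0; rewrite mulrN ltrD2l; apply: lt_trans w.
by rewrite oppr_lt0 mulr_gt0.
Qed.

(** For k <> 0 the difference of the two sides is a Gram determinant, the square of the triple
    product of the point, the vector and n; for k = 0 it is the square in Lagrange's identity. *)
Lemma gram_ge0 (R : realType) (k x y z dx dy dz n1 n2 n3 : R) : curv k -> md k x y z ->
  k * (x * dx + y * dy) + z * dz = 0 -> n1 ^+ 2 + n2 ^+ 2 + k * n3 ^+ 2 = 1 ->
  (n1 * dx + n2 * dy + k * (n3 * dz)) ^+ 2 <=
  (1 - k * (n1 * x + n2 * y + k * (n3 * z)) ^+ 2) * (dx ^+ 2 + dy ^+ 2 + k * dz ^+ 2).
Proof.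
move=> hk [hm _] ht hn; rewrite -subr_ge0.
have [k0|kn] := eqVneq k 0.
  move: hn; rewrite k0 !mul0r !addr0 subr0 mul1r => hn.
  rewrite (_ : _ - _ = (n1 * dy - n2 * dx) ^+ 2) ?sqr_ge0//.
  transitivity ((n1 ^+ 2 + n2 ^+ 2) * (dx ^+ 2 + dy ^+ 2) - (n1 * dx + n2 * dy) ^+ 2).
    by rewrite hn mul1r.
  by ring.
rewrite (_ : _ - _ = (x * (dy * n3 - dz * n2) + y * (dz * n1 - dx * n3)
  + z * (dx * n2 - dy * n1)) ^+ 2) ?sqr_ge0//.
set s := dx ^+ 2 + dy ^+ 2 + k * dz ^+ 2; set w := n1 * dx + n2 * dy + k * (n3 * dz).
set Y := n1 * x + n2 * y + k * (n3 * z).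
set N := n1 ^+ 2 + n2 ^+ 2 + k * n3 ^+ 2 in hn; set M := k * (x ^+ 2 + y ^+ 2) + z ^+ 2 in hm.
set T := k * (x * dx + y * dy) + z * dz in ht.
transitivity (M * N * s - M * w ^+ 2 - k * Y ^+ 2 * s - k * T ^+ 2 * N + 2 * T * Y * w).
  by rewrite hn hm ht; ring.
by rewrite /M /N /s /w /Y /T; case: hk kn => [|[|]] ->; rewrite ?eqxx// => _; ring.
Qed.

(** Project the curve on the unit direction n of its chord. The projection Y runs from - S to S, and
    by [gram_ge0] the function [arsnk k] of it moves no faster than the curve. Since 1 - k Y^2 may
    vanish, Y is first shrunk by a factor th < 1. *)
Lemma arc_dist (R : realType) (k a b rho : R) E (x dx y dy z dz : R -> R) :
  curv k -> curve k a b E x dx y dy z dz -> 0 <= rho -> (k = 1 -> rho <= pi) ->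
  (x b - x a) ^+ 2 + (y b - y a) ^+ 2 + k * (z b - z a) ^+ 2 = 4 * snk k (rho / 2) ^+ 2 ->
  rho <= prim a (speed k dx dy dz) b.
Proof.
move=> hk hc rho0 rhopi hD; have [ab px py pz hmd] := hc.
set L := prim a _ b.
have pL : pwd a b E (prim a (speed k dx dy dz)) (speed k dx dy dz).
  by apply: pwd_prim; [exact: ltW|exact: pwc_speed hc].
have L0 : 0 <= L.
  have := pwd_le (pwd_cst a b E 0) pL (lexx a) (ltW ab) (lexx b).
  by rewrite prim_self !subr0 => H; apply: H => u _ _; exact: sqrtr_ge0.
rewrite leNgt; apply/negP => Lrho.
(* If L < rho, take L' in between and shrink the chord to that of an arc of length L'; the
   comparison then gives L' <= L. *)
pose L' := (L + rho) / 2.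
have LL' : L < L' by rewrite /L'; move: Lrho; clear; lra.
have L'rho : L' < rho by rewrite /L'; move: Lrho; clear; lra.
have r2 : k = 1 -> rho / 2 <= pi / 2 by move=> /rhopi; rewrite ler_pM2r.
have L'0 : 0 < L' by exact: le_lt_trans LL'.
pose S := snk k (rho / 2).
have S0 : 0 < S.
  have := @snk_lt _ k 0 (rho / 2) hk (lexx 0); rewrite snk0; apply => //.
  by rewrite divr_gt0// (lt_trans L'0).
have S' : snk k (L' / 2) < S 
  by apply: snk_lt => //; [rewrite divr_ge0// ltW|rewrite ltr_pM2r// invr_gt0].
have S'0 : 0 < snk k (L' / 2).
  have := @snk_lt _ k 0 (L' / 2) hk (lexx 0); rewrite snk0; apply => //.
    by rewrite divr_gt0.
  by move=> k1; apply: le_trans (r2 k1); rewrite ler_pM2r// ltW.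
pose th := snk k (L' / 2) / S; have Sn := lt0r_neq0 S0.
have thS : th * S = snk k (L' / 2) by rewrite /th divfK.
have th0 : 0 <= th by rewrite divr_ge0// ltW.
have th1 : th ^+ 2 < 1.
  by rewrite expr_lt1// /th ltr_pdivrMr// mul1r.
pose n1 := (x b - x a) / (2 * S); pose n2 := (y b - y a) / (2 * S); pose n3 := (z b - z a) / (2 * S).
have hn : n1 ^+ 2 + n2 ^+ 2 + k * n3 ^+ 2 = 1.
  transitivity (((x b - x a) ^+ 2 + (y b - y a) ^+ 2 + k * (z b - z a) ^+ 2) / (4 * S ^+ 2)).
    by rewrite /n1 /n2 /n3; field.
  by rewrite hD divff// mulf_neq0 ?pnatr_eq0// expf_neq0.
pose G t := n1 * x t + n2 * y t + k * (n3 * z t).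
(* For k <> 0 the end points have opposite projections, since n is orthogonal to their sum; for k =
   0 the mean has to be subtracted. *)
pose m := (G a + G b) / 2.
have aab : a <= a <= b by rewrite lexx ltW.
have bab : a <= b <= b by rewrite lexx ltW.
have Gba : G b - G a = 2 * S.
  transitivity (((x b - x a) ^+ 2 + (y b - y a) ^+ 2 + k * (z b - z a) ^+ 2) / (2 * S)).
    by rewrite /G /n1 /n2 /n3; field.
  by rewrite hD -/S; field.
have km : k * m = 0.
  have [k0|kn] := eqVneq k 0; first by rewrite k0 mul0r.
  have k2 : k ^+ 2 = 1 by case: hk kn => [|[|]] ->; rewrite ?eqxx// ?sqrrN expr1n.
  have [h1 _] := hmd a aab; have [h2 _] := hmd b bab.
  transitivity (((k * (x b ^+ 2 + y b ^+ 2) + z b ^+ 2) - (k * (x a ^+ 2 + y a ^+ 2) + z a ^+ 2)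
     + (k ^+ 2 - 1) * (z b ^+ 2 - z a ^+ 2)) / (4 * S)).
    by rewrite /m /G /n1 /n2 /n3; field.
  by rewrite h1 h2 k2 !subrr mul0r addr0 mul0r.
pose Y t := G t - m.
have kY t : k * Y t ^+ 2 = k * G t ^+ 2.
  transitivity (k * G t ^+ 2 - 2 * G t * (k * m) + (k * m) * m); first by rewrite /Y; ring.
  by rewrite km mulr0 mul0r subr0 addr0.
have Yb : th * Y b = snk k (L' / 2).
  by rewrite -thS; congr (_ * _); rewrite /Y /m; move: Gba; clear; lra.
have Ya : th * Y a = snk k (- (L' / 2)).
  by rewrite snkN// -thS -mulrN; congr (_ * _); rewrite /Y /m; move: Gba; clear; lra.
have Y1 t : a <= t <= b -> 0 <= 1 - k * Y t ^+ 2.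
  rewrite kY => /hmd[h1 _]; case: (hk) => [kE|[kE|kE]].
  - by rewrite kE; have := sqr_ge0 (G t); clear; lra.
  - by rewrite kE mul0r subr0.
  - move: h1 hn; rewrite /G kE !mul1r => h1 hn.
    rewrite (_ : _ - _ = (n1 * y t - n2 * x t) ^+ 2 + (n2 * z t - n3 * y t) ^+ 2 +
      (n3 * x t - n1 * z t) ^+ 2); first by rewrite !addr_ge0 ?sqr_ge0.
    transitivity ((n1 ^+ 2 + n2 ^+ 2 + n3 ^+ 2) * (x t ^+ 2 + y t ^+ 2 + z t ^+ 2)
      - (n1 * x t + n2 * y t + n3 * z t) ^+ 2); first by rewrite hn h1 mulr1.
    by ring.
have Yth t : a <= t <= b -> 0 < 1 - k * (th * Y t) ^+ 2.
  move=> /Y1 h; case: (hk) => [kE|[kE|kE]].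
  - by rewrite kE; have := sqr_ge0 (th * Y t); clear; lra.
  - by rewrite kE mul0r subr0.
  - rewrite kE mul1r exprMn; move: h; rewrite kE mul1r subr_ge0 => h.
    by rewrite subr_gt0; apply: le_lt_trans th1; rewrite -[leRHS]mulr1 ler_wpM2l// sqr_ge0.
pose dG t := n1 * dx t + n2 * dy t + k * (n3 * dz t).
have pY : pwd a b E (fun t => th * Y t) (fun t => th * dG t).
  apply: pwdZ; have pG : pwd a b E G dG.
    by apply: pwdD; [apply: pwdD; exact: pwdZ|apply: pwdZ; exact: pwdZ].
  by have := pwdB pG (pwd_cst a b E m); apply: pwd_ext => t; rewrite subr0.
have pF : pwd a b E (arsnk k \o (fun t => th * Y t))
    (fun t => (Num.sqrt (1 - k * (th * Y t) ^+ 2))^-1 * (th * dG t)).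
  apply: (@pwd_comp _ _ _ _ _ _ _ (fun v => (Num.sqrt (1 - k * v ^+ 2))^-1) pY) => t /Yth h.
  split; first exact: is_derive_arsnk.
  apply: continuousV.
    by rewrite gt_eqF// sqrtr_gt0.
  apply: (@continuous_comp R R R (fun y => 1 - k * y ^+ 2) (@Num.sqrt R)).
    exact: continuous_one_sub.
  exact: sqrt_continuous.
have := pwd_norm_le pF pL (lexx a) (ltW ab) (lexx b).
rewrite prim_self subr0 -/L /= Yb Ya.
have p2 : k = 1 -> L' / 2 <= pi / 2.
  by move=> k1; apply: le_trans (r2 k1); rewrite ler_pM2r// ltW.
have pp := pi_ge0 R.
have l2 : 0 <= L' / 2 by rewrite divr_ge0// ltW.
have g2 : 0 <= pi / 2 :> R by rewrite divr_ge0.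
rewrite !snkK//; last 2 first.
- by move=> k1; rewrite lerNl opprK p2//= (le_trans _ g2)// oppr_le0.
- by move=> k1; rewrite p2// andbT (le_trans _ l2)// oppr_le0.
rewrite opprK -splitr gtr0_norm// => H.
have : L' <= L; last by rewrite leNgt LL'.
apply: H => t tab tE.
have tab' : a <= t <= b by case/andP: tab => /ltW-> /ltW->.
have h := Yth t tab'; have gr := gram_ge0 hk (hmd t tab') (curve_tangent hc tab tE) hn.
have sp := sqr_speed hk hc tab tE; rewrite -sp -/(dG t) -/(G t) -kY in gr.
rewrite normrM normfV (ger0_norm (sqrtr_ge0 _)) mulrC ler_pdivrMr ?sqrtr_gt0//.
rewrite -(@ler_pXn2r _ 2)// ?nnegrE ?mulr_ge0 ?sqrtr_ge0//.
rewrite real_normK ?num_real// [(th * dG t) ^+ 2]exprMn [(speed k dx dy dz t * _) ^+ 2]exprMn.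
rewrite (sqr_sqrtr (ltW h)).
apply: (@le_trans _ _ (th ^+ 2 * ((1 - k * Y t ^+ 2) * speed k dx dy dz t ^+ 2))).
  by rewrite ler_wpM2l ?sqr_ge0.
rewrite mulrA [leRHS]mulrC ler_wpM2r ?sqr_ge0//.
rewrite (_ : th ^+ 2 * _ = th ^+ 2 - k * (th * Y t) ^+ 2); first by rewrite lerD2r; exact: ltW.
by ring.
Qed.

(** * The sphere *)

Definition dot (R : realType) (x y z : R -> R) (s t : R) : R := x s * x t + y s * y t + z s * z t.

Lemma dotC (R : realType) (x y z : R -> R) (s t : R) : dot x y z s t = dot x y z t s.
Proof. by rewrite /dot [x s * _]mulrC [y s * _]mulrC [z s * _]mulrC. Qed.

Lemma sum3_sqr_eq0 (R : realType) (u v w : R) : u ^+ 2 + v ^+ 2 + w ^+ 2 <= 0 ->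
  [/\ u = 0, v = 0 & w = 0].
Proof.
move=> h; have hu := sqr_ge0 u; have hv := sqr_ge0 v; have hw := sqr_ge0 w.
by split; apply/eqP; rewrite -sqrf_eq0 eq_le; apply/andP; split => //;
  move: h hu hv hw; clear; lra.
Qed.

Lemma cos_acos_le (R : realType) (u w : R) : -1 <= u <= 1 -> 0 <= w <= pi ->
  cos w <= u -> acos u <= w.
Proof.
move=> u1 w1 h; rewrite leNgt; apply/negP => lt.
have := acos_ge0 u1; have := acos_lepi u1 => h1 h2.
have K : cos (acos u) = u by rewrite acosK// in_itv.
have := lt; rewrite -ltr_cos ?in_itv/= ?h1 ?h2// K.
by rewrite ltNge h.
Qed.

(** The last hypothesis says that the Gram determinant of three unit vectors with inner products u,
    v, w is nonnegative. *)
Lemma acos_triangle (R : realType) (u v w : R) : -1 <= u <= 1 -> -1 <= v <= 1 -> -1 <= w <= 1 ->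
  0 <= 1 - u ^+ 2 - v ^+ 2 - w ^+ 2 + 2 * u * v * w -> acos w <= acos u + acos v.
Proof.
move=> u1 v1 w1 h.
have a0 := acos_ge0 u1; have b0 := acos_ge0 v1.
have Ku : cos (acos u) = u by rewrite acosK// in_itv.
have Kv : cos (acos v) = v by rewrite acosK// in_itv.
have [pl|lp] := leP pi (acos u + acos v); first by apply: le_trans pl; exact: acos_lepi.
apply: cos_acos_le => //; first by rewrite addr_ge0//= ltW.
rewrite cosD Ku Kv !sin_acos// lerBlDr -lerBlDl.
have [//|/ltW l0] := leP (u * v - w) 0.
  by move/le_trans; apply; rewrite mulr_ge0 ?sqrtr_ge0.
have hu : 0 <= 1 - u ^+ 2 by rewrite subr_ge0 -real_normK ?num_real// expr_le1// ler_norml.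
have hv : 0 <= 1 - v ^+ 2 by rewrite subr_ge0 -real_normK ?num_real// expr_le1// ler_norml.
rewrite -(@ler_pXn2r _ 2)// ?nnegrE ?mulr_ge0 ?sqrtr_ge0// exprMn !sqr_sqrtr//.
rewrite -subr_ge0; apply: le_trans h _.
by rewrite [X in _ <= X](_ : _ = 1 - u ^+ 2 - v ^+ 2 - w ^+ 2 + 2 * u * v * w)//; ring.
Qed.

Lemma acos_sum_ge0 (R : realType) (u v : R) : -1 <= u <= 1 -> -1 <= v <= 1 ->
  acos u + acos v <= pi -> 0 <= u + v /\ (acos u + acos v < pi -> 0 < u + v).
Proof.
move=> u1 v1 h; have a0 := acos_ge0 u1; have b0 := acos_ge0 v1.
have a1 := acos_lepi u1; have b1 := acos_lepi v1.
have Ku : cos (acos u) = u by rewrite acosK// in_itv.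
have Kv : cos (pi - acos v) = - v.
  by rewrite addrC cosDpi cosN acosK// in_itv.
have i1 : acos u \in `[0, pi] by rewrite in_itv/= a0.
have i2 : pi - acos v \in `[0, pi] by rewrite in_itv/= subr_ge0 b1 gerBl.
split=> [|h'].
  rewrite -[v]opprK subr_ge0 -Ku -Kv leNgt ltr_cos// -leNgt.
  by move: h; move: (acos u) (acos v) (pi : R) => p q w; lra.
rewrite -[v]opprK subr_gt0 -Ku -Kv ltr_cos//.
by move: h'; move: (acos u) (acos v) (pi : R) => p q w; lra.
Qed.

(** Since [cos] decreases, u is at least cos (pi / 2 - acos v) = sqrt (1 - v^2). *)
Lemma acos_sum_half (R : realType) (u v : R) : -1 <= u <= 1 -> -1 <= v <= 1 ->
  acos u + acos v <= pi / 2 -> [/\ 0 <= u, 0 <= v & 1 <= u ^+ 2 + v ^+ 2].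
Proof.
move=> u1 v1 h; have a0 := acos_ge0 u1; have b0 := acos_ge0 v1.
have a1 := acos_lepi u1; have b1 := acos_lepi v1.
have pp := pi_gt0 R.
have key (p q : R) : 0 <= acos p -> 0 <= acos q -> acos p <= pi -> acos q <= pi ->
    -1 <= p <= 1 -> -1 <= q <= 1 -> acos p + acos q <= pi / 2 ->
    0 <= p /\ Num.sqrt (1 - q ^+ 2) <= p.
  move=> h1 h2 h3 h4 p1 q1 h5.
  have Kp : cos (acos p) = p by rewrite acosK// in_itv.
  have Kq : cos (pi / 2 - acos q) = Num.sqrt (1 - q ^+ 2).
    by rewrite cosB cos_pihalf sin_pihalf mul0r add0r mul1r sin_acos.
  have i1 : acos p \in `[0, pi] by rewrite in_itv/= h1.
  have i2 : pi / 2 - acos q \in `[0, pi].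
    rewrite in_itv/=; apply/andP; move: h1 h2 h5 pp.
    by move: (acos p) (acos q) (pi : R) => A B w; split; lra.
  have s : Num.sqrt (1 - q ^+ 2) <= p.
    rewrite -Kp -Kq leNgt ltr_cos// -leNgt.
    by move: h5; move: (acos p) (acos q) (pi : R) => A B w; lra.
  by split => //; apply: le_trans s; exact: sqrtr_ge0.
have [p1 p2] := key u v a0 b0 a1 b1 u1 v1 h.
have [p3 _] : 0 <= v /\ Num.sqrt (1 - u ^+ 2) <= v by apply: key => //; rewrite addrC.
split => //.
have hv : 0 <= 1 - v ^+ 2 by rewrite subr_ge0 -real_normK ?num_real// expr_le1// ler_norml.
have : Num.sqrt (1 - v ^+ 2) ^+ 2 <= u ^+ 2 by rewrite ler_pXn2r ?nnegrE ?sqrtr_ge0.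
by rewrite sqr_sqrtr// lerBlDr.
Qed.

(** The residual x - (u e + v f) has squared norm at most 1 - u^2 - v^2, because e.f <= 0 and u, v
    >= 0. With [acos_sum_half] this places a point whose distances to e and f add up to at most pi /
    2 in their plane. *)
Lemma in_span (R : realType) (e1 e2 e3 f1 f2 f3 x1 x2 x3 : R) :
  e1 ^+ 2 + e2 ^+ 2 + e3 ^+ 2 = 1 -> f1 ^+ 2 + f2 ^+ 2 + f3 ^+ 2 = 1 ->
  x1 ^+ 2 + x2 ^+ 2 + x3 ^+ 2 = 1 -> e1 * f1 + e2 * f2 + e3 * f3 <= 0 ->
  let u := e1 * x1 + e2 * x2 + e3 * x3 in let v := f1 * x1 + f2 * x2 + f3 * x3 in
  0 <= u -> 0 <= v -> 1 <= u ^+ 2 + v ^+ 2 ->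
  [/\ x1 = u * e1 + v * f1, x2 = u * e2 + v * f2 & x3 = u * e3 + v * f3].
Proof.
move=> he hf hx hef u v u0 v0 uv.
have : (x1 - (u * e1 + v * f1)) ^+ 2 + (x2 - (u * e2 + v * f2)) ^+ 2 +
    (x3 - (u * e3 + v * f3)) ^+ 2 <= 0.
  rewrite [leLHS](_ : _ = (x1 ^+ 2 + x2 ^+ 2 + x3 ^+ 2) - 2 * u ^+ 2 - 2 * v ^+ 2
    + u ^+ 2 * (e1 ^+ 2 + e2 ^+ 2 + e3 ^+ 2) + v ^+ 2 * (f1 ^+ 2 + f2 ^+ 2 + f3 ^+ 2)
    + 2 * (u * v * (e1 * f1 + e2 * f2 + e3 * f3))); last by rewrite /u /v; ring.
  rewrite he hf hx; have : u * v * (e1 * f1 + e2 * f2 + e3 * f3) <= 0.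
    by rewrite mulr_ge0_le0// mulr_ge0.
  by move: uv; clearbody u v; clear; lra.
move=> /sum3_sqr_eq0[/eqP + /eqP + /eqP]; rewrite !subr_eq0.
by move=> /eqP-> /eqP-> /eqP->.
Qed.

Lemma prim_split (R : realType) (a b s t : R) E (v : R -> R) : a <= s -> s <= t -> t <= b ->
  pwc a b E v -> prim s v t = prim a v t - prim a v s.
Proof.
move=> as_ st tb pv; have ab := le_trans as_ (le_trans st tb).
have p1 := pwd_prim ab pv.
have p1' := pwd_sub as_ tb p1.
have p2 : pwd s t E (prim s v) v by apply: pwd_prim => //; have [_ _] := p1'.
have := pwd_const (pwdB p2 p1') (lexx s) st (lexx t).
rewrite prim_self sub0r => H; have := H (fun _ _ _ => subrr _).
by move/eqP; rewrite subr_eq addrC => /eqP.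
Qed.

Lemma md1 (R : realType) (x y z : R) : md 1 x y z -> x ^+ 2 + y ^+ 2 + z ^+ 2 = 1.
Proof. by move=> [+ _]; rewrite mul1r. Qed.

Lemma sph_dot1 (R : realType) (x y z x' y' z' : R) : md 1 x y z -> md 1 x' y' z' ->
  -1 <= x * x' + y * y' + z * z' <= 1.
Proof.
move=> /md1 h /md1 h'; rewrite -ler_norml -(@ler_pXn2r _ 2)// ?nnegrE//.
rewrite real_normK ?num_real// expr1n -subr_ge0.
rewrite (_ : _ - _ = (x * y' - y * x') ^+ 2 + (y * z' - z * y') ^+ 2 + (z * x' - x * z') ^+ 2).
  by rewrite !addr_ge0 ?sqr_ge0.
transitivity ((x ^+ 2 + y ^+ 2 + z ^+ 2) * (x' ^+ 2 + y' ^+ 2 + z' ^+ 2) -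
  (x * x' + y * y' + z * z') ^+ 2); first by rewrite h h' mulr1.
by ring.
Qed.

Record loop (R : realType) (a b : R) E (x dx y dy z dz : R -> R) : Prop := Loop {
  loop_curve : curve 1 a b E x dx y dy z dz;
  loop_closed : [/\ x a = x b, y a = y b & z a = z b] }.

Lemma sph_arc (R : realType) (a b s t : R) E (x dx y dy z dz : R -> R) :
  curve 1 a b E x dx y dy z dz -> a <= s -> s <= t -> t <= b ->
  acos (dot x y z s t) <= prim a (speed 1 dx dy dz) t - prim a (speed 1 dx dy dz) s.
Proof.
move=> hc as_ st tb; have [ab px py pz hmd] := hc.
have hk : curv (1 : R) by right; right.
have sab : a <= s <= b by rewrite as_ (le_trans st).
have tab : a <= t <= b by rewrite tb (le_trans as_).
have h1 := md1 (hmd s sab); have h2 := md1 (hmd t tab).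
have [<-|nst] := eqVneq s t; first by rewrite subrr /dot -!expr2 h1 acos1.
rewrite -(prim_split as_ st tb (pwc_speed hc)).
have d1 : -1 <= dot x y z s t <= 1 by exact: sph_dot1 (hmd s sab) (hmd t tab).
have hc' : curve 1 s t E x dx y dy z dz.
  split; [by rewrite lt_neqAle nst| exact: pwd_sub px|exact: pwd_sub py|exact: pwd_sub pz|].
  by move=> u /andP[u1 u2]; apply: hmd; rewrite (le_trans as_ u1) (le_trans u2 tb).
apply: (arc_dist hk hc'); [exact: acos_ge0|by move=> _; exact: acos_lepi|].
have e2 : dot x y z s t = csk 1 (acos (dot x y z s t) / 2) ^+ 2 - snk 1 (acos (dot x y z s t) / 2) ^+ 2.
  have := cskD (acos (dot x y z s t) / 2) (acos (dot x y z s t) / 2) hk.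
  by rewrite -splitr mul1r -!expr2 => <-; rewrite /csk eqxx acosK// in_itv.
have := csk2snk2 (acos (dot x y z s t) / 2) hk; rewrite mul1r.
move: e2; set C := csk _ _; set S := snk _ _ => e2 e1.
transitivity (2 - 2 * dot x y z s t); last by move: e1 e2; clear; lra.
rewrite mul1r.
transitivity ((x s ^+ 2 + y s ^+ 2 + z s ^+ 2) + (x t ^+ 2 + y t ^+ 2 + z t ^+ 2)
  - 2 * dot x y z s t); first by rewrite /dot; ring.
by rewrite h1 h2.
Qed.

Lemma sph_triangle (R : realType) (a b s t u : R) E (x dx y dy z dz : R -> R) :
  curve 1 a b E x dx y dy z dz -> a <= s <= b -> a <= t <= b -> a <= u <= b ->
  acos (dot x y z s t) <= acos (dot x y z s u) + acos (dot x y z u t).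
Proof.
move=> [_ _ _ _ hmd] hs ht hu.
apply: acos_triangle; try exact: sph_dot1 (hmd _ _) (hmd _ _).
have h1 := md1 (hmd s hs); have h2 := md1 (hmd t ht); have h3 := md1 (hmd u hu).
rewrite [X in _ <= X](_ : _ = (x s * (y t * z u - z t * y u) + y s * (z t * x u - x t * z u)
  + z s * (x t * y u - y t * x u)) ^+ 2) ?sqr_ge0//.
pose S := x s ^+ 2 + y s ^+ 2 + z s ^+ 2; pose T := x t ^+ 2 + y t ^+ 2 + z t ^+ 2.
pose W := x u ^+ 2 + y u ^+ 2 + z u ^+ 2.
transitivity (S * T * W - T * dot x y z s u ^+ 2 - S * dot x y z u t ^+ 2 - W * dot x y z s t ^+ 2
  + 2 * dot x y z s u * dot x y z u t * dot x y z s t); first by rewrite /S /T /W h1 h2 h3 !mul1r.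
by rewrite /S /T /W /dot; ring.
Qed.

(** The other arc between the two points runs through the base point of the loop; the triangle
    inequality joins its two pieces. *)
Lemma sph_arc_compl (R : realType) (a b s t : R) E (x dx y dy z dz : R -> R) :
  loop a b E x dx y dy z dz -> a <= s -> s <= t -> t <= b ->
  acos (dot x y z s t) <= prim a (speed 1 dx dy dz) b -
    (prim a (speed 1 dx dy dz) t - prim a (speed 1 dx dy dz) s).
Proof.
pose V := prim a (speed 1 dx dy dz); rewrite -/V.
move=> [hc [xab yab zab]] as_ st tb; have [ab _ _ _ hmd] := hc.
have sab : a <= s <= b by rewrite as_ (le_trans st).
have tab : a <= t <= b by rewrite tb (le_trans as_).
have aab : a <= a <= b by rewrite lexx ltW.
apply: le_trans (sph_triangle hc sab tab aab) _.
have h1 := sph_arc hc (lexx a) as_ (le_trans st tb).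
have h2 := sph_arc hc (le_trans as_ st) tb (lexx b).
rewrite prim_self subr0 -/V in h1; rewrite -/V in h2.
have e1 : dot x y z s a = dot x y z a s by rewrite dotC.
have e2 : dot x y z a t = dot x y z t b by rewrite /dot xab yab zab -/(dot x y z b t) dotC.
by rewrite e1 e2; move: h1 h2; clear; lra.
Qed.

(* Four points of a loop of length [2 pi] at mutual distance at least [pi / 2] cut it
   into four minimizing arcs. *)
Lemma four_points (R : realType) (a b s1 s2 s3 s4 : R) E (x dx y dy z dz : R -> R) :
  loop a b E x dx y dy z dz -> prim a (speed 1 dx dy dz) b = 2 * pi ->
  a <= s1 -> s1 <= s2 -> s2 <= s3 -> s3 <= s4 -> s4 <= b ->
  dot x y z s1 s2 <= 0 -> dot x y z s2 s3 <= 0 -> dot x y z s3 s4 <= 0 -> dot x y z s4 s1 <= 0 ->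
  y s1 = 0 -> y s2 = 0 -> y s3 = 0 -> y s4 = 0 ->
  forall u, a <= u <= b -> y u = 0.
Proof.
move=> hl hL a1 s12 s23 s34 b4 d12 d23 d34 d41 y1 y2 y3 y4 u hu.
have [hc _] := hl; have [ab _ _ _ hmd] := hc.
pose V := prim a (speed 1 dx dy dz).
have i1 : a <= s1 <= b by rewrite a1 (le_trans s12)// (le_trans s23)// (le_trans s34).
have i2 : a <= s2 <= b by rewrite (le_trans a1)// (le_trans s23)// (le_trans s34).
have i3 : a <= s3 <= b by rewrite (le_trans a1)// ?(le_trans s12)// (le_trans s34).
have i4 : a <= s4 <= b by rewrite (le_trans a1)// (le_trans s12)// (le_trans s23).
have D s t : a <= s <= b -> a <= t <= b -> -1 <= dot x y z s t <= 1.
  by move=> hs ht; exact: sph_dot1 (hmd _ hs) (hmd _ ht).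
have far s t : a <= s <= b -> a <= t <= b -> dot x y z s t <= 0 -> pi / 2 <= acos (dot x y z s t).
  move=> hs ht h; rewrite leNgt; apply/negP => lt.
  have dd := D s t hs ht; have g1 := acos_ge0 dd.
  have Q : - (pi / 2) < acos (dot x y z s t) < pi / 2.
    by rewrite lt andbT (lt_le_trans _ g1)// oppr_lt0 divr_gt0// pi_gt0.
  by have := cos_gt0_pihalf Q; rewrite acosK ?in_itv// ltNge h.
have v12 := le_trans (far _ _ i1 i2 d12) (sph_arc hc a1 s12 (proj2 (andP i2))).
have v23 := le_trans (far _ _ i2 i3 d23) (sph_arc hc (proj1 (andP i2)) s23 (proj2 (andP i3))).
have v34 := le_trans (far _ _ i3 i4 d34) (sph_arc hc (proj1 (andP i3)) s34 b4).
have s14 : s1 <= s4 by rewrite (le_trans s12)// (le_trans s23).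
have d14 : dot x y z s1 s4 <= 0 by rewrite dotC.
have := le_trans (far _ _ i1 i4 d14) (sph_arc_compl hl a1 s14 b4).
rewrite hL -/V => v41; rewrite -/V in v12 v23 v34.
(* A point at total distance at most pi / 2 from two such points with y = 0 is a linear combination
   of them, so y vanishes there too. *)
have fin s t : a <= s <= b -> a <= t <= b -> dot x y z s t <= 0 -> y s = 0 -> y t = 0 ->
    acos (dot x y z s u) + acos (dot x y z t u) <= pi / 2 -> y u = 0.
  move=> hs ht dst ys yt h.
  have [g1 g2 g3] := acos_sum_half (D s u hs hu) (D t u ht hu) h.
  have h1 := md1 (hmd s hs); have h2 := md1 (hmd t ht); have h3 := md1 (hmd u hu).
    by have [_ -> _] := in_span h1 h2 h3 dst g1 g2 g3; rewrite ys yt !mulr0 addr0.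
have /andP[au ub] := hu.
have seg s t : a <= s <= b -> a <= t <= b -> s <= u <= t -> dot x y z s t <= 0 ->
    y s = 0 -> y t = 0 -> V t - V s <= pi / 2 -> y u = 0.
  move=> hs ht /andP[su ut] dst ys yt h; apply: (fin s t) => //.
  apply: le_trans h; rewrite [dot x y z t u]dotC.
  have := sph_arc hc (proj1 (andP hs)) su ub; have := sph_arc hc au ut (proj2 (andP ht)).
  by rewrite -/V; clear; lra.
have [u1|/ltW u1] := leP u s1.
  apply: (fin s1 s4) => //; rewrite [dot x y z s1 u]dotC [dot x y z s4 u]dotC.
  have := sph_arc hc au u1 (proj2 (andP i1)).
  have := sph_arc_compl hl au (le_trans u1 s14) b4.
  by rewrite hL -/V; move: v12 v23 v34 v41; clear; lra.
have [u2|/ltW u2] := leP u s2.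
  by apply: (seg s1 s2); rewrite ?u1//; move: v12 v23 v34 v41; clear; lra.
have [u3|/ltW u3] := leP u s3.
  by apply: (seg s2 s3); rewrite ?u2//; move: v12 v23 v34 v41; clear; lra.
have [u4|/ltW u4] := leP u s4.
  by apply: (seg s3 s4); rewrite ?u3//; move: v12 v23 v34 v41; clear; lra.
apply: (fin s1 s4) => //.
have := sph_arc hc (proj1 (andP i4)) u4 ub.
have := sph_arc_compl hl a1 (le_trans s14 u4) ub.
by rewrite hL -/V; move: v12 v23 v34 v41; clear; lra.
Qed.

(** * Areas of spherical regions that contain or miss a hemisphere *)

Lemma slice_window (R : realType) (y s : R) U : 0 < 1 - 1 * y ^+ 2 -> ropen 1 U ->
  slice 1 y U = lebesgue_measure (lon 1 y U `&` `]s, s + 2 * pi]%classic).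
Proof.
move=> hy hU; have hk : curv (1 : R) by right; right.
have mE : measurable (lon 1 y U) by exact: measurable_lon.
have per u : lon 1 y U (u + 2 * pi) <-> lon 1 y U u by rewrite lon_2pi.
have p0 : 0 < 2 * pi :> R by rewrite mulr_gt0// pi_gt0.
rewrite (slice_sph hy hU) (periodic_window s p0 mE per).
rewrite -(periodic_window (- (pi / 2)) p0 mE per).
have -> : 3 * (pi / 2) = - (pi / 2) + 2 * pi :> R by move: (pi : R) => p; field.
by [].
Qed.

Lemma measurable_slice_fun (R : realType) (U : R -> R -> R -> Prop) : ropen 1 U ->
  measurable_fun [set: R] ((slice 1 ^~ U) \_ [set y | 0 < 1 - 1 * y ^+ 2]).
Proof. by apply: measurable_slice; right; right. Qed.

Lemma area_slice (R : realType) (U : R -> R -> R -> Prop) : ropen 1 U ->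
  (area 1 (region U) = \int[@lebesgue_measure R]_y
     ((slice 1 ^~ U) \_ [set y | (0 < 1 - 1 * y ^+ 2)%R]) y)%E.
Proof. by move=> hU; rewrite areaE//; [rewrite integral_mkcond|right; right]. Qed.

Definition step (R : realType) (c : R) (B : set R) : R -> \bar R := (fun=> c%:E) \_ B.

Lemma integral_step (R : realType) (c : R) (B : set R) : measurable B ->
  (\int[@lebesgue_measure R]_y step c B y = c%:E * lebesgue_measure B)%E.
Proof. by move=> mB; rewrite -integral_mkcond integral_cst. Qed.

Lemma step_ge0 (R : realType) (c : R) (B : set R) y : 0 <= c -> (0 <= step c B y)%E.
Proof. by move=> c0; apply: erestrict_ge0 => *; rewrite lee_fin. Qed.

Lemma measurable_step (R : realType) (c : R) (B : set R) : measurable B ->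
  measurable_fun setT (step c B).
Proof. by move=> mB; apply/(measurable_restrictT _ mB); exact: measurable_cst. Qed.

Lemma lebesgue_oo (R : realType) (p q : R) : p <= q ->
  lebesgue_measure `]p, q[%classic = (q - p)%:E.
Proof.
move=> pq; rewrite lebesgue_measure_itv/= lte_fin; case: ltP => // h.
by have -> : q = p by [apply/le_anti; rewrite h pq]; rewrite subrr.
Qed.

(** The hemisphere y < 0 has area 2 pi, and the box of height d and longitude width 2 d adds 2 d
    d. *)
Lemma sph_area_lower (R : realType) (U : R -> R -> R -> Prop) (A u0 d : R) :
  ropen 1 U -> area 1 (region U) = A%:E -> 0 < d -> d < 1 ->
  (forall y u, -1 < y < 0 -> lon 1 y U u) ->
  (forall y u, 0 < y < d -> u0 - d < u < u0 + d -> lon 1 y U u) ->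
  2 * pi + 2 * d * d <= A.
Proof.
move=> hU hA d0 d1 low box.
have p3 : 2 < pi *+ 2 :> R by have := pi_ge2 R; rewrite mulr2n; lra.
have pp0 : 0 <= 2 * pi :> R by rewrite mulr_ge0// pi_ge0.
have dd0 : 0 <= 2 * d by rewrite mulr_ge0// ltW.
rewrite -lee_fin -hA area_slice//.
apply: (@le_trans _ _ (\int[lebesgue_measure]_y
  (step (2 * pi)%R `](-1)%R, 0%R[%classic y + step (2 * d)%R `]0%R, d[%classic y)%E)%E).
  rewrite ge0_integralD//=.
  - rewrite !integral_step// (lebesgue_oo (lerN10 R)) (lebesgue_oo (ltW d0)).
    by rewrite -!EFinM -EFinD lee_fin !subr0 sub0r opprK mulr1.
  - by move=> y _; exact: step_ge0.
  - exact: measurable_step.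
  - by move=> y _; exact: step_ge0.
  - exact: measurable_step.
apply: ge0_le_integral => //=.
- by move=> y _; apply: adde_ge0; exact: step_ge0.
- by apply: emeasurable_funD; exact: measurable_step.
- exact: measurable_slice_fun.
move=> y _; rewrite /step !patchE; case: ifPn => [|_].
  rewrite inE/= in_itv/= => /andP[y1 y2].
  rewrite memNset ?adde0; last by rewrite /= in_itv/= (lt_gtF y2).
  have hy : 0 < 1 - 1 * y ^+ 2.
    by rewrite mul1r (_ : _ - _ = (1 - y) * (1 + y)) ?mulr_gt0//; [move: y1 y2; lra|move: y1; lra|ring].
  rewrite mem_set// (slice_window 0 hy hU) add0r.
  rewrite (_ : lon 1 y U = setT) ?setTI; last first.
    by apply/seteqP; split=> // u _; apply: low; rewrite y1.
  rewrite lebesgue_measure_itv/= lte_fin mulr_gt0 ?pi_gt0//.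
  by rewrite -EFinB subr0.
case: ifPn => [|_]; last by rewrite add0e; case: ifPn => // _; rewrite /slice adde_ge0.
rewrite inE/= in_itv/= add0e => /andP[y1 y2].
have hy : 0 < 1 - 1 * y ^+ 2.
  by rewrite mul1r (_ : _ - _ = (1 - y) * (1 + y)) ?mulr_gt0//; [move: y1 y2 d1; lra|move: y1; lra|ring].
rewrite mem_set// (slice_window (u0 - d) hy hU).
apply: (@le_trans _ _ (lebesgue_measure `]u0 - d, u0 + d[%classic)).
  by rewrite lebesgue_oo ?lee_fin; move: d0; clear; lra.
apply: le_measure; rewrite ?inE//.
  by apply: measurableI => //; apply: measurable_lon => //; right; right.
move=> u /=; rewrite !in_itv/= => /andP[u1 u2]; split; first by apply: box; rewrite ?y1 ?u1.
by rewrite u1/=; move: u2 d1 p3; rewrite mulr2n; lra.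
Qed.

Lemma sph_area_upper (R : realType) (U : R -> R -> R -> Prop) (A u0 d : R) :
  ropen 1 U -> area 1 (region U) = A%:E -> 0 < d -> d < 1 ->
  (forall y u, -1 < y < 0 -> ~ lon 1 y U u) ->
  (forall y u, 0 < y < d -> u0 - d < u < u0 + d -> ~ lon 1 y U u) ->
  A + 2 * d * d <= 2 * pi.
Proof.
move=> hU hA d0 d1 low box.
have p3 : 2 < pi *+ 2 :> R by have := pi_ge2 R; rewrite mulr2n; lra.
have pp0 : 0 <= 2 * pi :> R by rewrite mulr_ge0// pi_ge0.
have dd0 : 0 <= 2 * d by rewrite mulr_ge0// ltW.
have hk : curv (1 : R) by right; right.
rewrite -lee_fin EFinD -hA area_slice//.
(* Written with integrals of step functions, the claim becomes a pointwise comparison: a slice at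
   height y >= 0 has measure at most 2 pi, and at most 2 pi - 2 d at the heights of the missing
   box. *)
have -> : (2 * pi)%:E = (\int[lebesgue_measure]_y step (2 * pi)%R `[0%R, 1%R]%classic y)%E :> \bar R.
  rewrite integral_step// lebesgue_measure_itv/= lte_fin ltr01.
  by rewrite -EFinB -EFinM subr0 mulr1.
have -> : (2 * d * d)%:E = (\int[lebesgue_measure]_y step (2 * d)%R `]0%R, d[%classic y)%E :> \bar R.
  by rewrite integral_step// (lebesgue_oo (ltW d0)) -EFinM subr0.
have ge0 y : (0 <= ((slice 1 ^~ U) \_ [set y | (0 < 1 - 1 * y ^+ 2)%R]) y :> \bar R)%E.
  by apply: erestrict_ge0 => *; rewrite /slice adde_ge0.
rewrite -ge0_integralD//=; last 3 first.
- exact: measurable_slice_fun.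
- by move=> y _; exact: step_ge0.
- exact: measurable_step.
apply: ge0_le_integral => //=.
- by move=> y _; apply: adde_ge0 => //; exact: step_ge0.
- by apply: emeasurable_funD; [exact: measurable_slice_fun|exact: measurable_step].
- exact: measurable_step.
move=> y _; rewrite /step !patchE; case: ifPn => [|_]; last first.
  rewrite add0e; case: ifPn => [|_]; last by case: ifPn => // _; rewrite lee_fin.
  rewrite inE/= in_itv/= => /andP[y1 y2].
  rewrite mem_set/=; last by rewrite in_itv/= !ltW// (lt_trans y2).
  by rewrite lee_fin; have := pi_ge2 R; move: d1; lra.
rewrite inE/= => hy.
have y1 : -1 < y < 1.
  move: hy; rewrite mul1r => h.
  by rewrite -ltr_norml -(@ltr_pXn2r _ 2)// ?nnegrE// real_normK ?num_real// expr1n -subr_gt0.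
case/andP: y1 => y1 y2.
have mE : measurable (lon 1 y U) by exact: measurable_lon.
have [y0|y0] := ltP y 0.
  rewrite [X in (X + _)%E](_ : _ = 0%E); last first.
    rewrite (slice_window 0 hy hU) (_ : lon 1 y U = set0) ?set0I ?measure0//.
    by apply/seteqP; split=> // u; apply: low; rewrite y1.
  rewrite memNset ?adde0; last by rewrite /= in_itv/= (lt_gtF y0).
  by rewrite memNset//= in_itv/= leNgt y0.
rewrite [in leRHS]mem_set/=; last by rewrite in_itv/= y0 ltW.
case: ifPn => [|_].
  (* The window begins with the missing interval, so the slice lies in the rest of it. *)
  rewrite inE/= in_itv/= => /andP[y0' yd]; rewrite (slice_window (u0 - d) hy hU).
  pose B : set R := `[u0 + d, u0 - d + 2 * pi]%classic.
  apply: (@le_trans _ _ (lebesgue_measure B + (2 * d)%:E)%E).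
    rewrite leeD2r//; apply: le_measure; rewrite ?inE//;
      [exact: measurableI|exact: measurable_itv|].
    move=> u [hu]; rewrite /B /= !in_itv/= => /andP[u1 ->]; rewrite andbT leNgt.
    by apply/negP => u2; apply: (box y u _ _ hu); rewrite ?y0' ?u1.
  rewrite /B lebesgue_measure_itv/= lte_fin ifT; last by move: d1 p3; rewrite mulr2n; lra.
  by rewrite -EFinB -EFinD lee_fin; lra.
rewrite adde0 (slice_window 0 hy hU) add0r.
apply: (@le_trans _ _ (lebesgue_measure `]0, 2 * pi : R]%classic)).
  by apply: le_measure; rewrite ?inE//; exact: measurableI.
by rewrite lebesgue_measure_itv/= lte_fin mulr_gt0 ?pi_gt0// -EFinB subr0.
Qed.

Lemma lrad1_sqr (R : realType) (s : R) : -1 <= s <= 1 -> lrad 1 s ^+ 2 = 1 - s ^+ 2.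
Proof.
move=> hs; rewrite /lrad mul1r sqr_sqrtr// subr_ge0 -real_normK ?num_real//.
by rewrite expr_le1// ler_norml.
Qed.

Lemma md_lon1 (R : realType) (s u : R) : -1 <= s <= 1 ->
  md 1 (lrad 1 s * snk 1 u) s (lrad 1 s * csk 1 u).
Proof.
move=> hs; split; last by rewrite eqxx.
have h : csk 1 u ^+ 2 + 1 * snk 1 u ^+ 2 = 1 by apply: csk2snk2; right; right.
transitivity (lrad 1 s ^+ 2 * (csk 1 u ^+ 2 + 1 * snk 1 u ^+ 2) + s ^+ 2); first by ring.
by rewrite h mulr1 lrad1_sqr// subrK.
Qed.

Lemma meridian_path (R : realType) (a b u y1 y2 : R) (x y z : R -> R) U :
  domain 1 a b x y z U -> -1 <= y1 -> y1 <= y2 -> y2 <= 1 ->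
  (forall s t, y1 <= s <= y2 -> a <= t <= b ->
    ~ [/\ lrad 1 s * snk 1 u = x t, s = y t & lrad 1 s * csk 1 u = z t]) ->
  lon 1 y1 U u <-> lon 1 y2 U u.
Proof.
move=> hU l1 l12 l2 H.
have cl (f : R -> R) (p : R) : continuous f -> continuous (fun s : R => lrad 1 (f s) * p).
  move=> cf s; apply: (@continuousM _ _ (fun s => lrad 1 (f s)) (fun _ => p));
    last exact: cst_continuous.
  by apply: (@continuous_comp R R R f (lrad 1)); [exact: cf|exact: continuous_lrad].
have cid : continuous (fun s : R => s) by move=> s; exact: cvg_id.
have cN : continuous (fun s : R => - s) by move=> s; exact: continuousN.
split=> h.
  apply: (domain_path hU (cl _ (snk 1 u) cid) cid (cl _ (csk 1 u) cid) l12) => // s hs.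
  split; last by move=> t; exact: H.
  by apply: md_lon1; move/andP: hs => [s1 s2]; rewrite (le_trans l1 s1) (le_trans s2 l2).
(* [domain_path] follows increasing parameters, so the way back is parametrized by - s. *)
have := domain_path hU (cl _ (snk 1 u) cN) cN (cl _ (csk 1 u) cN) (_ : - y2 <= - y1).
rewrite !opprK => H'; apply: H' => //; first by rewrite lerN2.
move=> s /andP[s1 s2]; have hs : y1 <= - s <= y2 by rewrite lerNr s2 lerNl.
split; last by move=> t; exact: H.
by apply: md_lon1; move/andP: hs => [s3 s4]; rewrite (le_trans l1 s3) (le_trans s4 l2).
Qed.

Lemma sqr_sin_le (R : realType) (v : R) : sin v ^+ 2 <= v ^+ 2.
Proof.
have key (w : R) : 0 <= w -> sin w ^+ 2 <= w ^+ 2.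
  move=> w0; have [w1|w1] := leP w 1.
    rewrite ler_pXn2r ?nnegrE//; first exact: sin_le.
    by apply: sin_ge0_pi; rewrite w0 (le_trans w1)// (le_trans _ (pi_ge2 R))// ler1n.
  have h := cos2Dsin2 w; have h1 := sqr_ge0 (cos w).
  have : 1 <= w ^+ 2 by rewrite expr_ge1// ltW.
  by move: h h1; clear; lra.
have [v0|/ltW v0] := leP 0 v; first exact: key.
by rewrite -[leLHS]sqrrN -sinN -[leRHS]sqrrN key// oppr_ge0.
Qed.

Lemma one_sub_cos (R : realType) (v : R) : 1 - cos v <= v ^+ 2 / 2.
Proof.
have E : cos v = 1 - 2 * sin (v / 2) ^+ 2.
  by rewrite {1}(splitr v) cosD -!expr2; have := cos2Dsin2 (v / 2); lra.
have := sqr_sin_le (v / 2); rewrite E exprMn; set s := sin _ ^+ 2.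
have -> : (2^-1 : R) ^+ 2 = 1 / 4 by field.
by set w := v ^+ 2; lra.
Qed.

Lemma lon_dist (R : realType) (s u u0 : R) : -1 <= s <= 1 ->
  (lrad 1 s * snk 1 u - snk 1 u0) ^+ 2 + s ^+ 2 + (lrad 1 s * csk 1 u - csk 1 u0) ^+ 2 <=
  2 * s ^+ 2 + (u - u0) ^+ 2.
Proof.
move=> hs; have q2 := lrad1_sqr hs; have q0 : 0 <= lrad 1 s by exact: sqrtr_ge0.
have c1 := one_sub_cos (u - u0); rewrite cosB in c1.
rewrite /snk /csk !eqxx; have h := cos2Dsin2 u; have h0 := cos2Dsin2 u0.
move: c1 h h0 q0 q2; set q := lrad 1 s; set C := cos u; set S := sin u; set C0 := cos u0.
set S0 := sin u0 => c1 h h0 q0 q2.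
have q1 : q <= 1.
  by rewrite -(@ler_pXn2r _ 2)// ?nnegrE// expr1n q2 gerBl sqr_ge0.
have e : (q * S - S0) ^+ 2 + s ^+ 2 + (q * C - C0) ^+ 2 = 2 * (1 - q) + 2 * (q * (1 - (C * C0 + S * S0))).
  transitivity (q ^+ 2 * (C ^+ 2 + S ^+ 2) + s ^+ 2 + (C0 ^+ 2 + S0 ^+ 2) - 2 * (q * (C * C0 + S * S0))).
    by ring.
  by rewrite h h0 q2; ring.
rewrite e.
have c0 : 0 <= 1 - (C * C0 + S * S0).
  have : (C - C0) ^+ 2 + (S - S0) ^+ 2 = 2 * (1 - (C * C0 + S * S0)).
    transitivity ((C ^+ 2 + S ^+ 2) + (C0 ^+ 2 + S0 ^+ 2) - 2 * (C * C0 + S * S0)); first by ring.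
    by rewrite h h0; ring.
  by have := sqr_ge0 (C - C0); have := sqr_ge0 (S - S0); lra.
have g1 : q * (1 - (C * C0 + S * S0)) <= 1 - (C * C0 + S * S0) by rewrite ler_piMl.
have g2 : 1 - q <= s ^+ 2.
  have : q ^+ 2 <= q by rewrite expr2 ler_piMl.
  by rewrite q2; clear; lra.
by move: g1 g2 c1; clear; lra.
Qed.

(** Below the curve each meridian leads to the south pole without meeting it, so the cap lies
    entirely inside or entirely outside [U]. *)
Lemma sphere_setup_y (R : realType) (a b : R) E (x dx y dy z dz : R -> R) U A :
  setup 1 a b E x dx y dy z dz U A -> (forall t, a <= t <= b -> 0 <= y t) ->
  forall y0, y0 <= 1 -> (forall t, a <= t <= b -> y0 <= y t) ->
  forall s u, -1 < s < y0 -> (lon 1 s U u <-> U 0 (-1) 0).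
Proof.
move=> [hc hU _ _ _ _] hy y0 y01 hy0 s u /andP[s1 s2].
have -> : U 0 (-1) 0 = lon 1 (-1) U u.
  by rewrite /lon/= /lrad sqrrN expr1n mulr1 subrr sqrtr0 !mul0r.
apply: iff_sym; apply: (meridian_path (y1 := -1) (y2 := s) hU) => //; try exact: ltW.
  by apply: ltW; exact: lt_le_trans y01.
move=> v t /andP[_ vs] tab [_ e _]; have := hy0 t tab.
by rewrite -e leNgt (le_lt_trans vs s2).
Qed.

Lemma sph_coord_le1 (R : realType) (x y z : R) : md 1 x y z -> y <= 1.
Proof.
move=> /md1 h; have := sqr_ge0 x; have := sqr_ge0 z.
move=> h1 h2; rewrite leNgt; apply/negP => h3.
have : 1 < y ^+ 2 by rewrite expr_gt1// (le_trans ler01 (ltW h3)).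
by move: h h1 h2; clear; lra.
Qed.

(** If the south pole were in [U], so would be the hemisphere y < 0 and a strip above it, with area
    more than 2 pi. Hence [U] misses the equator y = 0, which carries the poles of the x-axis; the
    curve misses them because y > 0 on it. *)
Lemma hemisphere_axis (R : realType) (a b : R) E (x dx y dy z dz : R -> R) U A :
  setup 1 a b E x dx y dy z dz U A -> A <= 2 * pi -> (forall t, a <= t <= b -> 0 < y t) ->
  good_axis 1 a b x (fun x y z => U y x z).
Proof.
move=> hs A2 hy; have [hc hU hA A0 _ _] := hs; have [ab px py pz hmd] := hc.
have [c [d [hc1 _ Hc]]] := within_range (ltW ab) (pwd_continuous py).
have y0 := hy c hc1; have y1 := sph_coord_le1 (hmd c hc1).
have low := sphere_setup_y hs (fun t h => ltW (hy t h)) y1 (fun t h => proj1 (andP (Hc t h))).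
have NS : ~ U 0 (-1) 0.
  move=> hS; pose e := Num.min (y c) (1 / 2).
  have e0 : 0 < e by rewrite lt_min y0 divr_gt0.
  have ey : e <= y c by rewrite ge_min lexx.
  have e1 : e < 1.
    by apply: (@le_lt_trans _ _ (1 / 2)); [rewrite ge_min lexx orbT|lra].
  have : 2 * pi + 2 * e * e <= A.
    apply: (@sph_area_lower R U A 0 e (domain_open hU) hA e0 e1) => s u.
      by move=> /andP[s1 s2]; apply/low => //; rewrite s1 (lt_trans s2).
    move=> /andP[s1 s2] _; apply/low => //; rewrite (lt_le_trans s2 ey) andbT.
    by apply: lt_trans s1; rewrite oppr_lt0.
  have : 0 < 2 * e * e by rewrite !mulr_gt0.
  by move: A2; clear; lra.
have eq (u : R) : ~ U (snk 1 u) 0 (csk 1 u).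
  move=> h; apply: NS; apply/(low 0 u); first by rewrite y0 ltrN10.
  by rewrite /lon/= /lrad expr0n mulr0 subr0 sqrtr1 !mul1r.
split.
  move=> _; split.
    by have := eq (pi / 2); rewrite /snk /csk !eqxx sin_pihalf cos_pihalf.
  by have := eq (- (pi / 2)); rewrite /snk /csk !eqxx sinN cosN sin_pihalf cos_pihalf.
move=> t tab; have := hy t tab; have := md1 (hmd t tab) => h h1.
by have := exprn_gt0 2 h1; have := sqr_ge0 (z t); move: h; rewrite mul1r; clear; lra.
Qed.

(** A curve missing the point of longitude u0 on the equator would miss a box around it. The part of
    the box above the equator would then lie on the same side of the curve as the hemisphere y < 0,
    and A would exceed 2 pi or fall short of it. *)
Lemma equator_point (R : realType) (a b u0 : R) E (x dx y dy z dz : R -> R) U A :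
  setup 1 a b E x dx y dy z dz U A -> A = 2 * pi -> (forall t, a <= t <= b -> 0 <= y t) ->
  exists t, [/\ a <= t <= b, x t = snk 1 u0, y t = 0 & z t = csk 1 u0].
Proof.
move=> hs A2 hy; have [hc hU hA A0 _ _] := hs; have [ab px py pz hmd] := hc.
have cB (f : R -> R) (p : R) : {within `[a, b], continuous f} ->
    {within `[a, b], continuous (fun t => (f t - p) * (f t - p))}.
  by move=> cf; apply: withinM; apply: withinD => //; exact: within_cst.
pose f t := (x t - snk 1 u0) * (x t - snk 1 u0) + (y t - 0) * (y t - 0)
  + (z t - csk 1 u0) * (z t - csk 1 u0).
have cf : {within `[a, b], continuous f}.
  by apply: withinD; [apply: withinD; apply: cB;
    [exact: pwd_continuous px|exact: pwd_continuous py]|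
    apply: cB; exact: pwd_continuous pz].
have [c [c' [hc1 _ Hc]]] := within_range (ltW ab) cf.
have fE t : f t = (x t - snk 1 u0) ^+ 2 + y t ^+ 2 + (z t - csk 1 u0) ^+ 2.
  by rewrite /f subr0 -!expr2.
have [f0|f0] := leP (f c) 0.
  move: f0; rewrite fE => /sum3_sqr_eq0[/eqP h1 h2 /eqP h3].
  by exists c; split => //; apply/eqP; rewrite -subr_eq0.
(* Squared distances from the chosen point are below 3 d^2 in the box, hence below [f c], their
   minimum over the curve. *)
pose d := Num.min (1 / 2) (f c / 8).
have d0 : 0 < d by rewrite lt_min !divr_gt0.
have dh : d <= 1 / 2 by rewrite ge_min lexx.
have d8 : d <= f c / 8 by rewrite ge_min lexx orbT.
have d1 : d < 1 by move: dh; clear; lra.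
have dd : d * d <= d / 2 by have := ler_wpM2l (ltW d0) dh; move: d0; clear; lra.
have box s u t : - d < s < d -> u0 - d < u < u0 + d -> a <= t <= b ->
    ~ [/\ lrad 1 s * snk 1 u = x t, s = y t & lrad 1 s * csk 1 u = z t].
  move=> /andP[s1 s2] /andP[u1 u2] tab [e1 e2 e3].
  have /andP[h _] := Hc t tab; move: h; rewrite leNgt => /negP; apply.
  have hs1 : -1 <= s <= 1 by apply/andP; split; move: s1 s2 d1; clear; lra.
  rewrite fE -e1 -e2 -e3; apply: le_lt_trans (lon_dist u u0 hs1) _.
  have sq (w : R) : - d < w -> w < d -> w ^+ 2 < d * d.
    move=> w1 w2; rewrite -expr2 -[w ^+ 2]real_normK ?num_real//.
    by rewrite ltr_pXn2r ?nnegrE// ?ltr_norml ?w1// ltW.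
  have h1 := sq s s1 s2; have h2 : (u - u0) ^+ 2 < d * d.
    by apply: sq; move: u1 u2; clear; lra.
  by move: h1 h2 dd d8 f0; clear; lra.
have low := sphere_setup_y hs hy ler01 hy.
have lift s u : 0 < s < d -> u0 - d < u < u0 + d -> lon 1 s U u <-> U 0 (-1) 0.
  move=> /andP[s1 s2] hu.
  have h1 : -1 < - (d / 2) < 0 by apply/andP; split; move: d0 d1; clear; lra.
  apply: iff_trans (low _ u h1); apply: iff_sym.
  apply: (meridian_path hU); try (move: s1 s2 d0 d1; clear; lra).
  move=> v t /andP[v1 v2] tab; apply: box => //.
  by apply/andP; split; move: v1 v2 s2 d0; clear; lra.
exfalso; have dp : 0 < 2 * d * d by rewrite !mulr_gt0.
have [hS|nS] := pselect (U 0 (-1) 0).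
  have : 2 * pi + 2 * d * d <= A.
    apply: (@sph_area_lower R U A u0 d (domain_open hU) hA d0 d1) => s u h.
      by apply/low.
    by move=> hu; apply/lift.
  by move: A2 dp; clear; lra.
have : A + 2 * d * d <= 2 * pi.
  apply: (@sph_area_upper R U A u0 d (domain_open hU) hA d0 d1) => s u h.
    by move/low => /(_ h).
  by move=> hu /lift => /(_ h hu).
by move: A2 dp; clear; lra.
Qed.

Lemma hemisphere_equator (R : realType) (a b : R) E (x dx y dy z dz : R -> R) U A :
  setup 1 a b E x dx y dy z dz U A -> A = 2 * pi -> prim a (speed 1 dx dy dz) b = 2 * pi ->
  (forall t, a <= t <= b -> 0 <= y t) -> forall t, a <= t <= b -> y t = 0.
Proof.
move=> hs A2 L2 hy; have [hc _ _ _ cl _] := hs.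
have hl : loop a b E x dx y dy z dz by split.
have P u0 := equator_point u0 hs A2 hy.
have [t1 [h1 x1 y1 z1]] := P 0; have [t2 [h2 x2 y2 z2]] := P (pi / 2).
have [t3 [h3 x3 y3 z3]] := P pi; have [t4 [h4 x4 y4 z4]] := P (- (pi / 2)).
rewrite /snk /csk !eqxx ?sinN ?cosN ?sin0 ?cos0 ?sin_pihalf ?cos_pihalf ?sinpi ?cospi in
  x1 x2 x3 x4 z1 z2 z3 z4.
(* [four_points] wants increasing parameters; sorting preserves its hypotheses because any two of
   the four points have inner product at most 0. *)
pose s := sort <=%R [:: t1; t2; t3; t4].
have ne u v : dot x y z u u != dot x y z u v -> u != v by apply: contra => /eqP->.
have us : uniq [:: t1; t2; t3; t4].
  rewrite /= !inE !negb_or; do ![apply/andP; split] => //; apply: ne;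
  rewrite /dot ?x1 ?x2 ?x3 ?x4 ?y1 ?y2 ?y3 ?y4 ?z1 ?z2 ?z3 ?z4;
  by apply/eqP; lra.
have prop u v : u \in s -> v \in s -> u != v -> dot x y z u v <= 0.
  rewrite !mem_sort !inE => /or4P[] /eqP-> /or4P[] /eqP->; rewrite ?eqxx// => _;
  rewrite /dot ?x1 ?x2 ?x3 ?x4 ?y1 ?y2 ?y3 ?y4 ?z1 ?z2 ?z3 ?z4; lra.
have prop0 u : u \in s -> a <= u <= b /\ y u = 0.
  by rewrite mem_sort !inE => /or4P[] /eqP->.
have ss : sorted <=%R s by exact: sort_le_sorted.
have su : uniq s by rewrite sort_uniq.
have sz : size s = 4%N by rewrite size_sort.
move: s sz ss su prop prop0 => [|s1 [|s2 [|s3 [|s4 [|//]]]]]//= _.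
rewrite !inE !negb_or => /and4P[s12 s23 s34 _] /and4P[/and3P[n12 n13 n14] /andP[n23 n24] n34 _] prop prop0.
have i1 : s1 \in [:: s1; s2; s3; s4] by rewrite inE eqxx.
have i2 : s2 \in [:: s1; s2; s3; s4] by rewrite !inE eqxx orbT.
have i3 : s3 \in [:: s1; s2; s3; s4] by rewrite !inE eqxx !orbT.
have i4 : s4 \in [:: s1; s2; s3; s4] by rewrite !inE eqxx !orbT.
have [/andP[a1 _] q1] := prop0 _ i1; have [_ q2] := prop0 _ i2; have [_ q3] := prop0 _ i3.
have [/andP[_ b4] q4] := prop0 _ i4.
apply: (four_points hl L2 a1 s12 s23 s34 b4) => //; apply: prop => //.
by rewrite eq_sym.
Qed.

(** Every unit vector m is the y-axis of some tilt: phi is the longitude of m, and tau is the angle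
    with sine - [lrad 1 m2] and cosine m2. *)
Lemma tilt_axis (R : realType) (m1 m2 m3 : R) : m1 ^+ 2 + m2 ^+ 2 + m3 ^+ 2 = 1 ->
  exists phi tau, forall x y z, tilty 1 phi tau x y z = m1 * x + m2 * y + m3 * z.
Proof.
move=> hm; have hk : curv (1 : R) by right; right.
have hm' : md 1 m1 m2 m3 by split; [rewrite mul1r|rewrite eqxx].
have m21 : 0 <= 1 - 1 * m2 ^+ 2.
  by have := sqr_ge0 m1; have := sqr_ge0 m3; move: hm; rewrite mul1r; clear; lra.
have q0 : 0 <= lrad 1 m2 by exact: sqrtr_ge0.
have q2 : lrad 1 m2 ^+ 2 = 1 - 1 * m2 ^+ 2 by rewrite sqr_sqrtr.
have [phi [e1 e3]] : exists u, m1 = lrad 1 m2 * snk 1 u /\ m3 = lrad 1 m2 * csk 1 u.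
  move: m21; rewrite le_eqVlt => /predU1P[h|h]; last exact: lon_exists hk hm' h.
  have [-> ->] : m1 = 0 /\ m3 = 0.
    by apply: sum_sqr_eq0; move: hm h; rewrite mul1r; clear; lra.
  by exists 0; rewrite /lrad -h sqrtr0 !mul0r.
have ht : md 1 (- lrad 1 m2) 0 m2.
  by split; [rewrite sqrrN q2 expr0n/=; ring|rewrite eqxx].
have [|tau [g1 g2]] := lon_exists hk ht; first by rewrite expr0n mulr0 subr0.
have l0 : lrad 1 (0 : R) = 1 by rewrite /lrad expr0n mulr0 subr0 sqrtr1.
rewrite l0 mul1r in g1; rewrite l0 mul1r in g2.
exists phi, tau => x y z; rewrite /tilty /tilt1 -g1 -g2 {1}e1 {1}e3; ring.
Qed.

Lemma tilt_quad (R : realType) (k phi tau x y z : R) : curv k -> k != 0 ->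
  tiltx k phi x z ^+ 2 + tilty k phi tau x y z ^+ 2 + k * tiltz k phi tau x y z ^+ 2 =
  x ^+ 2 + y ^+ 2 + k * z ^+ 2.
Proof.
move=> hk kn; rewrite -addrA (rot_quad tau y (tilt1 k phi x z) hk kn).
by rewrite addrCA (rot_quad phi x z hk kn); ring.
Qed.

Lemma md_swap (R : realType) (k x y z : R) : md k x y z -> md k y x z.
Proof. by rewrite /md [y ^+ 2 + _]addrC. Qed.

Lemma tilt_preimage (R : realType) (k phi tau o1 o2 o3 : R) : curv k -> md k o1 o2 o3 ->
  exists p1 p2 p3, [/\ md k p1 p2 p3, tiltx k phi p1 p3 = o1,
    tilty k phi tau p1 p2 p3 = o2 & tiltz k phi tau p1 p2 p3 = o3].
Proof.
move=> hk ho.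
pose p2 := o2 * csk k tau + o3 * snk k tau; pose z0 := o3 * csk k tau - k * (o2 * snk k tau).
pose p1 := o1 * csk k phi + z0 * snk k phi; pose p3 := z0 * csk k phi - k * (o1 * snk k phi).
have inv (t u v : R) : (u * csk k t + v * snk k t) * csk k t -
    (v * csk k t - k * (u * snk k t)) * snk k t = u /\
    (v * csk k t - k * (u * snk k t)) * csk k t + k * ((u * csk k t + v * snk k t) * snk k t) = v.
  have := rot_inverse (- t) u v hk; rewrite snkN// cskN// !mulrN !opprK => -[h1 h2].
  by rewrite -[RHS]h1 -[X in _ /\ _ = X]h2; split; ring.
have hz : md k o1 p2 z0 by apply: md_swap; apply/md_rotxz => //; exact: md_swap.
exists p1, p2, p3.
have [h1 h2] := inv phi o1 z0; have [h3 h4] := inv tau o2 o3.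
have t1 : tilt1 k phi p1 p3 = z0 by rewrite /tilt1 /p1 /p3 h2.
split; first exact/md_rotxz.
- by rewrite /tiltx.
- by rewrite /tilty t1.
- by rewrite /tiltz t1.
Qed.

(* Equals [4 * snk k (d / 2) ^+ 2] for points of the surface at distance [d]. *)
Definition sqdist (R : realType) (k x y z o1 o2 o3 : R) : R :=
  (x - o1) ^+ 2 + (y - o2) ^+ 2 + k * (z - o3) ^+ 2.

Lemma tilt_sqdist (R : realType) (k phi tau x y z o1 o2 o3 : R) : curv k -> k != 0 ->
  sqdist k (tiltx k phi x z) (tilty k phi tau x y z) (tiltz k phi tau x y z)
    (tiltx k phi o1 o3) (tilty k phi tau o1 o2 o3) (tiltz k phi tau o1 o2 o3) =
  sqdist k x y z o1 o2 o3.
Proof.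
move=> hk kn; rewrite /sqdist -[RHS](tilt_quad phi tau _ _ _ hk kn).
by congr (_ ^+ 2 + _ ^+ 2 + k * _ ^+ 2); rewrite /tiltx /tilty /tiltz /tilt1; ring.
Qed.

Definition round (R : realType) (k a b : R) (x y z : R -> R) (A : R) : Prop :=
  exists c r o1 o2 o3,
    [/\ c = 1 - k * A / (2 * pi), r = Num.sqrt (A * (4 * pi - k * A)) / (2 * pi),
      0 <= c, 0 < r & c ^+ 2 + k * r ^+ 2 = 1] /\
    (md k o1 o2 o3 /\ forall t, a <= t <= b ->
      sqdist k (x t) (y t) (z t) o1 o2 o3 = 2 * r ^+ 2 / (1 + c)).

Lemma good_isop (R : realType) (k a b : R) E (x dx y dy z dz : R -> R) U A :
  curv k -> setup k a b E x dx y dy z dz U A -> good_axis k a b y U ->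
  let L := prim a (speed k dx dy dz) b in
  4 * pi * A - k * A ^+ 2 <= L ^+ 2 /\
  (L ^+ 2 = 4 * pi * A - k * A ^+ 2 -> round k a b x y z A).
Proof.
move=> hk hs hg L; have [hc hU hA A0 [_ ycl _] _] := hs; have [hp hy] := hg.
have [h1 _] := axis_ineq hk hc hU hp hy hA A0 ycl.
split => // LE; have [c [r [p1 [p2 [p3 [[h2 h3 h4 h5 h6] h7]]]]]] := equality_circle hk hs hg LE.
by exists c, r, p1, p2, p3; split => //; split => //; exact: ltW.
Qed.

Lemma round_tilt (R : realType) (k phi tau a b : R) (x y z : R -> R) A : curv k -> k != 0 ->
  round k a b (fun t => tiltx k phi (x t) (z t)) (fun t => tilty k phi tau (x t) (y t) (z t))
    (fun t => tiltz k phi tau (x t) (y t) (z t)) A -> round k a b x y z A.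
Proof.
move=> hk kn [c [r [p1 [p2 [p3 [h1 [h2 h3]]]]]]].
have [q1 [q2 [q3 [h4 e1 e2 e3]]]] := tilt_preimage phi tau hk h2.
exists c, r, q1, q2, q3; split => //; split => // t tab.
by rewrite -(h3 t tab) -e1 -e2 -e3 tilt_sqdist.
Qed.

Lemma round_swap (R : realType) (k a b : R) (x y z : R -> R) A :
  round k a b y x z A -> round k a b x y z A.
Proof.
move=> [c [r [p1 [p2 [p3 [h1 [h2 h3]]]]]]]; exists c, r, p2, p1, p3; split => //.
split; first exact: md_swap.
by move=> t /h3 <-; rewrite /sqdist [(y t - _) ^+ 2 + _]addrC.
Qed.

Lemma hemisphere_plane (R : realType) (a b m1 m2 m3 : R) E (x dx y dy z dz : R -> R) U A :
  setup 1 a b E x dx y dy z dz U A -> A = 2 * pi -> prim a (speed 1 dx dy dz) b = 2 * pi ->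
  0 < m1 ^+ 2 + m2 ^+ 2 + m3 ^+ 2 ->
  (forall t, a <= t <= b -> 0 <= m1 * x t + m2 * y t + m3 * z t) ->
  exists o1 o2 o3, o1 ^+ 2 + o2 ^+ 2 + o3 ^+ 2 = 1 /\
    forall t, a <= t <= b -> o1 * x t + o2 * y t + o3 * z t = 0.
Proof.
move=> hs A2 L2 m0 hm; have hk : curv (1 : R) by right; right.
pose n := Num.sqrt (m1 ^+ 2 + m2 ^+ 2 + m3 ^+ 2).
have n0 : 0 < n by rewrite sqrtr_gt0.
have n2 : n ^+ 2 = m1 ^+ 2 + m2 ^+ 2 + m3 ^+ 2 by rewrite sqr_sqrtr// ltW.
have nn := lt0r_neq0 n0.
have u1 : (m1 / n) ^+ 2 + (m2 / n) ^+ 2 + (m3 / n) ^+ 2 = 1.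
  by rewrite !expr_div_n -!mulrDl -n2 divff// expf_neq0.
exists (m1 / n), (m2 / n), (m3 / n); split => // t tab.
have [phi [tau Y]] := tilt_axis u1.
have hs' := setup_tilt phi tau hk hs.
rewrite -Y; apply: (hemisphere_equator hs' A2) => //.
  by rewrite (tilt_length phi tau hk (setup_curve hs)).
move=> s /hm h; rewrite Y.
rewrite (_ : _ + _ = (m1 * x s + m2 * y s + m3 * z s) / n); last by field.
by rewrite divr_ge0// ltW.
Qed.

(** Both halves of the loop have length pi and join antipodal points, so they are half great
    circles, through their midpoints at t1 and t3. If these midpoints are not antipodal, their sum
    is the pole of a hemisphere containing the loop; otherwise the whole loop lies in one plane
    through the origin. *)
Lemma sphere_antipodal (R : realType) (a b tm : R) E (x dx y dy z dz : R -> R) :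
  loop a b E x dx y dy z dz -> prim a (speed 1 dx dy dz) b = 2 * pi -> a <= tm <= b ->
  prim a (speed 1 dx dy dz) tm = pi -> x tm = - x a -> y tm = - y a -> z tm = - z a ->
  (exists m1 m2 m3, 0 < m1 ^+ 2 + m2 ^+ 2 + m3 ^+ 2 /\
     forall t, a <= t <= b -> 0 <= m1 * x t + m2 * y t + m3 * z t) \/
  (exists o1 o2 o3, o1 ^+ 2 + o2 ^+ 2 + o3 ^+ 2 = 1 /\
    forall t, a <= t <= b -> o1 * x t + o2 * y t + o3 * z t = 0).
Proof.
move=> hl L2 /andP[am mb] Vm xm ym zm; have [hc [xab yab zab]] := hl.
have [ab px py pz hmd] := hc.
pose V := prim a (speed 1 dx dy dz).
have cV : {within `[a, b], continuous V}.
  by apply: (@pwd_continuous _ _ _ E _ (speed 1 dx dy dz)); apply: pwd_prim;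
    [exact: ltW|exact: pwc_speed hc].
have Va : V a = 0 by rewrite /V prim_self.
have {}Vm : V tm = pi by [].
have Vb : V b = 2 * pi by [].
have p0 := pi_gt0 R.
have [t1 /andP[a1 m1] V1] : exists2 t, a <= t <= tm & V t = pi / 2.
  have [|t ht <-] := IVT am (within_cont_sub (lexx a) mb cV) (v := pi / 2); last by exists t.
  by rewrite Va Vm (min_l (ltW p0)) (max_r (ltW p0)); apply/andP; split; lra.
have [t3 /andP[m3 b3] V3] : exists2 t, tm <= t <= b & V t = 3 * (pi / 2).
  have [|t ht <-] := IVT mb (within_cont_sub am (lexx b) cV) (v := 3 * (pi / 2)); last by exists t.
  have pq : pi <= 2 * pi :> R by lra.
  by rewrite Vm Vb (min_l pq) (max_r pq); apply/andP; split; lra.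
have ia : a <= a <= b by rewrite lexx ltW.
have ib : a <= b <= b by rewrite lexx ltW.
have i1 : a <= t1 <= b by rewrite a1 (le_trans m1).
have im : a <= tm <= b by rewrite am.
have i3 : a <= t3 <= b by rewrite b3 (le_trans am).
have D s t : a <= s <= b -> a <= t <= b -> -1 <= dot x y z s t <= 1.
  by move=> hs ht; exact: sph_dot1 (hmd _ hs) (hmd _ ht).
have db s : dot x y z s b = dot x y z s a by rewrite /dot xab yab zab.
have dm s : dot x y z s tm = - dot x y z s a by rewrite /dot xm ym zm; ring.
have ge (w : R) : -1 <= w <= 1 -> acos w <= pi / 2 -> 0 <= w.
  move=> hw h; rewrite -[w]acosK ?in_itv//; apply: cos_ge0_pihalf.
  by rewrite h andbT; apply: le_trans (acos_ge0 hw); rewrite oppr_le0 divr_ge0// ltW.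
have half s t u : a <= s -> s <= u -> u <= t -> t <= b -> V t - V s = pi / 2 ->
    acos (dot x y z s u) + acos (dot x y z u t) <= pi / 2.
  move=> as_ su ut tb <-; have := sph_arc hc as_ su (le_trans ut tb).
  by have := sph_arc hc (le_trans as_ su) ut tb; rewrite -/V; clear; lra.
have full s t : a <= s -> s <= t -> t <= b -> V t - V s = pi / 2 -> acos (dot x y z s t) <= pi / 2.
  by move=> as_ st tb h; have := sph_arc hc as_ st tb; rewrite -/V h.
have e1 : V t1 - V a = pi / 2 by rewrite V1 Va subr0.
have e2 : V tm - V t1 = pi / 2 by rewrite V1 Vm; lra.
have e3 : V t3 - V tm = pi / 2 by rewrite V3 Vm; lra.
have e4 : V b - V t3 = pi / 2 by rewrite V3 Vb; lra.
have o1 : dot x y z t1 a = 0.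
  have g1 := ge _ (D _ _ ia i1) (full _ _ (lexx a) a1 (le_trans m1 mb) e1).
  have g2 := ge _ (D _ _ i1 im) (full _ _ a1 m1 mb e2).
  by rewrite dm oppr_ge0 in g2; rewrite dotC in g1; apply/le_anti; rewrite g1 g2.
have o3 : dot x y z t3 a = 0.
  have g1 := ge _ (D _ _ im i3) (full _ _ am m3 b3 e3).
  have g2 := ge _ (D _ _ i3 ib) (full _ _ (le_trans am m3) b3 (lexx b) e4).
  by rewrite db in g2; rewrite dotC dm oppr_ge0 in g1; apply/le_anti; rewrite g1 g2.
(* The half great circle from g(a) through the point p to - g(a): only the coefficient of p has a
   prescribed sign. *)
pose arc p u := exists al be, [/\ 0 <= be, x u = al * x a + be * x p,
  y u = al * y a + be * y p & z u = al * z a + be * z p].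
have H u : a <= u <= b -> arc t1 u \/ arc t3 u.
  move=> hu; have /andP[au ub] := hu.
  have span s t : a <= s <= b -> a <= t <= b -> dot x y z s t = 0 ->
      acos (dot x y z s u) + acos (dot x y z u t) <= pi / 2 ->
      exists al be, [/\ 0 <= al, 0 <= be, x u = al * x s + be * x t,
        y u = al * y s + be * y t & z u = al * z s + be * z t].
    move=> hs ht dst h; rewrite [dot x y z u t]dotC in h.
    have [g1 g2 g3] := acos_sum_half (D s u hs hu) (D t u ht hu) h.
    have dst0 : dot x y z s t <= 0 by rewrite dst.
    have [h1 h2 h3] := in_span (md1 (hmd s hs)) (md1 (hmd t ht)) (md1 (hmd u hu)) dst0 g1 g2 g3.
    by eexists; eexists; split; [exact: g1|exact: g2|exact: h1|exact: h2|exact: h3].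
  have [u1|/ltW u1] := leP u t1.
    have [|al [be [g1 g2 g3 g4 g5]]] := span a t1 ia i1 _ (half _ _ _ (lexx a) au u1 (le_trans m1 mb) e1).
      by rewrite dotC.
    by left; exists al, be.
  have [um|/ltW um] := leP u tm.
    have [|al [be [g1 g2 g3 g4 g5]]] := span t1 tm i1 im _ (half _ _ _ a1 u1 um mb e2).
      by rewrite dm o1 oppr0.
    left; exists (- be), al; split => //; [rewrite g3 xm|rewrite g4 ym|rewrite g5 zm]; ring.
  have [u3|/ltW u3] := leP u t3.
    have [|al [be [g1 g2 g3 g4 g5]]] := span tm t3 im i3 _ (half _ _ _ am um u3 b3 e3).
      by rewrite dotC dm o3 oppr0.
    right; exists (- al), be; split => //; [rewrite g3 xm|rewrite g4 ym|rewrite g5 zm]; ring.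
  have [|al [be [g1 g2 g3 g4 g5]]] := span t3 b i3 ib _ (half _ _ _ (le_trans am m3) u3 ub (lexx b) e4).
    by rewrite db.
  right; exists be, al; split => //; [rewrite g3 xab|rewrite g4 yab|rewrite g5 zab]; ring.
have n1 := md1 (hmd _ i1); have n3 := md1 (hmd _ i3); have na := md1 (hmd _ ia).
rewrite /dot in o1 o3.
pose m (f : R -> R) := f t1 + f t3.
have [m0|m0] := ltP 0 (m x ^+ 2 + m y ^+ 2 + m z ^+ 2).
  left; exists (m x), (m y), (m z); split => // u /H.
  have c1 : 0 <= 1 + dot x y z t1 t3.
    by have /andP[] := D _ _ i1 i3; rewrite -subr_ge0 opprK addrC.
  case=> -[al [be [b0 -> -> ->]]].
    rewrite [leRHS](_ : _ = al * (x t1 * x a + y t1 * y a + z t1 * z a)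
      + al * (x t3 * x a + y t3 * y a + z t3 * z a)
      + be * (x t1 ^+ 2 + y t1 ^+ 2 + z t1 ^+ 2 + dot x y z t1 t3)); last by rewrite /m /dot; ring.
    by rewrite o1 o3 n1 !mulr0 !add0r mulr_ge0.
  rewrite [leRHS](_ : _ = al * (x t1 * x a + y t1 * y a + z t1 * z a)
      + al * (x t3 * x a + y t3 * y a + z t3 * z a)
      + be * (x t3 ^+ 2 + y t3 ^+ 2 + z t3 ^+ 2 + dot x y z t1 t3)); last by rewrite /m /dot; ring.
  by rewrite o1 o3 n3 !mulr0 !add0r mulr_ge0.
right; have [mx my mz] := sum3_sqr_eq0 m0.
exists (y a * z t1 - z a * y t1), (z a * x t1 - x a * z t1), (x a * y t1 - y a * x t1).
split.
  transitivity ((x a ^+ 2 + y a ^+ 2 + z a ^+ 2) * (x t1 ^+ 2 + y t1 ^+ 2 + z t1 ^+ 2)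
    - (x t1 * x a + y t1 * y a + z t1 * z a) ^+ 2); first by ring.
  by rewrite o1 n1 na expr0n mulr1 subr0.
have x3 : x t3 = - x t1 by move: mx; rewrite /m; lra.
have y3 : y t3 = - y t1 by move: my; rewrite /m; lra.
have z3 : z t3 = - z t1 by move: mz; rewrite /m; lra.
by move=> u /H[] [al [be [_ -> -> ->]]]; rewrite ?x3 ?y3 ?z3; ring.
Qed.

Lemma sphere_isop (R : realType) (a b : R) E (x dx y dy z dz : R -> R) U A :
  setup 1 a b E x dx y dy z dz U A -> A <= 2 * pi ->
  let L := prim a (speed 1 dx dy dz) b in
  4 * pi * A - 1 * A ^+ 2 <= L ^+ 2 /\
  (L ^+ 2 = 4 * pi * A - 1 * A ^+ 2 -> round 1 a b x y z A).
Proof.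
move=> hs A2 L; have hk : curv (1 : R) by right; right.
have kn : (1 : R) != 0 by exact: oner_neq0.
have [hc hU hA A0 cl inj] := hs; have [ab px py pz hmd] := hc; have [xab yab zab] := cl.
have hl : loop a b E x dx y dy z dz by split.
pose V := prim a (speed 1 dx dy dz).
have pV : pwd a b E V (speed 1 dx dy dz) by apply: pwd_prim; [exact: ltW|exact: pwc_speed hc].
have Va : V a = 0 by rewrite /V prim_self.
have L0 : 0 <= L.
  have := pwd_le (pwd_cst a b E 0) pV (lexx a) (ltW ab) (lexx b).
  by rewrite Va !subr0 => H; apply: H => u _ _; exact: sqrtr_ge0.
have p0 := pi_gt0 R.
have [tm /andP[am mb] Vm] : exists2 t, a <= t <= b & V t = L / 2.
  have [|t ht <-] := IVT (ltW ab) (pwd_continuous pV) (v := L / 2); last by exists t.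
  by rewrite Va /V -/L (min_l L0) (max_r L0); apply/andP; split; move: L0; clear; lra.
have ia : a <= a <= b by rewrite lexx ltW.
have im : a <= tm <= b by rewrite am.
have D s t : a <= s <= b -> a <= t <= b -> -1 <= dot x y z s t <= 1.
  by move=> hs' ht; exact: sph_dot1 (hmd _ hs') (hmd _ ht).
(* Each point of the curve has total distance at most L / 2 to g(a) and g(tm); when this is below
   pi, its inner product with their sum is positive. *)
pose m (f : R -> R) := f a + f tm.
have mE u : m x * x u + m y * y u + m z * z u = dot x y z a u + dot x y z tm u.
  by rewrite /m /dot; ring.
have sum u : a <= u <= b -> acos (dot x y z a u) + acos (dot x y z tm u) <= L / 2.
  move=> /andP[au ub]; have [um|/ltW um] := leP u tm.
    have := sph_arc hc (lexx a) au ub; have := sph_arc hc au um mb.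
    by rewrite -/V Va Vm [dot x y z u tm]dotC; clear; lra.
  have := sph_arc hc au ub (lexx b); have := sph_arc hc am um ub.
  have -> : dot x y z u b = dot x y z a u by rewrite dotC /dot xab yab zab.
  by rewrite -/V Vm /V -/L; clear; lra.
have [Llt|Lge] := ltP L (2 * pi).
  have L2 : L / 2 < pi by rewrite ltr_pdivrMr// mulrC.
  have pos u : a <= u <= b -> 0 < m x * x u + m y * y u + m z * z u.
    move=> hu; have h := le_lt_trans (sum u hu) L2.
    by rewrite mE; apply: (acos_sum_ge0 (D _ _ ia hu) (D _ _ im hu) (ltW h)).2.
  have m0 : 0 < m x ^+ 2 + m y ^+ 2 + m z ^+ 2.
    rewrite lt_neqAle !addr_ge0 ?sqr_ge0// andbT; apply/eqP => h.
    have [h1 h2 h3] : [/\ m x = 0, m y = 0 & m z = 0] by apply: sum3_sqr_eq0; rewrite -h.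
    by have := pos a ia; rewrite h1 h2 h3 !mul0r !addr0 ltxx.
  pose n := Num.sqrt (m x ^+ 2 + m y ^+ 2 + m z ^+ 2).
  have n0 : 0 < n by rewrite sqrtr_gt0.
  have n2 : n ^+ 2 = m x ^+ 2 + m y ^+ 2 + m z ^+ 2 by rewrite sqr_sqrtr// ltW.
  have nn := lt0r_neq0 n0.
  have u1 : (m x / n) ^+ 2 + (m y / n) ^+ 2 + (m z / n) ^+ 2 = 1.
    by rewrite !expr_div_n -!mulrDl -n2 divff// expf_neq0.
  have [phi [tau Y]] := tilt_axis u1.
  have hs' := setup_tilt phi tau hk hs.
  have hg : good_axis 1 a b (fun t => tiltx 1 phi (x t) (z t)) (fun x y z => tiltU 1 phi tau U y x z).
    apply: (hemisphere_axis hs' A2) => t /pos h; rewrite Y.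
    rewrite (_ : _ + _ = (m x * x t + m y * y t + m z * z t) / n); last by field.
    by rewrite divr_gt0.
  have := good_isop hk (setup_swap hs') hg.
  rewrite swap_length (tilt_length phi tau hk hc) -/L => -[h1 h2]; split => // LE.
  by apply: (@round_tilt _ 1 phi tau) => //; apply: round_swap; exact: h2.
(* In this form L >= 2 pi gives the inequality at once, and equality forces A = L = 2 pi. *)
have E4 : 4 * pi * A - 1 * A ^+ 2 = (2 * pi) ^+ 2 - (2 * pi - A) ^+ 2 by ring.
have L4 : (2 * pi) ^+ 2 <= L ^+ 2 by rewrite ler_pXn2r ?nnegrE// mulr_ge0// ltW.
split; first by rewrite E4; apply: le_trans L4; rewrite gerBl sqr_ge0.
rewrite E4 => LE; have s0 : (2 * pi - A) ^+ 2 = 0.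
  by apply/le_anti; rewrite sqr_ge0 andbT; move: L4; rewrite LE lerBrDl gerDr.
have AE : A = 2 * pi by move/eqP: s0; rewrite sqrf_eq0 subr_eq0 => /eqP.
have L2 : L = 2 * pi.
  by apply/eqP; rewrite -(@eqrXn2 _ 2)// ?mulr_ge0 ?ltW// LE s0 subr0.
have Lpi : L / 2 = pi by rewrite L2 mulrC mulKf.
suff [q1 [q2 [q3 [hq H]]]] : exists o1 o2 o3, o1 ^+ 2 + o2 ^+ 2 + o3 ^+ 2 = 1 /\
    forall t, a <= t <= b -> o1 * x t + o2 * y t + o3 * z t = 0.
  have pn := lt0r_neq0 p0.
  exists 0, 1, q1, q2, q3; split; first split => //.
  - by rewrite AE mul1r divff ?subrr// mulf_neq0.
  - rewrite AE (_ : _ * _ = (2 * pi) ^+ 2); last by ring.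
    by rewrite sqrtr_sqr ger0_norm ?mulr_ge0 ?ltW// divff// mulf_neq0.
  - by rewrite expr0n expr1n add0r mulr1.
  split; first by split; [rewrite mul1r|rewrite eqxx].
  move=> t tab; have h := H t tab; have h1 := md1 (hmd t tab).
  rewrite expr1n mulr1 addr0 divr1 /sqdist mul1r.
  transitivity ((x t ^+ 2 + y t ^+ 2 + z t ^+ 2) + (q1 ^+ 2 + q2 ^+ 2 + q3 ^+ 2)
    - 2 * (q1 * x t + q2 * y t + q3 * z t)); first by ring.
  by rewrite h h1 hq mulr0 subr0.
have [m0|m0] := ltP 0 (m x ^+ 2 + m y ^+ 2 + m z ^+ 2).
  apply: (hemisphere_plane hs AE L2 m0) => t tab; rewrite mE.
  apply: (acos_sum_ge0 (D _ _ ia tab) (D _ _ im tab) _).1.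
  by rewrite -Lpi; exact: sum.
(* The sum vanishes, so the two bisecting points are antipodal. *)
have [mx my mz] := sum3_sqr_eq0 m0.
have [||||[m1 [m2 [m3 [hm H]]]]|//] := sphere_antipodal hl L2 im.
- by rewrite -/V Vm Lpi.
- by move: mx; rewrite /m; lra.
- by move: my; rewrite /m; lra.
- by move: mz; rewrite /m; lra.
exact: hemisphere_plane hs AE L2 hm H.
Qed.

(** * Closed curves on a circle *)

(** A negative derivative at t would persist on an interval by continuity and keep f from increasing
    there. *)
Lemma increasing_deriv_ge0 (R : realType) (a b : R) E (f df : R -> R) : pwd a b E f df ->
  (forall s t, a <= s -> s < t -> t <= b -> f s < f t) ->
  forall t, a < t < b -> t \notin E -> 0 <= df t.
Proof.
move=> pf H t tab tE; rewrite leNgt; apply/negP => neg.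
have [_ _ [/(_ t tab tE) cd _]] := pf.
have : \forall s \near t, (a < s < b /\ s \notin E) /\ df s < 0.
  have h1 := near_itv_notin tab tE.
  have h2 : \forall s \near t, df s < 0 by by apply: (cvgr_lt (df t) cd).
  by near=> s; split; [near: s|near: s].
move=> /nbhs_ballP[d /= d0 Hd].
have near_ s : t <= s <= t + d / 2 -> (a < s < b /\ s \notin E) /\ df s < 0.
  move=> /andP[s1 s2]; apply: Hd; rewrite /ball/= distrC ger0_norm ?subr_ge0//.
  by move: s2 d0; clear; lra.
have d2 : t < t + d / 2 by rewrite ltrDl divr_gt0.
have [[/andP[_ tb] _] _] : (a < t + d / 2 < b /\ t + d / 2 \notin E) /\ df (t + d / 2) < 0.
  by apply: near_; rewrite lexx ltW.
have at_ : a <= t by case/andP: tab => /ltW.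
have := H t (t + d / 2) at_ d2 (ltW tb); apply/negP; rewrite -leNgt.
have := pwd_le pf (pwd_cst a b E 0) at_ (ltW d2) (ltW tb).
rewrite subrr subr_le0; apply => u /andP[u1 u2] _.
by have [_ /ltW] := near_ u (introT andP (conj (ltW u1) (ltW u2))).
Unshelve. all: by end_near.
Qed.

Lemma sin_periodz (R : realType) (u : R) (n : int) : sin (u + n%:~R * (2 * pi)) = sin u /\
  cos (u + n%:~R * (2 * pi)) = cos u.
Proof.
have key (m : nat) (v : R) : sin (v + m%:R * (2 * pi)) = sin v /\ cos (v + m%:R * (2 * pi)) = cos v.
  elim: m v => [|m IH] v; first by rewrite mul0r addr0.
  have -> : v + m.+1%:R * (2 * pi) = (v + m%:R * (2 * pi)) + pi *+ 2.
    by rewrite -natr1 mulr2n; ring.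
  by rewrite sinD2pi cosD2pi; exact: IH.
case: n => n; first exact: key.
have [h1 h2] := key n.+1 (u + (Negz n)%:~R * (2 * pi)).
move: h1 h2; rewrite NegzE mulrNz mulNr.
by rewrite -pmulrn subrK => -> ->.
Qed.

(* The angle of an injective closed curve on the unit circle is a continuous injective,
   hence monotone, function of the parameter. *)
Lemma circle_turn (R : realType) (a b : R) E (X dX Y dY : R -> R) :
  curve 1 a b E X dX (fun=> 0) (fun=> 0) Y dY -> X a = X b -> Y a = Y b ->
  (forall s t, a <= s < b -> a <= t < b -> X s = X t -> Y s = Y t -> s = t) ->
  prim a (fun t => `|Y t * dX t - X t * dY t|) b = 2 * pi /\
  forall p q, p ^+ 2 + q ^+ 2 = 1 -> exists t, [/\ a <= t <= b, X t = p & Y t = q].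
Proof.
move=> hc Xab Yab inj; have hk : curv (1 : R) by right; right.
have [ab _ _ _ _] := hc.
have y0 t : a <= t <= b -> 0 < 1 - 1 * (0 : R) ^+ 2 by move=> _; rewrite expr0n mulr0 subr0.
have [th pth0 hth0] := curve_lift hk hc y0.
have l0 : lrad 1 (0 : R) = 1 by rewrite /lrad expr0n mulr0 subr0 sqrtr1.
have hth t : a <= t <= b -> X t = sin (th t) /\ Y t = cos (th t).
  by move=> /hth0[-> ->]; rewrite l0 !mul1r /snk /csk eqxx.
have {}pth0 : pwd a b E th (fun t => Y t * dX t - X t * dY t).
  by move: pth0; apply: pwd_ext => t; rewrite expr0n mulr0 subr0 invr1 mulr1.
(* The sign that makes the angle at b at least the angle at a. *)
pose s : R := if th a <= th b then 1 else -1.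
have s2 : s * s = 1 by rewrite /s; case: ifP => _; rewrite ?mulr1// mulrNN mulr1.
have s2' w : s * (s * w) = w by rewrite mulrA s2 mul1r.
pose ps t := s * th t; pose dps t := s * (Y t * dX t - X t * dY t).
have pps : pwd a b E ps dps by exact: pwdZ.
have psab : ps a <= ps b.
  rewrite /ps /s; case: ifPn => [|]; first by rewrite !mul1r.
  by rewrite -ltNge !mulN1r lerN2 => /ltW.
have cps := pwd_continuous pps.
have trig t u (n : int) : a <= t <= b -> a <= u <= b -> ps t = ps u + n%:~R * (2 * pi) ->
    X t = X u /\ Y t = Y u.
  move=> ht hu h; have [-> ->] := hth t ht; have [-> ->] := hth u hu.
  have -> : th t = th u + (if th a <= th b then n else - n)%:~R * (2 * pi).
    rewrite -[LHS]s2' -/(ps t) h mulrDr s2'; congr (_ + _).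
    by rewrite /s; case: ifP => _; rewrite ?mul1r// mulN1r mulrNz mulNr.
  exact: sin_periodz.
have ia : a <= a <= b by rewrite lexx ltW.
have ib : a <= b <= b by rewrite lexx ltW.
have inj0 t u : a <= t -> t < u -> u < b -> ps t = ps u -> False.
  move=> at_ tu ub h; have it : a <= t < b by rewrite at_ (lt_trans tu).
  have iu : a <= u < b by rewrite ub (le_trans at_)// ltW.
  have [h1 h2] : X t = X u /\ Y t = Y u.
    apply: (trig t u 0); rewrite ?mul0r ?addr0//.
      by case/andP: it => -> /ltW.
    by case/andP: iu => -> /ltW.
  by have := inj t u it iu h1 h2 => e; move: tu; rewrite e ltxx.
have inj1 t : a < t -> t < b -> ps t = ps b -> False.
  move=> at_ tb h.
  have [h1 h2] : X t = X b /\ Y t = Y b.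
    by apply: (trig t b 0); rewrite ?mul0r ?addr0// !ltW.
  rewrite -Xab -Yab in h1 h2.
  have : t = a by apply: inj; rewrite ?lexx ?ab ?(ltW at_).
  by move=> e; move: at_; rewrite e ltxx.
have cs u v : a <= u -> v <= b -> {within `[u, v], continuous ps}.
  by move=> au vb; exact: within_cont_sub cps.
(* If both ends had the same angle, a value strictly between it and the angle at the midpoint c
   would be taken on either side of c. *)
have nab : ps a != ps b.
  apply/eqP => e; pose c := (a + b) / 2.
  have ac : a < c by rewrite /c; move: ab; clear; lra.
  have cb : c < b by rewrite /c; move: ab; clear; lra.
  pose v := (ps a + ps c) / 2.
  have nc : ps a <> ps c by exact: inj0.
  have bt : Num.min (ps a) (ps c) <= v <= Num.max (ps a) (ps c) /\ v <> ps a /\ v <> ps c.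
    rewrite /v; split; last by split => h; apply: nc; move: h; clear; lra.
    by case: (ltgtP (ps a) (ps c)) => h; apply/andP; split; move: h; clear; lra.
  have [b1 [b2 b3]] := bt.
  have [t1 + h1] := IVT (ltW ac) (cs a c (lexx a) (ltW cb)) b1.
  have [t2 + h2] : exists2 t, t \in `[c, b] & ps t = v.
    by apply: IVT; [exact: ltW|exact: cs (ltW ac) (lexx b)|rewrite -e minC maxC].
  rewrite !in_itv/= => /andP[g3 g4] /andP[g1 g2].
  have {}g2 : t1 < c by rewrite lt_neqAle g2 andbT; apply/eqP => h; apply: b3; rewrite -h1 h.
  have {}g3 : c < t2 by rewrite lt_neqAle g3 andbT; apply/eqP => h; apply: b3; rewrite -h2 -h.
  have {}g4 : t2 < b by rewrite lt_neqAle g4 andbT; apply/eqP => h; apply: b2; rewrite -h2 h e.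
  by apply: (inj0 t1 t2 g1 (lt_trans g2 g3) g4); rewrite h1 h2.
have injf : {in `[a, b] &, injective ps}.
  have key t u : a <= t -> t < u -> u <= b -> ps t = ps u -> False.
    move=> at_ tu; rewrite le_eqVlt => /predU1P[uE|ub]; last exact: inj0.
    move: at_; rewrite le_eqVlt => /predU1P[tE|at_]; first by rewrite uE -tE => /eqP; rewrite (negbTE nab).
    by rewrite uE in tu *; exact: inj1.
  move=> t u; rewrite !in_itv/= => /andP[t1 t2] /andP[u1 u2] h.
  by case: (ltgtP t u) => // tu; exfalso; [exact: (key t u)|exact: (key u t)].
have mono := segment_continuous_inj_le psab cps injf.
have incr t u : a <= t -> t < u -> u <= b -> ps t < ps u.
  move=> at_ tu ub; have it : t \in `[a, b] by rewrite in_itv/= at_ (le_trans (ltW tu)).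
  have iu : u \in `[a, b] by rewrite in_itv/= ub (le_trans at_)// ltW.
  by rewrite lt_neqAle mono// ltW// andbT; apply/eqP => /(injf _ _ it iu) e;
    move: tu; rewrite e ltxx.
have dps0 := increasing_deriv_ge0 pps incr.
have pp := pi_gt0 R.
(* The total angle is a positive multiple of 2 pi; a larger multiple than the first would bring the
   curve back to its starting point before b. *)
have turn : ps b = ps a + 2 * pi.
  have [n hn] : exists n : int, th a + n%:~R * (2 * pi) = th b.
    have [e1 e2] := hth a ia; have [e3 e4] := hth b ib.
    by apply: sin_cos_eq; rewrite -?e1 -?e2 -?e3 -?e4.
  have [m hm] : exists m : int, ps b = ps a + m%:~R * (2 * pi).
    exists (if th a <= th b then n else - n); rewrite /ps -[in LHS]hn mulrDr; congr (_ + _).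
    by rewrite /s; case: ifP => _; rewrite ?mul1r// mulN1r mulrNz mulNr.
  have m0 : (0 < m)%R.
    have tp : 0 < 2 * pi :> R by rewrite mulr_gt0.
    rewrite -(ltr0z R) -(pmulr_lgt0 _ tp).
    by have := incr a b (lexx a) ab (lexx b); rewrite hm ltrDl.
  have [m1|m1] := eqVneq m 1; first by rewrite hm m1 mul1r.
  have m2 : 2 <= m%:~R :> R.
    rewrite (_ : 2 = (1 + 1 : int)%:~R :> R)// ler_int lez1D lt_neqAle eq_sym m1/=.
    by rewrite -gtz0_ge1.
  exfalso; have w1 : ps a <= ps a + 2 * pi <= ps b.
    have : 2 * (2 * pi) <= m%:~R * (2 * pi) :> R by rewrite ler_wpM2r// mulr_ge0// ltW.
    by rewrite hm => mm; apply/andP; split; move: mm pp; clear; lra.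
  have w2 : Num.min (ps a) (ps b) <= ps a + 2 * pi <= Num.max (ps a) (ps b).
    by rewrite (min_l psab) (max_r psab).
  have [t + ht] := IVT (ltW ab) cps w2; rewrite in_itv/= => /andP[t1 t2].
  have at_ : a < t.
    rewrite lt_neqAle t1 andbT; apply/eqP => e; move: ht; rewrite -e; move: pp; clear; lra.
  have tb : t < b.
    rewrite lt_neqAle t2 andbT; apply/eqP => e; move: ht; rewrite e hm => /addrI.
    have : 2 * (2 * pi) <= m%:~R * (2 * pi) :> R by rewrite ler_wpM2r// mulr_ge0// ltW.
    by move=> h1 h2; rewrite h2 in h1; move: h1 pp; clear; lra.
  have [h1 h2] : X t = X a /\ Y t = Y a.
    by apply: (trig t a 1) => //; [rewrite t1|rewrite mul1r].
  have : t = a by apply: inj => //; rewrite ?lexx ?ab// t1.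
  by move=> e; move: at_; rewrite e ltxx.
split.
  have pV : pwd a b E (prim a (fun t => `|Y t * dX t - X t * dY t|))
      (fun t => `|Y t * dX t - X t * dY t|).
    by apply: pwd_prim; [exact: ltW|apply: pwc_norm; have [_ _] := pth0].
  have absE u : a < u < b -> u \notin E -> `|Y u * dX u - X u * dY u| = dps u.
    move=> hu uE; have h := dps0 u hu uE; rewrite -(ger0_norm h) /dps normrM.
    have -> : `|s| = 1 by rewrite /s; case: ifP => _; rewrite ?normrN normr1.
    by rewrite mul1r.
  have dz u : a < u < b -> u \notin E -> `|Y u * dX u - X u * dY u| - dps u = 0.
    by move=> hu uE; rewrite absE// subrr.
  have := pwd_const (pwdB pV pps) (lexx a) (ltW ab) (lexx b) dz.
  by rewrite prim_self sub0r turn => /eqP; rewrite subr_eq => /eqP ->; ring.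
move=> p q hpq; have hpq' : md 1 p 0 q by split; [rewrite mul1r expr0n/= addr0|rewrite eqxx].
have [|u0 [pE qE]] := lon_exists hk hpq'; first by rewrite expr0n mulr0 subr0.
rewrite l0 !mul1r /snk /csk eqxx in pE qE.
pose w := s * u0; have tp : 0 < 2 * pi :> R by rewrite mulr_gt0.
pose n := Num.floor ((w - ps a) / (2 * pi)).
pose w' := w - n%:~R * (2 * pi).
have w1 : ps a <= w' <= ps b.
  have := floor_le ((w - ps a) / (2 * pi)); have := lt_succ_floor ((w - ps a) / (2 * pi)).
  rewrite -/n; rewrite ltr_pdivrMr// ler_pdivlMr// intrD mulrDl mul1r turn /w'.
  by move=> h1 h2; apply/andP; split; move: h1 h2; clear; lra.
have w2 : Num.min (ps a) (ps b) <= w' <= Num.max (ps a) (ps b).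
  by rewrite (min_l psab) (max_r psab).
have [t + ht] := IVT (ltW ab) cps w2; rewrite in_itv/= => tab.
exists t; have [-> ->] := hth t tab; rewrite pE qE.
have -> : th t = u0 + (if th a <= th b then - n else n)%:~R * (2 * pi).
  rewrite -[LHS]s2' -/(ps t) ht /w' mulrBr s2'; congr (_ + _).
  by rewrite /s; case: ifP => _; [rewrite mul1r mulrNz mulNr|rewrite mulN1r opprK].
by have [-> ->] := sin_periodz u0 (if th a <= th b then - n else n).
Qed.

(** * Circles moved to the centre (0, 0, 1) *)

Lemma curv_sqr (R : realType) (k : R) : curv k -> k != 0 -> k ^+ 2 = 1.
Proof. by move=> [|[|]] ->; rewrite ?eqxx// => _; rewrite ?sqrrN expr1n. Qed.

Lemma lon_exists_weak (R : realType) (k x y z : R) : curv k -> md k x y z ->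
  0 <= 1 - k * y ^+ 2 /\
  exists u, x = lrad k y * snk k u /\ z = lrad k y * csk k u.
Proof.
move=> hk hm; have [h hz] := hm; have [k1|kn] := eqVneq k 1.
  have q : 1 - k * y ^+ 2 = x ^+ 2 + z ^+ 2 by rewrite -h k1; ring.
  have q0 : 0 <= 1 - k * y ^+ 2 by rewrite q addr_ge0 ?sqr_ge0.
  split => //; move: (q0); rewrite le_eqVlt => /predU1P[e|]; last exact: lon_exists.
  have [-> ->] : x = 0 /\ z = 0 by apply: sum_sqr_eq0; rewrite -q -e.
  by exists 0; rewrite /lrad -e sqrtr0 !mul0r.
have q0 : 0 < 1 - k * y ^+ 2.
  case: hk kn => [|[|]] ->; rewrite ?eqxx// => _; last by rewrite mul0r subr0.
  by have := sqr_ge0 y; clear; lra.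
by split; [exact: ltW|exact: lon_exists].
Qed.

(** phi brings the centre to longitude 0, and tau then brings its height to 0. The centre may be a
    pole of the y-axis, hence the weak form of [lon_exists]. *)
Lemma tilt_center (R : realType) (k o1 o2 o3 : R) : curv k -> md k o1 o2 o3 ->
  exists phi tau, [/\ tiltx k phi o1 o3 = 0, tilty k phi tau o1 o2 o3 = 0 &
    tiltz k phi tau o1 o2 o3 = 1].
Proof.
move=> hk ho; have [q0 [phi [e1 e3]]] := lon_exists_weak hk ho.
set q := lrad k o2 in e1 e3; have q2 : q ^+ 2 = 1 - k * o2 ^+ 2 by rewrite sqr_sqrtr.
have hq : md k o2 0 q.
  split=> [|kn]; first by rewrite q2 expr0n/=; ring.
  rewrite lt_neqAle sqrtr_ge0 andbT eq_sym; apply/eqP => q00.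
  by have [_ /(_ kn)] := ho; rewrite e3 q00 mul0r ltxx.
have [_ [tau [g1 g2]]] := lon_exists_weak hk hq.
have l0 : lrad k (0 : R) = 1 by rewrite /lrad expr0n mulr0 subr0 sqrtr1.
rewrite l0 mul1r in g1; rewrite l0 mul1r in g2.
have t1 : tilt1 k phi o1 o3 = q.
  rewrite /tilt1 e1 e3.
  transitivity (q * (csk k phi ^+ 2 + k * snk k phi ^+ 2)); first by ring.
  by rewrite csk2snk2// mulr1.
exists phi, tau; split.
- by rewrite /tiltx e1 e3; ring.
- by rewrite /tilty t1 -g1 -g2; ring.
- by rewrite /tiltz t1 -g1 -g2 -expr2 q2; ring.
Qed.

Lemma md0 (R : realType) (x y z : R) : md 0 x y z -> z = 1.
Proof.
move=> [h hz]; rewrite mul0r add0r in h; apply/eqP.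
by rewrite -(@eqrXn2 _ 2) ?expr1n ?h1 ?h//; apply: ltW; apply: hz; rewrite eq_sym oner_eq0.
Qed.

Lemma tilt_sqdist_md (R : realType) (k phi tau x y z o1 o2 o3 : R) : curv k ->
  md k x y z -> md k o1 o2 o3 ->
  sqdist k (tiltx k phi x z) (tilty k phi tau x y z) (tiltz k phi tau x y z)
    (tiltx k phi o1 o3) (tilty k phi tau o1 o2 o3) (tiltz k phi tau o1 o2 o3) =
  sqdist k x y z o1 o2 o3.
Proof.
move=> hk hm ho; have [k0|kn] := eqVneq k 0; last exact: tilt_sqdist.
rewrite k0 in hm ho *; rewrite (md0 hm) (md0 ho).
have c (u : R) : csk 0 u = 1 by rewrite /csk !curvE.
by rewrite /sqdist /tiltx /tilty /tiltz /tilt1 !c; ring.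
Qed.

Lemma md_tilt (R : realType) (k phi tau x y z : R) : curv k -> md k x y z ->
  md k (tiltx k phi x z) (tilty k phi tau x y z) (tiltz k phi tau x y z).
Proof.
move=> hk /(md_rot phi hk)/md_swap/(md_rot tau hk)/md_swap; exact.
Qed.

Lemma tilt_inj (R : realType) (k phi tau x y z x' y' z' : R) : curv k ->
  tiltx k phi x z = tiltx k phi x' z' ->
  tilty k phi tau x y z = tilty k phi tau x' y' z' ->
  tiltz k phi tau x y z = tiltz k phi tau x' y' z' -> [/\ x = x', y = y' & z = z'].
Proof.
move=> hk h1 h2 h3.
have [a1 a2] := rot_inverse tau y (tilt1 k phi x z) hk.
have [b1 b2] := rot_inverse tau y' (tilt1 k phi x' z') hk.
rewrite /tilty in h2; rewrite /tiltz in h3.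
have e1 : y = y' by rewrite -a1 -b1 h2 h3.
have e2 : tilt1 k phi x z = tilt1 k phi x' z' by rewrite -a2 -b2 h2 h3.
have [c1 c2] := rot_inverse phi x z hk; have [d1 d2] := rot_inverse phi x' z' hk.
rewrite /tiltx in h1; rewrite /tilt1 in e2.
by split => //; [rewrite -c1 -d1 h1 e2|rewrite -c2 -d2 h1 e2].
Qed.

(** Around (0, 0, 1) the circle is a section by the plane z = c: for k <> 0 the squared chord is an
    affine function of Z on the surface. *)
Lemma circle_flat (R : realType) (k c r X Y Z : R) : curv k -> md k X Y Z ->
  c ^+ 2 + k * r ^+ 2 = 1 -> 0 <= c ->
  sqdist k X Y Z 0 0 1 = 2 * r ^+ 2 / (1 + c) -> X ^+ 2 + Y ^+ 2 = r ^+ 2 /\ Z = c.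
Proof.
move=> hk hm cr c0; have cp : 0 < 1 + c by rewrite (lt_le_trans ltr01)// lerDl.
have cn := lt0r_neq0 cp; rewrite /sqdist !subr0 => h.
have [k0|kn] := eqVneq k 0.
  move: hm cr h; rewrite k0 => /md0 -> cr h.
  have c1 : c = 1.
    have : (c - 1) * (1 + c) = 0.
      by transitivity (c ^+ 2 + 0 * r ^+ 2 - 1); [ring|rewrite cr subrr].
    by move/eqP; rewrite mulf_eq0 (negbTE cn) orbF subr_eq0 => /eqP.
  split; last by rewrite c1.
  by move: h; rewrite mul0r addr0 => ->; rewrite c1; field.
have k2 := curv_sqr hk kn; have [hm1 _] := hm.
have {}h : (X ^+ 2 + Y ^+ 2 + k * (Z - 1) ^+ 2) * (1 + c) = 2 * r ^+ 2 by rewrite h divfK.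
have e1 : k * (X ^+ 2 + Y ^+ 2 + k * (Z - 1) ^+ 2) = 2 * (1 - Z).
  transitivity ((k * (X ^+ 2 + Y ^+ 2) + Z ^+ 2) - Z ^+ 2 + k ^+ 2 * (Z - 1) ^+ 2); first by ring.
  by rewrite hm1 k2; ring.
have ZE : Z = c.
  have : 2 * (1 - Z) * (1 + c) = 2 * (1 - c) * (1 + c).
    rewrite -e1 -[LHS]mulrA h; transitivity (2 * (k * r ^+ 2)); first by ring.
    have -> : k * r ^+ 2 = 1 - c ^+ 2 by rewrite -cr; ring.
    by ring.
  by move/(mulIf cn); clear; lra.
split => //; apply: (mulfI kn).
have -> : k * r ^+ 2 = 1 - c ^+ 2 by rewrite -cr; ring.
by rewrite -ZE -hm1; ring.
Qed.

(** Tilt the centre to (0, 0, 1). Then Z is constant and (X, Y) / r is an injective closed curve on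
    the Euclidean unit circle, so that [circle_turn] gives both its length and its surjectivity. *)
Lemma round_curve (R : realType) (k a b c r o1 o2 o3 : R) E (x dx y dy z dz : R -> R) :
  curv k -> curve k a b E x dx y dy z dz -> [/\ x a = x b, y a = y b & z a = z b] ->
  (forall s t, a <= s < b -> a <= t < b -> x s = x t -> y s = y t -> z s = z t -> s = t) ->
  md k o1 o2 o3 -> c ^+ 2 + k * r ^+ 2 = 1 -> 0 < r -> 0 <= c ->
  (forall t, a <= t <= b -> sqdist k (x t) (y t) (z t) o1 o2 o3 = 2 * r ^+ 2 / (1 + c)) ->
  prim a (speed k dx dy dz) b = 2 * pi * r /\
  forall p1 p2 p3, md k p1 p2 p3 -> sqdist k p1 p2 p3 o1 o2 o3 = 2 * r ^+ 2 / (1 + c) ->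
    exists t, [/\ a <= t <= b, x t = p1, y t = p2 & z t = p3].
Proof.
move=> hk hc [xab yab zab] inj ho cr r0 c0 H; have rn := lt0r_neq0 r0.
have [phi [tau [t1 t2 t3]]] := tilt_center hk ho.
have hc' := curve_tilt phi tau hk hc.
rewrite -(tilt_length phi tau hk hc).
pose X t := tiltx k phi (x t) (z t); pose dX t := tiltx k phi (dx t) (dz t).
pose Y t := tilty k phi tau (x t) (y t) (z t); pose dY t := tilty k phi tau (dx t) (dy t) (dz t).
pose Z t := tiltz k phi tau (x t) (y t) (z t); pose dZ t := tiltz k phi tau (dx t) (dy t) (dz t).
rewrite -/X -/dX -/Y -/dY -/Z -/dZ in hc' *.
have [ab pX pY pZ hmd] := hc'; have [_ _ _ _ hmd0] := hc.
have flat t : a <= t <= b -> X t ^+ 2 + Y t ^+ 2 = r ^+ 2 /\ Z t = c.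
  move=> tab; apply: (circle_flat hk (hmd t tab) cr c0).
  by rewrite -(H t tab) -(tilt_sqdist_md phi tau hk (hmd0 t tab) ho) t1 t2 t3.
have dZ0 t : a < t < b -> t \notin E -> dZ t = 0.
  by apply: (pwd_deriv_const (k := c) pZ) => s /flat[].
have hc1 : curve 1 a b E (fun t => r^-1 * X t) (fun t => r^-1 * dX t) (fun=> 0) (fun=> 0)
    (fun t => r^-1 * Y t) (fun t => r^-1 * dY t).
  split => //; try exact: pwdZ; first exact: pwd_cst.
  move=> t /flat[h _]; split; last by rewrite eqxx.
  rewrite expr0n/= addr0 mul1r !exprMn -mulrDr h -exprMn mulVf ?expr1n//.
have [turn surj] : prim a (fun t => `|(r^-1 * Y t) * (r^-1 * dX t) - (r^-1 * X t) * (r^-1 * dY t)|) b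
    = 2 * pi /\
  forall p q, p ^+ 2 + q ^+ 2 = 1 -> exists t, [/\ a <= t <= b, r^-1 * X t = p & r^-1 * Y t = q].
  apply: (circle_turn hc1).
  - by rewrite /X xab zab.
  - by rewrite /Y xab yab zab.
  - move=> s t hs ht h1 h2; have ir : r^-1 != 0 by rewrite invr_eq0.
    have hs' : a <= s <= b by case/andP: hs => -> /ltW.
    have ht' : a <= t <= b by case/andP: ht => -> /ltW.
    have [_ z1] := flat s hs'; have [_ z2] := flat t ht'.
    have [] := tilt_inj hk (mulfI ir h1) (mulfI ir h2) (etrans z1 (esym z2)).
    exact: inj.
split.
  rewrite mulrC -turn.
  have ps := pwc_speed hc'.
  have pw : pwc a b E (fun t => `|(r^-1 * Y t) * (r^-1 * dX t) - (r^-1 * X t) * (r^-1 * dY t)|).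
    have [_ _ qdX] := pX; have [_ _ qdY] := pY; have qX := pwd_pwc pX.
    apply: pwc_norm; rewrite (_ : (fun t => _) = (fun t => (r^-1 * Y t) * (r^-1 * dX t)
      + (- r^-1 * X t) * (r^-1 * dY t))); last by apply/funext => t; rewrite !mulNr.
    have cM (p : R) (f : R -> R) : pwc a b E f -> pwc a b E (fun t => p * f t).
      by move=> pf; apply: pwcM => //; exact: pwc_cst.
    by apply: pwcD; apply: pwcM; apply: cM => //; exact: pwd_pwc pY.
  have eqd t : a < t < b -> t \notin E -> speed k dX dY dZ t =
      r * `|(r^-1 * Y t) * (r^-1 * dX t) - (r^-1 * X t) * (r^-1 * dY t)|.
    move=> tab tE; have tab' : a <= t <= b by case/andP: tab => /ltW-> /ltW->.
    have [h _] := flat t tab'.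
    have ht : X t * dX t + Y t * dY t = 0.
      have := curve_tangent hc1 tab tE; rewrite mul1r mulr0 addr0 => ht.
      apply: (mulfI (_ : r^-1 * r^-1 != 0)); first by rewrite mulf_neq0// invr_eq0.
      by rewrite mulr0 -ht; ring.
    rewrite /speed dZ0// expr0n/= mulr0 addr0 -[X in X * `|_|](gtr0_norm r0) -normrM.
    rewrite -sqrtr_sqr; congr Num.sqrt.
    transitivity ((r ^+ 2 * (dX t ^+ 2 + dY t ^+ 2) - (X t * dX t + Y t * dY t) ^+ 2) / r ^+ 2).
      by rewrite ht; field.
    by rewrite -h; rewrite (_ : r * (r^-1 * Y t * (r^-1 * dX t) - r^-1 * X t * (r^-1 * dY t)) =
      (Y t * dX t - X t * dY t) / r); [rewrite expr_div_n -h; congr (_ / _); ring|field].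
  have pA := pwd_prim (ltW ab) ps; have pB := pwdZ r (pwd_prim (ltW ab) pw).
  have := pwd_const (pwdB pA pB) (lexx a) (ltW ab) (lexx b).
  rewrite !prim_self mulr0 subr0 => h; have /eqP := h (fun t tab tE => etrans
    (congr1 (fun w => w - _) (eqd t tab tE)) (subrr _)).
  by rewrite subr_eq0 => /eqP.
move=> p1 p2 p3 hp hD.
have [e1 e2] : tiltx k phi p1 p3 ^+ 2 + tilty k phi tau p1 p2 p3 ^+ 2 = r ^+ 2 /\
    tiltz k phi tau p1 p2 p3 = c.
  apply: (circle_flat hk (md_tilt phi tau hk hp) cr c0).
  by rewrite -hD -(tilt_sqdist_md phi tau hk hp ho) t1 t2 t3.
have [|t [tab h1 h2]] := surj (r^-1 * tiltx k phi p1 p3) (r^-1 * tilty k phi tau p1 p2 p3).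
  by rewrite !exprMn -mulrDr e1 -exprMn mulVf// expr1n.
have ir : r^-1 != 0 by rewrite invr_eq0.
have [_ z1] := flat t tab.
have [h3 h4 h5] := tilt_inj hk (mulfI ir h1) (mulfI ir h2) (etrans z1 (esym e2)).
by exists t.
Qed.

(** * Piecewise smooth curves and their enclosures *)

Lemma pwd_weaken (R : realType) (a b : R) (E E' : seq R) (f df : R -> R) :
  {subset E <= E'} -> pwd a b E f df -> pwd a b E' f df.
Proof.
move=> EE' [cf hd [cd [K HK]]].
have nE t : t \notin E' -> t \notin E by apply: contra; exact: EE'.
split => //; first by move=> t tab /nE; exact: hd.
by split; [move=> t tab /nE; exact: cd|exists K => t tab /nE; exact: HK].
Qed.

Lemma pwd_cat (R : realType) (a b c : R) (E : seq R) (f df : R -> R) :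
  a <= c -> c <= b -> c \in E -> pwd a c E f df -> pwd c b E f df -> pwd a b E f df.
Proof.
move=> ac cb cE [c1 d1 [e1 [K1 H1]]] [c2 d2 [e2 [K2 H2]]].
have side t : a < t < b -> t \notin E -> a < t < c \/ c < t < b.
  move=> /andP[at_ tb] tE; case: (ltgtP t c) => h.
  - by left; rewrite at_.
  - by right.
  - by move: tE; rewrite h cE.
split.
- have -> : `[a, b]%classic = `[a, c]%classic `|` `[c, b]%classic.
    apply/seteqP; split=> t /=; rewrite !in_itv/=.
      move=> /andP[at_ tb]; have [tc|ct] := leP t c; [by left; rewrite at_|].
      by right; rewrite ltW.
    by case=> /andP[h1 h2]; [rewrite h1 (le_trans h2)|rewrite h2 (le_trans ac)].
  by apply: withinU_continuous => //; exact: interval_closed.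
- by move=> t tab tE; case: (side t tab tE) => h; [exact: d1|exact: d2].
- split; first by move=> t tab tE; case: (side t tab tE) => h; [exact: e1|exact: e2].
  exists (Num.max K1 K2) => t tab tE; rewrite le_max.
  by case: (side t tab tE) => h; [rewrite H1|rewrite H2 ?orbT].
Qed.

Lemma pwd_eq (R : realType) (a b : R) (f df h dh : R -> R) :
  (forall t : R, is_derive t 1 h (dh t)) -> continuous dh ->
  (forall t, a <= t <= b -> f t = h t) -> (forall t, a < t < b -> df t = dh t) ->
  pwd a b [::] f df.
Proof.
move=> hd cd fh dfh.
have ch : continuous h by move=> t; exact: continuous_derive (hd t).
have near_ (u v : R -> R) t : (forall s, a < s < b -> u s = v s) -> a < t < b ->
    \forall s \near t, v s = u s.
  move=> uv tab; have := near_itv_notin (E := [::]) tab isT.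
  by apply: filterS => s [sab _]; rewrite uv.
have fh' s : a < s < b -> f s = h s by move=> /andP[s1 s2]; apply: fh; rewrite !ltW.
split.
- apply: (@subspace_eq_continuous _ _ _ h); last exact: within_of_continuous.
  by move=> t; rewrite inE/= in_itv/= => /fh.
- move=> t tab _; rewrite dfh//.
  exact: (near_eq_is_derive (near_ f h t fh' tab) (hd t)).
- split.
    move=> t tab _; have := near_ df dh t dfh tab => nn.
    rewrite /prop_for /continuous_at dfh//; apply: cvg_trans (cd t).
    exact: near_eq_cvg.
  have [K HK] := within_bounded (within_of_continuous (a := a) (b := b) cd).
  exists K => t tab _; rewrite dfh//; apply: HK.
  by case/andP: tab => /ltW-> /ltW->.
Qed.

Lemma smooth_entry (R : realType) (g : R -> 'rV[R]_3) (j : 'I_3) : smooth g ->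
  (forall t : R, is_derive t 1 (fun t => g t 0 j) (derive1 g t 0 j)) /\
  continuous (fun t => derive1 g t 0 j).
Proof.
move=> hg; split.
  move=> t; have h0 := hg 0%N t; rewrite derive1n0 in h0.
  have h1 := (derivable_mxP _ _ _).1 h0 0 j.
  by apply: DeriveDef => //; rewrite derive1E derive_mx// mxE.
move=> t; have h0 := hg 1%N t; rewrite derive1n1 in h0.
have h1 := (derivable_mxP _ _ _).1 h0 0 j.
by apply: differentiable_continuous; exact/derivable1_diffP.
Qed.

Lemma pwd_piecewise (R : realType) (b : R) (s : seq R) (j : 'I_3) (gamma : R -> 'rV[R]_3) :
  forall a, a < b -> itv_partition a b s ->
  (forall i : nat, (i < size s)%N -> exists2 g : R -> 'rV[R]_3, smooth g &
    forall t : R, nth a (a :: s) i <= t <= nth a (a :: s) i.+1 -> gamma t = g t) ->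
  pwd a b (a :: s) (fun t => gamma t 0 j) (fun t => derive1 gamma t 0 j).
Proof.
elim: s => [a ab /itv_partition_nil|c s IH a ab hp H]; first by move=> e; move: ab; rewrite e ltxx.
have piece : pwd a c [::] (fun t => gamma t 0 j) (fun t => derive1 gamma t 0 j).
  have [g hg gE] := H 0%N isT; rewrite /= in gE.
  have [h1 h2] := smooth_entry j hg.
  apply: (pwd_eq h1 h2) => [t /gE->//|t tac].
  congr (fun_of_matrix _ _ _); rewrite !derive1E; apply: near_eq_derive.
  have := near_itv_notin (E := [::]) tac isT.
  by apply: filterS => u [/andP[u1 u2] _]; rewrite gE// !ltW.
have ac : a < c by case: hp => /= /andP[].
have hp' := itv_partition_cons hp.
have cE : c \in [:: a, c & s] by rewrite !inE eqxx orbT.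
have piece' : pwd a c [:: a, c & s] (fun t => gamma t 0 j) (fun t => derive1 gamma t 0 j).
  exact: pwd_weaken piece.
have := itv_partition_le hp'; rewrite le_eqVlt => /predU1P[cb|cb].
  by rewrite -cb.
apply: (pwd_cat (ltW ac) (ltW cb) cE piece').
apply: (@pwd_weaken _ _ _ (c :: s)); first by move=> u; rewrite !inE => ->; rewrite orbT.
apply: IH => // i isz; have [g hg gE] := H i.+1 isz; exists g => // t.
have -> : nth c (c :: s) i = nth a (c :: s) i by apply: set_nth_default; rewrite /= ltnW.
have -> : nth c (c :: s) i.+1 = nth a (c :: s) i.+1 by apply: set_nth_default.
exact: gE.
Qed.

Lemma curve_of_piecewise (R : realType) (k a b : R) (gamma : R -> 'rV[R]_3) : a < b ->
  piecewise_smooth_curve k a b gamma ->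
  exists E, curve k a b E (fun t => gamma t 0 0) (fun t => derive1 gamma t 0 0)
    (fun t => gamma t 0 1) (fun t => derive1 gamma t 0 1)
    (fun t => gamma t 0 2) (fun t => derive1 gamma t 0 2).
Proof.
move=> ab [[s hp H] hm]; exists (a :: s); split => //; exact: pwd_piecewise.
Qed.

Lemma arc_lengthE (R : realType) (k a b : R) (gamma : R -> 'rV[R]_3) :
  arc_length k a b gamma = prim a (speed k (fun t => derive1 gamma t 0 0)
    (fun t => derive1 gamma t 0 1) (fun t => derive1 gamma t 0 2)) b.
Proof. by []. Qed.

Lemma pt3_delta (R : realType) (x y z : R) :
  pt3 x y z = x *: delta_mx 0 0 + y *: delta_mx 0 1 + z *: delta_mx 0 2.
Proof.
apply/rowP => j; rewrite !mxE/=; case: j => [[|[|[|//]]] h] /=;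
  by rewrite ?mulr1 ?mulr0 ?addr0 ?add0r.
Qed.

Lemma within_pt3 (R : realType) (a b : R) (fx fy fz : R -> R) :
  {within `[a, b], continuous fx} -> {within `[a, b], continuous fy} ->
  {within `[a, b], continuous fz} ->
  {within `[a, b], continuous (fun s => pt3 (fx s) (fy s) (fz s))}.
Proof.
move=> cx cy cz.
rewrite (_ : (fun s => _) = (fun s => fx s *: delta_mx 0 0 + fy s *: delta_mx 0 1
  + fz s *: delta_mx 0 2)); last by apply/funext => s; rewrite pt3_delta.
move=> s; apply: cvgD; [apply: cvgD|]; apply: cvgZr_tmp;
  by [exact: cx|exact: cy|exact: cz].
Qed.

Lemma component_path (R : realType) (M : set 'rV[R]_3) (p : 'rV[R]_3) (fx fy fz : R -> R) (s0 s1 : R) :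
  s0 <= s1 -> {within `[s0, s1], continuous fx} -> {within `[s0, s1], continuous fy} ->
  {within `[s0, s1], continuous fz} ->
  (forall s, s0 <= s <= s1 -> M (pt3 (fx s) (fy s) (fz s))) ->
  connected_component M p (pt3 (fx s0) (fy s0) (fz s0)) ->
  connected_component M p (pt3 (fx s1) (fy s1) (fz s1)).
Proof.
move=> s01 cx cy cz HM h0; apply: (connected_component_trans h0).
have cf := within_pt3 cx cy cz.
apply: (@connected_component_max _ M ((fun s => pt3 (fx s) (fy s) (fz s)) @` `[s0, s1])).
- by exists s0 => //=; rewrite in_itv/= lexx.
- by move=> _ [s /= + <-]; rewrite in_itv/=; exact: HM.
- by apply: connected_continuous_connected => //; exact: segment_connected.
- by exists s1 => //=; rewrite in_itv/= lexx s01.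
Qed.

Lemma pt3_eta (R : realType) (p : 'rV[R]_3) : pt3 (p 0 0) (p 0 1) (p 0 2) = p.
Proof.
by apply/rowP => j; rewrite !mxE/=; case: j => [[|[|[|//]]] h] /=; congr (p _ _); apply/val_inj.
Qed.

Lemma pt3_inj (R : realType) (x y z x' y' z' : R) : pt3 x y z = pt3 x' y' z' ->
  [/\ x = x', y = y' & z = z'].
Proof.
move=> h; have [h1 h2 h3] := pt3E x y z; have [g1 g2 g3] := pt3E x' y' z'.
by split; [rewrite -[LHS]h1 h g1|rewrite -[LHS]h2 h g2|rewrite -[LHS]h3 h g3].
Qed.

Lemma model_pt3 (R : realType) (k x y z : R) : model k (pt3 x y z) <-> md k x y z.
Proof. by rewrite /model /md/=; have [-> -> ->] := pt3E x y z. Qed.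

Lemma curve_away (R : realType) (a b p1 p2 p3 : R) (x y z : R -> R) : a <= b ->
  {within `[a, b], continuous x} -> {within `[a, b], continuous y} ->
  {within `[a, b], continuous z} ->
  (forall t, a <= t <= b -> ~ [/\ p1 = x t, p2 = y t & p3 = z t]) ->
  exists2 mu, 0 < mu & forall t, a <= t <= b ->
    mu <= (x t - p1) ^+ 2 + (y t - p2) ^+ 2 + (z t - p3) ^+ 2.
Proof.
move=> ab cx cy cz H.
have cB (f : R -> R) (p : R) : {within `[a, b], continuous f} ->
    {within `[a, b], continuous (fun t => (f t - p) * (f t - p))}.
  by move=> cf; apply: withinM; apply: withinD => //; exact: within_cst.
have cf := withinD (withinD (cB _ p1 cx) (cB _ p2 cy)) (cB _ p3 cz).
have [c [c' [hc _ Hc]]] := within_range ab cf.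
exists ((x c - p1) ^+ 2 + (y c - p2) ^+ 2 + (z c - p3) ^+ 2).
  rewrite ltNge; apply/negP => /sum3_sqr_eq0[/eqP h1 /eqP h2 /eqP h3].
  by apply: (H c hc); split; apply/esym/eqP; rewrite -subr_eq0.
by move=> t /Hc /andP[+ _]; rewrite -!expr2.
Qed.

Lemma continuous_coord3 (R : realType) :
  [/\ continuous (fun v : R * R * R => v.1.1), continuous (fun v : R * R * R => v.1.2) &
    continuous (fun v : R * R * R => v.2)].
Proof.
split=> v.
- by apply: (@continuous_comp _ _ _ fst fst v); [exact: cvg_fst|exact: cvg_fst].
- by apply: (@continuous_comp _ _ _ fst snd v); [exact: cvg_fst|exact: cvg_snd].
- exact: cvg_snd.
Qed.

(* Near the surface, the central projection (x, y, z) |-> (x, y, z) / sqrt (k (x^2 + y^2) + z^2)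
   is a continuous retraction; it carries short chords to paths in the surface. *)
Lemma ropen_component (R : realType) (k a b : R) (x y z : R -> R) (C : set 'rV[R]_3) (p0 : 'rV[R]_3) :
  a <= b ->
  {within `[a, b], continuous x} -> {within `[a, b], continuous y} ->
  {within `[a, b], continuous z} ->
  (forall q, C q -> exists2 t, a <= t <= b & q = pt3 (x t) (y t) (z t)) ->
  (forall t, a <= t <= b -> C (pt3 (x t) (y t) (z t))) ->
  ropen k (fun x y z => connected_component (model k `\` C) p0 (pt3 x y z)).
Proof.
move=> ab cx cy cz CE CE'; set M := model k `\` C.
have sub q : connected_component M p0 q -> M q by exact: connected_component_sub.
pose good (v : R * R * R) (e : R) := 0 < e /\ forall q : R * R * R, md k q.1.1 q.1.2 q.2 ->
  ball v e q -> connected_component M p0 (pt3 q.1.1 q.1.2 q.2).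
have key p1 p2 p3 : connected_component M p0 (pt3 p1 p2 p3) -> exists e, good (p1, p2, p3) e.
  move=> hp; have [/model_pt3 hm nC] := sub _ hp; have [hm1 hm2] := hm.
  have [|mu mu0 Hmu] := curve_away (p1 := p1) (p2 := p2) (p3 := p3) ab cx cy cz.
    by move=> t tab [e1 e2 e3]; apply: nC; rewrite e1 e2 e3; exact: CE'.
  have [k1 k2 k3] := continuous_coord3 R.
  pose N (v : R * R * R) := k * (v.1.1 * v.1.1 + v.1.2 * v.1.2) + v.2 * v.2.
  have cM (f g : R * R * R -> R) : continuous f -> continuous g -> continuous (fun v => f v * g v).
    by move=> cf cg v; apply: (@continuousM _ _ f g); [exact: cf|exact: cg].
  have cD (f g : R * R * R -> R) : continuous f -> continuous g -> continuous (fun v => f v + g v).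
    by move=> cf cg v; apply: (@continuousD _ _ _ f g); [exact: cf|exact: cg].
  have cN : continuous N.
    apply: (cD); last exact: (cM).
    by apply: (cM (fun _ => k)); [move=> v; exact: cst_continuous|apply: cD; exact: cM].
  have N1 : N (p1, p2, p3) = 1 by rewrite /N/= -!expr2.
  (* The squared distance from the point p to the projection of v; as long as it is below [mu], the
     projection misses the curve. *)
  pose D (v : R * R * R) := (v.1.1 / Num.sqrt (N v) - p1) ^+ 2 + (v.1.2 / Num.sqrt (N v) - p2) ^+ 2
    + (v.2 / Num.sqrt (N v) - p3) ^+ 2.
  have cDp : {for (p1, p2, p3), continuous D}.
    have cs : {for (p1, p2, p3), continuous (fun v => (Num.sqrt (N v))^-1)}.
      apply: continuousV; first by rewrite N1 sqrtr1 oner_neq0.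
      by apply: (@continuous_comp _ _ _ N (@Num.sqrt R)); [exact: cN|exact: sqrt_continuous].
    have c1 (f : R * R * R -> R) (p : R) : continuous f ->
        {for (p1, p2, p3), continuous (fun v => (f v / Num.sqrt (N v) - p) * (f v / Num.sqrt (N v) - p))}.
      move=> cf.
      have c2 : {for (p1, p2, p3), continuous (fun v => f v / Num.sqrt (N v) - p)}.
        apply: (@continuousB _ _ _ (fun v => f v / Num.sqrt (N v)) (fun _ => p)).
          by apply: (@continuousM _ _ f (fun v => (Num.sqrt (N v))^-1)); [exact: cf|].
        exact: cst_continuous.
      exact: (continuousM c2 c2).
    exact: (continuousD (continuousD (c1 _ p1 k1) (c1 _ p2 k2)) (c1 _ p3 k3)).
  have D0 : D (p1, p2, p3) = 0 by rewrite /D N1 sqrtr1 !divr1/= !subrr expr0n/= !addr0.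
  have : \forall v \near (p1, p2, p3), [/\ 0 < N v, (k != 1 -> 0 < v.2) & D v < mu].
    have h1 : \forall v \near (p1, p2, p3), 0 < N v.
      by apply: (cvgr_gt (N (p1, p2, p3)) (cN _)); rewrite N1.
    have h2 : \forall v \near (p1, p2, p3), k != 1 -> 0 < v.2.
      have [k1'|kn1] := eqVneq k 1; first by near=> v.
      have h : \forall v \near (p1, p2, p3), 0 < v.2.
        by apply: (cvgr_gt p3 (k3 (p1, p2, p3))); exact: hm2.
      by apply: filterS h => v hv _.
    have h3 : \forall v \near (p1, p2, p3), D v < mu.
      by apply: (cvgr_lt (D (p1, p2, p3)) cDp); rewrite D0.
    by near=> v; split; near: v.
  move=> /nbhs_ballP[e /= e0 He]; exists e; split => // -[[q1 q2] q3] /= hq [[b1 b2] b3].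
  pose l1 s := p1 + s * (q1 - p1); pose l2 s := p2 + s * (q2 - p2); pose l3 s := p3 + s * (q3 - p3).
  have inb s : 0 <= s <= 1 -> [/\ 0 < N (l1 s, l2 s, l3 s), (k != 1 -> 0 < l3 s) &
      D (l1 s, l2 s, l3 s) < mu].
    move=> /andP[s0 s1]; apply: He.
    have bb (u v : R) : ball u e v -> ball u e (u + s * (v - u)).
      rewrite /ball/= opprD addNKr normrN normrM (ger0_norm s0) distrC => h.
      by apply: le_lt_trans h; rewrite ler_piMl.
    by split; [split|]; exact: bb.
  have cl (p q : R) : continuous (fun s : R => p + s * (q - p)).
    move=> s; apply: (@continuous_derive _ _ _ (q - p)).
    by apply: is_derive_eq; rewrite /GRing.scale/=; ring.
  pose S s := Num.sqrt (N (l1 s, l2 s, l3 s)).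
  have cS : {within `[0, 1], continuous S}.
    apply: within_of_continuous => s.
    apply: (@continuous_comp _ _ _ (fun s => N (l1 s, l2 s, l3 s)) (@Num.sqrt R)); last exact: sqrt_continuous.
    apply: (@continuous_comp _ _ _ (fun s => (l1 s, l2 s, l3 s)) N); last exact: cN.
    by apply: (@continuous_pair _ _ _ (fun s => (l1 s, l2 s)) l3); [apply: continuous_pair|]; exact: cl.
  have S0 s : 0 <= s <= 1 -> S s != 0.
    by move=> /inb[h _ _]; rewrite gt_eqF// sqrtr_gt0.
  have S2 s : 0 <= s <= 1 -> S s ^+ 2 = N (l1 s, l2 s, l3 s).
    by move=> /inb[h _ _]; rewrite sqr_sqrtr// ltW.
  have cq (p q : R) : {within `[0, 1], continuous (fun s => (p + s * (q - p)) / S s)}.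
    by apply: within_div => //; apply: within_of_continuous; exact: cl.
  have := component_path (M := M) (p := p0) ler01 (cq p1 q1) (cq p2 q2) (cq p3 q3).
  rewrite !mul0r !addr0 !mul1r !subrKC.
  have -> : S 0 = 1 by rewrite /S /l1 /l2 /l3 !mul0r !addr0 N1 sqrtr1.
  have -> : S 1 = 1.
    by rewrite /S /l1 /l2 /l3 !mul1r !subrKC /N/= -!expr2; have [-> _] := hq; rewrite sqrtr1.
  rewrite !divr1; apply => // s hs; have [g1 g2 g3] := inb s hs; split.
    apply/model_pt3; split=> [|kn]; last by rewrite divr_gt0 ?g2// sqrtr_gt0.
    have e4 : k * (l1 s ^+ 2 + l2 s ^+ 2) + l3 s ^+ 2 = S s ^+ 2 by rewrite S2// /N/= -!expr2.
    by rewrite !expr_div_n -mulrDl mulrA -mulrDl e4 divff// expf_neq0// S0.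
  move=> /CE[t tab /pt3_inj[e1 e2 e3]]; have := Hmu t tab.
  by rewrite -e1 -e2 -e3 leNgt => /negP; apply.
(* Taking all good pairs of centre and radius avoids choosing a radius for each point. *)
exists (\bigcup_(pe in [set pe : (R * R * R) * R | good pe.1 pe.2]) (ball pe.1 pe.2)^°).
  by apply: bigcup_open => pe _; exact: open_interior.
move=> u v w; split.
  move=> h; have [/model_pt3 hm _] := sub _ h; split => //.
  have [e he] := key _ _ _ h; exists ((u, v, w), e) => //=.
  by apply: nbhsx_ballx; have [] := he.
move=> [hm [[q e] /= [e0 H] /interior_subset hb]].
exact: (H (u, v, w)).
Unshelve. all: by end_near.
Qed.

Lemma compact_entry_bounded (R : realType) (A : set 'rV[R]_3) (j : 'I_3) : compact A ->
  exists M, forall v, A v -> `|v 0 j| <= M.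
Proof.
move=> cA; have : compact ((fun v : 'rV[R]_3 => v 0 j) @` A).
  apply: continuous_compact => //; apply: continuous_subspaceT; exact: coord_continuous.
move=> /compact_bounded[M [_ HM]]; exists (M + 1) => v Av.
by apply: HM; [rewrite ltrDl|exists v].
Qed.

Lemma domain_of_component (R : realType) (k a b : R) E (x dx y dy z dz : R -> R)
    (C : set 'rV[R]_3) (p0 : 'rV[R]_3) : curve k a b E x dx y dy z dz ->
  (forall q, C q -> exists2 t, a <= t <= b & q = pt3 (x t) (y t) (z t)) ->
  (forall t, a <= t <= b -> C (pt3 (x t) (y t) (z t))) ->
  (k != 1 -> compact (closure (connected_component (model k `\` C) p0))) ->
  domain k a b x y z (fun x y z => connected_component (model k `\` C) p0 (pt3 x y z)).
Proof.
move=> [ab px py pz hmd] CE CE' hcpt.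
have cx := pwd_continuous px; have cy := pwd_continuous py; have cz := pwd_continuous pz.
have sub q : connected_component (model k `\` C) p0 q -> (model k `\` C) q.
  exact: connected_component_sub.
split.
- exact: ropen_component (ltW ab) cx cy cz CE CE'.
- by move=> t tab /sub[_]; apply; exact: CE'.
- move=> fx fy fz s0 s1 cfx cfy cfz s01 H h0.
  apply: (component_path s01 _ _ _ _ h0); try exact: within_of_continuous.
  move=> s hs; have [h1 h2] := H s hs; split; first exact/model_pt3.
  by move=> /CE[t tab /pt3_inj[e1 e2 e3]]; apply: (h2 t tab).
- move=> k1; have cA := hcpt k1.
  have [M1 H1] := compact_entry_bounded 0 cA; have [M2 H2] := compact_entry_bounded 1 cA.
  have [M3 H3] := compact_entry_bounded 2 cA.
  exists (Num.max M1 (Num.max M2 M3)) => u v w h.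
  have hc := subset_closure h; have [e1 e2 e3] := pt3E u v w.
  split; rewrite !le_max.
  + by have := H1 _ hc; rewrite e1 => ->.
  + by have := H2 _ hc; rewrite e2 => ->; rewrite orbT.
  + by have := H3 _ hc; rewrite e3 => ->; rewrite !orbT.
Qed.

Lemma setup_of_enclosure (R : realType) (k a b A : R) (gamma : R -> 'rV[R]_3) C :
  piecewise_smooth_curve k a b gamma -> simple_closed a b gamma -> C = gamma @` `[a, b] ->
  0 < A -> encloses k C A ->
  exists E U, setup k a b E (fun t => gamma t 0 0) (fun t => derive1 gamma t 0 0)
    (fun t => gamma t 0 1) (fun t => derive1 gamma t 0 1)
    (fun t => gamma t 0 2) (fun t => derive1 gamma t 0 2) U A.
Proof.
move=> hs [ab cl inj] CE A0 [p0 _ [hcpt hA]].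
have [E hc] := curve_of_piecewise ab hs.
exists E, (fun x y z => connected_component (model k `\` C) p0 (pt3 x y z)); split => //.
- apply: (domain_of_component hc) => //.
    by move=> q; rewrite CE => -[t /= + <-]; rewrite in_itv/= => tab; exists t; rewrite // pt3_eta.
  by move=> t tab; rewrite pt3_eta CE; exists t => //=; rewrite in_itv.
- rewrite -hA; congr (area k _); apply/seteqP; split=> q; rewrite /region/= pt3_eta//.
- by rewrite cl.
- move=> s t hs' ht e1 e2 e3; apply: inj; rewrite ?in_itv//=.
  by rewrite -[gamma s]pt3_eta -[gamma t]pt3_eta e1 e2 e3.
Qed.

(** * The Riemannian distance and its circles *)

(** The form of a geodesic with initial point P and velocity V. Its derivative is of the same form
    with data V and - k P, which yields smoothness of every order. *)
Definition harmonic (R : realType) (k : R) (P V : 'rV[R]_3) (s : R) : 'rV[R]_3 :=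
  csk k s *: P + snk k s *: V.

Lemma is_derive_harmonic (R : realType) (k p v s : R) : curv k ->
  is_derive s 1 (fun s : R => csk k s * p + snk k s * v) (csk k s * v + snk k s * (- k * p)).
Proof.
move=> hk; have h1 := is_deriveM (is_derive_csk s hk) (is_derive_cst p s 1).
have h2 := is_deriveM (is_derive_snk s hk) (is_derive_cst v s 1).
have h := is_deriveD h1 h2; apply: is_derive_eq h _.
by rewrite /GRing.scale/= !mulr0 !add0r; ring.
Qed.

Lemma derivable_harmonic (R : realType) (k : R) (P V : 'rV[R]_3) (s : R) : curv k ->
  derivable (harmonic k P V) s 1.
Proof.
move=> hk; apply/derivable_mxP => i j.
rewrite (_ : (fun s => _) = (fun s => csk k s * P i j + snk k s * V i j)).
  by have [] := is_derive_harmonic (P i j) (V i j) s hk.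
by apply/funext => t; rewrite !mxE.
Qed.

Lemma derive1_harmonic (R : realType) (k : R) (P V : 'rV[R]_3) : curv k ->
  derive1 (harmonic k P V) = harmonic k V (- k *: P).
Proof.
move=> hk; apply/funext => s; rewrite derive1E derive_mx; last exact: derivable_harmonic.
apply/matrixP => i j; rewrite !mxE.
rewrite (_ : (fun s => _) = (fun s => csk k s * P i j + snk k s * V i j)); last first.
  by apply/funext => t; rewrite !mxE.
by have [_ ->] := is_derive_harmonic (P i j) (V i j) s hk.
Qed.

Lemma smooth_harmonic (R : realType) (k : R) (P V : 'rV[R]_3) : curv k ->
  smooth (harmonic k P V).
Proof.
move=> hk n t; suff [P' [V' ->]] : exists P' V', derive1n n (harmonic k P V) = harmonic k P' V'.
  exact: derivable_harmonic.
elim: n => [|n [P' [V' IH]]]; first by exists P, V.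
by exists V', (- k *: P'); rewrite derive1nS IH derive1_harmonic.
Qed.

Lemma csk_half (R : realType) (k u : R) : curv k ->
  csk k u = 1 - 2 * k * snk k (u / 2) ^+ 2 /\ 1 + csk k u = 2 * csk k (u / 2) ^+ 2 /\
  snk k u = 2 * snk k (u / 2) * csk k (u / 2).
Proof.
move=> hk; have h := csk2snk2 (u / 2) hk.
have := cskD (u / 2) (u / 2) hk; have := snkD (u / 2) (u / 2) hk; rewrite -splitr.
set c := csk k (u / 2) in h *; set s := snk k (u / 2) in h *.
move=> -> ->; split; last split.
- transitivity (c ^+ 2 + k * s ^+ 2 - 2 * k * s ^+ 2); first by ring.
  by rewrite h.
- transitivity (c ^+ 2 + k * s ^+ 2 + c ^+ 2 - k * s ^+ 2); last by ring.
  by rewrite h; ring.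
- by ring.
Qed.

Lemma md_bilinear (R : realType) (k p1 p2 p3 q1 q2 q3 rho : R) : curv k ->
  md k p1 p2 p3 -> md k q1 q2 q3 -> sqdist k q1 q2 q3 p1 p2 p3 = 4 * snk k (rho / 2) ^+ 2 ->
  k * (p1 * q1 + p2 * q2) + p3 * q3 = csk k rho.
Proof.
move=> hk hp hq hD; have [-> _] := csk_half rho hk.
have [k0|kn] := eqVneq k 0.
  by rewrite k0 in hp hq *; rewrite (md0 hp) (md0 hq); ring.
have k2 := curv_sqr hk kn; have [h1 _] := hp; have [h2 _] := hq.
apply: (mulfI (_ : (2 : R) != 0)) => //.
transitivity ((k * (p1 ^+ 2 + p2 ^+ 2) + p3 ^+ 2) + (k * (q1 ^+ 2 + q2 ^+ 2) + q3 ^+ 2)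
  - k * sqdist k q1 q2 q3 p1 p2 p3 + (k ^+ 2 - 1) * (q3 - p3) ^+ 2).
  by rewrite /sqdist; ring.
by rewrite h1 h2 hD k2; ring.
Qed.

Lemma geodesic (R : realType) (k rho : R) (p q : 'rV[R]_3) : curv k ->
  model k p -> model k q -> 0 < rho -> (k = 1 -> rho < pi) ->
  sqdist k (q 0 0) (q 0 1) (q 0 2) (p 0 0) (p 0 1) (p 0 2) = 4 * snk k (rho / 2) ^+ 2 ->
  exists gamma, [/\ piecewise_smooth_curve k 0 rho gamma, gamma 0 = p, gamma rho = q &
    arc_length k 0 rho gamma = rho].
Proof.
move=> hk hp hq rho0 rhopi hD.
have s0 : 0 < snk k rho by apply: snk_gt0.
have sn := lt0r_neq0 s0; have hcs := csk2snk2 rho hk.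
(* The initial velocity with which the geodesic from p reaches q at time rho; on the sphere rho < pi
   makes [snk k rho] nonzero. *)
pose V := (snk k rho)^-1 *: (q - csk k rho *: p).
have VE j : V 0 j = (snk k rho)^-1 * (q 0 j - csk k rho * p 0 j) by rewrite !mxE.
have B := md_bilinear hk hp hq hD.
have [hp1 hp2] := hp; have [hq1 hq2] := hq.
pose g := harmonic k p V.
have gE s j : g s 0 j = csk k s * p 0 j + snk k s * V 0 j by rewrite !mxE.
(* Up to time rho these coefficients of p and q are nonnegative for k <> 1, which keeps the third
   coordinate positive. *)
have gE2 s j : g s 0 j = (snk k (rho - s) * p 0 j + snk k s * q 0 j) / snk k rho.
  by rewrite gE VE snkD// snkN// cskN//; field.
have Bpv : k * (p 0 0 * V 0 0 + p 0 1 * V 0 1) + p 0 2 * V 0 2 = 0.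
  rewrite !VE; transitivity ((snk k rho)^-1 * ((k * (p 0 0 * q 0 0 + p 0 1 * q 0 1) + p 0 2 * q 0 2)
    - csk k rho * (k * (p 0 0 ^+ 2 + p 0 1 ^+ 2) + p 0 2 ^+ 2))); first by ring.
  by rewrite B hp1 mulr1 subrr mulr0.
have Bvv : k * (V 0 0 ^+ 2 + V 0 1 ^+ 2) + V 0 2 ^+ 2 = k.
  rewrite !VE; transitivity (((k * (q 0 0 ^+ 2 + q 0 1 ^+ 2) + q 0 2 ^+ 2)
    - 2 * csk k rho * (k * (p 0 0 * q 0 0 + p 0 1 * q 0 1) + p 0 2 * q 0 2)
    + csk k rho ^+ 2 * (k * (p 0 0 ^+ 2 + p 0 1 ^+ 2) + p 0 2 ^+ 2)) / snk k rho ^+ 2).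
    by field.
  have e1 : k * snk k rho ^+ 2 = 1 - csk k rho ^+ 2 by rewrite -hcs; ring.
  rewrite B hp1 hq1 (_ : _ + _ = k * snk k rho ^+ 2); first by field.
  by rewrite e1; ring.
have g0 : g 0 = p by rewrite /g /harmonic csk0 snk0 scale1r scale0r addr0.
have gr : g rho = q.
  by rewrite /g /harmonic /V scalerA divff// scale1r addrC subrK.
exists g; split => //.
  split.
    exists [:: rho]; first exact: itv_partition1.
    move=> [|//] _; exists g => //; exact: smooth_harmonic.
  move=> t /andP[t0 t1]; split.
    rewrite !gE; transitivity (csk k t ^+ 2 * (k * (p 0 0 ^+ 2 + p 0 1 ^+ 2) + p 0 2 ^+ 2)
      + 2 * csk k t * snk k t * (k * (p 0 0 * V 0 0 + p 0 1 * V 0 1) + p 0 2 * V 0 2)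
      + snk k t ^+ 2 * (k * (V 0 0 ^+ 2 + V 0 1 ^+ 2) + V 0 2 ^+ 2)); first by ring.
    by rewrite hp1 Bpv Bvv mulr1 mulr0 addr0 [_ * k]mulrC csk2snk2.
  move=> kn; rewrite gE2 divr_gt0//; have k1 : k <> 1 by apply/eqP.
  have sg (u : R) : 0 <= u -> 0 <= snk k u.
    rewrite le_eqVlt => /predU1P[<-|u0]; first by rewrite snk0.
    by apply: ltW; apply: snk_gt0.
  move: t0; rewrite le_eqVlt => /predU1P[<-|t0].
    by rewrite subr0 snk0 mul0r addr0 mulr_gt0// hp2.
  apply: ltr_wpDl; first by rewrite mulr_ge0 ?sg ?subr_ge0// ltW// hp2.
  by rewrite mulr_gt0 ?hq2//; apply: snk_gt0.
have sp1 t : rnorm k (derive1 g t) = 1.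
  rewrite /rnorm derive1_harmonic// -[RHS]sqrtr1; congr Num.sqrt.
  have E j : harmonic k V (- k *: p) t 0 j = csk k t * V 0 j - k * snk k t * p 0 j.
    by rewrite !mxE; ring.
  rewrite !E; have [k0|kn] := eqVneq k 0.
    have p3 : p 0 2 = 1 by apply: (md0 (x := p 0 0) (y := p 0 1)); rewrite -k0; exact: hp.
    have q3 : q 0 2 = 1 by apply: (md0 (x := q 0 0) (y := q 0 1)); rewrite -k0; exact: hq.
    move: hD; rewrite /sqdist p3 q3 !VE k0 /csk /snk !curvE => hD.
    transitivity (((q 0 0 - p 0 0) ^+ 2 + (q 0 1 - p 0 1) ^+ 2 + 0 * (1 - 1) ^+ 2) / rho ^+ 2).
      by field; exact: lt0r_neq0.
    by rewrite hD; field; exact: lt0r_neq0.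
  have k2 := curv_sqr hk kn.
  transitivity (k * (csk k t ^+ 2 * (k * (V 0 0 ^+ 2 + V 0 1 ^+ 2) + V 0 2 ^+ 2)
    - 2 * k * csk k t * snk k t * (k * (p 0 0 * V 0 0 + p 0 1 * V 0 1) + p 0 2 * V 0 2)
    + k ^+ 2 * snk k t ^+ 2 * (k * (p 0 0 ^+ 2 + p 0 1 ^+ 2) + p 0 2 ^+ 2))
    + (1 - k ^+ 2) * ((csk k t * V 0 0 - k * snk k t * p 0 0) ^+ 2
      + (csk k t * V 0 1 - k * snk k t * p 0 1) ^+ 2)); first by ring.
  rewrite k2 subrr mul0r addr0 hp1 Bpv Bvv mulr0 subr0 mulr1 mul1r.
  by rewrite -(csk2snk2 t hk) mulrDr; congr (_ + _); rewrite mulrCA -expr2 k2 mulr1.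
rewrite /arc_length (_ : (fun t => _) = cst 1); last exact/funext.
rewrite Rintegral_cst//= lebesgue_measure_itv/= lte_fin rho0 -EFinB/=.
by rewrite subr0 mul1r.
Qed.

Lemma arc_length_ge (R : realType) (k rho a b : R) (p q : 'rV[R]_3) (gamma : R -> 'rV[R]_3) :
  curv k -> 0 <= rho -> (k = 1 -> rho <= pi) ->
  sqdist k (q 0 0) (q 0 1) (q 0 2) (p 0 0) (p 0 1) (p 0 2) = 4 * snk k (rho / 2) ^+ 2 ->
  piecewise_smooth_curve k a b gamma -> gamma a = p -> gamma b = q ->
  rho <= arc_length k a b gamma.
Proof.
move=> hk rho0 rhopi hD hs ga gb.
have [[s hp _] _] := hs; have := itv_partition_le hp.
rewrite le_eqVlt => /predU1P[ab|ab]; last first.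
  have [E hc] := curve_of_piecewise ab hs; rewrite arc_lengthE.
  by apply: (arc_dist hk hc rho0 rhopi); rewrite ga gb.
(* A partition may have a = b; then p = q, and rho cannot be positive. *)
have pq : p = q by rewrite -ga -gb ab.
have s0 : snk k (rho / 2) = 0.
  move: hD; rewrite pq /sqdist !subrr expr0n/= mulr0 !addr0 => /esym/eqP.
  by rewrite mulf_eq0 pnatr_eq0/= sqrf_eq0 => /eqP.
rewrite arc_lengthE ab prim_self leNgt; apply/negP => rp.
have : 0 < snk k (rho / 2).
  apply: snk_gt0 => //; first by rewrite divr_gt0.
  by move=> /rhopi; have := pi_gt0 R; lra.
by rewrite s0 ltxx.
Qed.

Lemma rdist_eq (R : realType) (k rho : R) (p q : 'rV[R]_3) : curv k ->
  model k p -> model k q -> 0 <= rho -> (k = 1 -> rho < pi) ->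
  sqdist k (q 0 0) (q 0 1) (q 0 2) (p 0 0) (p 0 1) (p 0 2) = 4 * snk k (rho / 2) ^+ 2 ->
  rdist k p q = rho.
Proof.
move=> hk hp hq rho0 rhopi hD; rewrite /rdist; set S := [set l | _].
have lb : lbound S rho.
  move=> _ [a [b [gamma [hs ga gb ->]]]].
  by apply: (arc_length_ge hk rho0 _ hD hs ga gb) => /rhopi/ltW.
have Srho : S rho.
  move: rho0; rewrite le_eqVlt => /predU1P[r0|r0]; last first.
    have [gamma [h1 h2 h3 h4]] := geodesic hk hp hq r0 rhopi hD.
    by exists 0, rho, gamma.
  have pq : q = p.
    move: hD; rewrite -r0 mul0r snk0 expr0n mulr0 => hD.
    have [x1 y1 z1] : [/\ q 0 0 = p 0 0, q 0 1 = p 0 1 & q 0 2 = p 0 2].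
      have B := md_bilinear (rho := 0) hk hp hq.
      rewrite mul0r snk0 expr0n mulr0 csk0 in B; move: hD; rewrite /sqdist => hD.
      have hd : k * (p 0 0 * (q 0 0 - p 0 0) + p 0 1 * (q 0 1 - p 0 1))
          + p 0 2 * (q 0 2 - p 0 2) = 0.
        have [e _] := hp; transitivity ((k * (p 0 0 * q 0 0 + p 0 1 * q 0 1) + p 0 2 * q 0 2) -
          (k * (p 0 0 ^+ 2 + p 0 1 ^+ 2) + p 0 2 ^+ 2)); first by ring.
        by rewrite B// e subrr.
      have [/eqP e1 /eqP e2 /eqP e3] := metric_eq0 hk hp hd hD.
      by split; apply/eqP; rewrite -subr_eq0.
    by rewrite -[q]pt3_eta -[p]pt3_eta x1 y1 z1.
  exists 0, 0, (fun=> p); split => //.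
    split; first by exists [::]; [split|].
    by move=> t _.
  by rewrite arc_lengthE prim_self -r0.
apply/le_anti/andP; split; first by apply: ge_inf => //; exists rho.
by apply: lb_le_inf => //; exists rho.
Qed.

(** The squared chord [D] is nonnegative, for k = -1 by the reversed Cauchy-Schwarz inequality, and
    at most 4 on the sphere; so half its root is a value of [snk k] on the admissible range. *)
Lemma dist_exists (R : realType) (k : R) (p1 p2 p3 q1 q2 q3 : R) : curv k ->
  md k p1 p2 p3 -> md k q1 q2 q3 ->
  exists rho, [/\ 0 <= rho, k = 1 -> rho <= pi & sqdist k q1 q2 q3 p1 p2 p3 = 4 * snk k (rho / 2) ^+ 2].
Proof.
move=> hk hp hq; set D := sqdist k q1 q2 q3 p1 p2 p3.
have [D0 D4] : 0 <= D /\ (k = 1 -> D <= 4).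
  rewrite /D; case: (hk) hp hq => [|[|]] ->.
  - move=> [h1 /(_ _) z1] [h2 /(_ _) z2]; split; last by move/eqP; rewrite lt_eqF// (lt_trans _ ltr01)// oppr_lt0.
    have n1 : (-1 : R) != 1 by rewrite lt_eqF// (lt_trans _ ltr01)// oppr_lt0.
    have {}z1 := z1 n1; have {}z2 := z2 n1.
    have e : sqdist (-1) q1 q2 q3 p1 p2 p3 = 2 * (p3 * q3 - (p1 * q1 + p2 * q2) - 1).
      transitivity (- (-1 * (p1 ^+ 2 + p2 ^+ 2) + p3 ^+ 2) - (-1 * (q1 ^+ 2 + q2 ^+ 2) + q3 ^+ 2)
        + 2 * (p3 * q3 - (p1 * q1 + p2 * q2))); first by rewrite /sqdist; ring.
      by rewrite h1 h2; ring.
    rewrite e mulr_ge0// subr_ge0 lerBrDl -[leRHS]gtr0_norm ?mulr_gt0//.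
    apply: le_trans (ler_norm _) _.
    rewrite -(@ler_pXn2r _ 2)// ?nnegrE// !real_normK ?num_real// -subr_ge0.
    rewrite (_ : _ - _ = (p1 - q1) ^+ 2 + (p2 - q2) ^+ 2 + (p1 * q2 - p2 * q1) ^+ 2).
      by rewrite !addr_ge0 ?sqr_ge0.
    have -> : (p3 * q3) ^+ 2 = (1 + p1 ^+ 2 + p2 ^+ 2) * (1 + q1 ^+ 2 + q2 ^+ 2).
      rewrite exprMn; congr (_ * _); [move: h1|move: h2]; lra.
    by ring.
  - move=> /md0-> /md0->; split; last by move/eqP; rewrite eq_sym oner_eq0.
    by rewrite /sqdist mul0r addr0 addr_ge0 ?sqr_ge0.
  - move=> h1 h2; have /andP[b1 b2] := sph_dot1 h1 h2.
    have e : sqdist 1 q1 q2 q3 p1 p2 p3 = 2 - 2 * (p1 * q1 + p2 * q2 + p3 * q3).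
      transitivity ((p1 ^+ 2 + p2 ^+ 2 + p3 ^+ 2) + (q1 ^+ 2 + q2 ^+ 2 + q3 ^+ 2)
        - 2 * (p1 * q1 + p2 * q2 + p3 * q3)); first by rewrite /sqdist; ring.
      by rewrite (md1 h1) (md1 h2); ring.
    by rewrite e; split=> [|_]; move: b1 b2; clear; lra.
pose v := Num.sqrt D / 2; have v0 : 0 <= v by rewrite divr_ge0// sqrtr_ge0.
have v2 : 4 * v ^+ 2 = D by rewrite /v expr_div_n sqr_sqrtr//; field.
have v1 : k = 1 -> -1 <= v <= 1.
  move=> k1; apply/andP; split; first by apply: le_trans v0; rewrite lerN10.
  by rewrite -(@ler_pXn2r _ 2)// ?nnegrE// expr1n; have := D4 k1; move: v2; clear; lra.
have hv := arsnkK hk v1.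
have w1 : k = 1 -> - (pi / 2) <= arsnk k v <= pi / 2.
  by move=> k1; rewrite k1 /arsnk eqxx; have h := v1 k1; rewrite asin_geNpi2// asin_lepi2.
have w0 : 0 <= arsnk k v.
  rewrite leNgt; apply/negP => neg.
  have : 0 < snk k (- arsnk k v).
    apply: snk_gt0; rewrite ?oppr_gt0// => /w1 /andP[h _].
    by have := pi_gt0 R; move: h; lra.
  by rewrite snkN// hv oppr_gt0 ltNge v0.
exists (2 * arsnk k v); split.
- by rewrite mulr_ge0.
- by move=> /w1 /andP[_ h]; rewrite mulrC -ler_pdivlMr.
- by rewrite [2 * _]mulrC mulfK// hv.
Qed.

(* The antipode of [p] is left out of [rdist_eq]; it is only seen to be at distance at least [pi]. *)
Lemma rdistP (R : realType) (k rho : R) (p q : 'rV[R]_3) : curv k ->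
  model k p -> model k q -> 0 < rho -> (k = 1 -> rho < pi) ->
  rdist k p q = rho <->
  sqdist k (q 0 0) (q 0 1) (q 0 2) (p 0 0) (p 0 1) (p 0 2) = 4 * snk k (rho / 2) ^+ 2.
Proof.
move=> hk hp hq rho0 rhopi; split; last exact: rdist_eq (ltW rho0) rhopi.
have [rho' [h1 h2 h3]] := dist_exists hk hp hq; rewrite h3.
have [[k1 r1]|N] := pselect (k = 1 /\ rho' = pi); last first.
  have h2' : k = 1 -> rho' < pi.
    by move=> k1; rewrite lt_neqAle h2// andbT; apply/eqP => e; apply: N.
  by rewrite (rdist_eq hk hp hq h1 h2' h3) => ->.
rewrite /rdist; set S := [set l | _] => infS; exfalso.
(* [inf] of the empty set is 0, which differs from rho > 0. *)
have [S0|S0] := pselect (S !=set0); last first.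
  have S00 : S = set0 by apply/eqP; apply/negPn/negP => /set0P.
  by move: rho0; rewrite -infS S00 inf0 ltxx.
have : pi <= inf S.
  apply: lb_le_inf => // _ [a [b [gamma [hs ga gb ->]]]]; rewrite -r1.
  exact: arc_length_ge hk h1 h2 h3 hs ga gb.
by rewrite infS leNgt rhopi.
Qed.

(** * The three geometries together, and the radius of the extremal circle *)

Lemma setup_isop (R : realType) (k a b : R) E (x dx y dy z dz : R -> R) U A :
  curv k -> setup k a b E x dx y dy z dz U A -> (k = 1 -> A <= 2 * pi) ->
  let L := prim a (speed k dx dy dz) b in
  4 * pi * A - k * A ^+ 2 <= L ^+ 2 /\
  (L ^+ 2 = 4 * pi * A - k * A ^+ 2 -> round k a b x y z A).
Proof.
move=> hk hs hA; have [k1|kn] := eqVneq k 1.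
  by rewrite k1 in hs hA *; exact: sphere_isop hs (hA erefl).
apply: (good_isop hk hs); split; first by move=> k1; move: kn; rewrite k1 eqxx.
move=> t _; case: hk kn => [|[|]] ->; rewrite ?eqxx// => _.
  by have := sqr_ge0 (y t); clear; lra.
by rewrite mul0r subr0.
Qed.

Lemma sinh_asinh (R : realType) (t : R) : sinh (asinh t) = t.
Proof.
rewrite /asinh; suff : [set y : R | sinh y = t] (get [set y : R | sinh y = t]) by [].
have hk : curv (-1 : R) by left.
apply: getPex; exists (arsnk (-1) t) => /=.
have := @arsnkK _ _ t hk; rewrite {1}/snk !curvE; apply.
by move/eqP; rewrite lt_eqF// (lt_trans _ ltr01)// oppr_lt0.
Qed.

(** The condition 0 <= c selects the radius in [0, pi / 2] on the sphere, the range of [asin] at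
    nonnegative arguments, so that [csk k] of it is c and not - c. *)
Lemma AS_spec (R : realType) (k c r : R) : curv k -> c ^+ 2 + k * r ^+ 2 = 1 -> 0 <= c ->
  0 < r -> [/\ 0 < AS k r, k = 1 -> AS k r < pi, snk k (AS k r) = r & csk k (AS k r) = c].
Proof.
move=> hk cr c0 r0.
have r1 : k = 1 -> -1 <= r <= 1.
  move=> k1; apply/andP; split; first by apply: le_trans (ltW r0); rewrite lerN10.
  rewrite -(@ler_pXn2r _ 2)// ?nnegrE ?(ltW r0)// expr1n; have := sqr_ge0 c.
  by move: cr; rewrite k1 mul1r; clear; lra.
have sE : snk k (AS k r) = r.
  case: (hk) r1 => [|[|]] ->; rewrite /snk /AS !curvE.
  - by rewrite sinh_asinh.
  - by [].
  - by move=> /(_ erefl) h; rewrite asinK// in_itv.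
have w1 : k = 1 -> - (pi / 2) <= AS k r <= pi / 2.
  by move=> k1; have h := r1 k1; rewrite k1 /AS eqxx asin_geNpi2// asin_lepi2.
have pp := pi_gt0 R.
have a0 : 0 < AS k r.
  rewrite ltNge; apply/negP; rewrite le_eqVlt => /predU1P[e|neg].
    by move: r0; rewrite -sE e snk0 ltxx.
  have : 0 < snk k (- AS k r).
    by apply: snk_gt0; rewrite ?oppr_gt0// => /w1 /andP[h _]; move: h; lra.
  by rewrite snkN// sE oppr_gt0 ltNge ltW.
split => //; first by move=> /w1 /andP[_ h]; move: h; lra.
have c1 : 0 <= csk k (AS k r).
  case: (hk) w1 => [|[|]] ->; rewrite /csk !curvE => h.
  - by rewrite divr_ge0// addr_ge0// expR_ge0.
  - exact: ler01.
  - by apply: cos_ge0_pihalf; exact: h.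
apply/eqP; rewrite -(@eqrXn2 _ 2)//; apply/eqP.
by apply: (addIr (k * r ^+ 2)); have := csk2snk2 (AS k r) hk; rewrite sE cr => ->.
Qed.

Lemma chord_of_radius (R : realType) (k u : R) : curv k -> 0 < 1 + csk k u ->
  2 * snk k u ^+ 2 / (1 + csk k u) = 4 * snk k (u / 2) ^+ 2.
Proof.
move=> hk h; have [_ [e1 e2]] := csk_half u hk.
rewrite e1 in h; rewrite e1 e2; have c0 : csk k (u / 2) != 0.
  by apply/eqP => e; move: h; rewrite e expr0n mulr0 ltxx.
by field.
Qed.

(* [c] and [r] are the values of [csk k] and [snk k] at the radius of the disk of area [A]. *)
Lemma disk_constants (R : realType) (p k A : R) : 0 < p -> curv k -> 0 < A ->
  (k = 1 -> A <= 2 * p) ->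
  let c := 1 - k * A / (2 * p) in let r := Num.sqrt (A * (4 * p - k * A)) / (2 * p) in
  [/\ 0 <= c, 0 < r, c ^+ 2 + k * r ^+ 2 = 1 & (2 * p * r) ^+ 2 = 4 * p * A - k * A ^+ 2].
Proof.
move=> p0 hk A0 hA c r; have pn := lt0r_neq0 p0.
have w0 : 0 < 4 * p - k * A.
  case: (hk) hA => [|[|]] -> hA'; [|rewrite mul0r|have := hA' erefl]; by move: p0 A0; lra.
have r2 : r ^+ 2 = A * (4 * p - k * A) / (2 * p) ^+ 2.
  by rewrite /r expr_div_n sqr_sqrtr// mulr_ge0 ?ltW.
have r0 : 0 < r by rewrite divr_gt0 ?mulr_gt0// sqrtr_gt0 mulr_gt0.
split => //.
- rewrite /c subr_ge0 ler_pdivrMr ?mulr_gt0// mul1r.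
  by case: (hk) hA => [|[|]] -> hA'; [|rewrite mul0r|have := hA' erefl]; move: p0 A0; lra.
- rewrite r2 /c; have [k0|kn] := eqVneq k 0; first by rewrite k0; field.
  by have k2 := curv_sqr hk kn; field.
- by rewrite exprMn r2; field.
Qed.

Theorem theorem4 (R : realType) (kappa : R)
    (hkappa : kappa = -1 \/ kappa = 0 \/ kappa = 1)
    (a b : R) (gamma : R -> 'rV[R]_3)
    (hsmooth : piecewise_smooth_curve kappa a b gamma)
    (hsimple : simple_closed a b gamma)
    (C : set 'rV[R]_3) (hC : C = gamma @` `[a, b])
    (l A : R) (hl : l = arc_length kappa a b gamma)
    (hA : 0 < A) (hencl : encloses kappa C A)
    (hA1 : kappa = 1 -> A <= 2 * pi) :
  4 * pi * A - kappa * A ^+ 2 <= l ^+ 2 /\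
  (l ^+ 2 = 4 * pi * A - kappa * A ^+ 2 <->
   is_circle kappa
     (AS kappa (Num.sqrt (A * (4 * pi - kappa * A)) / (2 * pi))) C).
Proof.
have hk : curv kappa := hkappa.
have [E [U hs]] := setup_of_enclosure hsmooth hsimple hC hA hencl.
have [hin heq] := setup_isop hk hs hA1; rewrite -arc_lengthE -hl in hin heq.
have [hc _ _ _ cl inj] := hs; have [ab _ _ _ hmd] := hc.
have [c0 r0 cr Lr] := disk_constants (pi_gt0 R) hk hA hA1.
set c := 1 - _ in c0 cr; set r := Num.sqrt _ / _ in r0 cr Lr *.
have [rho0 rhopi sE cE] := AS_spec hk cr c0 r0; set rho := AS kappa r in rho0 rhopi sE cE *.
have c1 : 0 < 1 + c by rewrite (lt_le_trans ltr01)// lerDl.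
(* The constant squared chord found in the equality case is that of the distance rho. *)
have dE : 2 * r ^+ 2 / (1 + c) = 4 * snk kappa (rho / 2) ^+ 2.
  by rewrite -sE -cE chord_of_radius// cE.
have circ (p q : 'rV[R]_3) : model kappa p -> model kappa q -> rdist kappa p q = rho <->
    sqdist kappa (q 0 0) (q 0 1) (q 0 2) (p 0 0) (p 0 1) (p 0 2) = 2 * r ^+ 2 / (1 + c).
  by move=> hp hq; rewrite dE; exact: rdistP.
have CP q : C q <-> exists2 t, a <= t <= b & q = gamma t.
  rewrite hC; split=> [[t /= + <-]|[t tab ->]]; first by rewrite in_itv; exists t.
  by exists t => //=; rewrite in_itv.
split => //; split=> [/heq|[_ _ [p hp Cp]]].
  (* The equality case puts the curve on the circle; that it fills the circle is the surjectivity in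
     [round_curve]. *)
  move=> [c' [r' [p1 [p2 [p3 [[cE' rE' _ _ _] [ho H]]]]]]].
  rewrite -/c -/r in cE' rE'; rewrite cE' rE' in H.
  have [_ surj] := round_curve hk hc cl inj ho cr r0 c0 H.
  split => //; exists (pt3 p1 p2 p3); first exact/model_pt3.
  have [e1 e2 e3] := pt3E p1 p2 p3.
  apply/seteqP; split=> q.
    move=> /CP[t tab ->]; split; first exact: hmd.
    by apply/circ; [exact/model_pt3|exact: hmd|rewrite e1 e2 e3; exact: H].
  move=> [hq /circ]; rewrite e1 e2 e3 => h.
  have [t [tab t1 t2 t3]] := surj _ _ _ hq (h ((model_pt3 kappa p1 p2 p3).2 ho) hq).
  apply/CP; exists t => //.
  by rewrite -[q]pt3_eta -[gamma t]pt3_eta t1 t2 t3.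
(* Conversely, a simple closed curve on this circle has length 2 pi r, and [Lr] evaluates the square
   of that. *)
have H t : a <= t <= b -> sqdist kappa (gamma t 0 0) (gamma t 0 1) (gamma t 0 2)
    (p 0 0) (p 0 1) (p 0 2) = 2 * r ^+ 2 / (1 + c).
  move=> tab; have : C (gamma t) by apply/CP; exists t.
  by rewrite Cp => -[hg /circ]; apply.
have [LE _] := round_curve hk hc cl inj hp cr r0 c0 H.
by rewrite hl arc_lengthE LE Lr.
Qed.
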